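(* Let $\mathbf i=(I,\varepsilon,d)$ be a seed, $k\in I$, let $\mu_k:\mathbf i\to\mathbf i'$ be the mutation in the direction $k$, and let $\hbar$ be a nonzero real number. Put $\widehat d_i=d_i^{-1}$, $\hbar_k=\widehat d_k\hbar$, $n=|I|$, and define $$G(a_1,\ldots,a_n)=\int_{\mathbb R}\Phi^{\hbar_k}\Bigl(\widehat d_k c-\sum_j\varepsilon_{kj}a_j\Bigr)^{-1}\Phi^{\hbar_k}\Bigl(-\widehat d_k c-\sum_j\varepsilon_{kj}a_j\Bigr)\exp\left(c\,\frac{-\sum_{j\,|\,\varepsilon_{kj}>0}\varepsilon_{kj}a_j+a_k}{\pi i\hbar}\right)dc ,$$ $$(\mathbf K_{\mathbf i\to\mathbf i'}f)(a_1,\ldots,a_k',\ldots,a_n)=\int_{\mathbb R} G(a_1,\ldots,a_k'+a_k,\ldots,a_n)\,f(a_1,\ldots,a_k,\ldots,a_n)\,da_k ,$$ where $a'_k+a_k$ and $a_k$ stand at the $k$-th places. Then $\mathbf K_{\mathbf i\to\mathbf i'}:L^2(\mathcal A^+_{\mathbf i})\to L^2(\mathcal A^+_{\mathbf i'})$ intertwines the $\mathcal H^\hbar_{\mathbf i}\otimes\mathcal H^\hbar_{\mathbf i^o}$- and $\mathcal H^\hbar_{\mathbf i'}\otimes\mathcal H^\hbar_{\mathbf i'^o}$-module structures; that is, for each choice of sign $\pm$, on Schwartz functions one has $$\widehat x'^{\pm}_k\,\mathbf K_{\mathbf i\to\mathbf i'}=\mathbf K_{\mathbf i\to\mathbf i'}\,\bigl(-\widehat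 x_k^{\pm}\bigr),$$ $$\widehat x'^{\pm}_i\,\mathbf K_{\mathbf i\to\mathbf i'}=\mathbf K_{\mathbf i\to\mathbf i'}\,\Bigl(\widehat x_i^{\pm}-\varepsilon_{ik}\,\phi^{\hbar_k}\bigl(-\mathrm{sgn}(\varepsilon_{ik})\,\widehat x_k^{\pm}\bigr)\Bigr)\qquad (i\in I,\ i\neq k).$$
   Context: A seed $\mathbf i=(I,\varepsilon,d)$ consists of a finite set $I$, an integer matrix $\varepsilon=(\varepsilon_{ij})_{i,j\in I}$ and positive integers $d_i$ ($i\in I$) such that $\widehat\varepsilon_{ij}:=\varepsilon_{ij}d_j^{-1}$ is skew-symmetric. Identify $I=\{1,\dots,n\}$. The mutation in the direction $k$ produces the seed $\mathbf i'=(I,\varepsilon',d)$ (identifying the index sets) with $\varepsilon'_{ij}=-\varepsilon_{ij}$ if $i=k$ or $j=k$; otherwise $\varepsilon'_{ij}=\varepsilon_{ij}$ if $\varepsilon_{ik}\varepsilon_{kj}\le 0$, and $\varepsilon'_{ij}=\varepsilon_{ij}+|\varepsilon_{ik}|\varepsilon_{kj}$ if $\varepsilon_{ik}\varepsilon_{kj}>0$. The chiral dual seed is $\mathbf i^o=(I,-\varepsilon,d)$. $\mathcal A^+_{\mathbf i}$ is the space of positive real points of the torus $(\mathbb G_m)^I$ with coordinates $A_i$; the logarithmic coordinates $a_i=\log A_i$ identify it with $\mathbb R^I$, and $L^2(\mathcal A^+_{\mathbf i})$ is taken with respect to Lebesgue measure in the $a_i$. The coordinates for $\mathbf i'$ are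 $(a_1,\dots,a'_k,\dots,a_n)$: only the $k$-th coordinate is changed by the mutation. Operators on $L^2(\mathcal A_{\mathbf i}^+)$: $$\widehat x_j^{\pm}=\pm\pi i\hbar\,\widehat d_j\frac{\partial}{\partial a_j}+\sum_{l}\varepsilon_{jl}a_l ,$$ which are self-adjoint (as closures from the Schwartz space). The operators $\widehat x'^{\pm}_j$ on $L^2(\mathcal A^+_{\mathbf i'})$ are defined by the same formula using $\varepsilon'$ and the coordinates $(a_1,\dots,a_k',\dots,a_n)$. Expressions $\phi^{\hbar_k}(\pm\widehat x_k^{\pm})$ are understood by functional calculus. The Heisenberg $*$-algebra $\mathcal H^\hbar_{\mathbf i}$ is generated by $x_j=x_j^*$, $j\in I$, with $[x_j,x_l]=2\pi i\hbar\,\widehat\varepsilon_{jl}$. It acts on $L^2(\mathcal A^+_{\mathbf i})$ from the left by $x_j\mapsto\widehat x_j^-$ and from the right by $x_j\mapsto\widehat x_j^+$; equivalently $\mathcal H^\hbar_{\mathbf i}\otimes\mathcal H^\hbar_{\mathbf i^o}$ acts, the generator $x_j^o$ of $\mathcal H^\hbar_{\mathbf i^o}$ acting by $-\widehat x_j^+$. The gluing map for $\mu_k$ sends the generators of $\mathcal H^\hbar_{\mathbf i'}$ to: $x'_k\mapsto -x_k$ and $x'_i\mapsto x_i-\varepsilon_{ik}\phi^{\hbar_k}(-\mathrm{sgn}(\varepsilon_{ik})x_k)$ for $i\ne k$. ''Intertwining'' refers only to the action of generators and of their images under the gluing map, as written out in the claim. Quantum logarithm and quantum dilogarithm: $$\phi^\hbar(z)=-2\pi\hbar\int_\Omega\frac{e^{-ipz}}{(e^{\pi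 p}-e^{-\pi p})(e^{\pi\hbar p}-e^{-\pi\hbar p})}\,dp,\qquad \Phi^\hbar(z)=\exp\Bigl(-\frac14\int_\Omega\frac{e^{-ipz}}{\sinh(\pi p)\sinh(\pi\hbar p)}\frac{dp}{p}\Bigr),$$ where the contour $\Omega$ goes along the real axis from $-\infty$ to $\infty$ bypassing the origin from above. The integral over $c$ defining $G$ is an oscillatory (conditionally convergent) integral. *)

(* Defs.v *)
From HB Require Import structures.
From mathcomp Require Import all_boot all_order all_algebra.
From mathcomp Require Import all_classical all_reals all_analysis.
From mathcomp Require Import complex ring.

Set Implicit Arguments.
Unset Strict Implicit.
Unset Printing Implicit Defensive.

Import Order.TTheory GRing.Theory Num.Theory.
Import numFieldNormedType.Exports.
Local Open Scope classical_set_scope.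
Local Open Scope ring_scope.
Local Open Scope complex_scope.

Local Notation Re := complex.Re.
Local Notation Im := complex.Im.
Local Notation cabs := ComplexField.Normc.normc.

(** The index set [I] is ['I_n]; [eps], [mult] and the quotient in
    [hat_eps_skew] are the matrix, the multipliers [d_i] and the entries of
    [hat eps]. *)
Record seed (n : nat) := Seed {
  eps : 'M[int]_n;
  mult : 'I_n -> nat;
  mult_gt0 : forall i, (0 < mult i)%N;
  hat_eps_skew : forall i j,
    (eps i j)%:~R / (mult j)%:R = - ((eps j i)%:~R / (mult i)%:R) :> rat
}.

Definition mut_eps n (e : 'M[int]_n) (k : 'I_n) : 'M[int]_n :=
  \matrix_(i, j)
    if (i == k) || (j == k) then - e i j
    else if e i k * e k j <= 0 then e i j
    else e i j + `|e i k| * e k j.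

Section Mutation.
Variables (n : nat) (s : seed n) (k : 'I_n).

Let dQ_gt0 i : 0 < (mult s i)%:R :> rat.
Proof. by rewrite ltr0n mult_gt0. Qed.

Let skewQ i j : (eps s i j)%:~R * (mult s i)%:R
  = - ((eps s j i)%:~R * (mult s j)%:R) :> rat.
Proof.
have := hat_eps_skew s i j.
have := lt0r_neq0 (dQ_gt0 i); have := lt0r_neq0 (dQ_gt0 j).
set a : rat := (mult s i)%:R; set b : rat := (mult s j)%:R => b0 a0 h.
transitivity ((eps s i j)%:~R / b * (a * b)); first by field.
by rewrite h; field.
Qed.

Lemma mut_hat_eps_skew i j :
  (mut_eps (eps s) k i j)%:~R / (mult s j)%:R =
  - ((mut_eps (eps s) k j i)%:~R / (mult s i)%:R) :> rat.
Proof.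
rewrite !mxE orbC; case: ifPn => _.
  by rewrite !rmorphN/= !mulNr hat_eps_skew.
rewrite -![_ * _ <= 0 :> int](ler_int rat) !intrM.
have := skewQ i k; have := skewQ k j.
have := hat_eps_skew s i j; rewrite !(fun_if (fun x : int => x%:~R : rat)).
rewrite !intrD !intrM !intr_norm.
move: (dQ_gt0 i) (dQ_gt0 j) (dQ_gt0 k).
move: ((mult s i)%:R : rat) ((mult s j)%:R : rat) ((mult s k)%:R : rat).
move: ((eps s i k)%:~R : rat) ((eps s k j)%:~R : rat).
move: ((eps s j k)%:~R : rat) ((eps s k i)%:~R : rat).
move: ((eps s i j)%:~R : rat) ((eps s j i)%:~R : rat).
move=> eij eji ejk eki eik ekj a b c a0 b0 c0 h hkj hik.
have E : eik * ekj * a = ejk * eki * b.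
  transitivity (- (eki * (ekj * c))).
    by rewrite mulrAC hik; ring.
  by rewrite hkj; ring.
have -> : (eik * ekj <= 0) = (ejk * eki <= 0).
  by rewrite -(pmulr_lle0 _ a0) E pmulr_lle0.
case: ifPn => [//|]; rewrite -ltNge => pos.
have posi : 0 < eik * ekj by rewrite -(pmulr_lgt0 _ a0) E pmulr_lgt0.
have hab : `|eik| * a = `|eki| * c.
  by rewrite -[in LHS](gtr0_norm a0) -[in RHS](gtr0_norm c0) -!normrM hik normrN.
have sg : `|eki| * ejk = `|ejk| * eki.
  case: (ltrgt0P ejk) pos => [p|p|->]; last by rewrite mul0r ltxx.
    by rewrite pmulr_rgt0// => q; rewrite (gtr0_norm q) mulrC.
  by rewrite nmulr_rgt0// => q; rewrite (ltr0_norm q); ring.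
have key : `|eik| * ekj * a = - (`|ejk| * eki * b).
  transitivity (`|eki| * (ekj * c)); first by rewrite mulrAC hab; ring.
  by rewrite hkj -sg; ring.
have a1 := lt0r_neq0 a0; have b1 := lt0r_neq0 b0.
rewrite !mulrDl h opprD; congr (_ + _).
transitivity (`|eik| * ekj * a / (a * b)); first by field; rewrite a1 b1.
by rewrite key; field; rewrite a1 b1.
Qed.

Definition mutation : seed n := Seed (mult_gt0 s) mut_hat_eps_skew.

End Mutation.

(** [R^n] is [n.-tuple R] with the product of the Borel sigma-algebras. *)
Notation Rn R n := (n.-tuple (measurableTypeR R)).

Definition crd (R : realType) n (a : Rn R n) (i : 'I_n) : R := tnth a i.

Definition upd (R : realType) n (a : Rn R n) (k : 'I_n) (t : R) : Rn R n :=
  [tuple if j == k then (t : measurableTypeR R) else tnth a j | j < n].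

Section ConsMeasure.
Local Open Scope ereal_scope.
Variables (R : realType) (n : nat).
Variable m : {sigma_finite_measure set (Rn R n) -> \bar R}.

Definition cons_pt (p : measurableTypeR R * Rn R n) : Rn R n.+1 :=
  [tuple of p.1 :: p.2].

Let measurable_cons_pt : measurable_fun [set: _] cons_pt.
Proof. by apply: measurable_cons. Qed.

Let split_pt (a : Rn R n.+1) : measurableTypeR R * Rn R n :=
  (tnth a ord0, [tuple of behead a]).

Let measurable_split_pt : measurable_fun [set: _] split_pt.
Proof.
apply/measurable_fun_pairP; split.
  exact: measurable_tnth.
exact: measurable_behead.
Qed.

Let split_ptK : cancel cons_pt split_pt.
Proof. by case=> x t; congr pair; apply: val_inj. Qed.

Definition cons_measure : set (Rn R n.+1) -> \bar R :=
  pushforward ((@lebesgue_measure R) \x m) cons_pt.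

Let cons_measure0 : cons_measure set0 = 0.
Proof. by rewrite /cons_measure /pushforward preimage_set0 measure0. Qed.

Let cons_measure_ge0 A : 0 <= cons_measure A.
Proof. exact: measure_ge0. Qed.

Let cons_measure_sigma_additive : semi_sigma_additive cons_measure.
Proof.
move=> F mF tF mUF; rewrite /cons_measure /pushforward preimage_bigcup.
apply: measure_semi_sigma_additive.
- by move=> i; rewrite -[X in measurable X]setTI; exact: measurable_cons_pt.
- apply/trivIsetP => /= i j _ _ ij; rewrite -preimage_setI.
  by move/trivIsetP : tF => /(_ _ _ _ _ ij) ->//; rewrite preimage_set0.
- rewrite -preimage_bigcup -[X in measurable X]setTI.
  exact: measurable_cons_pt.
Qed.

HB.instance Definition _ := isMeasure.Build _ _ _ cons_measure
  cons_measure0 cons_measure_ge0 cons_measure_sigma_additive.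

Let cons_measure_sigma_finite : sigma_finite setT cons_measure.
Proof.
have /sigma_finiteP[F [TF ndF Foo]] := sigma_finiteT (@lebesgue_measure R).
have /sigma_finiteP[G [TG ndG Goo]] := sigma_finiteT m.
exists (fun i => split_pt @^-1` (F i `*` G i)).
  apply/seteqP; split=> // a _.
  have [i _ Fi] : (\bigcup_i F i) (split_pt a).1 by rewrite -TF.
  have [j _ Gj] : (\bigcup_i G i) (split_pt a).2 by rewrite -TG.
  exists (maxn i j) => //; split.
  - by move: (_ a).1 Fi; exact/subsetPset/ndF/leq_maxl.
  - by move: (_ a).2 Gj; exact/subsetPset/ndG/leq_maxr.
move=> i; have [mF Fi] := Foo i; have [mG Gi] := Goo i; split.
  rewrite -[X in measurable X]setTI; apply: measurable_split_pt => //.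
  exact: measurableX.
rewrite /cons_measure /pushforward -comp_preimage.
rewrite (_ : split_pt \o cons_pt = id); last first.
  by apply/funext => p; exact: split_ptK.
by rewrite preimage_id product_measure1E// lte_mul_pinfty// ge0_fin_numE.
Qed.

HB.instance Definition _ := Measure_isSigmaFinite.Build _ _ _ cons_measure
  cons_measure_sigma_finite.

End ConsMeasure.

(** Lebesgue measure on [R^n]: the iterated product, with unit mass in
    dimension 0. *)
Fixpoint lebesgue_Rn (R : realType) n :
    {sigma_finite_measure set (Rn R n) -> \bar R} :=
  match n with
  | 0 => \d_([tuple] : Rn R 0)
  | n.+1 => cons_measure (lebesgue_Rn R n)
  end.

Section ComplexAnalysis.
Variable R : realType.
Implicit Types (z p : R[i]) (h : R -> R[i]).

Definition cexp z : R[i] :=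
  (expR (Re z) * cos (Im z)) +i* (expR (Re z) * sin (Im z)).

Definition csinh z : R[i] := (cexp z - cexp (- z)) / 2%:R.

Definition Cintegrable d (T : measurableType d) (mu : set T -> \bar R)
    (D : set T) (u : T -> R[i]) : Prop :=
  mu.-integrable D (fun x => (Re (u x))%:E) /\
  mu.-integrable D (fun x => (Im (u x))%:E).

Definition Cint (D : set R) h : R[i] :=
  (\int[lebesgue_measure]_(t in D) Re (h t)) +i*
  (\int[lebesgue_measure]_(t in D) Im (h t)).

(** Integral along the real axis from -oo to +oo, with [[-r, r]] replaced by
    the upper half of the circle of radius [r], run through clockwise. *)
Definition contour_int (r : R) (g : R[i] -> R[i]) : R[i] :=
  Cint `]-oo, (- r)] (fun t => g t%:C)
  + Cint `[0, pi] (fun t =>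
      let p := r%:C * cexp ('i%C * (pi - t)%:C) in g p * (- 'i%C * p))
  + Cint `[r, +oo[ (fun t => g t%:C).

(** The integrands of [qlog] and [qdilog] have their poles in [i Z] and
    [i Z / hbar]; with this radius the contour goes around the pole at the
    origin only. *)
Definition contour_radius (hbar : R) : R := Num.min 1 `|hbar|^-1 / 2.

(** The function [phi^hbar] on the real line. *)
Definition qlog (hbar z : R) : R[i] :=
  - (2 * pi * hbar)%:C *
  contour_int (contour_radius hbar) (fun p =>
    cexp (- 'i%C * p * z%:C) /
    ((cexp (pi%:C * p) - cexp (- (pi%:C * p))) *
     (cexp ((pi * hbar)%:C * p) - cexp (- ((pi * hbar)%:C * p))))).

(** The function [Phi^hbar] on the real line. *)
Definition qdilog (hbar z : R) : R[i] :=
  cexp (- (4%:R^-1) *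
  contour_int (contour_radius hbar) (fun p =>
    cexp (- 'i%C * p * z%:C) /
    (csinh (pi%:C * p) * csinh ((pi * hbar)%:C * p)) / p)).

(** Conditionally convergent integrals over the real line: the two ends are
    independent limits. *)
Definition improper_cvg (h : R -> R) : Prop :=
  [/\ forall M, lebesgue_measure.-integrable `[- M, M] (fun t => (h t)%:E),
      cvg ((fun M => \int[lebesgue_measure]_(t in `[0, M]) h t) @ +oo%R) &
      cvg ((fun M => \int[lebesgue_measure]_(t in `[- M, 0]) h t) @ +oo%R)].

Definition improper_int (h : R -> R) : R :=
  lim ((fun M => \int[lebesgue_measure]_(t in `[0, M]) h t) @ +oo%R) +
  lim ((fun M => \int[lebesgue_measure]_(t in `[- M, 0]) h t) @ +oo%R).

Definition Cimproper_cvg h : Prop :=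
  improper_cvg (fun t => Re (h t)) /\ improper_cvg (fun t => Im (h t)).

Definition Cimproper_int h : R[i] :=
  improper_int (fun t => Re (h t)) +i* improper_int (fun t => Im (h t)).

End ComplexAnalysis.

Section Schwartz.
Variables (R : realType) (n : nat).
Implicit Types (f : Rn R n -> R[i]) (a : Rn R n) (i : 'I_n).

Definition pderivable f a i : Prop :=
  derivable (fun t : R => Re (f (upd a i t))) (crd a i) 1 /\
  derivable (fun t : R => Im (f (upd a i t))) (crd a i) 1.

Definition pderive i f a : R[i] :=
  derive1 (fun t : R => Re (f (upd a i t))) (crd a i) +i*
  derive1 (fun t : R => Im (f (upd a i t))) (crd a i).

Definition pderives (l : seq 'I_n) f : Rn R n -> R[i] := foldr pderive f l.

(** All iterated partial derivatives exist and decay rapidly. The bounds make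
    each of them locally Lipschitz, so [f] is automatically smooth. *)
Definition schwartz f : Prop :=
  (forall (l : seq 'I_n) a i, pderivable (pderives l f) a i) /\
  (forall (l : seq 'I_n) (N : nat), exists C : R, forall a,
    (1 + \sum_j `|crd a j|) ^+ N * cabs (pderives l f a) <= C).

End Schwartz.

Section L2.
Variable R : realType.

(** Elements of [L^2] are represented by functions. Almost everywhere linearity
    together with a norm bound makes an operator compatible with almost
    everywhere equality. *)
Definition sqnorm d (T : measurableType d) (mu : {measure set T -> \bar R})
  (u : T -> R[i]) : \bar R := (\int[mu]_x (cabs (u x) ^+ 2)%:E)%E.

Definition L2 d (T : measurableType d) (mu : {measure set T -> \bar R})
    (u : T -> R[i]) : Prop :=
  [/\ measurable_fun setT (fun x => Re (u x)),
      measurable_fun setT (fun x => Im (u x)) & (sqnorm mu u < +oo)%E].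

Definition L2_linear d1 d2 (X : measurableType d1) (Y : measurableType d2)
    (mu : {measure set X -> \bar R}) (nu : {measure set Y -> \bar R})
    (T : (X -> R[i]) -> (Y -> R[i])) : Prop :=
  (forall u, L2 mu u -> L2 nu (T u)) /\
  (forall (c : R[i]) u v, L2 mu u -> L2 mu v ->
    {ae nu, forall y, T (fun x => c * u x + v x) y = c * T u y + T v y}).

Definition L2_bounded d1 d2 (X : measurableType d1) (Y : measurableType d2)
    (mu : {measure set X -> \bar R}) (nu : {measure set Y -> \bar R})
    (T : (X -> R[i]) -> (Y -> R[i])) : Prop :=
  L2_linear mu nu T /\
  exists C : R, forall u, L2 mu u ->
    (sqnorm nu (T u) <= C%:E * sqnorm mu u)%E.

Definition L2_unitary d1 d2 (X : measurableType d1) (Y : measurableType d2)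
    (mu : {measure set X -> \bar R}) (nu : {measure set Y -> \bar R})
    (U : (X -> R[i]) -> (Y -> R[i])) : Prop :=
  [/\ L2_linear mu nu U,
      forall u, L2 mu u -> sqnorm nu (U u) = sqnorm mu u &
      forall w, L2 nu w ->
        exists2 u, L2 mu u & {ae nu, forall y, U u y = w y}].

(** Unbounded operators on [L^2] are given by their graphs. *)

(** The graph of the closure of the operator [A] with domain [S]. *)
Definition op_closure d (X : measurableType d)
    (mu : {measure set X -> \bar R}) (S : set (X -> R[i]))
    (A : (X -> R[i]) -> (X -> R[i])) (u v : X -> R[i]) : Prop :=
  [/\ L2 mu u, L2 mu v &
   exists F : nat -> X -> R[i],
     [/\ forall m, S (F m),
         (fun m => sqnorm mu (fun x => F m x - u x)) @ \oo --> 0%E &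
         (fun m => sqnorm mu (fun x => A (F m) x - v x)) @ \oo --> 0%E]].

(** [U] carries the operator with graph [A] to the operator of multiplication,
    with its maximal domain, by the real function [m]. *)
Definition spectral_rep d1 d2 (X : measurableType d1) (Y : measurableType d2)
    (mu : {measure set X -> \bar R}) (nu : {measure set Y -> \bar R})
    (A : (X -> R[i]) -> (X -> R[i]) -> Prop)
    (U : (X -> R[i]) -> (Y -> R[i])) (m : Y -> R) : Prop :=
  [/\ L2_unitary mu nu U, measurable_fun setT m &
      forall u v, L2 mu u -> L2 mu v ->
        (A u v <-> {ae nu, forall y, U v y = (m y)%:C * U u y})].

(** [fcalc mu A g u v] means that [u] is in the domain of [g(A)] and
    [g(A) u = v], for a self-adjoint operator [A]. By the spectral theorem a
    representation as below exists, and [g(A)] does not depend on it. *)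
Definition fcalc d (X : measurableType d) (mu : {measure set X -> \bar R})
    (A : (X -> R[i]) -> (X -> R[i]) -> Prop) (g : R -> R[i])
    (u v : X -> R[i]) : Prop :=
  [/\ L2 mu u, L2 mu v &
   exists (d' : measure_display) (Y : measurableType d')
     (nu : {measure set Y -> \bar R}) (U : (X -> R[i]) -> (Y -> R[i]))
     (m : Y -> R),
     spectral_rep mu nu A U m /\
     {ae nu, forall y, U v y = g (m y) * U u y}].

End L2.

Section Operators.
Variables (R : realType) (n : nat) (s : seed n) (hbar : R).
Implicit Types (f u v : Rn R n -> R[i]) (a : Rn R n).

Definition epsR i j : R := (eps s i j)%:~R.
Definition dhat i : R := (mult s i)%:R^-1.

(** [xdiff b j] is the differential expression of [hat x_j^+] for
    [b = false] and of [hat x_j^-] for [b = true]. *)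
Definition xdiff (b : bool) (j : 'I_n) f a : R[i] :=
  (-1) ^+ b * (pi * hbar * dhat j)%:C * 'i%C * pderive j f a
  + (\sum_l epsR j l * crd a l)%:C * f a.

(** The graph of the self-adjoint operator [hat x_j^+] or [hat x_j^-]. *)
Definition xhat (b : bool) (j : 'I_n) u v : Prop :=
  op_closure (lebesgue_Rn R n) (@schwartz R n) (xdiff b j) u v.

Definition Gintegrand (k : 'I_n) a (c : R) : R[i] :=
  let hk := dhat k * hbar in
  let e := \sum_j epsR k j * crd a j in
  let ep := \sum_(j | 0 < eps s k j) epsR k j * crd a j in
  (qdilog hk (dhat k * c - e))^-1 * qdilog hk (- (dhat k * c) - e) *
  cexp ((c * (- ep + crd a k))%:C / ((pi * hbar)%:C * 'i%C)).

Definition G (k : 'I_n) a : R[i] := Cimproper_int (Gintegrand k a).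

(** The integrand of [(K f)(a)]; [crd a k] is the coordinate [a'_k], and the
    integration variable [t] is [a_k]. *)
Definition Kintegrand (k : 'I_n) f a (t : R) : R[i] :=
  G k (upd a k (crd a k + t)) * f (upd a k t).

Definition Kint (k : 'I_n) f a : R[i] := Cint setT (Kintegrand k f a).

End Operators.

(* Main.v *)
From HB Require Import structures.
Require Import Defs.
From mathcomp Require Import all_boot all_order all_algebra.
From mathcomp Require Import all_classical all_reals all_analysis.
From mathcomp Require Import measurable_realfun complex ring lra zify.
Import Order.TTheory GRing.Theory Num.Theory.
Import numFieldNormedType.Exports.
Local Open Scope classical_set_scope.
Local Open Scope ring_scope.
Local Open Scope complex_scope.

(** The kernel of the operator is a pair of Fourier transforms around a function
    of modulus one. Write [F] for the Fourier transform in the coordinate [a_k]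
    at frequency [lam = 1 / (pi hbar)] ([pft]). As a function of its [k]-th
    coordinate, [G] is the Fourier transform of [e^(i theta)], where
    [theta = arg Phi (- d c - e) - arg Phi (d c - e) + lam c e+], with [d = 1 / d_k],
    with [e] the sum of all [eps_kj a_j] and with [e+] the sum of those with
    [eps_kj > 0]; and the argument [a'_k + a_k] splits the exponential
    [e^(- i lam c (a'_k + a_k))] into the kernels of two transforms. Hence
    [K = F e^(i theta) F] on Schwartz functions ([Kint_kernel_op]).

    Conjugation by [F] exchanges the derivative in [a_k] with multiplication by
    [a_k]. It therefore turns [x_k^+] and [x_k^-] into multiplication by the real
    linear forms [e - d a_k] and [e + d a_k] ([pft_xdiff]). Three consequences
    follow. Multiplication by a form commutes with [e^(i theta)], and the mutation
    reverses the sign of the row [k] of [eps], so [K] intertwines [x'_k] and [- x_k]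
    ([kernel_op_xdiff_k]). The normalized [F] is a spectral representation of
    [x_k], so [phi (- sgn x_k)] is, after [F], multiplication by [phi] of the
    linear form ([U_spectral], [fcalc_phi_mult]). Finally, for [i <> k], both
    sides of the intertwining relation become first order operators applied to
    [e^(i theta) F f], and all that remains is an identity between the derivatives
    of [theta] in [a_i] and [a_k], the change of the row [i] of [eps], and [phi]
    ([kernel_op_xdiff_other], [phase_identity]). Since the logarithmic derivative
    of [Phi] is a multiple of [phi] ([phase_derive]), these derivatives are linear
    in the two values [phi (d a_k - e)] and [phi (- d a_k - e)]. When
    [eps_ik > 0] they match directly; when [eps_ik < 0] the functional equation
    [phi z - phi (- z) = z] is used, and its linear term accounts for the
    difference between the two cases of the mutation rule.

    The functional equation is obtained from [phi' z + phi' (- z) = 1]. In this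
    sum the two rays of the contour cancel and half a circle remains. The
    integral over the half circle of radius [s] does not depend on [s]
    ([arc_mean_derive]), because the integrand is an even function of [p] against
    [dp / p], and its limit for small [s] is known ([arc_mean_value]).

    The analysis needed to give these formulas a meaning is as follows. For
    negative [z] the contour integrals of the derivatives of [phi] are bounded,
    and the functional equation carries this to positive [z]; so [phi] grows
    linearly and its derivatives are bounded. It follows that multiplication by
    [e^(i theta)] preserves Schwartz functions ([moderate_phase_factor]), and that
    the phase in the integral defining [G] has a derivative growing linearly and
    a bounded second derivative, so that one integration by parts makes the
    integral converge, with polynomial bounds ([osc_improper], [osc_bound]).
    Truncating the integral, exchanging the order of integration and passing to
    the limit identify [K f]. By Fourier inversion and Plancherel's theorem, the
    operators are bounded on Schwartz functions for the [L^2] norm. As Schwartz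
    functions are dense ([schwartz_dense]), the bounded operators extend to [L^2],
    and an operator that such a unitary extension carries to multiplication by
    [m] on Schwartz functions has as closure the multiplication by [m] on its
    full domain, provided that [1 + i m] has an inverse of moderate growth
    ([ext_spectral]). *)

Set Implicit Arguments.
Unset Strict Implicit.
Unset Printing Implicit Defensive.

Local Notation Re := complex.Re.
Local Notation Im := complex.Im.
Local Notation cabs := ComplexField.Normc.normc.

(** * Complex numbers *)

Section ComplexNumbers.
Variable R : realType.
Implicit Types (z w : R[i]) (x y : R).

Lemma complex_ext z w : Re z = Re w -> Im z = Im w -> z = w.
Proof. by case: z w => [a b] [c d] /= -> ->. Qed.

Lemma ReD z w : Re (z + w) = Re z + Re w. Proof. by case: z w => ? ? []. Qed.
Lemma ImD z w : Im (z + w) = Im z + Im w. Proof. by case: z w => ? ? []. Qed.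
Lemma ReN z : Re (- z) = - Re z. Proof. by case: z. Qed.
Lemma ImN z : Im (- z) = - Im z. Proof. by case: z. Qed.
Lemma ReM z w : Re (z * w) = Re z * Re w - Im z * Im w.
Proof. by case: z w => ? ? []. Qed.
Lemma ImM z w : Im (z * w) = Re z * Im w + Im z * Re w.
Proof. by case: z w => ? ? []. Qed.
Lemma Re_rC x : Re x%:C = x. Proof. by []. Qed.
Lemma Im_rC x : Im x%:C = 0. Proof. by []. Qed.
Lemma Re_i : Re ('i%C : R[i]) = 0. Proof. by []. Qed.
Lemma Im_i : Im ('i%C : R[i]) = 1. Proof. by []. Qed.
Lemma Re_sum (I : Type) (s : seq I) (P : pred I) (F : I -> R[i]) :
  Re (\sum_(i <- s | P i) F i) = \sum_(i <- s | P i) Re (F i).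
Proof. by apply: (big_morph (@complex.Re R)) => // u v; exact: ReD. Qed.
Lemma Im_sum (I : Type) (s : seq I) (P : pred I) (F : I -> R[i]) :
  Im (\sum_(i <- s | P i) F i) = \sum_(i <- s | P i) Im (F i).
Proof. by apply: (big_morph (@complex.Im R)) => // u v; exact: ImD. Qed.

Definition CE := (ReD, ImD, ReN, ImN, ReM, ImM, Re_rC, Im_rC, Re_i, Im_i).

Lemma rCD x y : (x + y)%:C = x%:C + y%:C :> R[i].
Proof. exact: (rmorphD (real_complex R)). Qed.
Lemma rCB x y : (x - y)%:C = x%:C - y%:C :> R[i].
Proof. exact: (rmorphB (real_complex R)). Qed.
Lemma rCN x : (- x)%:C = - x%:C :> R[i].
Proof. exact: (rmorphN (real_complex R)). Qed.
Lemma rCM x y : (x * y)%:C = x%:C * y%:C :> R[i].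
Proof. exact: (rmorphM (real_complex R)). Qed.
Lemma rCV x : (x^-1)%:C = (x%:C)^-1 :> R[i].
Proof. exact: (fmorphV (real_complex R)). Qed.
Lemma rCX x m : (x ^+ m)%:C = x%:C ^+ m :> R[i].
Proof. exact: (rmorphXn (real_complex R)). Qed.
Lemma rC_nat m : (m%:R : R)%:C = m%:R :> R[i].
Proof. exact: (rmorph_nat (real_complex R)). Qed.
Lemma rC0 : (0 : R)%:C = 0 :> R[i]. Proof. by []. Qed.
Lemma rC1 : (1 : R)%:C = 1 :> R[i]. Proof. by []. Qed.
Lemma rC_eq0 x : (x%:C == 0 :> R[i]) = (x == 0).
Proof. exact: (fmorph_eq0 (real_complex R)). Qed.

Lemma sqr_i_ : ('i%C : R[i]) * 'i%C = -1.
Proof. by apply: complex_ext; rewrite /= ?mulr0 ?mul0r ?mulr1 ?addr0 ?sub0r ?oppr0. Qed.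

Lemma i_neq0 : ('i%C : R[i]) != 0.
Proof. by apply/eqP => -[] /eqP; rewrite oner_eq0. Qed.

Lemma cabs_ge0 z : 0 <= cabs z.
Proof. by case: z => a b; exact: sqrtr_ge0. Qed.
Lemma cabsE z : cabs z = Num.sqrt (Re z ^+ 2 + Im z ^+ 2).
Proof. by case: z. Qed.
Lemma cabs_sq z : cabs z ^+ 2 = Re z ^+ 2 + Im z ^+ 2.
Proof. by rewrite cabsE sqr_sqrtr // addr_ge0 ?sqr_ge0. Qed.
Lemma cabsM z w : cabs (z * w) = cabs z * cabs w.
Proof. exact: ComplexField.Normc.normcM. Qed.
Lemma cabsD z w : cabs (z + w) <= cabs z + cabs w.
Proof. exact: le_normcD. Qed.
Lemma cabsN z : cabs (- z) = cabs z.
Proof. by rewrite !cabsE !CE !sqrrN. Qed.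
Lemma cabsB z w : cabs (z - w) <= cabs z + cabs w.
Proof. by rewrite -(cabsN w) cabsD. Qed.
Lemma cabsV z : cabs z^-1 = (cabs z)^-1.
Proof. exact: ComplexField.Normc.normcV. Qed.
Lemma cabs0 : cabs (0 : R[i]) = 0.
Proof. by rewrite cabsE /= expr0n /= addr0 sqrtr0. Qed.
Lemma cabs_rC x : cabs x%:C = `|x|.
Proof. by rewrite cabsE /= expr0n /= addr0 sqrtr_sqr. Qed.
Lemma cabs1 : cabs (1 : R[i]) = 1.
Proof. by rewrite -[1 : R[i]]/((1:R)%:C) cabs_rC normr1. Qed.
Lemma cabs_i : cabs ('i%C : R[i]) = 1.
Proof. by rewrite cabsE /= expr0n /= add0r expr1n sqrtr1. Qed.
Lemma cabs_eq0 z : cabs z = 0 -> z = 0.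
Proof. exact: ComplexField.Normc.eq0_normc. Qed.
Lemma cabsX z m : cabs (z ^+ m) = cabs z ^+ m.
Proof. by elim: m => [|m ih]; rewrite ?expr0 ?cabs1 // !exprS cabsM ih. Qed.
Lemma cabs_conj z : cabs z^*%C = cabs z.
Proof. by case: z => a b; rewrite !cabsE /= sqrrN. Qed.
Lemma Re_le_cabs z : `|Re z| <= cabs z.
Proof. by rewrite cabsE -sqrtr_sqr ler_sqrt ?addr_ge0 ?sqr_ge0// lerDl sqr_ge0. Qed.
Lemma Im_le_cabs z : `|Im z| <= cabs z.
Proof. by rewrite cabsE -sqrtr_sqr ler_sqrt ?addr_ge0 ?sqr_ge0// lerDr sqr_ge0. Qed.
Lemma cabs_le_ReIm z : cabs z <= `|Re z| + `|Im z|.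
Proof.
rewrite -ler_sqr ?nnegrE ?cabs_ge0 ?addr_ge0// cabs_sq sqrrD !real_normK ?num_real//.
by rewrite addrAC lerDl mulrn_wge0 ?mulr_ge0.
Qed.

Lemma ReB z w : Re (z - w) = Re z - Re w. Proof. by rewrite !CE. Qed.
Lemma ImB z w : Im (z - w) = Im z - Im w. Proof. by rewrite !CE. Qed.
(** * The complex exponential *)

Lemma cexpD z w : cexp (z + w) = cexp z * cexp w.
Proof.
apply: complex_ext; rewrite /= !CE /= expRD ?cosD ?sinD; ring.
Qed.
Lemma cexp0 : cexp (0 : R[i]) = 1.
Proof. by apply: complex_ext; rewrite /= expR0 ?cos0 ?sin0 ?mulr0 ?mulr1. Qed.
Lemma cexpNM z : cexp z * cexp (- z) = 1.
Proof. by rewrite -cexpD subrr cexp0. Qed.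
Lemma cexp_neq0 z : cexp z != 0.
Proof.
apply/eqP => h; have := cexpNM z; rewrite h mul0r => /eqP.
by rewrite eq_sym oner_eq0.
Qed.
Lemma cexpN z : cexp (- z) = (cexp z)^-1.
Proof.
by apply: (mulfI (cexp_neq0 z)); rewrite cexpNM divff// cexp_neq0.
Qed.
Lemma cabs_cexp z : cabs (cexp z) = expR (Re z).
Proof.
rewrite cabsE /= !exprMn -mulrDr cos2Dsin2 mulr1 sqrtr_sqr ger0_norm// expR_ge0.
Qed.
Lemma cexp_conj z : (cexp z)^*%C = cexp z^*%C.
Proof.
by apply: complex_ext; rewrite /= ?CE; case: z => a b /=;
   rewrite ?cosN ?sinN ?mulrN.
Qed.
Lemma cabs_cexpi x : cabs (cexp ('i%C * x%:C)) = 1.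
Proof. by rewrite cabs_cexp !CE mul0r mulr0 subr0 expR0. Qed.

End ComplexNumbers.

(** * Differentiation of complex-valued functions of a real variable *)

Section ComplexDerivative.
Variable R : realType.
Implicit Types (h g : R -> R[i]) (t : R) (l : R[i]).

(** Stating the derivative through real and imaginary parts keeps the domain
    real, so that the one-variable theory of real functions applies to each
    part. *)
Definition Cder h t l :=
  is_derive t (1:R) (fun x => Re (h x)) (Re l) /\
  is_derive t (1:R) (fun x => Im (h x)) (Im l).

Lemma Cder_eq h t l l' : Cder h t l -> l = l' -> Cder h t l'.
Proof. by move=> ? <-. Qed.

Lemma Cder_ext h g t l : (forall x, h x = g x) -> Cder h t l -> Cder g t l.
Proof. by move=> /funext->. Qed.

Lemma Cder_cst (c : R[i]) t : Cder (fun=> c) t 0.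
Proof. by split; exact: is_derive_cst. Qed.

Lemma Cder_id t : Cder (fun x => x%:C) t 1.
Proof. by split; [exact: is_derive_id | exact: is_derive_cst]. Qed.

Lemma CderD h g t l l' :
  Cder h t l -> Cder g t l' -> Cder (fun x => h x + g x) t (l + l').
Proof.
move=> [a b] [c d]; split.
- rewrite ReD (_ : (fun _ => _) = (fun x => Re (h x)) + (fun x => Re (g x))).
    exact: is_deriveD.
  by apply/funext => x; rewrite ReD.
- rewrite ImD (_ : (fun _ => _) = (fun x => Im (h x)) + (fun x => Im (g x))).
    exact: is_deriveD.
  by apply/funext => x; rewrite ImD.
Qed.

Lemma CderM h g t l l' : Cder h t l -> Cder g t l' ->
  Cder (fun x => h x * g x) t (l * g t + h t * l').
Proof.
move=> [a b] [c d]; split.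
- rewrite (_ : (fun _ => _) = (fun x => Re (h x)) * (fun x => Re (g x))
      - (fun x => Im (h x)) * (fun x => Im (g x))); last first.
    by apply/funext => x; rewrite ReM.
  apply: is_derive_eq (is_deriveB (is_deriveM a c) (is_deriveM b d)) _.
  rewrite /GRing.scale /= !CE; ring.
- rewrite (_ : (fun _ => _) = (fun x => Re (h x)) * (fun x => Im (g x))
      + (fun x => Im (h x)) * (fun x => Re (g x))); last first.
    by apply/funext => x; rewrite ImM.
  apply: is_derive_eq (is_deriveD (is_deriveM a d) (is_deriveM b c)) _.
  rewrite /GRing.scale /= !CE; ring.
Qed.

Lemma CderZ (c : R[i]) h t l : Cder h t l -> Cder (fun x => c * h x) t (c * l).
Proof.
by move=> hl; apply: Cder_eq (CderM (Cder_cst c t) hl) _; rewrite mul0r add0r.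
Qed.

Lemma CderN h t l : Cder h t l -> Cder (fun x => - h x) t (- l).
Proof.
move=> hl; apply: (@Cder_ext (fun x => (-1) * h x)).
  by move=> x; rewrite mulN1r.
by apply: Cder_eq (CderZ (-1) hl) _; rewrite mulN1r.
Qed.

Lemma CderB h g t l l' :
  Cder h t l -> Cder g t l' -> Cder (fun x => h x - g x) t (l - l').
Proof. by move=> a b; apply: CderD => //; exact: CderN. Qed.

Lemma Cder_real (f : R -> R) t (d : R) :
  is_derive t (1:R) f d -> Cder (fun x => (f x)%:C) t d%:C.
Proof. by move=> h; split => //; exact: is_derive_cst. Qed.

Lemma is_derive_chain (f : R -> R) (u : R -> R) t (d e : R) :
  is_derive t (1:R) u e -> is_derive (u t) (1:R) f d ->
  is_derive t (1:R) (fun x => f (u x)) (e * d).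
Proof. by move=> hu hf; rewrite mulrC; exact: (@is_derive1_comp _ f u). Qed.

Lemma Cder_comp h (u : R -> R) t l (e : R) :
  is_derive t (1:R) u e -> Cder h (u t) l ->
  Cder (fun x => h (u x)) t (e%:C * l).
Proof.
move=> hu [a b]; split.
- apply: is_derive_eq (is_derive_chain hu a) _; rewrite !CE; ring.
- apply: is_derive_eq (is_derive_chain hu b) _; rewrite !CE; ring.
Qed.

Lemma Cder_cexp h t l : Cder h t l ->
  Cder (fun x => cexp (h x)) t (cexp (h t) * l).
Proof.
move=> [a b].
have e := is_derive_chain a (is_derive_expR (Re (h t))).
have c := is_derive_chain b (is_derive_cos (Im (h t))).
have s := is_derive_chain b (is_derive_sin (Im (h t))).
split => /=.
- rewrite (_ : (fun _ => _) = (fun x => expR (Re (h x))) * (fun x => cos (Im (h x)))) //.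
  by apply: is_derive_eq (is_deriveM e c) _; rewrite ReM /cexp /GRing.scale /=; ring.
- rewrite (_ : (fun _ => _) = (fun x => expR (Re (h x))) * (fun x => sin (Im (h x)))) //.
  by apply: is_derive_eq (is_deriveM e s) _; rewrite ImM /cexp /GRing.scale /=; ring.
Qed.

Lemma CderV h t l : h t != 0 -> Cder h t l ->
  Cder (fun x => (h x)^-1) t (- (l / h t ^+ 2)).
Proof.
move=> h0 [a b].
pose N x := Re (h x) * Re (h x) + Im (h x) * Im (h x).
have N0 : N t != 0.
  apply: contra h0 => /eqP; rewrite /N -!expr2 => /eqP.
  rewrite paddr_eq0 ?sqr_ge0// !sqrf_eq0 => /andP[/eqP x /eqP y].
  by apply/eqP; apply: complex_ext.
have dN : is_derive t (1:R) N (2 * (Re (h t) * Re l + Im (h t) * Im l)).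
  by apply: is_derive_eq (is_deriveD (is_deriveM a a) (is_deriveM b b)) _; rewrite /GRing.scale /=; ring.
have dV : is_derive t (1:R) (fun x => (N x)^-1)
    (- (N t) ^- 2 * (2 * (Re (h t) * Re l + Im (h t) * Im l))).
  by apply: is_derive_eq (is_deriveV N0 _) _ => //.
have VE x : (h x)^-1 = (Re (h x) * (N x)^-1) +i* (- Im (h x) * (N x)^-1).
  rewrite /N; case: (h x) => u v /=; rewrite -!expr2 mulNr.
  by rewrite -[(u +i* v)^-1]/((u / (u ^+ 2 + v ^+ 2)) +i* - (v / (u ^+ 2 + v ^+ 2))).
have VR : Re (h t)^-1 = Re (h t) * (N t)^-1 by rewrite VE.
have VI : Im (h t)^-1 = - Im (h t) * (N t)^-1 by rewrite VE.
have NV : (N t)^-1 = N t * ((N t)^-1 * (N t)^-1) by rewrite mulrA divff// mul1r.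
have lR : Re (- (l / h t ^+ 2)) =
    Re l * (N t)^-1 - Re (h t) * (N t) ^- 2 * (2 * (Re (h t) * Re l + Im (h t) * Im l)).
  rewrite !expr2 !invfM ReN !ReM !ImM VR VI [X in _ = _ * X - _]NV.
  by move: (N t)^-1 => v; rewrite /N; ring.
have lI : Im (- (l / h t ^+ 2)) =
    - Im l * (N t)^-1 + Im (h t) * (N t) ^- 2 * (2 * (Re (h t) * Re l + Im (h t) * Im l)).
  rewrite !expr2 !invfM ImN !ImM !ReM VR VI [X in _ = _ * X + _]NV.
  by move: (N t)^-1 => v; rewrite /N; ring.
split; rewrite ?lR ?lI.
- rewrite (_ : (fun _ => _) = (fun x => Re (h x)) * (fun x => (N x)^-1)); last first.
    by apply/funext => x; rewrite VE.
  by apply: is_derive_eq (is_deriveM a dV) _; rewrite /GRing.scale /=; ring.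
- rewrite (_ : (fun _ => _) = (- (fun x => Im (h x))) * (fun x => (N x)^-1)); last first.
    by apply/funext => x; rewrite VE.
  by apply: is_derive_eq (is_deriveM (is_deriveN b) dV) _; rewrite /GRing.scale /= ?fctE; ring.
Qed.

Definition Ccont h := continuous (fun x => Re (h x)) /\ continuous (fun x => Im (h x)).

Lemma is_derive_cvg (f : R -> R) t (d : R) : is_derive t (1:R) f d ->
  {for t, continuous f}.
Proof. by move=> [dv _]; apply/differentiable_continuous/derivable1_diffP. Qed.

Lemma Cder_cont h h' : (forall t, Cder h t (h' t)) -> Ccont h.
Proof. by move=> d; split => t; exact: is_derive_cvg (proj1 (d t)) || exact: is_derive_cvg (proj2 (d t)). Qed.

Lemma CcontD h g : Ccont h -> Ccont g -> Ccont (fun x => h x + g x).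
Proof.
move=> [a b] [c d]; split => t.
- under eq_fun do rewrite ReD; apply: cvgD; [exact: a|exact: c].
- under eq_fun do rewrite ImD; apply: cvgD; [exact: b|exact: d].
Qed.

Lemma CcontM h g : Ccont h -> Ccont g -> Ccont (fun x => h x * g x).
Proof.
move=> [a b] [c d]; split => t.
- under eq_fun do rewrite ReM; apply: cvgB; apply: cvgM;
  [exact: a|exact: c|exact: b|exact: d].
- under eq_fun do rewrite ImM; apply: cvgD; apply: cvgM;
  [exact: a|exact: d|exact: b|exact: c].
Qed.

Lemma Ccont_cst (c : R[i]) : Ccont (fun=> c).
Proof. by split => t; exact: cvg_cst. Qed.

End ComplexDerivative.

(** * Integration of complex-valued functions *)

Section ComplexIntegral.
Variable R : realType.
Local Notation mu := (@lebesgue_measure R).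
Definition Cmeas d (T : measurableType d) (D : set T) (u : T -> R[i]) :=
  measurable_fun D (fun x => Re (u x)) /\ measurable_fun D (fun x => Im (u x)).

Section Measurability.
Context d (T : measurableType d).
Implicit Types (D : set T) (u v : T -> R[i]).

Lemma CmeasD D u v : Cmeas D u -> Cmeas D v -> Cmeas D (fun x => u x + v x).
Proof.
move=> [a b] [c e]; split.
- by under eq_fun do rewrite ReD; exact: measurable_funD.
- by under eq_fun do rewrite ImD; exact: measurable_funD.
Qed.

Lemma CmeasM D u v : Cmeas D u -> Cmeas D v -> Cmeas D (fun x => u x * v x).
Proof.
move=> [a b] [c e]; split.
- by under eq_fun do rewrite ReM; apply: measurable_funB; exact: measurable_funM.
- by under eq_fun do rewrite ImM; apply: measurable_funD; exact: measurable_funM.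
Qed.

Lemma Cmeas_cst D (c : R[i]) : Cmeas D (fun=> c).
Proof. by split; exact: measurable_cst. Qed.

Lemma CmeasB D u v : Cmeas D u -> Cmeas D v -> Cmeas D (fun x => u x - v x).
Proof.
move=> a b; apply: CmeasD => //.
by under eq_fun do rewrite -mulN1r; apply: CmeasM => //; exact: Cmeas_cst.
Qed.

Lemma Cmeas_real D (f : T -> R) : measurable_fun D f -> Cmeas D (fun x => (f x)%:C).
Proof. by split => //; exact: measurable_cst. Qed.

Lemma Cmeas_cexp D u : Cmeas D u -> Cmeas D (fun x => cexp (u x)).
Proof.
move=> [a b].
have c : measurable_fun D (fun x => cos (Im (u x))).
  have mc : measurable_fun setT (@cos R : R -> R).
    by apply: continuous_measurable_fun => x; exact: is_derive_cvg (is_derive_cos x).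
  exact: measurableT_comp mc b.
have s : measurable_fun D (fun x => sin (Im (u x))).
  have mc : measurable_fun setT (@sin R : R -> R).
    by apply: continuous_measurable_fun => x; exact: is_derive_cvg (is_derive_sin x).
  exact: measurableT_comp mc b.
have e : measurable_fun D (fun x => expR (Re (u x))).
  by apply: (measurableT_comp (f := @expR R)) ; [exact: measurable_expR | exact: a].
by split => /=; exact: measurable_funM.
Qed.

Lemma Cmeas_cabs D u : Cmeas D u -> measurable_fun D (fun x => cabs (u x)).
Proof.
move=> [a b]; under eq_fun do rewrite cabsE.
apply: (measurableT_comp (f := (@Num.sqrt R : R -> R))).
  by apply: continuous_measurable_fun; exact: sqrt_continuous.
by apply: measurable_funD; exact: measurable_funX.
Qed.

Lemma Cmeas_S D E u : measurable E -> D `<=` E -> Cmeas E u -> Cmeas D u.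
Proof. by move=> mE DE [a b]; split; exact: measurable_funS a || exact: measurable_funS b. Qed.

Lemma Cmeas_comp d' (T' : measurableType d') (g : T' -> T) u :
  measurable_fun setT g -> Cmeas setT u -> Cmeas setT (fun x => u (g x)).
Proof. by move=> mg [a b]; split; [exact: measurableT_comp a mg|exact: measurableT_comp b mg]. Qed.

Lemma Cmeas_cvg D (h : nat -> T -> R[i]) u : (forall m, Cmeas D (h m)) ->
  (forall x, D x -> (fun m => Re (h m x)) @ \oo --> Re (u x)) ->
  (forall x, D x -> (fun m => Im (h m x)) @ \oo --> Im (u x)) -> Cmeas D u.
Proof.
move=> mh hr hi; split.
- by apply: (@measurable_fun_cvg _ _ _ D (fun m x => Re (h m x))) => // m; exact: (mh m).1.
- by apply: (@measurable_fun_cvg _ _ _ D (fun m x => Im (h m x))) => // m; exact: (mh m).2.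
Qed.

End Measurability.

Lemma Ccont_meas (D : set R) (u : R -> R[i]) : measurable D -> Ccont u -> Cmeas D u.
Proof.
move=> mD [a b]; split.
- by apply: measurable_funTS; exact: continuous_measurable_fun.
- by apply: measurable_funTS; exact: continuous_measurable_fun.
Qed.

Section Integrability.
Context d (T : measurableType d) (nu : {measure set T -> \bar R}).
Implicit Types (D : set T) (u v : T -> R[i]).

Lemma Cintegrable_meas D u : Cintegrable nu D u -> Cmeas D u.
Proof.
by move=> [a b]; split; apply/measurable_EFinP; [exact: measurable_int a|exact: measurable_int b].
Qed.

Lemma Cintegrable_dom D u (g : T -> R) : measurable D -> Cmeas D u ->
  nu.-integrable D (EFin \o g) -> (forall x, D x -> cabs (u x) <= g x) ->
  Cintegrable nu D u.
Proof.
move=> mD [a b] ig ug; split.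
- apply: le_integrable ig => //; first exact/measurable_EFinP.
  move=> x Dx /=; rewrite lee_fin (le_trans (Re_le_cabs _))// (le_trans (ug _ Dx))//.
  exact: ler_norm.
- apply: le_integrable ig => //; first exact/measurable_EFinP.
  move=> x Dx /=; rewrite lee_fin (le_trans (Im_le_cabs _))// (le_trans (ug _ Dx))//.
  exact: ler_norm.
Qed.

Lemma Cintegrable_cabs D u : measurable D -> Cintegrable nu D u ->
  nu.-integrable D (fun x => (cabs (u x))%:E).
Proof.
move=> mD iu; have [mr mi] := Cintegrable_meas iu; case: iu => ir ii.
have i1 : nu.-integrable D (fun x => `|(Re (u x))%:E|)%E by exact: integrable_norm.
have i2 : nu.-integrable D (fun x => `|(Im (u x))%:E|)%E by exact: integrable_norm.
apply: le_integrable (integrableD mD i1 i2) => //.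
  by apply/measurable_EFinP; exact: Cmeas_cabs.
move=> x Dx /=; rewrite lee_fin ger0_norm ?cabs_ge0// ger0_norm ?addr_ge0//.
exact: cabs_le_ReIm.
Qed.

Lemma CintegrableZ D (c : R[i]) u : measurable D -> Cintegrable nu D u ->
  Cintegrable nu D (fun x => c * u x).
Proof.
move=> mD [a b]; split.
- by under eq_fun do rewrite ReM EFinB !EFinM; apply: integrableB => //; exact: integrableZl.
- by under eq_fun do rewrite ImM EFinD !EFinM; apply: integrableD => //; exact: integrableZl.
Qed.

Lemma CintegrableM_bdd D u v (K : R) : measurable D -> Cmeas D u ->
  (forall x, D x -> cabs (u x) <= K) -> Cintegrable nu D v ->
  Cintegrable nu D (fun x => u x * v x).
Proof.
move=> mD mu_ uK iv.
apply: (@Cintegrable_dom _ _ (fun x => K * cabs (v x))) => //.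
- by apply: CmeasM => //; exact: Cintegrable_meas iv.
- rewrite (_ : _ \o _ = fun x => (K%:E * (cabs (v x))%:E)%E) //.
  by apply: integrableZl => //; exact: Cintegrable_cabs.
- by move=> x Dx; rewrite cabsM ler_wpM2r ?cabs_ge0 ?uK.
Qed.

End Integrability.

Implicit Types (D : set R) (u v : R -> R[i]).

Lemma Cint_ext D u v : (forall t, D t -> u t = v t) -> Cint D u = Cint D v.
Proof.
move=> uv; apply: complex_ext => /=;
  by apply: eq_Rintegral => t /set_mem Dt; rewrite uv.
Qed.

Lemma CintD D u v : measurable D -> Cintegrable mu D u -> Cintegrable mu D v ->
  Cint D (fun t => u t + v t) = Cint D u + Cint D v.
Proof.
move=> mD [a b] [c e]; apply: complex_ext => /=.
- by under eq_Rintegral do rewrite ReD; rewrite RintegralD.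
- by under eq_Rintegral do rewrite ImD; rewrite RintegralD.
Qed.

Lemma RintegrableZ D (c : R) (f : R -> R) : measurable D ->
  mu.-integrable D (EFin \o f) -> mu.-integrable D (EFin \o (fun x => c * f x)).
Proof.
move=> mD h; rewrite (_ : _ \o _ = fun x => (c%:E * (f x)%:E)%E) //.
exact: integrableZl.
Qed.

Lemma CintZ D (c : R[i]) u : measurable D -> Cintegrable mu D u ->
  Cint D (fun t => c * u t) = c * Cint D u.
Proof.
move=> mD [a b].
have -> : c * Cint D u =
  (Re c * (\int[mu]_(t in D) Re (u t)) - Im c * (\int[mu]_(t in D) Im (u t))) +i*
  (Re c * (\int[mu]_(t in D) Im (u t)) + Im c * (\int[mu]_(t in D) Re (u t))).
  by case: (c).
apply: complex_ext.
- rewrite -[LHS]/(\int[mu]_(t in D) Re (c * u t)).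
  under eq_Rintegral do rewrite ReM.
  by rewrite RintegralB ?RintegralZl//; exact: RintegrableZ.
- rewrite -[LHS]/(\int[mu]_(t in D) Im (c * u t)).
  under eq_Rintegral do rewrite ImM.
  by rewrite RintegralD ?RintegralZl//; exact: RintegrableZ.
Qed.

Lemma CintB D u v : measurable D -> Cintegrable mu D u -> Cintegrable mu D v ->
  Cint D (fun t => u t - v t) = Cint D u - Cint D v.
Proof.
move=> mD iu iv; under Cint_ext do rewrite -mulN1r.
by rewrite CintD ?CintZ ?mulN1r//; exact: CintegrableZ.
Qed.

(** The real and the imaginary part are estimated separately; whence the
    factor two. *)
Lemma Cint_le D u (g : R -> R) : measurable D -> Cmeas D u ->
  mu.-integrable D (EFin \o g) -> (forall x, D x -> cabs (u x) <= g x) ->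
  cabs (Cint D u) <= 2 * \int[mu]_(t in D) g t.
Proof.
move=> mD mu_ ig ug; have [a b] := @Cintegrable_dom _ (measurableTypeR R) mu D u g mD mu_ ig ug.
rewrite (le_trans (cabs_le_ReIm _))//= mulr2n mulrDl !mul1r lerD//.
- rewrite (le_trans (le_normr_Rintegral _ _))//; apply: le_Rintegral => //.
    exact: (integrable_norm a).
  by move=> x Dx; rewrite (le_trans (Re_le_cabs _)) ?ug.
- rewrite (le_trans (le_normr_Rintegral _ _))//; apply: le_Rintegral => //.
    exact: (integrable_norm b).
  by move=> x Dx; rewrite (le_trans (Im_le_cabs _)) ?ug.
Qed.

Lemma Rint_dominated D (f_ : nat -> R -> R) (f g : R -> R) : measurable D ->
  (forall m, measurable_fun D (f_ m)) -> mu.-integrable D (EFin \o g) ->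
  (forall m x, D x -> `|f_ m x| <= g x) ->
  (forall x, D x -> f_ ^~ x @ \oo --> f x) ->
  (fun m => \int[mu]_(x in D) f_ m x) @ \oo --> \int[mu]_(x in D) f x.
Proof.
move=> mD mf ig fg cv.
have mlim : measurable_fun D f by exact: measurable_fun_cvg cv.
have cv' x : D x -> (fun m => (f_ m x)%:E) @ \oo --> (f x)%:E.
  by move=> Dx; apply: cvg_EFin; [exact: nearW|exact: cv].
have cva : {ae mu, forall x, D x -> (fun m => (f_ m x)%:E) @ \oo --> (f x)%:E}.
  by apply: aeW => x; exact: cv'.
have fga : {ae mu, forall x m, D x -> (`|(f_ m x)%:E| <= (EFin \o g) x)%E}.
  by apply: aeW => x m Dx; exact: fg.
have [ilim _ cvi] := @dominated_convergence _ _ _ mu D mD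
  (fun m x => (f_ m x)%:E) (fun x => (f x)%:E) (EFin \o g)
  (fun m => proj2 (measurable_EFinP _ _) (mf m)) (proj2 (measurable_EFinP _ _) mlim)
  cva ig fga.
apply: fine_cvg; rewrite fineK; first exact: cvi.
exact: integrable_fin_num.
Qed.

Definition Ccvg (z : nat -> R[i]) (l : R[i]) :=
  (fun m => Re (z m)) @ \oo --> Re l /\ (fun m => Im (z m)) @ \oo --> Im l.

Lemma Ccvg_unique z l l' : Ccvg z l -> Ccvg z l' -> l = l'.
Proof.
by move=> [a b] [c e]; apply: complex_ext; [exact: cvg_unique a c|exact: cvg_unique b e].
Qed.

Lemma CcvgM z w l l' : Ccvg z l -> Ccvg w l' -> Ccvg (fun m => z m * w m) (l * l').
Proof.
move=> [a b] [c e]; split.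
- by rewrite ReM; under eq_fun do rewrite ReM; apply: cvgB; exact: cvgM.
- by rewrite ImM; under eq_fun do rewrite ImM; apply: cvgD; exact: cvgM.
Qed.

Lemma CcvgD z w l l' : Ccvg z l -> Ccvg w l' -> Ccvg (fun m => z m + w m) (l + l').
Proof.
move=> [a b] [c e]; split.
- by rewrite ReD; under eq_fun do rewrite ReD; exact: cvgD.
- by rewrite ImD; under eq_fun do rewrite ImD; exact: cvgD.
Qed.

Lemma Ccvg_cst l : Ccvg (fun=> l) l.
Proof. by split; exact: cvg_cst. Qed.

Lemma Cint_dominated D (u_ : nat -> R -> R[i]) u (g : R -> R) : measurable D ->
  (forall m, Cmeas D (u_ m)) -> mu.-integrable D (EFin \o g) ->
  (forall m x, D x -> cabs (u_ m x) <= g x) ->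
  (forall x, D x -> Ccvg (fun m => u_ m x) (u x)) ->
  Ccvg (fun m => Cint D (u_ m)) (Cint D u).
Proof.
move=> mD mu_ ig ug cv; split => /=.
- apply: (@Rint_dominated D (fun m x => Re (u_ m x)) _ g) => //.
  + by move=> m; exact: (mu_ m).1.
  + by move=> m x Dx; rewrite (le_trans (Re_le_cabs _)) ?ug.
  + by move=> x Dx; exact: (cv x Dx).1.
- apply: (@Rint_dominated D (fun m x => Im (u_ m x)) _ g) => //.
  + by move=> m; exact: (mu_ m).2.
  + by move=> m x Dx; rewrite (le_trans (Im_le_cabs _)) ?ug.
  + by move=> x Dx; exact: (cv x Dx).2.
Qed.

Lemma is_derive_ball (F : R -> R) (c dF : R) :
  derivable F c 1 -> derive1 F c = dF -> is_derive c (1:R) F dF.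
Proof. by move=> dv <-; split => //; rewrite derive1E. Qed.

(** The real and the imaginary part of [dh] are dominated by [g], so the real
    theorem on differentiation under the integral sign applies to each. *)
Lemma Cint_derive D (h dh : R -> R -> R[i]) (g : R -> R) (a b c : R) :
  measurable D -> a < c < b ->
  (forall x, a < x < b -> Cintegrable mu D (h x)) ->
  (forall x t, a < x < b -> D t -> Cder (h ^~ t) x (dh x t)) ->
  (forall t, 0 <= g t) -> mu.-integrable D (EFin \o g) ->
  (forall x t, a < x < b -> D t -> cabs (dh x t) <= g t) ->
  Cder (fun x => Cint D (h x)) c (Cint D (dh c)).
Proof.
move=> mD cab ih dv g0 ig dg.
have Ic : `]a, b[%classic c by rewrite /= in_itv.
split => /=.
- have d1 x t : `]a, b[%classic x -> D t ->
      partial1of2 (fun x t => Re (h x t)) x t = Re (dh x t).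
    rewrite /= in_itv /= => xab Dt; rewrite partial1of2E.
    exact: (@derive_val _ _ _ _ _ _ _ (dv x t xab Dt).1).
  have ih' x : `]a, b[%classic x -> mu.-integrable D (EFin \o (fun t => Re (h x t))).
    by rewrite /= in_itv /= => /ih[].
  have dh' x t : `]a, b[%classic x -> D t -> derivable (fun x => Re (h x t)) x 1.
    by rewrite /= in_itv /= => /dv dd Dt; exact: (dd t Dt).1.(ex_derive).
  have bd x t : `]a, b[%classic x -> D t -> `|partial1of2 (fun x t => Re (h x t)) x t| <= g t.
    move=> xab Dt; rewrite d1// (le_trans (Re_le_cabs _))//.
    by move: xab; rewrite /= in_itv /= => /dg; exact.
  apply: is_derive_ball.
    exact: (@derivable_under_integral _ _ _ mu (fun x t => Re (h x t)) D mD c a b Ic ih' dh' g g0 ig bd).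
  rewrite (@differentiation_under_integral _ _ _ mu (fun x t => Re (h x t)) D mD c a b Ic ih' dh' g g0 ig bd).
  by apply: eq_Rintegral => t /set_mem Dt; rewrite -d1.
- have d1 x t : `]a, b[%classic x -> D t ->
      partial1of2 (fun x t => Im (h x t)) x t = Im (dh x t).
    rewrite /= in_itv /= => xab Dt; rewrite partial1of2E.
    exact: (@derive_val _ _ _ _ _ _ _ (dv x t xab Dt).2).
  have ih' x : `]a, b[%classic x -> mu.-integrable D (EFin \o (fun t => Im (h x t))).
    by rewrite /= in_itv /= => /ih[].
  have dh' x t : `]a, b[%classic x -> D t -> derivable (fun x => Im (h x t)) x 1.
    by rewrite /= in_itv /= => /dv dd Dt; exact: (dd t Dt).2.(ex_derive).
  have bd x t : `]a, b[%classic x -> D t -> `|partial1of2 (fun x t => Im (h x t)) x t| <= g t.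
    move=> xab Dt; rewrite d1// (le_trans (Im_le_cabs _))//.
    by move: xab; rewrite /= in_itv /= => /dg; exact.
  apply: is_derive_ball.
    exact: (@derivable_under_integral _ _ _ mu (fun x t => Im (h x t)) D mD c a b Ic ih' dh' g g0 ig bd).
  rewrite (@differentiation_under_integral _ _ _ mu (fun x t => Im (h x t)) D mD c a b Ic ih' dh' g g0 ig bd).
  by apply: eq_Rintegral => t /set_mem Dt; rewrite -d1.
Qed.

Lemma Rint_FTC (F f : R -> R) (a b : R) : a <= b ->
  (forall t, is_derive t (1:R) F (f t)) -> continuous f ->
  \int[mu]_(t in `[a, b]) f t = F b - F a.
Proof.
rewrite le_eqVlt => /predU1P[<- *|ab dF cf].
  by rewrite set_itv1 Rintegral_set1 subrr.
have cF t : {for t, continuous F} by exact: is_derive_cvg (dF t).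
rewrite /Rintegral (@continuous_FTC2 _ f F a b)//.
- exact: continuous_subspaceT.
- split; first by move=> x _; exact: (dF x).(ex_derive).
  + exact/cvg_at_right_filter/cF.
  + exact/cvg_at_left_filter/cF.
- by move=> x _; rewrite derive1E; exact: (@derive_val _ _ _ _ _ _ _ (dF x)).
Qed.

Lemma Cint_FTC (F f : R -> R[i]) (a b : R) : a <= b ->
  (forall t, Cder F t (f t)) -> Ccont f -> Cint `[a, b] f = F b - F a.
Proof.
move=> ab dF [c1 c2]; apply: complex_ext; rewrite /= !CE.
- exact: Rint_FTC ab (fun t => (dF t).1) c1.
- exact: Rint_FTC ab (fun t => (dF t).2) c2.
Qed.

Lemma Rcont_integrable (f : R -> R) (a b : R) :
  continuous f -> mu.-integrable `[a, b] (EFin \o f).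
Proof.
move=> cf; apply: continuous_compact_integrable; first exact: segment_compact.
exact: continuous_subspaceT.
Qed.

Lemma Ccont_integrable u (a b : R) : Ccont u -> Cintegrable mu `[a, b] u.
Proof. by move=> [c1 c2]; split; exact: Rcont_integrable. Qed.

(** * The invariance of Lebesgue measure under affine maps *)

Section Affine.
Variables (a b : R).
Hypothesis a0 : a != 0.

Definition affine (x : measurableTypeR R) : measurableTypeR R := a * x + b.

Lemma measurable_affine : measurable_fun setT affine.
Proof. by apply: measurable_funD => //; exact: measurable_funM. Qed.

Definition affine_measure : {measure set (measurableTypeR R) -> \bar R}.
Proof. by refine [the measure _ _ of pushforward mu affine]; exact: measurable_affine. Defined.

Let na0 : 0 <= `|a|. Proof. by []. Qed.

(** By uniqueness: after scaling by [`|a|], the image measure gives every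
    interval its length. *)
Lemma lebesgue_affine (A : set R) : measurable A ->
  mu A = mscale (NngNum na0) affine_measure A.
Proof.
apply: lebesgue_measure_unique => _ [[u v]] _ <-.
rewrite -[RHS]/(`|a|%:E * mu (affine @^-1` `]u, v]))%E /=.
have [pa|na] : 0 < a \/ a < 0 by apply/orP; rewrite orbC -neq_lt.
  rewrite (_ : _ @^-1` _ = `](u - b) / a, (v - b) / a]%classic); last first.
    apply/seteqP; split => x /=; rewrite /affine !in_itv /= ltr_pdivrMr// ler_pdivlMr// [x * a]mulrC;
    by rewrite ltrBlDr lerBrDr.
  rewrite !lebesgue_measure_itv /= !lte_fin ltr_pM2r ?invr_gt0// ltrD2r.
  case: ifPn => _; last by rewrite mule0.
  rewrite -!EFinB -EFinM gtr0_norm// -mulrBl opprB addrA subrK.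
  by rewrite mulrC divfK// gt_eqF.
rewrite (_ : _ @^-1` _ = `[(v - b) / a, (u - b) / a[%classic); last first.
  apply/seteqP; split => x /=; rewrite /affine !in_itv /= ler_ndivrMr// ltr_ndivlMr// [x * a]mulrC;
  by rewrite ltrBlDr lerBrDr andbC.
rewrite !lebesgue_measure_itv /= !lte_fin ltr_nM2r ?invr_lt0// ltrD2r.
case: ifPn => _; last by rewrite mule0.
rewrite -!EFinB -EFinM ltr0_norm// -mulrBl opprB addrA subrK.
by rewrite mulNr mulrC divfK ?lt_eqF// opprB.
Qed.

Lemma ge0_integral_affine (f : R -> \bar R) : measurable_fun setT f ->
  (forall x, 0 <= f x)%E ->
  (\int[mu]_x f x = `|a|%:E * \int[mu]_x f (a * x + b)%R)%E.
Proof.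
move=> mf f0.
rewrite (@eq_measure_integral _ _ _ setT (mscale (NngNum na0) affine_measure) mu); last first.
  by move=> A mA _; exact: lebesgue_affine.
rewrite ge0_integral_mscale//= (ge0_integral_pushforward measurable_affine)//.
Qed.

Lemma integrable_affine (f : R -> R) : mu.-integrable setT (EFin \o f) ->
  mu.-integrable setT (fun x => (f (a * x + b))%:E).
Proof.
move=> /integrableP[mf foo]; apply/integrableP; split.
  exact: measurableT_comp mf measurable_affine.
have mf' : measurable_fun setT (fun x : R => `|(f x)%:E|)%E by exact: measurableT_comp.
move: foo; rewrite (ge0_integral_affine mf')//.
move=> h; rewrite ltNge leye_eq; apply/eqP => e.
by move: h; rewrite e gt0_muley ?ltxx// lte_fin normr_gt0.
Qed.

Lemma Rint_affine (f : R -> R) : mu.-integrable setT (EFin \o f) ->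
  \int[mu]_x f x = `|a| * \int[mu]_x f (a * x + b).
Proof.
move=> fi; have fi' := integrable_affine fi; move/integrableP: (fi) => [mf _].
rewrite /Rintegral -[`|a|]/(fine `|a|%:E) -fineM//; last exact: integrable_fin_num fi'.
congr fine; rewrite integralE [in RHS]integralE.
rewrite (ge0_integral_affine (measurable_funepos mf))//.
rewrite (ge0_integral_affine (measurable_funeneg mf))//.
have fn := integrable_fin_num measurableT (integrable_funeneg measurableT fi').
set A := (X in (_ = _ * (X - _))%E); set B := (X in (_ = _ * (_ - X))%E).
have fB : B \is a fin_num by exact: fn.
rewrite [RHS]muleBr//; last by rewrite fin_num_adde_defl// fin_numN.
by congr (_ - _)%E; congr (_ * _)%E; apply: eq_integral => x _; rewrite ?funeposE ?funenegE.
Qed.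

Lemma Cint_affine u : Cintegrable mu setT u ->
  Cint setT u = `|a|%:C * Cint setT (fun x => u (a * x + b)).
Proof.
move=> [i1 i2]; apply: complex_ext; rewrite !CE mul0r ?subr0 ?addr0.
- exact: (@Rint_affine (fun x => Re (u x))).
- exact: (@Rint_affine (fun x => Im (u x))).
Qed.

End Affine.

End ComplexIntegral.

(** * Inverses, conjugates and reflections of complex integrands *)

Section RealIntegrals.
Variable R : realType.
Local Notation mu := (@lebesgue_measure R).
Implicit Types (D : set R) (u v : R -> R[i]).

Lemma measurable_invr : measurable_fun setT (fun x : R => x^-1).
Proof.
pose h (m : nat) (x : R) := x * (x ^+ 2 + m.+1%:R^-1)^-1.
have p m (x : R) : x ^+ 2 + m.+1%:R^-1 != 0.
  by rewrite gt_eqF// ltr_wpDl ?sqr_ge0// invr_gt0 ltr0n.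
apply: (@measurable_fun_cvg _ _ _ setT h) => [m|x _].
  apply: continuous_measurable_fun => x; apply: cvgM; first exact: cvg_id.
  apply: cvgV => //; apply: cvgD; last exact: cvg_cst.
  exact: (@exprn_continuous R 2 x).
have [->|x0] := eqVneq x 0.
  by rewrite invr0 /h; under eq_fun do rewrite mul0r; exact: cvg_cst.
have -> : x^-1 = x * (x ^+ 2 + 0)^-1 by rewrite addr0 expr2 invfM mulrA divff// mul1r.
apply: cvgM; first exact: cvg_cst.
apply: cvgV; first by rewrite addr0 sqrf_eq0.
by apply: cvgD; [exact: cvg_cst|exact: cvg_harmonic].
Qed.

Lemma invcE (z : R[i]) :
  z^-1 = (Re z * (Re z ^+ 2 + Im z ^+ 2)^-1) +i* (- Im z * (Re z ^+ 2 + Im z ^+ 2)^-1).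
Proof.
case: z => u v /=; rewrite mulNr.
by rewrite -[(u +i* v)^-1]/((u / (u ^+ 2 + v ^+ 2)) +i* - (v / (u ^+ 2 + v ^+ 2))).
Qed.

Lemma CmeasV d (T : measurableType d) (D : set T) (u : T -> R[i]) :
  Cmeas D u -> Cmeas D (fun x => (u x)^-1).
Proof.
move=> [a b].
have m : measurable_fun D (fun x => (Re (u x) ^+ 2 + Im (u x) ^+ 2)^-1).
  apply: (measurableT_comp measurable_invr).
  by apply: measurable_funD; exact: measurable_funX.
split; under eq_fun do rewrite invcE /=; apply: measurable_funM => //.
by under eq_fun do rewrite -mulN1r; apply: measurable_funM.
Qed.

Lemma CcontV u : (forall t, u t != 0) -> Ccont u -> Ccont (fun t => (u t)^-1).
Proof.
move=> u0 [a b].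
have n0 t : Re (u t) ^+ 2 + Im (u t) ^+ 2 != 0.
  rewrite -cabs_sq sqrf_eq0; apply: contra (u0 t) => /eqP/cabs_eq0->//.
have c t : (fun t => (Re (u t) ^+ 2 + Im (u t) ^+ 2)^-1) x @[x --> t] -->
    (Re (u t) ^+ 2 + Im (u t) ^+ 2)^-1.
  apply: cvgV => //; apply: cvgD.
    by apply: (@cvg_comp _ _ _ _ (fun x : R => x ^+ 2) _ _ _ (a t)); exact: exprn_continuous.
  by apply: (@cvg_comp _ _ _ _ (fun x : R => x ^+ 2) _ _ _ (b t)); exact: exprn_continuous.
split => t; under eq_fun do rewrite invcE /=; apply: cvgM; try exact: c.
  exact: a.
apply: cvgN; exact: b.
Qed.

Lemma Ccont_cexp u : Ccont u -> Ccont (fun t => cexp (u t)).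
Proof.
move=> [a b].
have e t : (fun t => expR (Re (u t))) x @[x --> t] --> expR (Re (u t)).
  by apply: (@cvg_comp _ _ _ _ (@expR R) _ _ _ (a t)); exact: continuous_expR.
have c t : (fun t => cos (Im (u t))) x @[x --> t] --> cos (Im (u t)).
  by apply: (@cvg_comp _ _ _ _ (@cos R) _ _ _ (b t)); exact: continuous_cos.
have s t : (fun t => sin (Im (u t))) x @[x --> t] --> sin (Im (u t)).
  by apply: (@cvg_comp _ _ _ _ (@sin R) _ _ _ (b t)); exact: continuous_sin.
by split => t; rewrite /cexp /=; apply: cvgM; by [exact: e|exact: c|exact: s].
Qed.

Lemma Ccont_rC : Ccont (fun t : R => t%:C).
Proof. by apply: (@Cder_cont _ _ (fun=> 1)) => t; exact: Cder_id. Qed.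

Lemma Ccont_cabs u : Ccont u -> continuous (fun t => cabs (u t)).
Proof.
move=> [a b] t; under eq_fun do rewrite cabsE.
apply: (@cvg_comp _ _ _ (fun t => Re (u t) ^+ 2 + Im (u t) ^+ 2) (@Num.sqrt R)).
  apply: cvgD.
    by apply: (@cvg_comp _ _ _ _ (fun x : R => x ^+ 2) _ _ _ (a t)); exact: exprn_continuous.
  by apply: (@cvg_comp _ _ _ _ (fun x : R => x ^+ 2) _ _ _ (b t)); exact: exprn_continuous.
exact: sqrt_continuous.
Qed.

Lemma integrable_cauchy :
  mu.-integrable setT (EFin \o (fun t : R => (1 + t ^+ 2)^-1)).
Proof.
have f0 (x : R) : 0 <= (1 + x ^+ 2)^-1 by rewrite invr_ge0 addr_ge0 ?sqr_ge0.
have cf : continuous (fun t : R => (1 + t ^+ 2)^-1).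
  by move=> x; exact: (@continuous_oneDsqrV R x).
apply/integrableP; split.
  by apply/measurable_EFinP; exact: continuous_measurable_fun.
under eq_integral do rewrite /= ger0_norm//.
rewrite ge0_symfun_integralT//; last by move=> x /=; rewrite sqrrN.
rewrite (_ : [set x : R | 0 <= x] = `[0, +oo[%classic); last first.
  by apply/seteqP; split => x /=; rewrite in_itv /= andbT.
have := integral0y_oneDsqr R; rewrite /oneDsqr => ->.
by rewrite -EFinM ltry.
Qed.

Lemma Rintegral_cauchy : \int[mu]_t (1 + t ^+ 2)^-1 = pi :> R.
Proof.
have f0 (x : R) : 0 <= (1 + x ^+ 2)^-1 by rewrite invr_ge0 addr_ge0 ?sqr_ge0.
have cf : continuous (fun t : R => (1 + t ^+ 2)^-1).
  by move=> x; exact: (@continuous_oneDsqrV R x).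
rewrite /Rintegral ge0_symfun_integralT//; last by move=> x /=; rewrite sqrrN.
rewrite (_ : [set x : R | 0 <= x] = `[0, +oo[%classic); last first.
  by apply/seteqP; split => x /=; rewrite in_itv /= andbT.
have := integral0y_oneDsqr R; rewrite /oneDsqr => ->.
by rewrite -EFinM /= mulrC divfK.
Qed.

Lemma integrable_cauchyZ D (K : R) : measurable D ->
  mu.-integrable D (EFin \o (fun t : R => K * (1 + t ^+ 2)^-1)).
Proof.
move=> mD; apply: RintegrableZ => //.
by apply: integrableS integrable_cauchy.
Qed.

Lemma integrable_cst_itv (a b K : R) :
  mu.-integrable `[a, b] (EFin \o (fun=> K)).
Proof. by apply: Rcont_integrable => x; exact: cvg_cst. Qed.

Definition Crestr D u (t : R) : R[i] := if t \in D then u t else 0.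

Lemma Cint_mkcond D u : Cint D u = Cint setT (Crestr D u).
Proof.
apply: complex_ext => /=; rewrite Rintegral_mkcond; apply: eq_Rintegral => x _;
  by rewrite /Crestr /patch /=; case: ifP.
Qed.

Lemma Cintegrable_mkcond D u : measurable D -> Cintegrable mu D u ->
  Cintegrable mu setT (Crestr D u).
Proof.
move=> mD [a b]; split.
- rewrite (_ : (fun x => _) = ((fun x => (Re (u x))%:E) \_ D)%E); first exact: (proj1 (@integrable_mkcond _ (measurableTypeR R) _ mu D _ mD) a).
  by apply/funext => x; rewrite /Crestr /patch /=; case: ifP.
- rewrite (_ : (fun x => _) = ((fun x => (Im (u x))%:E) \_ D)%E); first exact: (proj1 (@integrable_mkcond _ (measurableTypeR R) _ mu D _ mD) b).
  by apply/funext => x; rewrite /Crestr /patch /=; case: ifP.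
Qed.

Lemma Cint_reflect D D' u (b : R) : measurable D -> Cintegrable mu D u ->
  (forall t, D' t <-> D (b - t)) -> Cint D u = Cint D' (fun t => u (b - t)).
Proof.
move=> mD iu DD'.
have N1 : (-1 : R) != 0 by rewrite oppr_eq0 oner_eq0.
rewrite Cint_mkcond (Cint_affine b N1); last exact: Cintegrable_mkcond.
rewrite normrN normr1 mul1r [RHS]Cint_mkcond; apply: Cint_ext => t _.
rewrite /Crestr mulN1r addrC; congr (if _ then _ else _).
by apply/asboolP/asboolP => /DD'.
Qed.

Lemma Cint_conj D u : measurable D -> Cintegrable mu D u ->
  (Cint D u)^*%C = Cint D (fun t => (u t)^*%C).
Proof.
move=> mD [a b]; apply: complex_ext => /=.
  by apply: eq_Rintegral => t _; case: (u t).
rewrite -mulN1r -RintegralZl//; apply: eq_Rintegral => t _.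
by case: (u t) => x y /=; rewrite mulN1r.
Qed.

(** The difference quotient at the origin, along a sequence and for a function
    vanishing there; it yields the limits of the integrand on small half
    circles. *)
Lemma Cder_quot_cvg (h : R -> R[i]) (l : R[i]) (s : nat -> R) :
  Cder h 0 l -> h 0 = 0 -> (forall m, s m != 0) -> s @ \oo --> (0 : R) ->
  Ccvg (fun m => h (s m) / (s m)%:C) l.
Proof.
have key (f : R -> R) (d : R) : is_derive (0 : R) (1 : R) f d -> f 0 = 0 ->
    (forall m, s m != 0) -> s @ \oo --> (0 : R) ->
    (fun m => f (s m) / s m) @ \oo --> d.
  move=> [df <-] f0 s0 sc.
  have /cvgr_dnbhsP/(_ s (conj s0 sc)) : h^-1 *: (f (h *: (1:R) + 0) - f 0) @[h --> 0^'] --> 'D_1 f 0.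
    exact: df.
  apply: cvg_trans; apply: near_eq_cvg; apply: nearW => m /=.
  by rewrite f0 subr0 addr0 /GRing.scale /= mulr1 mulrC.
move=> [a b] h0 s0 sc.
have e m : h (s m) / (s m)%:C = (Re (h (s m)) / s m) +i* (Im (h (s m)) / s m).
  by rewrite -rCV; apply: complex_ext; rewrite !CE /= mulr0 ?subr0 ?add0r.
split; under eq_fun do rewrite e /=; apply: key => //; by rewrite h0.
Qed.

Lemma CcvgV (z : nat -> R[i]) (l : R[i]) : l != 0 -> Ccvg z l ->
  Ccvg (fun m => (z m)^-1) l^-1.
Proof.
move=> l0 [a b].
have n0 : Re l ^+ 2 + Im l ^+ 2 != 0.
  rewrite -cabs_sq sqrf_eq0; apply: contra l0 => /eqP/cabs_eq0->//.
have c : (fun m => (Re (z m) ^+ 2 + Im (z m) ^+ 2)^-1) @ \oo -->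
    (Re l ^+ 2 + Im l ^+ 2)^-1.
  apply: cvgV => //; apply: cvgD.
    by apply: (@cvg_comp _ _ _ _ (fun x : R => x ^+ 2) _ _ _ a); exact: exprn_continuous.
  by apply: (@cvg_comp _ _ _ _ (fun x : R => x ^+ 2) _ _ _ b); exact: exprn_continuous.
split; under eq_fun do rewrite invcE /=; rewrite invcE /=; apply: cvgM => //.
exact: cvgN.
Qed.

Lemma Cder0_cst (h : R -> R[i]) (a b x y : R) :
  (forall t, a < t < b -> Cder h t 0) -> a < x < b -> a < y < b -> h x = h y.
Proof.
have key (f : R -> R) (u v : R) : a < u < b -> a < v < b -> u <= v ->
    (forall t, a < t < b -> is_derive t (1:R) f 0) -> f u = f v.
  move=> /andP[au ub] /andP[av vb] uv df.
  have d t : t \in `]u, v[ -> is_derive t (1:R) f ((fun=> 0) t).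
    rewrite in_itv /= => /andP[ut tv]; apply: df.
    by rewrite (lt_trans au ut) (lt_trans tv vb).
  have cf : {within `[u, v], continuous f}.
    apply: derivable_within_continuous => t; rewrite in_itv /= => /andP[ut tv].
    by apply: (@ex_derive _ _ _ _ _ _ _ (df t _)); rewrite (lt_le_trans au ut) (le_lt_trans tv vb).
  have [c _] := MVT_segment uv d cf.
  by rewrite mul0r => /eqP; rewrite subr_eq0 => /eqP.
move=> dh hx hy; have [le|/ltW le] := lerP x y; apply: complex_ext.
- by apply: (key (fun t => Re (h t))) => // t /dh[].
- by apply: (key (fun t => Im (h t))) => // t /dh[].
- by apply/esym; apply: (key (fun t => Re (h t))) => // t /dh[].
- by apply/esym; apply: (key (fun t => Im (h t))) => // t /dh[].
Qed.

Lemma Cint_dom D u (g : R -> R) : measurable D -> Cmeas D u ->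
  mu.-integrable D (EFin \o g) -> (forall x, D x -> cabs (u x) <= g x) ->
  Cintegrable mu D u.
Proof.
move=> a b c d; have [p q] := @Cintegrable_dom R _ (measurableTypeR R) mu D u g a b c d.
by split; [exact: p|exact: q].
Qed.

Lemma conjM (x y : R[i]) : (x * y)^*%C = x^*%C * y^*%C.
Proof. by case: x y => a b [c d]; apply: complex_ext => /=; ring. Qed.
Lemma conjN (x : R[i]) : (- x)^*%C = - x^*%C.
Proof. by case: x. Qed.
Lemma conj_rC (x : R) : (x%:C)^*%C = x%:C :> R[i].
Proof. by apply: complex_ext; rewrite //= oppr0. Qed.
Lemma conj_i : ('i%C : R[i])^*%C = - 'i%C.
Proof. by apply: complex_ext; rewrite //= oppr0. Qed.
Lemma conjD (x y : R[i]) : (x + y)^*%C = x^*%C + y^*%C.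
Proof. by case: x y => a b [c d]; apply: complex_ext => /=; ring. Qed.
Lemma cexp_ipi : cexp ('i%C * (- pi)%:C) = -1 :> R[i].
Proof.
by apply: complex_ext; rewrite /= !mul0r ?mul1r ?mulr0 ?subr0 ?addr0 ?add0r ?cosN ?sinN
  ?cospi ?sinpi expR0 ?mul1r ?oppr0 ?mulr0 ?oppr0.
Qed.

(** * Contour integrals of Fourier type *)

(** The weight [w] contains the factor [c'], so that this is the part of a
    contour integral coming from one parametrized piece [c] in the closed upper
    half plane. *)
Definition piece D (c w : R -> R[i]) (z : R) : R[i] :=
  Cint D (fun t => cexp (- 'i%C * c t * z%:C) * w t).

Section Piece.
Variables (D : set R) (c w : R -> R[i]) (g : R -> R) (B : R).
Hypotheses (mD : measurable D) (mc : Cmeas D c) (mw : Cmeas D w).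
Hypothesis cB : forall t, D t -> 0 <= Im (c t) <= B.
Hypothesis ig : mu.-integrable D (EFin \o g).
Hypothesis wg : forall t, D t -> cabs (w t) <= g t.

Lemma cabs_kernel t (z : R) :
  cabs (cexp (- 'i%C * c t * z%:C)) = expR (Im (c t) * z).
Proof. rewrite cabs_cexp; congr expR; rewrite ReM Re_rC Im_rC mulr0 subr0.
by rewrite ReM ReN ImN Re_i Im_i oppr0 mul0r mulN1r sub0r opprK. Qed.

Let meas (z : R) : Cmeas D (fun t => cexp (- 'i%C * c t * z%:C) * w t).
Proof.
apply: CmeasM => //; apply: Cmeas_cexp; apply: CmeasM; last exact: Cmeas_cst.
by apply: CmeasM => //; exact: Cmeas_cst.
Qed.

Lemma piece_integrable (z : R) :
  Cintegrable mu D (fun t => cexp (- 'i%C * c t * z%:C) * w t).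
Proof.
apply: (Cint_dom (g := fun t => expR (B * `|z|) * g t)) => //.
- exact: (RintegrableZ _ mD ig).
- move=> t Dt; rewrite cabsM cabs_kernel ler_pM ?expR_ge0 ?cabs_ge0 ?wg//.
  rewrite ler_expR; have /andP[a b] := cB Dt.
  rewrite (le_trans (ler_norm _))// normrM ler_wpM2r//.
  by rewrite ger0_norm.
Qed.

Lemma piece_bound (z : R) : z <= 0 -> cabs (piece D c w z) <= 2 * \int[mu]_(t in D) g t.
Proof.
move=> z0; apply: Cint_le => // t Dt.
rewrite cabsM cabs_kernel (le_trans _ (wg Dt))// ler_piMl ?cabs_ge0//.
by rewrite -expR0 ler_expR mulr_ge0_le0//; have /andP[] := cB Dt.
Qed.

Hypothesis g0 : forall t, 0 <= g t.
Hypothesis cwg : forall t, D t -> cabs (c t) * cabs (w t) <= g t.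

(** Every differentiation in [z] multiplies the weight by [- i c], so the
    hypothesis asks for a dominating function of both [w] and [c w]. *)
Lemma piece_derive (z : R) :
  Cder (piece D c w) z (piece D c (fun t => - 'i%C * c t * w t) z).
Proof.
apply: (@Cint_derive _ _ _ (fun z t => cexp (- 'i%C * c t * z%:C) * (- 'i%C * c t * w t))
  (fun t => expR (B * (`|z| + 1)) * g t) (z - 1) (z + 1)) => //.
- by apply/andP; split; lra.
- by move=> x _; exact: piece_integrable.
- move=> x t _ Dt.
  apply: Cder_eq (CderM (Cder_cexp (CderZ (- 'i%C * c t) (Cder_id x))) (Cder_cst (w t) x)) _.
  by ring.
- by move=> t; rewrite mulr_ge0 ?expR_ge0.
- exact: (RintegrableZ _ mD ig).
- move=> x t /andP[xa xb] Dt; rewrite cabsM cabs_kernel ler_pM ?expR_ge0 ?cabs_ge0//.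
    rewrite ler_expR; have /andP[a b] := cB Dt.
    rewrite (le_trans (ler_norm _))// normrM ger0_norm//.
    apply: ler_pM => //.
    have h := ler_norm z; have h' := ler_norm (- z); rewrite normrN in h'.
    by rewrite ler_norml; apply/andP; split; lra.
  by rewrite cabsM cabsM cabsN cabs_i mul1r cwg.
Qed.

End Piece.

End RealIntegrals.

Section Contour.
Variable R : realType.
Local Notation mu := (@lebesgue_measure R).
Variable r : R.
Hypothesis r0 : 0 < r.
Implicit Types (q : R[i] -> R[i]) (z t : R).

Definition arc t : R[i] := r%:C * cexp ('i%C * (pi - t)%:C).

Lemma cabs_arc t : cabs (arc t) = r.
Proof. by rewrite cabsM cabs_rC cabs_cexpi mulr1 gtr0_norm. Qed.

Lemma ImM_rC (x : R) (u : R[i]) : Im (x%:C * u) = x * Im u.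
Proof. by case: u => a b /=; rewrite mul0r addr0. Qed.

Lemma arc_Im t : 0 <= t <= pi -> 0 <= Im (arc t) <= r.
Proof.
move=> /andP[t0 tpi]; apply/andP; split; last first.
  by rewrite -[leRHS](cabs_arc t) (le_trans (ler_norm _)) ?Im_le_cabs.
rewrite ImM_rC mulr_ge0 ?(ltW r0)//= mulr_ge0 ?expR_ge0//.
rewrite mul0r mul1r add0r sin_ge0_pi//; apply/andP; split; lra.
Qed.

Lemma Cder_arc t : Cder arc t (- 'i%C * arc t).
Proof.
apply: Cder_eq (CderZ _ (Cder_cexp (CderZ _ (Cder_real _)))) _.
rewrite /arc add0r mul1r rCN rC1; ring.
Qed.

Lemma Ccont_arc : Ccont arc.
Proof. exact: Cder_cont Cder_arc. Qed.

Lemma arc_reflect t : arc (pi - t) = - (arc t)^*%C.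
Proof.
rewrite /arc subKr conjM conj_rC cexp_conj conjM conj_i conj_rC.
rewrite (_ : - 'i%C * (pi - t)%:C = 'i%C * t%:C + 'i%C * (- pi)%:C); last first.
  by rewrite rCB rCN; ring.
by rewrite cexpD cexp_ipi; ring.
Qed.

Lemma arc0 : arc 0 = - r%:C.
Proof.
by have := arc_reflect pi; rewrite subrr /arc subrr rC0 mulr0 cexp0 mulr1 conj_rC => ->.
Qed.

Lemma arc_pi : arc pi = r%:C.
Proof. by rewrite /arc subrr rC0 mulr0 cexp0 mulr1. Qed.

(** Only what makes the integrals over the two rays and the half circle converge,
    together with all their derivatives in [z], is required. *)
Definition contour_weight q := [/\ Ccont (fun t => q (arc t)), Cmeas setT (fun t : R => q t%:C)
  & forall N : nat, exists K : R, forall t, r <= `|t| -> `|t| ^+ N * cabs (q t%:C) <= K].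

Lemma contour_weight_mul q : contour_weight q -> contour_weight (fun p => - 'i%C * p * q p).
Proof.
move=> [c m d]; split.
- apply: CcontM => //; apply: CcontM; [exact: Ccont_cst|exact: Ccont_arc].
- apply: CmeasM => //; apply: CmeasM; first exact: Cmeas_cst.
  by apply: Cmeas_real; exact: measurable_id.
- move=> N; have [K hK] := d N.+1; exists K => t rt.
  rewrite cabsM cabsM cabsN cabs_i mul1r cabs_rC mulrA -exprSr; exact: hK.
Qed.

Lemma Ccont_bdd (u : R -> R[i]) (a b : R) : Ccont u -> a <= b ->
  exists K : R, forall t, a <= t <= b -> cabs (u t) <= K.
Proof.
move=> cu ab; have [c _ hc] := @EVT_max R _ a b ab (continuous_subspaceT (Ccont_cabs cu)).
by exists (cabs (u c)) => t tab; apply: hc; rewrite in_itv.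
Qed.

Definition contour_ft q z := contour_int r (fun p => cexp (- 'i%C * p * z%:C) * q p).

Let lineL := `]-oo, (- r)]%classic.
Let lineR := `[r, +oo[%classic.
Let half := `[(0 : R), pi]%classic.
Definition harc q t := q (arc t) * (- 'i%C * arc t).

Let mL : measurable (lineL : set R). Proof. exact: measurable_itv. Qed.
Let mR : measurable (lineR : set R). Proof. exact: measurable_itv. Qed.
Let mH : measurable (half : set R). Proof. exact: measurable_itv. Qed.
Let halfP t : half t -> 0 <= t <= pi. Proof. by rewrite /half /= in_itv. Qed.

Lemma contour_ft_pieces q z : contour_ft q z = piece lineL (fun t => t%:C) (fun t => q t%:C) z
  + piece half arc (harc q) z + piece lineR (fun t => t%:C) (fun t => q t%:C) z.
Proof.
rewrite /contour_ft /contour_int /piece; congr (_ + _ + _).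
by apply: Cint_ext => t _; rewrite /harc mulrA.
Qed.

Lemma line_norm t : lineL t \/ lineR t -> r <= `|t|.
Proof.
rewrite /lineL /lineR /= !in_itv /= andbT => -[h|h].
  by have := ler_norm (- t); rewrite normrN; lra.
by have := ler_norm t; lra.
Qed.

Lemma contour_weight_bound q : contour_weight q -> exists2 K : R, 0 <= K & forall t, r <= `|t| ->
  cabs (q t%:C) <= K * (1 + t ^+ 2)^-1 /\ `|t| * cabs (q t%:C) <= K * (1 + t ^+ 2)^-1.
Proof.
move=> [_ _ d].
have [K0 h0] := d 0%N; have [K1 h1] := d 1%N; have [K2 h2] := d 2%N; have [K3 h3] := d 3%N.
have rr : r <= `|r| by rewrite ler_norm.
have p (N : nat) K : (forall t, r <= `|t| -> `|t| ^+ N * cabs (q t%:C) <= K) -> 0 <= K.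
  by move=> /(_ r rr); apply: le_trans; rewrite mulr_ge0 ?exprn_ge0 ?cabs_ge0.
have := p _ _ h0; have := p _ _ h1; have := p _ _ h2; have := p _ _ h3 => q3 q2 q1 q0.
exists (K0 + K1 + K2 + K3); first by rewrite !addr_ge0.
move=> t rt; have D : 0 < 1 + t ^+ 2 by rewrite ltr_wpDr ?sqr_ge0.
rewrite !ler_pdivlMr//.
have := h0 t rt; have := h1 t rt; have := h2 t rt; have := h3 t rt.
rewrite expr0 expr1 mul1r exprS real_normK ?num_real// => e3 e2 e1 e0.
by split; nra.
Qed.

Lemma Ccont_harc q : contour_weight q -> Ccont (harc q).
Proof.
move=> [c _ _]; apply: CcontM => //; apply: CcontM; [exact: Ccont_cst|exact: Ccont_arc].
Qed.

Lemma contour_weight_harc q : contour_weight q -> exists2 K : R, 0 <= K & forall t, half t ->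
  cabs (harc q t) <= K /\ cabs (arc t) * cabs (harc q t) <= K.
Proof.
move=> gq; have [K hK] := Ccont_bdd (Ccont_harc gq) (pi_ge0 R).
have K0 : 0 <= K by apply: le_trans (cabs_ge0 _) (hK 0 _); rewrite lexx pi_ge0.
exists (K + r * K); first by rewrite addr_ge0 ?mulr_ge0 ?(ltW r0).
move=> t /halfP/hK h; rewrite cabs_arc.
have : 0 <= r * K by rewrite mulr_ge0 ?(ltW r0).
have : r * cabs (harc q t) <= r * K by rewrite ler_wpM2l ?(ltW r0).
by move=> *; split; lra.
Qed.

Let meas_id D : measurable D -> Cmeas D (fun t : R => t%:C).
Proof. by move=> mD; apply: Cmeas_real; exact: measurable_id. Qed.

Let meas_q q D : measurable D -> contour_weight q -> Cmeas D (fun t : R => q t%:C).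
Proof. by move=> mD [_ m _]; exact: Cmeas_S m. Qed.

Let Im_line D t : D t -> 0 <= Im (t%:C : R[i]) <= 0.
Proof. by rewrite /= lexx. Qed.

Lemma contour_ft_derive q z : contour_weight q -> Cder (contour_ft q) z (contour_ft (fun p => - 'i%C * p * q p) z).
Proof.
move=> gq; have [K K0 hK] := contour_weight_bound gq; have [M M0 hM] := contour_weight_harc gq.
have g0 (t : R) : 0 <= K * (1 + t ^+ 2)^-1.
  by rewrite mulr_ge0 ?invr_ge0 ?addr_ge0 ?sqr_ge0.
apply: (@Cder_ext _ (fun z => piece lineL (fun t => t%:C) (fun t => q t%:C) z
  + piece half arc (harc q) z + piece lineR (fun t => t%:C) (fun t => q t%:C) z)).
  by move=> x; rewrite contour_ft_pieces.
rewrite contour_ft_pieces; apply: CderD; first apply: CderD.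
- apply: (@piece_derive _ _ _ _ (fun t => K * (1 + t ^+ 2)^-1) 0) => //.
  + exact: meas_id.
  + exact: meas_q.
  + exact: Im_line.
  + exact: integrable_cauchyZ.
  + by move=> t lt; apply: (hK t _).1; apply: line_norm; left.
  + by move=> t lt; rewrite cabs_rC; apply: (hK t _).2; apply: line_norm; left.
- rewrite (_ : harc (fun p => - 'i%C * p * q p) = fun t => - 'i%C * arc t * harc q t); last first.
    by apply/funext => t; rewrite /harc; ring.
  apply: (@piece_derive _ _ _ _ (fun=> M) r) => //.
  + by apply: Ccont_meas => //; exact: Ccont_arc.
  + by apply: Ccont_meas => //; exact: Ccont_harc.
  + by move=> t /halfP; exact: arc_Im.
  + exact: integrable_cst_itv.
  + by move=> t /hM[].
  + by move=> t /hM[].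
- apply: (@piece_derive _ _ _ _ (fun t => K * (1 + t ^+ 2)^-1) 0) => //.
  + exact: meas_id.
  + exact: meas_q.
  + exact: Im_line.
  + exact: integrable_cauchyZ.
  + by move=> t lt; apply: (hK t _).1; apply: line_norm; right.
  + by move=> t lt; rewrite cabs_rC; apply: (hK t _).2; apply: line_norm; right.
Qed.

(** On the contour [Im p >= 0], so [e^(- i p z)] has modulus at most one for
    negative [z]. *)
Lemma contour_ft_bound q : contour_weight q -> exists K : R, forall z, z <= 0 -> cabs (contour_ft q z) <= K.
Proof.
move=> gq; have [K K0 hK] := contour_weight_bound gq; have [M M0 hM] := contour_weight_harc gq.
exists (2 * \int[mu]_(t in lineL) (K * (1 + t ^+ 2)^-1)
  + 2 * \int[mu]_(t in half) M + 2 * \int[mu]_(t in lineR) (K * (1 + t ^+ 2)^-1)).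
move=> z z0; rewrite contour_ft_pieces (le_trans (cabsD _ _))// lerD//.
  rewrite (le_trans (cabsD _ _))// lerD//.
    apply: (@piece_bound _ _ _ _ _ 0) => //.
    + exact: meas_id.
    + exact: meas_q.
    + exact: Im_line.
    + exact: integrable_cauchyZ.
    + by move=> t lt; apply: (hK t _).1; apply: line_norm; left.
  apply: (@piece_bound _ _ _ _ _ r) => //.
  + by apply: Ccont_meas => //; exact: Ccont_arc.
  + by apply: Ccont_meas => //; exact: Ccont_harc.
  + by move=> t /halfP; exact: arc_Im.
  + exact: integrable_cst_itv.
  + by move=> t /hM[].
apply: (@piece_bound _ _ _ _ _ 0) => //.
+ exact: meas_id.
+ exact: meas_q.
+ exact: Im_line.
+ exact: integrable_cauchyZ.
+ by move=> t lt; apply: (hK t _).1; apply: line_norm; right.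
Qed.

Lemma int_line q z D : measurable D -> (D `<=` lineL \/ D `<=` lineR) -> contour_weight q ->
  Cintegrable mu D (fun t => cexp (- 'i%C * t%:C * z%:C) * q t%:C).
Proof.
move=> mD DD gq; have [K K0 hK] := contour_weight_bound gq.
apply: (@piece_integrable _ D (fun t => t%:C) (fun t => q t%:C) (fun t => K * (1 + t ^+ 2)^-1) 0) => //.
- exact: meas_id.
- exact: meas_q.
- exact: Im_line.
- exact: integrable_cauchyZ.
- move=> t Dt; apply: (hK t _).1; apply: line_norm.
  by case: DD => h; [left|right]; exact: h.
Qed.

Lemma int_half q z : contour_weight q ->
  Cintegrable mu half (fun t => cexp (- 'i%C * arc t * z%:C) * harc q t).
Proof.
move=> gq; apply: Ccont_integrable; apply: CcontM; last exact: Ccont_harc.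
apply: Ccont_cexp; apply: CcontM; last exact: Ccont_cst.
by apply: CcontM; [exact: Ccont_cst|exact: Ccont_arc].
Qed.

Lemma contour_ft_scale q z (k : R[i]) : contour_weight q -> contour_ft (fun p => k * q p) z = k * contour_ft q z.
Proof.
move=> gq; rewrite !contour_ft_pieces !mulrDr /piece.
have iL := int_line z mL (or_introl (@subset_refl _ _)) gq.
have iR := int_line z mR (or_intror (@subset_refl _ _)) gq.
have iH := int_half z gq.
by rewrite -!CintZ//; congr (_ + _ + _); apply: Cint_ext => t _; rewrite /harc; ring.
Qed.

(** Reflection in the imaginary axis maps the contour to itself. *)
Lemma contour_ft_conj q z (s : R) : contour_weight q ->
  (forall p, q (- p^*%C) = s%:C * (q p)^*%C) -> s * s = 1 ->
  (contour_ft q z)^*%C = s%:C * contour_ft q z.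
Proof.
move=> gq sym ss.
have symr (t : R) : (q t%:C)^*%C = s%:C * q (- t)%:C.
  have := sym t%:C; rewrite conj_rC -rCN => ->.
  by rewrite mulrA -rCM ss mul1r.
have ker (c : R[i]) : (cexp (- 'i%C * c * z%:C))^*%C = cexp (- 'i%C * - c^*%C * z%:C).
  rewrite cexp_conj; congr cexp; rewrite !conjM conjN conj_rC conj_i; ring.
have iL := int_line z mL (or_introl (@subset_refl _ _)) gq.
have iR := int_line z mR (or_intror (@subset_refl _ _)) gq.
have iH := int_half z gq.
rewrite !contour_ft_pieces !conjD !mulrDr /piece.
rewrite (Cint_conj mL iL) (Cint_conj mR iR) (Cint_conj mH iH).
rewrite -!CintZ//.
have e1 : Cint lineL (fun t => (cexp (- 'i%C * t%:C * z%:C) * q t%:C)^*%C) =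
    Cint lineR (fun t => s%:C * (cexp (- 'i%C * t%:C * z%:C) * q t%:C)).
  rewrite [RHS](@Cint_reflect _ lineR lineL _ 0)//; last 2 first.
  - exact: CintegrableZ.
  - by move=> t; rewrite /lineL /lineR /= !in_itv /= andbT sub0r; split => ?; lra.
  apply: Cint_ext => t _; rewrite conjM ker symr conj_rC sub0r !rCN; ring.
have e2 : Cint lineR (fun t => (cexp (- 'i%C * t%:C * z%:C) * q t%:C)^*%C) =
    Cint lineL (fun t => s%:C * (cexp (- 'i%C * t%:C * z%:C) * q t%:C)).
  rewrite [RHS](@Cint_reflect _ lineL lineR _ 0)//; last 2 first.
  - exact: CintegrableZ.
  - by move=> t; rewrite /lineL /lineR /= !in_itv /= andbT sub0r; split => ?; lra.
  apply: Cint_ext => t _; rewrite conjM ker symr conj_rC sub0r !rCN; ring.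
have e3 : Cint half (fun t => (cexp (- 'i%C * arc t * z%:C) * harc q t)^*%C) =
    Cint half (fun t => s%:C * (cexp (- 'i%C * arc t * z%:C) * harc q t)).
  rewrite [RHS](@Cint_reflect _ half half _ pi)//; last 2 first.
  - exact: CintegrableZ.
  - by move=> t; rewrite /half /= !in_itv /=; split => /andP[? ?]; apply/andP; split; lra.
  apply: Cint_ext => t _; rewrite conjM ker /harc arc_reflect sym; move: (arc t) => w.
  rewrite !conjM conjN conj_i.
  transitivity ((s * s)%:C * (cexp (- 'i%C * - w^*%C * z%:C) * ((q w)^*%C * (- - 'i%C * w^*%C)))).
    by rewrite ss rC1 mul1r.
  rewrite rCM; ring.
rewrite e1 e2 e3; ring.
Qed.

(** For an odd weight the two lines cancel. *)
Lemma contour_ft_odd q z : contour_weight q -> (forall p : R[i], q (- p) = - q p) ->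
  contour_ft q z + contour_ft q (- z) = Cint half (fun t =>
    (cexp (- 'i%C * arc t * z%:C) + cexp ('i%C * arc t * z%:C)) * harc q t).
Proof.
move=> gq odd.
have key x : piece lineL (fun t => t%:C) (fun t => q t%:C) x =
   - piece lineR (fun t => t%:C) (fun t => q t%:C) (- x).
  have iL := int_line x mL (or_introl (@subset_refl _ _)) gq.
  have iR := int_line (- x) mR (or_intror (@subset_refl _ _)) gq.
  rewrite /piece (@Cint_reflect _ lineL lineR _ 0)//; last first.
    by move=> t; rewrite /lineL /lineR /= !in_itv /= andbT sub0r; split => ?; lra.
  rewrite -[RHS]mulN1r -CintZ//; apply: Cint_ext => t _.
  have -> : q (0 - t)%:C = - q t%:C by rewrite sub0r rCN odd.
  by rewrite sub0r mulrN mulN1r !rCN; congr (- (cexp _ * _)); ring.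
rewrite !contour_ft_pieces (key z) (key (- z)) opprK.
have e (A B C D : R[i]) : - A + B + C + (- C + D + A) = B + D by ring.
rewrite e /piece -CintD//; try exact: int_half.
apply: Cint_ext => t _; rewrite mulrDl rCN; congr (_ + _ * _); congr cexp; ring.
Qed.

End Contour.

(** * The hyperbolic sine in the complex plane *)

Section SinhBound.
Variable R : realType.

Definition dsinh (w : R[i]) : R[i] := cexp w - cexp (- w).

(** Half of [dsinh] is the hyperbolic sine, and this is the identity [|sinh (x +
    i y)|^2 = sinh^2 x + sin^2 y]. *)
Lemma cabs_dsinh_sq (w : R[i]) : cabs (dsinh w) ^+ 2 =
  (expR (Re w) - expR (- Re w)) ^+ 2 + 4 * sin (Im w) ^+ 2.
Proof.
rewrite cabs_sq /dsinh ReB ImB /cexp /= ReN ImN cosN sinN.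
have c2 := cos2Dsin2 (Im w); have e1 : expR (Re w) * expR (- Re w) = 1.
  by rewrite -expRD subrr expR0.
rewrite mulrN opprK -mulrBl -mulrDl !exprMn.
move: c2 e1; set a := expR _; set b := expR _; set c := cos _; set s := sin _ => c2 e1.
have -> : c ^+ 2 = 1 - s ^+ 2 by rewrite -c2 addrK.
transitivity ((a - b) ^+ 2 + 4 * (a * b) * s ^+ 2); first by ring.
by rewrite e1 mulr1.
Qed.

Lemma expR_diff_sq (x : R) : x ^+ 2 <= (expR x - expR (- x)) ^+ 2.
Proof.
have key (y : R) : 0 <= y -> y ^+ 2 <= (expR y - expR (- y)) ^+ 2.
  move=> y0; rewrite lerXn2r ?nnegrE//.
    by rewrite subr_ge0 ler_expR; lra.
  have := expR_ge1Dx y; have : expR (- y) <= 1 by rewrite -expR0 ler_expR; lra.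
  lra.
have [x0|x0] := lerP 0 x; first exact: key.
have := key (- x); rewrite sqrrN opprK -(sqrrN (expR _ - _)) opprB; apply; lra.
Qed.

(** The derivative of [sin x - x cos x] is [x sin x]. *)
Lemma le_xcos_sin (x : R) : 0 <= x <= pi -> x * cos x <= sin x.
Proof.
move=> /andP[x0 xpi].
pose f (t : R) := sin t - t * cos t.
have df (t : R) : is_derive t (1:R) f (t * sin t).
  apply: is_derive_eq (is_deriveB (is_derive_sin t)
    (is_deriveM (is_derive_id t (1:R)) (is_derive_cos t))) _.
  rewrite /GRing.scale /=; ring.
have cf : {within `[0, x], continuous f}.
  by apply: continuous_subspaceT => t; exact: is_derive_cvg (df t).
have [c] := MVT_segment x0 (fun t _ => df t) cf.
rewrite in_itv /= => /andP[c0 cx].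
rewrite /f sin0 mul0r !subr0 => e; rewrite -subr_ge0 e mulr_ge0// mulr_ge0//.
by rewrite sin_ge0_pi// c0 (le_trans cx).
Qed.

(** Writing [sin v = 2 sin (v/2) cos (v/2)] and using [x cos x <= sin x] gives
    [sin v >= v cos^2 (v/2)]; the cosine is smallest at the end [v = 3 pi / 4]
    of the strip. *)
Definition sinc_bound : R := cos (pi * (3 / 8)) ^+ 2.

Lemma sinc_bound_gt0 : 0 < sinc_bound.
Proof.
rewrite exprn_gt0// cos_gt0_pihalf//; have := pi_gt0 R => p.
by apply/andP; split; lra.
Qed.

Lemma sin_sq_ge (y : R) : `|y| <= pi * (3 / 4) -> (sinc_bound * y) ^+ 2 <= sin y ^+ 2.
Proof.
have p := pi_gt0 R.
have key (v : R) : 0 <= v <= pi * (3 / 4) -> (sinc_bound * v) ^+ 2 <= sin v ^+ 2.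
  move=> /andP[v0 v1].
  have -> : sin v = 2 * (sin (v / 2) * cos (v / 2)).
    by rewrite {1}[v]splitr sinD; ring.
  have c0 : 0 <= cos (pi * (3 / 8) : R) by apply/ltW; rewrite cos_gt0_pihalf//; apply/andP; split; lra.
  have cc : cos (pi * (3 / 8)) <= cos (v / 2).
    have [<-//|ne] := eqVneq (v / 2) (pi * (3 / 8)).
    have lt : v / 2 < pi * (3 / 8) by rewrite lt_neqAle ne /=; lra.
    by rewrite ltW// ltr_cos ?in_itv //=; apply/andP; split; lra.
  have ss : v / 2 * cos (v / 2) <= sin (v / 2).
    by apply: le_xcos_sin; apply/andP; split; lra.
  rewrite lerXn2r ?nnegrE ?mulr_ge0 ?(ltW sinc_bound_gt0)//.
  - by apply: le_trans ss; rewrite mulr_ge0 ?divr_ge0// (le_trans c0).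
  - exact: le_trans c0 cc.
  - have : sinc_bound <= cos (v / 2) ^+ 2 by rewrite /sinc_bound lerXn2r ?nnegrE// (le_trans c0).
    have : v / 2 * cos (v / 2) * cos (v / 2) <= sin (v / 2) * cos (v / 2).
      by rewrite ler_wpM2r// (le_trans c0).
    move=> h1 h2; have : sinc_bound * v <= cos (v / 2) ^+ 2 * v by rewrite ler_wpM2r.
    move: h1; rewrite expr2; move: (cos (v / 2)) (sin (v/2)) => c s; lra.
have [y0|y0] := leP 0 y => yb; first by apply: key; rewrite y0 -(ger0_norm y0).
rewrite (ltr0_norm y0) in yb; have := key (- y); rewrite mulrN sinN !sqrrN; apply; apply/andP; split; lra.
Qed.

(** Up to height [3 pi / 4] the only zero of [sinh] is the simple one at the
    origin. The bound is uniform in the strip, so it covers the half circles of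
    all radii up to three halves of the contour radius. *)
Lemma dsinh_lower : exists2 m : R, 0 < m & forall w : R[i],
  `|Im w| <= pi * (3 / 4) -> m * cabs w <= cabs (dsinh w).
Proof.
have s0 := sinc_bound_gt0.
have s1 : sinc_bound <= 1.
  have p := pi_gt0 R.
  have c0 : 0 <= cos (pi * (3 / 8) : R).
    by apply/ltW; rewrite cos_gt0_pihalf//; apply/andP; split; lra.
  by rewrite /sinc_bound -[leRHS](expr1n _ 2) lerXn2r ?nnegrE ?cos_le1.
move: sinc_bound s0 s1 sin_sq_ge => m s0 s1 hm; exists m => // w wb.
rewrite -ler_sqr ?nnegrE ?mulr_ge0 ?cabs_ge0 ?(ltW s0)//.
have m2 : m ^+ 2 <= 1 by rewrite -[leRHS](expr1n _ 2) lerXn2r ?nnegrE ?(ltW s0).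
rewrite cabs_dsinh_sq exprMn cabs_sq mulrDr lerD//.
  by apply: le_trans (expR_diff_sq _); rewrite ler_piMl ?sqr_ge0.
by rewrite -exprMn (le_trans (hm _ wb))// ler_peMl ?sqr_ge0//; lra.
Qed.

(** On the rays [sinh] dominates every power, by a single term of the
    exponential series. *)
Lemma dsinh_real_lower (x : R) (N : nat) :
  `|x| ^+ N.+1 / (N.+1)`!%:R <= cabs (dsinh x%:C).
Proof.
rewrite -ler_sqr ?nnegrE ?divr_ge0 ?exprn_ge0 ?cabs_ge0 ?ler0n//.
rewrite cabs_dsinh_sq /= sin0 expr0n /= mulr0 addr0.
have key (y : R) : 0 <= y -> y ^+ N.+1 / (N.+1)`!%:R <= expR y - expR (- y).
  move=> y0; have := expR_ge1Dxn N y0; have : expR (- y) <= 1 by rewrite -expR0 ler_expR; lra.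
  lra.
rewrite -[X in _ <= X]real_normK ?num_real// ler_sqr ?nnegrE ?divr_ge0 ?exprn_ge0 ?ler0n//.
apply: le_trans (key _ (normr_ge0 x)) _.
have [x0|x0] := leP 0 x; first by rewrite (ger0_norm x0) ler_norm.
by rewrite (ltr0_norm x0) opprK -normrN opprB; exact: ler_norm.
Qed.

End SinhBound.

(** * The quantum logarithm and the quantum dilogarithm *)

Section Dilogarithm.
Variable R : realType.
Local Notation mu := (@lebesgue_measure R).
Variable h : R.
Hypothesis h0 : h != 0.
Local Notation r := (contour_radius h).

Lemma contour_radius_gt0 : 0 < r.
Proof. by rewrite /contour_radius divr_gt0// lt_min ltr01 invr_gt0 normr_gt0. Qed.
Let r0 := contour_radius_gt0.

(** The frequencies of the two hyperbolic sines in the denominator; the boolean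
    lets both be treated at once. *)
Definition kap (b : bool) : R := if b then pi * h else pi.

Lemma kap_neq0 b : kap b != 0.
Proof. by case: b; rewrite /= ?mulf_neq0// gt_eqF// pi_gt0. Qed.

(** The contour radius is at most half the distance from the origin to the
    nearest other pole, so radii up to three halves of it still avoid all of
    them. *)
Lemma kap_small b (p : R[i]) : cabs p <= r * (3 / 2) ->
  `|Im ((kap b)%:C * p)| <= pi * (3 / 4).
Proof.
move=> pr; rewrite ImM_rC normrM.
have := Im_le_cabs p; have := pi_gt0 R => p0 ip.
have a1 : r <= 1 / 2 by rewrite /contour_radius ler_pM2r ?invr_gt0// ge_min lexx.
have a2 : r <= `|h|^-1 / 2 by rewrite /contour_radius ler_pM2r ?invr_gt0// ge_min lexx orbT.
have hh : 0 < `|h| by rewrite normr_gt0.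
case: b => /=.
  rewrite normrM gtr0_norm// -mulrA ler_pM2l//.
  have : `|h| * `|Im p| <= `|h| * (`|h|^-1 / 2 * (3 / 2)).
    by rewrite ler_pM2l//; lra.
  rewrite !mulrA mulfV ?gt_eqF//; lra.
by rewrite gtr0_norm// ler_pM2l//; lra.
Qed.

Definition den b (p : R[i]) : R[i] := dsinh ((kap b)%:C * p).

Lemma den_lower : exists2 m : R, 0 < m & forall b p,
  cabs p <= r * (3 / 2) -> m * cabs p <= cabs (den b p).
Proof.
have [m m0 hm] := @dsinh_lower R.
pose k := Num.min `|kap true| `|kap false|.
have k0 : 0 < k by rewrite lt_min !normr_gt0 !kap_neq0.
exists (m * k); first exact: mulr_gt0.
move=> b p pr; apply: le_trans (hm _ (kap_small b pr)).
rewrite cabsM cabs_rC mulrA ler_wpM2r ?cabs_ge0// ler_pM2l// /k.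
by case: b; rewrite ge_min lexx ?orbT.
Qed.

Lemma den_neq0 b p : p != 0 -> cabs p <= r * (3 / 2) -> den b p != 0.
Proof.
move=> p0 pr; have [m m0 /(_ b p pr) hm] := den_lower.
apply: contra p0 => /eqP e; move: hm; rewrite e cabs0 pmulr_rle0// => c0.
by apply/eqP/cabs_eq0/le_anti; rewrite c0 cabs_ge0.
Qed.

Lemma denN b p : den b (- p) = - den b p.
Proof. by rewrite /den /dsinh mulrN opprK opprB. Qed.

Lemma den_conj b p : den b p^*%C = (den b p)^*%C.
Proof. by rewrite /den /dsinh conjD conjN !cexp_conj conjN conjM conj_rC. Qed.

Definition ddsinh (w : R[i]) : R[i] := cexp w + cexp (- w).

Lemma Cder_den b (c : R -> R[i]) t l : Cder c t l ->
  Cder (fun x => den b (c x)) t ((kap b)%:C * ddsinh ((kap b)%:C * c t) * l).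
Proof.
move=> cl; have k := CderZ (kap b)%:C cl.
apply: Cder_eq (CderB (Cder_cexp k) (Cder_cexp (CderN k))) _.
by rewrite /ddsinh; ring.
Qed.

Lemma Ccont_den b (c : R -> R[i]) : Ccont c -> Ccont (fun t => den b (c t)).
Proof.
move=> cc; have k : Ccont (fun t => (kap b)%:C * c t) by apply: CcontM => //; exact: Ccont_cst.
apply: CcontD; first exact: Ccont_cexp.
rewrite (_ : (fun _ => _) = fun t => -1 * cexp (- 1 * ((kap b)%:C * c t))).
  apply: CcontM; first exact: Ccont_cst.
  by apply: Ccont_cexp; apply: CcontM => //; exact: Ccont_cst.
by apply/funext => t; rewrite !mulN1r.
Qed.

(** The weight in the contour integral of the quantum logarithm. *)
Definition wlog (p : R[i]) : R[i] := (den false p * den true p)^-1.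

Lemma cabs_arc_le t : cabs (arc r t) <= r * (3 / 2).
Proof. by rewrite cabs_arc//; have := r0; lra. Qed.

Lemma arc_neq0 t : arc r t != 0.
Proof. by apply/eqP => e; have := cabs_arc r0 t; rewrite e cabs0 => e'; have := r0; rewrite -e' ltxx. Qed.

Lemma contour_weight_wlog : contour_weight r wlog.
Proof.
split.
- apply: CcontV.
    by move=> t; rewrite mulf_neq0// den_neq0 ?arc_neq0 ?cabs_arc_le.
  by apply: CcontM; apply: Ccont_den; exact: Ccont_arc.
- apply: CmeasV; apply: CmeasM; apply: Ccont_meas => //; apply: Ccont_den; exact: Ccont_rC.
- move=> N; pose F : R := (N.+1)`!%:R; pose k0 := `|kap false|; pose k1 := `|kap true|.
  have F0 : 0 < F by rewrite ltr0n fact_gt0.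
  have k00 : 0 < k0 by rewrite normr_gt0 kap_neq0.
  have k10 : 0 < k1 by rewrite normr_gt0 kap_neq0.
  (* The factor with [kap false] is compared with a power of order [N + 1], which
      absorbs [t ^ N]; for the other factor a linear bound is enough. *)
  exists ((k0 ^+ N.+1 / F * r)^-1 * (k1 * r)^-1) => t rt.
  have t0 : 0 < `|t| by exact: lt_le_trans rt.
  have d0 : k0 ^+ N.+1 / F * `|t| ^+ N * r <= cabs (den false t%:C).
    rewrite /den -rCM; apply: le_trans (dsinh_real_lower _ N).
    rewrite normrM exprMn -/k0 exprSr [`|t| ^+ N.+1]exprSr.
    rewrite -/F (_ : k0 ^+ N * k0 * (`|t| ^+ N * `|t|) / F = k0 ^+ N * k0 / F * `|t| ^+ N * `|t|); last by ring.
    rewrite ler_wpM2l// mulr_ge0 ?exprn_ge0// mulr_ge0 ?invr_ge0 ?(ltW F0)//.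
    by rewrite mulr_ge0 ?exprn_ge0 ?(ltW k00).
  have d1 : k1 * r <= cabs (den true t%:C).
    rewrite /den -rCM; apply: le_trans (dsinh_real_lower _ 0).
    by rewrite expr1 -[1`!]/1%N divr1 normrM ler_wpM2l ?(ltW k10).
  have q0 : 0 < k0 ^+ N.+1 by exact: exprn_gt0.
  have qt : 0 < `|t| ^+ N by exact: exprn_gt0.
  have p0 : 0 < k0 ^+ N.+1 / F * `|t| ^+ N * r by rewrite mulr_gt0// mulr_gt0// divr_gt0.
  have p1 : 0 < k1 * r by rewrite mulr_gt0.
  rewrite cabsV cabsM invfM.
  apply: (@le_trans _ _ (`|t| ^+ N * ((k0 ^+ N.+1 / F * `|t| ^+ N * r)^-1 * (k1 * r)^-1))).
    rewrite ler_wpM2l ?exprn_ge0// ler_pM ?invr_ge0 ?cabs_ge0//.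
      by rewrite lef_pV2 ?posrE// (lt_le_trans p0).
    by rewrite lef_pV2 ?posrE// (lt_le_trans p1).
  rewrite le_eqVlt; apply/orP; left; apply/eqP.
  have tN : `|t| ^+ N != 0 by rewrite gt_eqF ?exprn_gt0.
  have kN : k0 ^+ N.+1 != 0 by rewrite gt_eqF ?exprn_gt0.
  by field; rewrite tN kN gt_eqF //= gt_eqF//= gt_eqF//= gt_eqF.
Qed.

End Dilogarithm.

(** * The integral over small half circles *)

Section DilogarithmFacts.
Variable R : realType.
Local Notation mu := (@lebesgue_measure R).
Variable h : R.
Hypothesis h0 : h != 0.
Local Notation r := (contour_radius h).
Local Notation half := `[(0 : R), pi]%classic.
Let r0 : 0 < r := contour_radius_gt0 h0.

(** The even function whose integral over the half circle is
    [phi' z + phi' (- z)], up to a factor. *)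
Definition even_weight (z : R) (p : R[i]) : R[i] :=
  (cexp (- 'i%C * p * z%:C) + cexp ('i%C * p * z%:C)) * (p / den h false p) * (p / den h true p).

(** The derivative of [p / den p], and below it that of [even_weight z], as
    complex functions of [p]. *)
Definition dT b (p : R[i]) : R[i] :=
  (den h b p)^-1 - p * ((kap h b)%:C * ddsinh ((kap h b)%:C * p) / den h b p ^+ 2).

Definition even_weight_der (z : R) (p : R[i]) : R[i] :=
  (- 'i%C * z%:C * cexp (- 'i%C * p * z%:C) + 'i%C * z%:C * cexp ('i%C * p * z%:C))
    * (p / den h false p) * (p / den h true p)
  + (cexp (- 'i%C * p * z%:C) + cexp ('i%C * p * z%:C)) *
    (dT false p * (p / den h true p) + (p / den h false p) * dT true p).

Lemma Cder_T b (c : R -> R[i]) t l : Cder c t l -> den h b (c t) != 0 ->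
  Cder (fun x => c x / den h b (c x)) t (dT b (c t) * l).
Proof.
move=> cl d0; apply: Cder_eq (CderM cl (CderV d0 (Cder_den h b cl))) _.
rewrite /dT; ring.
Qed.

Lemma Cder_even_weight z (c : R -> R[i]) t l : Cder c t l -> c t != 0 ->
  cabs (c t) <= r * (3 / 2) -> Cder (fun x => even_weight z (c x)) t (even_weight_der z (c t) * l).
Proof.
move=> cl c0 cr.
have T b := Cder_T cl (den_neq0 h0 b c0 cr).
have e1 := Cder_cexp (CderM (CderZ (- 'i%C) cl) (Cder_cst z%:C t)).
have e2 := Cder_cexp (CderM (CderZ 'i%C cl) (Cder_cst z%:C t)).
apply: Cder_eq (CderM (CderM (CderD e1 e2) (T false)) (T true)) _.
rewrite /even_weight_der; ring.
Qed.

Lemma even_weight_even z p : even_weight z (- p) = even_weight z p.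
Proof. by rewrite /even_weight !denN !invrN !mulrNN addrC; congr ((cexp _ + cexp _) * _ * _); ring. Qed.

Lemma den_bounds : exists2 m : R, 0 < m & forall b p, p != 0 -> cabs p <= r * (3 / 2) ->
  cabs (p / den h b p) <= m^-1 /\ cabs (den h b p)^-1 <= m^-1 * (cabs p)^-1.
Proof.
have [m m0 hm] := den_lower h0; exists m => // b p p0 pr.
have P : 0 < cabs p by rewrite lt_neqAle cabs_ge0 andbT eq_sym; apply: contra p0 => /eqP/cabs_eq0->.
have mp : 0 < m * cabs p by rewrite mulr_gt0.
have d : cabs (den h b p)^-1 <= m^-1 * (cabs p)^-1.
  by rewrite cabsV -invfM lef_pV2 ?posrE// ?hm// (lt_le_trans mp)// hm.
split=> //; rewrite cabsM mulrC -ler_pdivlMr//.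
Qed.

Lemma cabs_cexp_le (w : R[i]) : cabs (cexp w) <= expR (cabs w).
Proof. by rewrite cabs_cexp ler_expR (le_trans (ler_norm _)) ?Re_le_cabs. Qed.

Lemma even_weight_bound z : exists K : R, forall p, p != 0 -> cabs p <= r * (3 / 2) -> cabs (even_weight z p) <= K.
Proof.
have [m m0 hm] := den_bounds.
exists ((expR (r * (3 / 2) * `|z|) + expR (r * (3 / 2) * `|z|)) * m^-1 * m^-1) => p p0 pr.
have e (s : R[i]) : cabs s = 1 -> cabs (cexp (s * p * z%:C)) <= expR (r * (3 / 2) * `|z|).
  move=> s1; rewrite (le_trans (cabs_cexp_le _))// ler_expR !cabsM cabs_rC s1 mul1r.
  by rewrite ler_wpM2r.
rewrite /even_weight cabsM ler_pM ?cabs_ge0//; last exact: (hm true p p0 pr).1.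
rewrite cabsM ler_pM ?cabs_ge0//; last exact: (hm false p p0 pr).1.
by rewrite (le_trans (cabsD _ _))// lerD// e// ?cabsN cabs_i.
Qed.

Lemma even_weight_der_bound z (a : R) : 0 < a -> exists2 K : R, 0 <= K &
  forall p, a <= cabs p -> cabs p <= r * (3 / 2) -> cabs (even_weight_der z p) <= K.
Proof.
move=> a0; have [m m0 hm] := den_bounds.
pose k := `|kap h false| + `|kap h true|.
pose E := expR (r * (3 / 2) * `|z|).
pose F := expR (k * (r * (3 / 2))).
pose T1 := m^-1 * a^-1 + r * (3 / 2) * (k * (F + F) * (m^-1 * a^-1) ^+ 2).
have k0 : 0 <= k by rewrite addr_ge0.
have r1 : 0 <= r * (3 / 2) by rewrite mulr_ge0 ?(ltW r0).
have mi : 0 <= m^-1 by rewrite invr_ge0 ltW.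
have ai : 0 <= a^-1 by rewrite invr_ge0 ltW.
have E0 : 0 <= E := expR_ge0 _.
have F0 : 0 <= F := expR_ge0 _.
have T0 : 0 <= T1 by rewrite addr_ge0 ?mulr_ge0 ?exprn_ge0 ?addr_ge0 ?mulr_ge0.
exists ((`|z| * E + `|z| * E) * m^-1 * m^-1 + (E + E) * (T1 * m^-1 + m^-1 * T1)).
  by rewrite !addr_ge0 ?mulr_ge0 ?addr_ge0 ?mulr_ge0.
move=> p ap pr; have p0 : p != 0 by apply: contraTneq ap => ->; rewrite cabs0 -ltNge.
have e (s : R[i]) : cabs s = 1 -> cabs (cexp (s * p * z%:C)) <= E.
  move=> s1; rewrite (le_trans (cabs_cexp_le _))// ler_expR !cabsM cabs_rC s1 mul1r.
  by rewrite ler_wpM2r.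
have kb b : `|kap h b| <= k by rewrite /k; case: b; rewrite ?lerDl ?lerDr.
have f b (s : R[i]) : cabs s = 1 -> cabs (cexp (s * ((kap h b)%:C * p))) <= F.
  move=> s1; rewrite (le_trans (cabs_cexp_le _))// ler_expR !cabsM cabs_rC s1 mul1r.
  by rewrite ler_pM ?cabs_ge0.
have di b : cabs (den h b p)^-1 <= m^-1 * a^-1.
  apply: le_trans (hm b p p0 pr).2 _; rewrite ler_wpM2l// lef_pV2 ?posrE//.
  exact: lt_le_trans ap.
have T b : cabs (dT b p) <= T1.
  rewrite /dT (le_trans (cabsB _ _))// lerD// cabsM ler_pM ?cabs_ge0//.
  rewrite cabsM cabsM cabs_rC -exprVn cabsX ler_pM ?mulr_ge0 ?exprn_ge0 ?cabs_ge0//.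
    rewrite ler_pM ?cabs_ge0// /ddsinh (le_trans (cabsD _ _))// lerD//.
      by rewrite -[X in cexp X]mul1r f ?cabs1.
    by rewrite -mulN1r f// cabsN cabs1.
  by rewrite lerXn2r ?nnegrE ?cabs_ge0 ?mulr_ge0.
have e1 := e (- 'i%C) (etrans (cabsN _) (cabs_i R)).
have e2 := e 'i%C (cabs_i R).
have h1 := (hm false p p0 pr).1; have h2 := (hm true p p0 pr).1.
rewrite /even_weight_der (le_trans (cabsD _ _))// lerD//.
  rewrite cabsM ler_pM ?cabs_ge0// cabsM ler_pM ?cabs_ge0// (le_trans (cabsD _ _))// lerD//.
    by rewrite cabsM cabsM cabsN cabs_i mul1r cabs_rC ler_wpM2l.
  by rewrite cabsM cabsM cabs_i mul1r cabs_rC ler_wpM2l.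
rewrite cabsM ler_pM ?cabs_ge0//.
  by rewrite (le_trans (cabsD _ _))// lerD.
rewrite (le_trans (cabsD _ _))// lerD// cabsM ler_pM ?cabs_ge0//.
Qed.

Lemma Ccont_even_weight z (c : R -> R[i]) : Ccont c -> (forall t, c t != 0) ->
  (forall t, cabs (c t) <= r * (3 / 2)) -> Ccont (fun t => even_weight z (c t)).
Proof.
move=> cc c0 cr.
have E (s : R[i]) : Ccont (fun t => cexp (s * c t * z%:C)).
  apply: Ccont_cexp; apply: CcontM; last exact: Ccont_cst.
  by apply: CcontM => //; exact: Ccont_cst.
have T b : Ccont (fun t => c t / den h b (c t)).
  apply: CcontM => //; apply: CcontV; last exact: Ccont_den.
  by move=> t; apply: den_neq0.
by apply: CcontM => //; apply: CcontM => //; exact: CcontD.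
Qed.

Lemma Ccont_even_weight_der z (c : R -> R[i]) : Ccont c -> (forall t, c t != 0) ->
  (forall t, cabs (c t) <= r * (3 / 2)) -> Ccont (fun t => even_weight_der z (c t)).
Proof.
move=> cc c0 cr.
have Z (s : R[i]) u : Ccont u -> Ccont (fun t => s * u t).
  by move=> cu; apply: CcontM => //; exact: Ccont_cst.
have E (s : R[i]) : Ccont (fun t => cexp (s * c t * z%:C)).
  apply: Ccont_cexp; apply: CcontM; last exact: Ccont_cst.
  exact: Z.
have D b : Ccont (fun t => (den h b (c t))^-1).
  by apply: CcontV; [move=> t; apply: den_neq0|exact: Ccont_den].
have T b : Ccont (fun t => c t / den h b (c t)) by exact: CcontM.
have DD b : Ccont (fun t => ddsinh ((kap h b)%:C * c t)).
  apply: CcontD; first by apply: Ccont_cexp; exact: Z.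
  rewrite (_ : (fun _ => _) = fun t => cexp (-1 * ((kap h b)%:C * c t))); last first.
    by apply/funext => t; rewrite mulN1r.
  by apply: Ccont_cexp; apply: (Z (-1)); exact: Z.
have DT b : Ccont (fun t => dT b (c t)).
  rewrite (_ : (fun _ => _) = fun t => (den h b (c t))^-1 + -1 * (c t *
     ((kap h b)%:C * ddsinh ((kap h b)%:C * c t) * ((den h b (c t))^-1 * (den h b (c t))^-1)))).
    apply: CcontD => //; apply: (Z (-1)); apply: CcontM => //; apply: CcontM; first exact: Z.
    exact: CcontM.
  by apply/funext => t; rewrite /dT mulN1r expr2 invfM.
apply: CcontD.
  apply: CcontM => //; apply: CcontM => //; apply: CcontD; exact: Z.
apply: CcontM; first exact: CcontD.
by apply: CcontD; exact: CcontM.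
Qed.

(** The measure [dt] on the half circle is [i dp / p]. *)
Definition arc_mean z (s : R) : R[i] := Cint half (fun t => even_weight z (arc s t)).

Let arc_ok s t : 0 < s < r * (3 / 2) -> arc s t != 0 /\ cabs (arc s t) <= r * (3 / 2).
Proof.
move=> /andP[s0 s1]; rewrite (cabs_arc s0) (ltW s1); split=> //.
by apply/eqP => e; have := cabs_arc s0 t; rewrite e cabs0 => e'; move: s0; rewrite -e' ltxx.
Qed.

(** Both polar derivatives of [even_weight z] are multiples of its complex
    derivative, so the radial one is, up to the constant [i / s], an angular
    derivative. Its integral over the half circle is a difference of values at
    [s] and [- s], which vanishes because the function is even. *)
Lemma arc_mean_derive z s : 0 < s < r * (3 / 2) -> Cder (arc_mean z) s 0.
Proof.
move=> sr; have /andP[s0 s1] := sr.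
have [K K0 hK] := even_weight_der_bound z (divr_gt0 s0 (ltr0Sn R 1)).
have Z0 : Cint half (fun t => even_weight_der z (arc s t) * cexp ('i%C * (pi - t)%:C)) = 0.
  have e : Cint half (fun t => even_weight_der z (arc s t) * (- 'i%C * arc s t)) = 0.
    apply: (etrans (@Cint_FTC R (fun t => even_weight z (arc s t))
      (fun t => even_weight_der z (arc s t) * (- 'i%C * arc s t)) 0 pi (pi_ge0 R) _ _)).
    3: by rewrite (arc0 s) (arc_pi s) even_weight_even subrr.
    - by move=> t; have [a b] := arc_ok t sr; apply: Cder_even_weight => //; exact: Cder_arc.
    - apply: CcontM; first by apply: Ccont_even_weight_der => [|t|t]; [exact: Ccont_arc|have [] := arc_ok t sr|have [] := arc_ok t sr].
      by apply: CcontM; [exact: Ccont_cst|exact: Ccont_arc].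
  have c : (fun t => even_weight_der z (arc s t) * cexp ('i%C * (pi - t)%:C)) =
      fun t => ('i%C / s%:C) * (even_weight_der z (arc s t) * (- 'i%C * arc s t)).
    apply/funext => t; rewrite {3}/arc.
    have sn : s%:C != 0 :> R[i] by rewrite rC_eq0 gt_eqF.
    transitivity (even_weight_der z (arc s t) * cexp ('i%C * (pi - t)%:C) * - ('i%C * 'i%C) * (s%:C / s%:C)).
      by rewrite sqr_i_ opprK mulr1 divff// mulr1.
    by ring.
  rewrite c CintZ ?e ?mulr0//.
  apply: Ccont_integrable; apply: CcontM; first by apply: Ccont_even_weight_der => [|t|t]; [exact: Ccont_arc|have [] := arc_ok t sr|have [] := arc_ok t sr].
  by apply: CcontM; [exact: Ccont_cst|exact: Ccont_arc].
rewrite -Z0.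
have ok x : s / 2 < x < r * (3 / 2) -> 0 < x < r * (3 / 2).
  by move=> /andP[a ->]; rewrite andbT; lra.
pose A x t := even_weight z (arc x t).
pose B x t := even_weight_der z (arc x t) * cexp ('i%C * (pi - t)%:C).
have iA x : s / 2 < x < r * (3 / 2) -> Cintegrable mu half (A x).
  move=> /ok xr; apply: Ccont_integrable; apply: Ccont_even_weight => [|t|t].
  - exact: Ccont_arc.
  - by have [] := arc_ok t xr.
  - by have [] := arc_ok t xr.
have dA x t : s / 2 < x < r * (3 / 2) -> half t -> Cder (A ^~ t) x (B x t).
  move=> /ok xr _; have [a b] := arc_ok t xr.
  apply: (@Cder_even_weight z (fun x => arc x t) x _ _ a b); rewrite /arc.
  by apply: Cder_eq (CderM (Cder_id x) (Cder_cst _ x)) _; rewrite mul1r mulr0 addr0.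
have bB x t : s / 2 < x < r * (3 / 2) -> half t -> cabs (B x t) <= K.
  move=> xr _; have [a b] := arc_ok t (ok _ xr); rewrite cabsM cabs_cexpi mulr1.
  apply: hK => //; have /andP[x0 _] := ok _ xr; rewrite (cabs_arc x0).
  by move: xr => /andP[]; lra.
have sab : s / 2 < s < r * (3 / 2) by apply/andP; split => //; lra.
exact: (@Cint_derive R half A B (fun=> K) _ _ s (measurable_itv _) sab iA dA
  (fun=> K0) (integrable_cst_itv _ _ _) bB).
Qed.

(** The mean is independent of the radius, and as the radius tends to zero the
    integrand tends to the product of the limits [2], [1 / (2 pi)] and [1 / (2
    pi h)] of its three factors. *)
Lemma arc_mean_value z : arc_mean z r = pi%:C * (2 * (2 * (kap h false)%:C)^-1 * (2 * (kap h true)%:C)^-1).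
Proof.
have rr : r < r * (3 / 2) by have := r0; lra.
pose s (m : nat) := r * m.+1%:R^-1.
have s_gt0 m : 0 < s m by rewrite mulr_gt0// invr_gt0.
have s_le m : s m <= r by rewrite ler_piMr ?(ltW r0)// invf_le1 ?ltr0n// ler1n.
have s_ok m : 0 < s m < r * (3 / 2) by rewrite s_gt0 (le_lt_trans (s_le m)).
have s_cvg : s @ \oo --> (0 : R).
  by rewrite -(mulr0 r); apply: cvgM; [exact: cvg_cst|exact: cvg_harmonic].
have [K hK] := even_weight_bound z.
set l := RHS.
have lE : l = Cint half (fun=> 2 * (2 * (kap h false)%:C)^-1 * (2 * (kap h true)%:C)^-1).
  apply: complex_ext; rewrite /l ReM || rewrite /l ImM; rewrite Re_rC Im_rC mul0r ?subr0 ?addr0 /Cint /=;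
  by rewrite Rintegral_cst//= lebesgue_measure_itv /= lte_fin pi_gt0 /= subr0 mulrC.
apply: (@Ccvg_unique _ (fun m => arc_mean z (s m))).
  rewrite (_ : (fun _ => _) = fun=> arc_mean z r); first exact: Ccvg_cst.
  apply/funext => m; apply: (@Cder0_cst _ _ 0 (r * (3 / 2))) => //.
  - exact: arc_mean_derive.
  - by rewrite r0.
rewrite lE; apply: (@Cint_dominated _ half _ _ (fun=> K)) => //.
- move=> m; apply: Ccont_meas => //; apply: Ccont_even_weight => [|t|t]; [exact: Ccont_arc|have [] := arc_ok t (s_ok m)|have [] := arc_ok t (s_ok m)] => //.
- exact: integrable_cst_itv.
- by move=> m t _; have [a b] := arc_ok t (s_ok m); apply: hK.
move=> t _; set u := cexp ('i%C * (pi - t)%:C).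
have u0 : u != 0 := cexp_neq0 _.
have sC m : (s m)%:C != 0 :> R[i] by rewrite rC_eq0 gt_eqF.
have cu x : Cder (fun x => x%:C * u) x u.
  by apply: Cder_eq (CderM (Cder_id x) (Cder_cst u x)) _; rewrite mul1r mulr0 addr0.
(* The denominator has a simple zero at the origin, with derivative [2 kap]. *)
have T b : Ccvg (fun m => arc (s m) t / den h b (arc (s m) t)) (2 * (kap h b)%:C)^-1.
  have k0 : (kap h b)%:C != 0 :> R[i] by rewrite rC_eq0 kap_neq0.
  have d := Cder_den h b (cu 0).
  rewrite mul0r mulr0 /ddsinh oppr0 cexp0 in d.
  have c := Cder_quot_cvg d (s := s).
  have {}c := c _ _ s_cvg.
  have {}c : Ccvg (fun m => den h b ((s m)%:C * u) / (s m)%:C) ((kap h b)%:C * (1 + 1) * u).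
    apply: c; first by rewrite mul0r /den mulr0 /dsinh oppr0 subrr.
    by move=> m; rewrite gt_eqF.
  have {}c := CcvgM (Ccvg_cst u) (CcvgV _ c).
  have -> : (2 * (kap h b)%:C)^-1 = u * ((kap h b)%:C * (1 + 1) * u)^-1.
    by field; rewrite k0 u0.
  rewrite (_ : (fun _ => _) = fun m => u * (den h b ((s m)%:C * u) / (s m)%:C)^-1).
    by apply: c; rewrite !mulf_neq0// -[1 + 1]/(2%:R) pnatr_eq0.
  apply/funext => m; rewrite invf_div /arc -/u mulrA; congr (_ * _); exact: mulrC.
have E (c : R[i]) : Ccvg (fun m => cexp (c * arc (s m) t * z%:C)) 1.
  have d : Cder (fun x => cexp (c * (x%:C * u) * z%:C) - 1) 0 (c * u * z%:C).
    apply: Cder_eq (CderB (Cder_cexp (CderM (CderZ c (cu 0)) (Cder_cst z%:C 0))) (Cder_cst 1 0)) _.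
    by rewrite mul0r mulr0 mul0r cexp0 mulr0 addr0 mul1r subr0.
  have q := Cder_quot_cvg d (s := s).
  have {}q : Ccvg (fun m => (cexp (c * ((s m)%:C * u) * z%:C) - 1) / (s m)%:C) (c * u * z%:C).
    apply: q => //; first by rewrite mul0r mulr0 mul0r cexp0 subrr.
    by move=> m; rewrite gt_eqF.
  have sc : Ccvg (fun m => (s m)%:C) 0 by split => //; exact: cvg_cst.
  have := CcvgD (CcvgM sc q) (Ccvg_cst 1).
  rewrite mul0r add0r (_ : (fun _ => _) = fun m => cexp (c * arc (s m) t * z%:C))//.
  by apply/funext => m; rewrite mulrC divfK// subrK.
have -> : 2 * (2 * (kap h false)%:C)^-1 * (2 * (kap h true)%:C)^-1 =
  (1 + 1) * (2 * (kap h false)%:C)^-1 * (2 * (kap h true)%:C)^-1 :> R[i] by [].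
exact: CcvgM (CcvgM (CcvgD (E _) (E _)) (T false)) (T true).
Qed.

End DilogarithmFacts.

(** * Derivatives and symmetry of the quantum logarithm *)

(** The function [f z - f (- z) - z] vanishes at the origin and has derivative
    zero. *)
Lemma sym_of_derive (R : realType) (f f' : R -> R) :
  (forall z : R, is_derive z (1:R) f (f' z)) -> (forall z, f' z + f' (- z) = 1) ->
  forall z, f z - f (- z) = z.
Proof.
move=> df sf z; pose D (x : R) := f x - f (- x) - x.
have dD x : is_derive x (1:R) D 0.
  have n : is_derive x (1:R) (fun x : R => - x) (-1) by exact: is_deriveNid.
  have c := is_derive_chain n (df (- x)).
  apply: is_derive_eq (is_deriveB (is_deriveB (df x) c) (is_derive_id x (1:R))) _.
  by rewrite mulN1r opprK sf subrr.
have : D z = D 0 by apply: is_derive_0_is_cst.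
by rewrite /D oppr0 addr0 subrr => /eqP; rewrite subr_eq0 => /eqP.
Qed.

Section DilogarithmTheorem.
Variable R : realType.
Variable h : R.
Hypothesis h0 : h != 0.
Local Notation r := (contour_radius h).
Let r0 : 0 < r := contour_radius_gt0 h0.

(** The weights of the derivatives of the quantum logarithm. *)
Definition wder (m : nat) (p : R[i]) : R[i] := (- 'i%C * p) ^+ m * wlog h p.

Lemma contour_weight_wder m : contour_weight r (wder m).
Proof.
elim: m => [|m ih].
  rewrite (_ : wder 0 = wlog h); first exact: contour_weight_wlog.
  by apply/funext => p; rewrite /wder expr0 mul1r.
rewrite (_ : wder m.+1 = fun p => - 'i%C * p * wder m p); first exact: contour_weight_mul.
by apply/funext => p; rewrite /wder exprS mulrA.
Qed.

Lemma wlogN p : wlog h (- p) = wlog h p.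
Proof. by rewrite /wlog !denN mulrNN. Qed.

Lemma wlog_conj p : wlog h p^*%C = (wlog h p)^*%C.
Proof. by rewrite /wlog !den_conj -conjM conjc_inv. Qed.

Lemma wder_conj m p : wder m (- p^*%C) = (1 : R)%:C * (wder m p)^*%C.
Proof.
rewrite rC1 mul1r /wder wlogN wlog_conj conjM; congr (_ * _).
elim: m => [|m ih]; first by rewrite !expr0; apply: complex_ext; rewrite //= oppr0.
by rewrite !exprS ih !conjM conjN conj_i; ring.
Qed.

(** [phider 0] is the quantum logarithm, [phider m] its derivative of order [m].
    The contour integrals are real, which is why the real part is taken. *)
Definition phider (m : nat) (z : R) : R := Re (- (2 * pi * h)%:C * contour_ft r (wder m) z).

Lemma phiderE m z : - (2 * pi * h)%:C * contour_ft r (wder m) z = (phider m z)%:C.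
Proof.
have c := contour_ft_conj z (contour_weight_wder m) (wder_conj m) (mulr1 1).
rewrite rC1 mul1r in c; apply: complex_ext => //.
have im : Im (contour_ft r (wder m) z) = 0.
  by move: c; case: (contour_ft r (wder m) z) => a b [] /= e; lra.
by rewrite ImM im mulr0 -rCN Im_rC mul0r addr0.
Qed.

Lemma qlogE z : qlog h z = (phider 0 z)%:C.
Proof.
rewrite -phiderE /qlog /contour_ft; congr (_ * contour_int _ _).
apply/funext => p; rewrite /wder expr0 mul1r /wlog /den /dsinh /kap.
by rewrite -!mulNr.
Qed.

Lemma phider_derive m z : is_derive z (1:R) (phider m) (phider m.+1 z).
Proof.
have e : (fun p => - 'i%C * p * wder m p) = wder m.+1.
  by apply/funext => p; rewrite /wder exprS mulrA.
have := CderZ (- (2 * pi * h)%:C) (contour_ft_derive r0 z (contour_weight_wder m)).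
by rewrite e => -[].
Qed.

Lemma phider_bound m : exists K : R, forall z, z <= 0 -> `|phider m z| <= K.
Proof.
have [K hK] := contour_ft_bound r0 (contour_weight_wder m).
exists (cabs (- (2 * pi * h)%:C) * K) => z z0.
by rewrite /phider (le_trans (Re_le_cabs _))// cabsM ler_wpM2l ?cabs_ge0// hK.
Qed.

(** The weight of the first derivative is odd, so only the half circle
    contributes; there the sum of the two exponentials makes up [even_weight z],
    whose mean is known. *)
Lemma phider1_sum z : phider 1 z + phider 1 (- z) = 1.
Proof.
apply: (complexI (R := R)); rewrite -[LHS]/((phider 1 z + phider 1 (- z))%:C) rCD -!phiderE -mulrDr.
have odd p : wder 1 (- p) = - wder 1 p.
  by rewrite /wder wlogN !expr1; ring.
rewrite (contour_ft_odd z (contour_weight_wder 1) odd).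
have e t : (cexp (- 'i%C * arc r t * z%:C) + cexp ('i%C * arc r t * z%:C)) * harc r (wder 1) t
    = -1 * even_weight h z (arc r t).
  rewrite /harc /wder /wlog /even_weight expr1 invfM.
  transitivity ('i%C * 'i%C * (cexp (- 'i%C * arc r t * z%:C) + cexp ('i%C * arc r t * z%:C))
    * (arc r t / den h false (arc r t)) * (arc r t / den h true (arc r t))); first by ring.
  by rewrite sqr_i_ !mulrA.
have iV : Cintegrable lebesgue_measure `[(0 : R), pi] (fun t => even_weight h z (arc r t)).
  apply: Ccont_integrable; apply: Ccont_even_weight => //; first exact: Ccont_arc.
    exact: arc_neq0.
  exact: cabs_arc_le.
rewrite (Cint_ext (fun t _ => e t)) CintZ// -/(arc_mean h z r) arc_mean_value// /kap.
have hC : h%:C != 0 :> R[i] by rewrite rC_eq0.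
have pC : pi%:C != 0 :> R[i] by rewrite rC_eq0 gt_eqF ?pi_gt0.
rewrite !rCM rC_nat rC1; move: (h%:C) (pi%:C) hC pC => c d c0 d0.
by field; rewrite c0 d0.
Qed.

Lemma phider_sym z : phider 0 z - phider 0 (- z) = z.
Proof.
exact: sym_of_derive (phider_derive 0) phider1_sum z.
Qed.

Definition wdil (p : R[i]) : R[i] := 4 * wlog h p / p.

Lemma contour_weight_wdil : contour_weight r wdil.
Proof.
have [c m d] := contour_weight_wlog h0; split.
- apply: CcontM; first by apply: CcontM => //; exact: Ccont_cst.
  by apply: CcontV; [exact: arc_neq0|exact: Ccont_arc].
- apply: CmeasM; first by apply: CmeasM => //; exact: Cmeas_cst.
  by apply: CmeasV; apply: Cmeas_real; exact: measurable_id.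
- move=> N; have [K hK] := d N; exists (4 * K / r) => t rt.
  rewrite cabsM cabsM cabsV cabs_rC.
  have -> : cabs (4 : R[i]) = 4 by rewrite -(rC_nat R 4) cabs_rC normr_nat.
  rewrite (_ : _ * _ = 4 * (`|t| ^+ N * cabs (wlog h t%:C)) / `|t|); last by ring.
  apply: ler_pM; rewrite ?invr_ge0// ?mulr_ge0 ?exprn_ge0 ?cabs_ge0//.
    by rewrite ler_wpM2l// hK.
  by rewrite lef_pV2 ?posrE// (lt_le_trans r0).
Qed.

(** The exponent of the quantum dilogarithm is purely imaginary. *)
Definition phase (z : R) : R := Im (- (4%:R^-1) * contour_ft r wdil z).

(** The weight is odd under reflection in the imaginary axis followed by
    conjugation, so the contour integral is its own negative conjugate. *)
Lemma qdilogE z : qdilog h z = cexp ('i%C * (phase z)%:C).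
Proof.
have -> : qdilog h z = cexp (- (4%:R^-1) * contour_ft r wdil z).
  rewrite /qdilog /contour_ft; congr (cexp (_ * contour_int _ _)).
  apply/funext => p; rewrite /wdil /wlog /den /dsinh /kap /csinh.
  rewrite invfM !invf_div (_ : (4 : R[i]) = 2%:R * 2%:R); last by rewrite -natrM.
  move: (cexp (pi%:C * p) - _) (cexp ((pi * h)%:C * p) - _) => a b.
  rewrite !invfM; ring.
have sym p : wdil (- p^*%C) = (-1 : R)%:C * (wdil p)^*%C.
  rewrite /wdil wlogN wlog_conj invrN mulrN rCN rC1 mulN1r; congr (- _).
  rewrite !conjM conjc_inv; congr (_ * _ * _).
    by rewrite -(rC_nat R 4) conj_rC.
  by rewrite conjc_inv.
have N1 : (-1 : R) * -1 = 1 by rewrite mulrNN mulr1.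
have e := contour_ft_conj z contour_weight_wdil sym N1; rewrite rCN rC1 mulN1r in e.
have a0 : Re (contour_ft r wdil z) = 0.
  by have := congr1 (@complex.Re R) e; rewrite ReN; case: (contour_ft r wdil z) => a b /=; lra.
have q : - 4^-1 = (- 4^-1)%:C :> R[i] by rewrite rCN rCV rC_nat.
congr cexp; rewrite /phase q; move: (contour_ft r wdil z) a0 => [a b] /= ->.
by apply: complex_ext => /=; ring.
Qed.

(** Differentiating in [z] cancels the factor [1 / p] that distinguishes the two
    weights. *)
Lemma phase_derive z : is_derive z (1:R) phase (- phider 0 z / (2 * pi * h)).
Proof.
have := CderZ (- (4%:R^-1)) (contour_ft_derive r0 z contour_weight_wdil).
have pC : (2 * pi * h)%:C != 0 :> R[i].
  by rewrite rC_eq0 !mulf_neq0// gt_eqF ?pi_gt0.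
suff e : - 4^-1 * contour_ft r (fun p => - 'i%C * p * wdil p) z = 'i%C * (- phider 0 z / (2 * pi * h))%:C.
  move=> [_ d]; apply: is_derive_eq d _.
  by rewrite e ImM Re_i Im_i mul0r mul1r add0r.
rewrite rCM rCN rCV -phiderE.
have -> : (fun p => - 'i%C * p * wdil p) = fun p => - (4 * 'i%C) * wder 0 p.
  apply/funext => p; rewrite /wdil /wder expr0 mul1r.
  (* At the pole both sides vanish, by the convention on the inverse of zero. *)
  have [->|p0] := eqVneq p 0; last by field; rewrite p0.
  by rewrite /wlog /den !mulr0 /dsinh oppr0 subrr mulr0 invr0 !mulr0.
rewrite contour_ft_scale; last exact: contour_weight_wder.
have f0 : (4 : R[i]) != 0 by rewrite pnatr_eq0.
move: pC (contour_ft _ _ _); move: ((2 * pi * h)%:C) => c c0 w; field; exact: c0.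
Qed.

End DilogarithmTheorem.

(** * Calculus of partial derivatives *)

Section PartialDerivatives.
Variables (R : realType) (n : nat).
Local Notation T := (Rn R n).
Implicit Types (f g m : T -> R[i]) (a : T) (i j : 'I_n).

Lemma crd_upd a i t j : crd (upd a i t) j = if j == i then t else crd a j.
Proof. by rewrite /crd /upd tnth_mktuple. Qed.

Lemma crd_upd_same a i t : crd (upd a i t) i = t.
Proof. by rewrite crd_upd eqxx. Qed.

Lemma crd_ext a b : (forall j, crd a j = crd b j) -> a = b.
Proof. by move=> h; apply: eq_from_tnth => j; exact: h. Qed.

Lemma upd_upd a i s t : upd (upd a i s) i t = upd a i t.
Proof. by apply: crd_ext => j; rewrite !crd_upd; case: (j == i). Qed.

Lemma upd_crd a i : upd a i (crd a i) = a.
Proof. by apply: crd_ext => j; rewrite crd_upd; case: eqP => [->|]. Qed.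

Lemma upd_comm a i j s t : i != j -> upd (upd a i s) j t = upd (upd a j t) i s.
Proof.
move=> ij; apply: crd_ext => l; rewrite !crd_upd.
by have [->|//] := eqVneq l j; rewrite eq_sym (negbTE ij).
Qed.

(** A relational form of the partial derivative; with it the value of [pderive]
    is computed together with the proof of differentiability. *)
Definition pder f i a l := Cder (fun t => f (upd a i t)) (crd a i) l.

Lemma pderP f i a l : pder f i a l -> pderivable f a i /\ pderive i f a = l.
Proof.
move=> [d1 d2]; split.
  by split; apply: ex_derive.
apply: complex_ext => /=; rewrite derive1E; first exact: (@derive_val _ _ _ _ _ _ _ d1).
exact: (@derive_val _ _ _ _ _ _ _ d2).
Qed.

Lemma pderivableP f i a : pderivable f a i -> pder f i a (pderive i f a).
Proof.
move=> [d1 d2]; split => /=; rewrite derive1E; exact: derivableP.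
Qed.

Lemma pder_at f i d a t : (forall a, pder f i a (d a)) ->
  Cder (fun x => f (upd a i x)) t (d (upd a i t)).
Proof.
move=> /(_ (upd a i t)); rewrite /pder crd_upd_same.
by apply: Cder_ext => x; rewrite upd_upd.
Qed.

Lemma pderive_ext f i d : (forall a, pder f i a (d a)) -> pderive i f = d.
Proof. by move=> h; apply/funext => a; exact: (pderP (h a)).2. Qed.

Lemma pderD f g i a l l' : pder f i a l -> pder g i a l' ->
  pder (fun a => f a + g a) i a (l + l').
Proof. exact: CderD. Qed.

Lemma pderM f g i a l l' : pder f i a l -> pder g i a l' ->
  pder (fun a => f a * g a) i a (l * g a + f a * l').
Proof. by move=> hf hg; have := CderM hf hg; rewrite upd_crd. Qed.

Lemma pder_cst (c : R[i]) i a : pder (fun=> c) i a 0.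
Proof. exact: Cder_cst. Qed.

Lemma pder_crd j i a : pder (fun a => (crd a j)%:C) i a (if j == i then 1 else 0).
Proof.
rewrite /pder; case: eqP => [->|/eqP ji].
  by apply: Cder_ext (Cder_id _) => t; rewrite crd_upd_same.
by apply: Cder_ext (Cder_cst (crd a j)%:C _) => t; rewrite crd_upd (negbTE ji).
Qed.

(** The weight in the definition of Schwartz functions. *)
Definition siz a : R := 1 + \sum_j `|crd a j|.

Lemma siz_ge1 a : 1 <= siz a.
Proof. by rewrite /siz lerDl sumr_ge0. Qed.

Lemma siz_gt0 a : 0 < siz a. Proof. exact: lt_le_trans ltr01 (siz_ge1 a). Qed.
Lemma sizX_gt0 a N : 0 < siz a ^+ N. Proof. by rewrite exprn_gt0// siz_gt0. Qed.

Lemma crd_le_siz a j : `|crd a j| <= siz a.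
Proof.
rewrite /siz (bigD1 j)//= addrCA lerDl addr_ge0// sumr_ge0//.
Qed.

Definition rapid f := forall N : nat, exists K : R, forall a, siz a ^+ N * cabs (f a) <= K.
Definition slow f := exists (N : nat) (K : R), forall a, cabs (f a) <= K * siz a ^+ N.

(** A class that contains, for every member, its partial derivatives up to
    extensional equality: to bound all iterated derivatives it is then enough to
    bound the members. *)
Definition stable (C : (T -> R[i]) -> Prop) := forall f i, C f ->
  exists2 d, C d & forall a, pder f i a (d a).

Definition moderate f :=
  (forall (l : seq 'I_n) a i, pderivable (pderives l f) a i) /\
  (forall l : seq 'I_n, slow (pderives l f)).

Lemma stable_pderives C : stable C -> forall f, C f -> forall l, C (pderives l f).
Proof.
move=> sC f Cf; elim=> [//|i l ih] /=.
by have [d Cd hd] := sC _ i ih; rewrite (pderive_ext hd).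
Qed.

Lemma stable_schwartz C : stable C -> (forall f, C f -> rapid f) ->
  forall f, C f -> schwartz f.
Proof.
move=> sC rC f Cf; split=> [l a i|l N].
  by have [d _ hd] := sC _ i (stable_pderives sC Cf l); exact: (pderP (hd a)).1.
exact: rC (stable_pderives sC Cf l) N.
Qed.

Lemma stable_moderate C : stable C -> (forall f, C f -> slow f) ->
  forall f, C f -> moderate f.
Proof.
move=> sC rC f Cf; split=> [l a i|l].
  by have [d _ hd] := sC _ i (stable_pderives sC Cf l); exact: (pderP (hd a)).1.
exact: rC (stable_pderives sC Cf l).
Qed.

Lemma pderives_rcons f i l : pderives l (pderive i f) = pderives (rcons l i) f.
Proof. by rewrite /pderives -cats1 foldr_cat. Qed.

Lemma schwartz_pder f i a : schwartz f -> pder f i a (pderive i f a).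
Proof. by move=> [h _]; apply: pderivableP; exact: (h [::]). Qed.

Lemma schwartz_pderive f i : schwartz f -> schwartz (pderive i f).
Proof.
by move=> [h1 h2]; split => [l|l]; rewrite pderives_rcons; [exact: h1|exact: h2].
Qed.

Lemma schwartz_rapid f : schwartz f -> rapid f.
Proof. by move=> [_ h]; exact: (h [::]). Qed.

Lemma moderate_slow f : moderate f -> slow f.
Proof. by move=> [_ h]; exact: (h [::]). Qed.

Lemma moderate_stable : stable moderate.
Proof.
move=> f i [h1 h2]; exists (pderive i f); last first.
  by move=> a; apply: pderivableP; exact: (h1 [::]).
by split=> [l|l]; rewrite pderives_rcons; [exact: h1|exact: h2].
Qed.

Lemma slowD f g : slow f -> slow g -> slow (fun a => f a + g a).
Proof.
move=> [N [K hK]] [M [L hL]]; exists (N + M)%N, (`|K| + `|L|) => a.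
rewrite (le_trans (cabsD _ _))// mulrDl lerD//.
  rewrite (le_trans (hK a))// (@le_trans _ _ (`|K| * siz a ^+ N))//.
    by rewrite ler_wpM2r ?ler_norm// ltW// sizX_gt0.
  by rewrite ler_wpM2l// ler_weXn2l ?siz_ge1// leq_addr.
rewrite (le_trans (hL a))// (@le_trans _ _ (`|L| * siz a ^+ M))//.
  by rewrite ler_wpM2r ?ler_norm// ltW// sizX_gt0.
by rewrite ler_wpM2l// ler_weXn2l ?siz_ge1// leq_addl.
Qed.

Lemma slowM f g : slow f -> slow g -> slow (fun a => f a * g a).
Proof.
move=> [N [K hK]] [M [L hL]]; exists (N + M)%N, (K * L) => a.
rewrite cabsM exprD mulrACA ler_pM ?cabs_ge0//.
Qed.

Lemma slow_cst (c : R[i]) : slow (fun=> c).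
Proof. by exists 0%N, (cabs c) => a; rewrite expr0 mulr1. Qed.

Lemma slow_bdd f (K : R) : (forall a, cabs (f a) <= K) -> slow f.
Proof. by move=> h; exists 0%N, K => a; rewrite expr0 mulr1. Qed.

Lemma rapidD f g : rapid f -> rapid g -> rapid (fun a => f a + g a).
Proof.
move=> rf rg N; have [K hK] := rf N; have [L hL] := rg N; exists (K + L) => a.
by rewrite (le_trans _ (lerD (hK a) (hL a)))// -mulrDr ler_wpM2l ?cabsD// ltW// sizX_gt0.
Qed.

Lemma rapidM m f : slow m -> rapid f -> rapid (fun a => m a * f a).
Proof.
move=> [M [L hL]] rf N; have [K hK] := rf (N + M)%N; exists (`|L| * K) => a.
rewrite cabsM mulrCA; apply: (@le_trans _ _ (`|L| * siz a ^+ M * (siz a ^+ N * cabs (f a)))).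
  apply: ler_wpM2r; first by rewrite mulr_ge0 ?cabs_ge0 ?(ltW (sizX_gt0 _ _)).
  apply: (le_trans (hL a)); rewrite ler_wpM2r ?ler_norm//.
  exact: ltW (sizX_gt0 _ _).
by rewrite -mulrA ler_wpM2l// mulrA -exprD addnC.
Qed.

(** Closing a set of functions under sums and products reduces the stability under
    differentiation to the generators. *)
Inductive alg (B : (T -> R[i]) -> Prop) : (T -> R[i]) -> Prop :=
| alg_base b : B b -> alg B b
| alg_cst c : alg B (fun=> c)
| alg_add f g : alg B f -> alg B g -> alg B (fun a => f a + g a)
| alg_mul f g : alg B f -> alg B g -> alg B (fun a => f a * g a).

Lemma alg_moderate B : (forall b, B b -> slow b) ->
  (forall b i, B b -> exists2 d, alg B d & forall a, pder b i a (d a)) ->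
  forall f, alg B f -> moderate f.
Proof.
move=> sB dB; apply: stable_moderate.
- move=> f i; elim=> {f} [b Bb|c|f g _ [d Ad hd] _ [e Ae he]|f g Af [d Ad hd] Ag [e Ae he]].
  + exact: dB.
  + by exists (fun=> 0); [exact: alg_cst|move=> a; exact: pder_cst].
  + by exists (fun a => d a + e a); [exact: alg_add|move=> a; exact: pderD].
  + exists (fun a => d a * g a + f a * e a); last by move=> a; exact: pderM.
    by apply: alg_add; exact: alg_mul.
- move=> f; elim=> {f} [b|c|f g _ sf _ sg|f g _ sf _ sg].
  + exact: sB.
  + exact: slow_cst.
  + exact: slowD.
  + exact: slowM.
Qed.

Lemma moderate_alg f : alg moderate f -> moderate f.
Proof.
apply: alg_moderate => [|b i mb]; first exact: moderate_slow.
by have [d md hd] := moderate_stable i mb; exists d => //; exact: alg_base.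
Qed.

Lemma moderateD f g : moderate f -> moderate g -> moderate (fun a => f a + g a).
Proof. by move=> mf mg; apply: moderate_alg; apply: alg_add; exact: alg_base. Qed.
Lemma moderateM f g : moderate f -> moderate g -> moderate (fun a => f a * g a).
Proof. by move=> mf mg; apply: moderate_alg; apply: alg_mul; exact: alg_base. Qed.
Lemma moderate_cst (c : R[i]) : moderate (fun=> c).
Proof. by apply: moderate_alg; exact: alg_cst. Qed.
Lemma moderateZ (c : R[i]) f : moderate f -> moderate (fun a => c * f a).
Proof. by move=> mf; apply: moderateM => //; exact: moderate_cst. Qed.

Lemma moderate_crd j : moderate (fun a => (crd a j)%:C).
Proof.
apply: (@alg_moderate (fun b => b = (fun a => (crd a j)%:C))); last exact: alg_base.
- move=> _ ->; exists 1%N, 1 => a; rewrite cabs_rC expr1 mul1r; exact: crd_le_siz.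
- move=> _ i ->; exists (fun=> if j == i then 1 else 0); first exact: alg_cst.
  by move=> a; exact: pder_crd.
Qed.

(** All derivatives of [u] lie in the algebra generated by [u] and the moderate
    functions. This applies to [u = e^(i theta)], where [u] itself is bounded. *)
Lemma moderate_logder u (w : 'I_n -> T -> R[i]) : slow u -> (forall i, moderate (w i)) ->
  (forall i a, pder u i a (w i a * u a)) -> moderate u.
Proof.
move=> su mw du; apply: (@alg_moderate (fun b => b = u \/ moderate b)); last by apply: alg_base; left.
- by move=> b [->//|]; exact: moderate_slow.
- move=> b i [->|mb].
    exists (fun a => w i a * u a); last exact: du.
    by apply: alg_mul; apply: alg_base; [right|left].
  by have [d md hd] := moderate_stable i mb; exists d => //; apply: alg_base; right.
Qed.

Definition linform (c : R) (l : 'I_n -> R) (a : T) : R := c + \sum_j l j * crd a j.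

Lemma linform_upd c l a i t :
  linform c l (upd a i t) = linform c l a + l i * (t - crd a i).
Proof.
rewrite /linform -addrA; congr (_ + _).
rewrite (bigD1 i)//= [in RHS](bigD1 i)//= crd_upd_same.
rewrite (eq_bigr (fun j => l j * crd a j)); first by ring.
by move=> j ji; rewrite crd_upd (negbTE ji).
Qed.

Lemma linform_slow c l : exists K : R, forall a, 1 + `|linform c l a| <= K * siz a.
Proof.
exists (1 + `|c| + \sum_j `|l j|) => a.
rewrite mulrDl mulrDl mul1r -addrA lerD ?siz_ge1//.
rewrite (le_trans (ler_normD _ _))// lerD ?ler_peMr ?siz_ge1//.
rewrite (le_trans (ler_norm_sum _ _ _))// mulr_suml ler_sum// => j _.
by rewrite normrM ler_wpM2l// crd_le_siz.
Qed.

Lemma pder_comp_lin (h : R -> R[i]) c l i a d : Cder h (linform c l a) d ->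
  pder (fun a => h (linform c l a)) i a ((l i)%:C * d).
Proof.
move=> hd; rewrite /pder.
apply: (@Cder_ext _ (fun t => h (linform c l a + l i * (t - crd a i)))).
  by move=> t; rewrite linform_upd.
apply: (@Cder_comp _ h (fun t => linform c l a + l i * (t - crd a i)) (crd a i) d (l i)); last first.
  by rewrite subrr mulr0 addr0.
apply: is_derive_eq (is_deriveD (is_derive_cst (linform c l a) (crd a i) (1:R))
  (is_deriveZ (l i) (is_deriveB (is_derive_id (crd a i) (1:R)) (is_derive_cst (crd a i) (crd a i) (1:R))))) _.
by rewrite /GRing.scale /= subr0 mulr1 add0r.
Qed.

(** The functions [h k] are the successive derivatives of [h 0]. *)
Lemma moderate_comp_lin (h : nat -> R -> R[i]) c l :
  (forall k t, Cder (h k) t (h k.+1 t)) ->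
  (forall k, exists (N : nat) (K : R), forall t, cabs (h k t) <= K * (1 + `|t|) ^+ N) ->
  moderate (fun a => h 0%N (linform c l a)).
Proof.
move=> dh sh; apply: (@alg_moderate (fun b => exists k, b = (fun a => h k (linform c l a)))).
- move=> _ [k ->]; have [N [K hK]] := sh k; have [L hL] := linform_slow c l.
  exists N, (`|K| * L ^+ N) => a; rewrite (le_trans (hK _))//.
  rewrite (@le_trans _ _ (`|K| * (1 + `|linform c l a|) ^+ N))//.
    by rewrite ler_wpM2r ?ler_norm// exprn_ge0// addr_ge0.
  rewrite -mulrA -exprMn ler_wpM2l// lerXn2r ?nnegrE ?hL ?addr_ge0//.
  by rewrite (le_trans _ (hL a))// addr_ge0.
- move=> _ i [k ->]; exists (fun a => (l i)%:C * h k.+1 (linform c l a)).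
    by apply: alg_mul; [exact: alg_cst|apply: alg_base; exists k.+1].
  by move=> a; apply: pder_comp_lin; exact: dh.
- by apply: alg_base; exists 0%N.
Qed.

(** The product rule produces sums of products [m f], so a class that is stable
    under differentiation has to contain them. *)
Inductive schwartz_mod : (T -> R[i]) -> Prop :=
| schwartz_mod_mul m f : moderate m -> schwartz f -> schwartz_mod (fun a => m a * f a)
| schwartz_mod_add f g : schwartz_mod f -> schwartz_mod g ->
    schwartz_mod (fun a => f a + g a).

Lemma schwartz_modP f : schwartz_mod f -> schwartz f.
Proof.
apply: stable_schwartz => {f} f.
- move=> i; elim=> {f} [m f mm sf|f g _ [d Ad hd] _ [e Ae he]].
    have [d md hd] := moderate_stable i mm.
    exists (fun a => d a * f a + m a * pderive i f a).
      apply: schwartz_mod_add; first exact: schwartz_mod_mul.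
      by apply: schwartz_mod_mul => //; exact: schwartz_pderive.
    by move=> a; apply: pderM => //; exact: schwartz_pder.
  by exists (fun a => d a + e a); [exact: schwartz_mod_add|move=> a; exact: pderD].
- elim=> {f} [m f mm sf|f g _ rf _ rg]; last exact: rapidD.
  by apply: rapidM; [exact: moderate_slow|exact: schwartz_rapid].
Qed.

Lemma schwartzM m f : moderate m -> schwartz f -> schwartz (fun a => m a * f a).
Proof. by move=> mm sf; apply: schwartz_modP; exact: schwartz_mod_mul. Qed.

Lemma schwartzZ (c : R[i]) f : schwartz f -> schwartz (fun a => c * f a).
Proof. by apply: schwartzM; exact: moderate_cst. Qed.

Lemma schwartzD f g : schwartz f -> schwartz g -> schwartz (fun a => f a + g a).
Proof.
move=> sf sg; rewrite (_ : (fun _ => _) = fun a => 1 * f a + 1 * g a).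
  by apply: schwartz_modP; apply: schwartz_mod_add; apply: schwartz_mod_mul => //; exact: moderate_cst.
by apply/funext => a; rewrite !mul1r.
Qed.

Lemma schwartzB f g : schwartz f -> schwartz g -> schwartz (fun a => f a - g a).
Proof.
move=> sf sg; rewrite (_ : (fun _ => _) = fun a => f a + (-1) * g a).
  by apply: schwartzD => //; exact: schwartzZ.
by apply/funext => a; rewrite mulN1r.
Qed.

(** * A Gaussian and smooth steps *)

(** A Schwartz function without zeros: one may multiply by it to gain decay, and
    divide by it afterwards. *)
Definition gauss (a : T) : R[i] := (expR (- (\sum_j crd a j ^+ 2) / 2))%:C.

Lemma gauss_gt0 a : 0 < expR (- (\sum_j crd a j ^+ 2) / 2). Proof. exact: expR_gt0. Qed.

Lemma pder_gauss i a : pder gauss i a (- (crd a i)%:C * gauss a).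
Proof.
rewrite /pder /gauss; pose S := \sum_(j | j != i) crd a j ^+ 2.
apply: (@Cder_ext _ (fun t => (expR (- (t ^+ 2 + S) / 2))%:C)).
  move=> t; rewrite (bigD1 i)//= crd_upd_same; congr ((expR (- (_ + _) / 2))%:C).
  by apply: eq_bigr => j ji; rewrite crd_upd (negbTE ji).
have d : is_derive (crd a i) (1:R) (fun t : R => - (t ^+ 2 + S) / 2) (- crd a i).
  rewrite (_ : (fun t : R => _) = (fun t : R => - 2^-1 * (t * t) + - 2^-1 * S)); last first.
    by apply/funext => t; ring.
  apply: is_derive_eq (is_deriveD (is_deriveZ (- 2^-1) (is_deriveM (is_derive_id (crd a i) (1:R)) (is_derive_id (crd a i) (1:R)))) (is_derive_cst (- 2^-1 * S) (crd a i) (1:R))) _.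
  by rewrite /GRing.scale /=; field.
apply: Cder_eq (Cder_real (is_derive_chain d (is_derive_expR _))) _.
by rewrite [in RHS](bigD1 i)//= rCM rCN.
Qed.

Lemma schwartz_gauss : schwartz gauss.
Proof.
apply: (@stable_schwartz (fun f => exists2 m, moderate m & f = (fun a => m a * gauss a))).
- move=> _ i [m mm ->]; have [d md hd] := moderate_stable i mm.
  exists (fun a => (d a + m a * (- 1 * (crd a i)%:C)) * gauss a).
    exists (fun a => d a + m a * (- 1 * (crd a i)%:C)) => //.
    apply: moderateD => //; apply: moderateM => //; apply: moderateZ; exact: moderate_crd.
  move=> a; apply: Cder_eq (pderM (hd a) (pder_gauss i a)) _; ring.
- move=> _ [m mm ->]; apply: rapidM; first exact: moderate_slow.
  (* From [siz ^ N <= e^(N siz)] and [N x - x^2 / 2 <= N^2 / 2] in each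
      coordinate. *)
  move=> N; exists (expR (N%:R + n%:R * (N%:R ^+ 2 / 2))) => a.
  rewrite cabs_rC ger0_norm ?expR_ge0// -ler_pdivlMr ?expR_gt0// -expRN -expRD.
  have e : siz a ^+ N <= expR (N%:R * siz a).
    have := expR_ge1Dx (siz a); have := siz_gt0 a => s0 s1.
    rewrite expRM_natl lerXn2r ?nnegrE ?expR_ge0 ?(ltW s0)//; lra.
  rewrite (le_trans e)// ler_expR /siz mulrDr mulr1 -addrA lerD2l mulr_sumr.
  rewrite mulNr opprK mulr_suml mulr_natl.
  have -> : N%:R ^+ 2 / 2 *+ n = \sum_(j < n) (N%:R ^+ 2 / 2) :> R by rewrite sumr_const card_ord.
  rewrite -big_split /=.
  apply: ler_sum => j _; rewrite -(real_normK (num_real (crd a j))).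
  by have := sqr_ge0 (`|crd a j| - N%:R); rewrite sqrrB; lra.
- by exists (fun=> 1); [exact: moderate_cst|apply/funext => a; rewrite mul1r].
Qed.

(** A smooth step. As [s' = s (1 - s)], its derivatives are polynomials in [s]. *)
Definition logistic (x : R) : R := (1 + expR (- x))^-1.

Lemma logistic_bound x : 0 <= logistic x <= 1.
Proof.
rewrite /logistic invr_ge0 addr_ge0 ?expR_ge0//= invf_le1 ?lerDl ?expR_ge0//.
Qed.

Lemma logistic_derive x : is_derive x (1:R) logistic (logistic x * (1 - logistic x)).
Proof.
have p : 1 + expR (- x) != 0 by rewrite gt_eqF// ltr_wpDr ?expR_ge0.
have e := is_derive_chain (is_deriveNid x (1:R)) (is_derive_expR (- x)).
have d : is_derive x (1:R) (fun y : R => 1 + expR (- y)) (- expR (- x)).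
  by apply: is_derive_eq (is_deriveD (is_derive_cst (1:R) x (1:R)) e) _; rewrite add0r mulN1r.
rewrite -[logistic]/(fun y : R => (1 + expR (- y))^-1).
apply: is_derive_eq (@is_deriveV R (fun y : R => 1 + expR (- y)) x _ 1 p d) _.
rewrite /logistic /GRing.scale /=; field; exact: p.
Qed.

Lemma moderate_logistic c l : moderate (fun a => (logistic (linform c l a))%:C).
Proof.
pose s a := (logistic (linform c l a))%:C : R[i].
apply: (@alg_moderate (fun b => b = s)); last exact: alg_base.
- move=> _ ->; apply: (@slow_bdd _ 1) => a; rewrite cabs_rC.
  by have /andP[a0 a1] := logistic_bound (linform c l a); rewrite ger0_norm.
- move=> _ i ->; exists (fun a => (l i)%:C * (s a * (1 + -1 * s a))).
    apply: alg_mul; first exact: alg_cst.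
    apply: alg_mul; first exact: alg_base.
    apply: alg_add; first exact: alg_cst.
    by apply: alg_mul; [exact: alg_cst|exact: alg_base].
  move=> a; apply: (@pder_comp_lin (fun x => (logistic x)%:C)).
  apply: Cder_eq (Cder_real (logistic_derive _)) _.
  by rewrite /s mulN1r rCM rCB rC1.
Qed.

End PartialDerivatives.

(** * Integration over the coordinate space *)

Section CoordinateSpace.
Variable R : realType.
Local Notation mu1 := (@lebesgue_measure R).
Local Open Scope ereal_scope.

Lemma measurable_crd n (i : 'I_n) : measurable_fun setT (fun a : Rn R n => crd a i).
Proof. exact: measurable_tnth. Qed.

Lemma measurable_upd n (i : 'I_n) :
  measurable_fun setT (fun p : measurableTypeR R * Rn R n => upd p.2 i p.1).
Proof.
apply/measurable_fun_tnthP => j; rewrite /upd.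
have [ji|ji] := eqVneq j i.
  rewrite (_ : _ \o _ = fst); first exact: measurable_fst.
  by apply/funext => p /=; rewrite tnth_mktuple ji eqxx.
rewrite (_ : _ \o _ = (fun a : Rn R n => crd a j) \o snd).
  by apply: measurableT_comp; [exact: measurable_crd|exact: measurable_snd].
by apply/funext => p /=; rewrite tnth_mktuple (negbTE ji).
Qed.

Lemma integral_cons n (F : Rn R n.+1 -> \bar R) : measurable_fun setT F ->
  (forall a, 0 <= F a) ->
  \int[lebesgue_Rn R n.+1]_a F a =
  \int[mu1]_x \int[lebesgue_Rn R n]_b F (cons_pt (x, b)).
Proof.
move=> mF F0.
have mc : measurable_fun setT (@cons_pt R n) by exact: measurable_cons.
transitivity (\int[pushforward (mu1 \x lebesgue_Rn R n) (@cons_pt R n)]_a F a).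
  by apply: eq_measure_integral.
rewrite (ge0_integral_pushforward mc)// preimage_setT.
by rewrite (fubini_tonelli1 (F \o @cons_pt R n) (measurableT_comp mF mc) (fun p => F0 _)).
Qed.

Lemma crd_cons0 n (x : R) (b : Rn R n) : crd (cons_pt (x, b)) ord0 = x.
Proof. by rewrite /crd tnth0. Qed.

Lemma crd_consS n (x : R) (b : Rn R n) j : crd (cons_pt (x, b)) (lift ord0 j) = crd b j.
Proof. by rewrite /crd tnthS. Qed.

Lemma upd_cons0 n (x t : R) (b : Rn R n) : upd (cons_pt (x, b)) ord0 t = cons_pt (t, b).
Proof.
apply: crd_ext => j; rewrite crd_upd; case: (unliftP ord0 j) => [k ->|->] /=.
  by rewrite !crd_consS.
by rewrite crd_cons0.
Qed.

Lemma upd_consS n (x t : R) (b : Rn R n) j :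
  upd (cons_pt (x, b)) (lift ord0 j) t = cons_pt (x, upd b j t).
Proof.
apply: crd_ext => k; rewrite crd_upd; case: (unliftP ord0 k) => [l ->|->].
  by rewrite (inj_eq lift_inj) !crd_consS crd_upd.
by rewrite !crd_cons0.
Qed.

(** Fubini's theorem for an arbitrary coordinate, stated without splitting it off:
    the probability density [rho] restores the coordinate that is integrated
    out. *)
Lemma integral_slice n (k : 'I_n) (rho : R -> \bar R) (F : Rn R n -> \bar R) :
  measurable_fun setT rho -> (forall t, 0 <= rho t) -> \int[mu1]_t rho t = 1 ->
  measurable_fun setT F -> (forall a, 0 <= F a) ->
  \int[lebesgue_Rn R n]_a F a =
  \int[lebesgue_Rn R n]_a (rho (crd a k) * \int[mu1]_t F (upd a k t)).
Proof.
move=> mrho rho0 rho1.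
have msl m (i : 'I_m) (H : Rn R m -> \bar R) : measurable_fun setT H -> (forall a, 0 <= H a) ->
    measurable_fun setT (fun a => \int[mu1]_t H (upd a i t)).
  move=> mH H0.
  apply: (measurable_fun_fubini_tonelli_G (fun p : measurableTypeR R * Rn R m => H (upd p.2 i p.1))).
    exact: (measurableT_comp mH (measurable_upd i)).
  by move=> p; exact: H0.
have mr m (i : 'I_m) : measurable_fun setT (fun a : Rn R m => rho (crd a i)).
  by apply: measurableT_comp => //; exact: measurable_crd.
elim: n k F => [[]//|n ih] k F mF F0.
have F0' a : 0 <= \int[mu1]_t F (upd a k t) by exact: integral_ge0.
rewrite [RHS]integral_cons; last 2 first.
- by apply: emeasurable_funM; [exact: mr|exact: msl].
- by move=> a; exact: mule_ge0.
rewrite integral_cons//.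
have mFc : measurable_fun setT (fun p : measurableTypeR R * Rn R n => F (cons_pt p)).
  by apply: measurableT_comp => //; exact: measurable_cons.
case: (unliftP ord0 k) => [j|] ->.
  apply: eq_integral => x _.
  have mFx : measurable_fun setT (fun b : Rn R n => F (cons_pt (x, b))).
    apply: (measurableT_comp mFc).
    by apply/measurable_fun_pairP; split; [exact: measurable_cst|exact: measurable_id].
  transitivity (\int[lebesgue_Rn R n]_b (rho (crd b j) * \int[mu1]_t F (cons_pt (x, upd b j t)))).
    exact: (ih j _ mFx (fun b => F0 _)).
  apply: eq_integral => b _; rewrite crd_consS; congr (_ * _).
  by apply: eq_integral => t _; rewrite upd_consS.
pose I t := \int[lebesgue_Rn R n]_b F (cons_pt (t, b)).
have I0 t : 0 <= I t by apply: integral_ge0.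
transitivity (\int[mu1]_x (rho x * \int[mu1]_t I t)).
  rewrite ge0_integralZr//; first by rewrite rho1 mul1e.
  exact: integral_ge0.
apply: eq_integral => x _.
have -> : \int[mu1]_t I t = \int[lebesgue_Rn R n]_b \int[mu1]_t F (cons_pt (t, b)).
  exact: (fubini_tonelli (fun p => F (cons_pt p)) mFc (fun p => F0 _)).
have mG : measurable_fun setT (fun b : Rn R n => \int[mu1]_t F (cons_pt (t, b))).
  by apply: (measurable_fun_fubini_tonelli_G (fun p => F (cons_pt p))) => // p; exact: F0.
transitivity (\int[lebesgue_Rn R n]_b (rho x * \int[mu1]_t F (cons_pt (t, b)))).
  by rewrite (@ge0_integralZl _ _ _ _ _ measurableT _ mG)// => b _; exact: integral_ge0.
apply: eq_integral => b _; rewrite crd_cons0; congr (_ * _).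
by apply: eq_integral => t _; rewrite upd_cons0.
Qed.

Lemma ge0_integral_prod n (g : R -> R) (c : R) : measurable_fun setT g ->
  (forall t, 0 <= g t)%R -> \int[mu1]_t (g t)%:E = c%:E ->
  \int[lebesgue_Rn R n]_a (\prod_j g (crd a j))%:E = (c ^+ n)%:E.
Proof.
move=> mg g0 gc.
have P0 m (a : Rn R m) : (0 <= \prod_j g (crd a j))%R by apply: prodr_ge0.
have mP m : measurable_fun setT (fun a : Rn R m => (\prod_j g (crd a j))%:E).
  apply/measurable_EFinP; apply: measurable_prod => j _.
  by apply: measurableT_comp => //; exact: measurable_crd.
elim: n => [|n ih].
  under eq_integral do rewrite big_ord0.
  by rewrite integral_cst// mul1e expr0; exact: diracT.
rewrite integral_cons//; last by move=> a; rewrite lee_fin.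
transitivity (\int[mu1]_x ((g x)%:E * (c ^+ n)%:E)).
  apply: eq_integral => x _; rewrite -ih -(@ge0_integralZl _ _ _ _ _ measurableT _ (mP n)); last 2 first.
  - by move=> b _; rewrite lee_fin.
  - by rewrite lee_fin.
  apply: eq_integral => b _; rewrite big_ord_recl crd_cons0 -EFinM; congr (_ * _)%:E.
  by apply: eq_bigr => j _; rewrite crd_consS.
have c0 : (0 <= c)%R by rewrite -lee_fin -gc integral_ge0// => x _; rewrite lee_fin.
rewrite ge0_integralZr//; first by rewrite gc -EFinM exprS.
- exact/measurable_EFinP.
- by move=> x _; rewrite lee_fin.
- by rewrite lee_fin exprn_ge0.
Qed.

End CoordinateSpace.

(** * Measurability and square integrability of smooth functions *)

Section SmoothMeasurable.
Variables (R : realType) (n : nat).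
Local Notation T := (Rn R n).
Local Notation mu1 := (@lebesgue_measure R).
Local Notation mu := (lebesgue_Rn R n).
Implicit Types (f g m : T -> R[i]) (a : T) (i j : 'I_n).

Lemma mean_value_bound (u du : R -> R) (K x y : R) :
  (forall t, is_derive t (1:R) u (du t)) -> (forall t, `|du t| <= K) ->
  `|u y - u x| <= K * `|y - x|.
Proof.
move=> hu hK; wlog xy : x y / x <= y.
  move=> h; have [/h//|/ltW/h] := leP x y.
  by rewrite -normrN opprB -[in X in _ -> X](normrN (y - x)) opprB.
have cu : {within `[x, y], continuous u}.
  by apply: continuous_subspaceT => t; exact: is_derive_cvg (hu t).
have [c _ ->] := MVT_segment xy (fun t _ => hu t) cu.
by rewrite normrM ler_wpM2r.
Qed.

Lemma pder_lipschitz f i d (K : R) : (forall a, pder f i a (d a)) ->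
  (forall a, cabs (d a) <= K) ->
  forall a t, cabs (f (upd a i t) - f a) <= 2 * K * `|t - crd a i|.
Proof.
move=> hd hK a t; have H s := pder_at a s hd.
rewrite -{2}(upd_crd a i) (le_trans (cabs_le_ReIm _))// -mulrA mulr_natl mulr2n lerD//.
  rewrite ReB; apply: (@mean_value_bound (fun s => Re (f (upd a i s))) _ _ _ _ (fun s => (H s).1)) => s.
  by rewrite (le_trans (Re_le_cabs _)).
rewrite ImB; apply: (@mean_value_bound (fun s => Im (f (upd a i s))) _ _ _ _ (fun s => (H s).2)) => s.
by rewrite (le_trans (Im_le_cabs _)).
Qed.

(** Moving the coordinates one after the other. *)
Lemma schwartz_lipschitz f : schwartz f -> exists L : R, forall a b,
  cabs (f b - f a) <= L * \sum_j `|crd b j - crd a j|.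
Proof.
move=> sf.
have /choice[K hK] i : exists K : R, forall a, cabs (pderive i f a) <= K.
  have [K hK] := schwartz_rapid (schwartz_pderive i sf) 0%N.
  by exists K => a; have := hK a; rewrite expr0 mul1r.
have K0 i a : 0 <= K i by rewrite (le_trans _ (hK i a))// cabs_ge0.
exists (\sum_i 2 * K i) => a b.
pose mix l c := foldr (fun j c => upd c j (crd b j)) c l.
have mixE l c j : crd (mix l c) j = if j \in l then crd b j else crd c j.
  elim: l => [//|x l ih] /=; rewrite crd_upd in_cons ih.
  by case: eqP => [->//|].
have mixb : mix (enum 'I_n) a = b.
  by apply: crd_ext => j; rewrite mixE mem_enum.
have step l : uniq l -> cabs (f (mix l a) - f a) <=
    \sum_(j <- l) (\sum_i 2 * K i) * `|crd b j - crd a j|.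
  elim: l => [|x l ih] /=; first by rewrite subrr cabs0 big_nil.
  move=> /andP[xl ul]; rewrite big_cons.
  rewrite (_ : _ - _ = (f (upd (mix l a) x (crd b x)) - f (mix l a)) + (f (mix l a) - f a)); last by ring.
  rewrite (le_trans (cabsD _ _))// lerD ?ih//.
  rewrite (le_trans (pder_lipschitz (fun a => schwartz_pder x a sf) (hK x) _ _))//.
  rewrite mixE (negbTE xl) ler_wpM2r// (bigD1 x)//= lerDl sumr_ge0// => i _.
  by rewrite mulr_ge0// (K0 i a).
by have := step _ (enum_uniq 'I_n); rewrite mixb big_enum mulr_sumr.
Qed.

(** Measurability of a smooth function is derived from continuity by rounding,
    since the measurable sets of the product are known only through the
    coordinates. *)
Definition round (N : nat) (x : R) : R := (Num.floor (N.+1%:R * x))%:~R / N.+1%:R.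

Lemma round_near N x : `|round N x - x| <= N.+1%:R^-1.
Proof.
have p : 0 < N.+1%:R :> R by rewrite ltr0n.
have := Num.Theory.floor_le (N.+1%:R * x); have := Num.Theory.floorD1_gt (N.+1%:R * x).
rewrite intrD /= => h1 h2; rewrite -(ler_pM2l p) mulfV ?gt_eqF//.
rewrite -{1}(gtr0_norm p) -normrM mulrBr /round mulrCA mulfV ?gt_eqF// mulr1.
rewrite ler_norml; lra.
Qed.

Definition round_pt N a : T := [tuple (round N (crd a j) : measurableTypeR R) | j < n].

(** Rounding has countably many values, each taken on a box. *)
Lemma measurable_round_pt N (X : set T) : measurable (round_pt N @^-1` X).
Proof.
pose V := {ffun 'I_n -> int}.
pose B (v : V) : set T := [set a | forall j, Num.floor (N.+1%:R * crd a j) = v j].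
have mB v : measurable (B v).
  rewrite -[B v]setCK; apply: measurableC.
  rewrite (_ : ~` B v = \bigcup_(j in [set: 'I_n])
      ~` [set a : T | Num.floor (N.+1%:R * crd a j) = v j]); last first.
    rewrite -setC_bigcap; congr (~` _); apply/seteqP; split => a /= h j.
      by move=> _; exact: h.
    exact: (h j Logic.I).
  apply: countable_bigcupT_measurable; first exact: countableP.
  move=> j; apply: measurableC.
  rewrite (_ : mkset _ = (fun a : T => crd a j) @^-1`
     `[(v j)%:~R / N.+1%:R, ((v j)%:~R + 1) / N.+1%:R[%classic).
    rewrite -[X in measurable X]setTI; exact: (@measurable_crd R n j).
  apply/seteqP; split => a /=; rewrite in_itv /= ler_pdivrMr ?ltr0n// ltr_pdivlMr ?ltr0n//.
    by move=> <-; rewrite mulrC Num.Theory.floor_le/= -(intrD _ _ 1) Num.Theory.floorD1_gt.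
  by move=> h; apply: Num.Theory.floor_def; rewrite intrD mulrC.
pose W (v : V) : set T := [set a | B v a /\ X (round_pt N a)].
rewrite (_ : _ @^-1` _ = \bigcup_(v in [set: V]) W v); last first.
  apply/seteqP; split => [a Xa|a [v _ []]//].
  by exists [ffun j => Num.floor (N.+1%:R * crd a j)] => //; split => // j; rewrite ffunE.
apply: countable_bigcupT_measurable; first exact: countableP.
move=> v; have e a b : B v a -> B v b -> round_pt N a = round_pt N b.
  move=> Ba Bb; apply: eq_from_tnth => j; rewrite !tnth_mktuple /round.
  by rewrite (Ba j) (Bb j).
have [[a [Ba Xa]]|h] := pselect (exists a, W v a).
  rewrite (_ : W v = B v)//; apply/seteqP; split => [b []//|b Bb]; split => //.
  by rewrite -(e a b).
rewrite (_ : W v = set0)//; apply/seteqP; split => // a Wa; case: h.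
by exists a.
Qed.

Lemma Ccvg_bound (z : nat -> R[i]) l (K : R) :
  (forall N, cabs (z N - l) <= K * N.+1%:R^-1) -> Ccvg z l.
Proof.
move=> h.
have c : (fun N : nat => K * N.+1%:R^-1) @ \oo --> (0:R).
  by rewrite -[X in _ --> X](mulr0 K); apply: cvgM; [exact: cvg_cst|exact: cvg_harmonic].
have aux (u : nat -> R) (v : R) : (forall N, `|u N - v| <= K * N.+1%:R^-1) -> u @ \oo --> v.
  move=> hu; apply/cvgrPdist_le => e e0.
  have /cvgrPdist_le/(_ e e0) := c; apply: filterS => m; rewrite sub0r normrN => hm.
  by rewrite -normrN opprB (le_trans (hu m))// (le_trans (ler_norm _)).
split; apply: aux => m; rewrite (le_trans _ (h m))//.
  by rewrite -ReB Re_le_cabs.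
by rewrite -ImB Im_le_cabs.
Qed.

Lemma schwartz_meas f : schwartz f -> Cmeas setT f.
Proof.
move=> sf; have [L hL] := schwartz_lipschitz sf.
have c a : Ccvg (fun N => f (round_pt N a)) (f a).
  apply: (@Ccvg_bound _ _ (`|L| * n%:R)) => N; rewrite (le_trans (hL _ _))//.
  rewrite (@le_trans _ _ (`|L| * \sum_j `|crd (round_pt N a) j - crd a j|))//.
    by rewrite ler_wpM2r ?ler_norm// sumr_ge0.
  rewrite -mulrA ler_wpM2l//.
  have -> : n%:R / N.+1%:R = \sum_(j < n) N.+1%:R^-1 :> R.
    by rewrite sumr_const card_ord mulr_natl.
  by apply: ler_sum => j _; rewrite {1}/crd tnth_mktuple round_near.
apply: (@Cmeas_cvg _ _ _ _ (fun N a => f (round_pt N a))).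
- move=> N; split => _ Y mY; rewrite setTI.
    exact: (measurable_round_pt N ((fun a => Re (f a)) @^-1` Y)).
  exact: (measurable_round_pt N ((fun a => Im (f a)) @^-1` Y)).
- by move=> a _; exact: (c a).1.
- by move=> a _; exact: (c a).2.
Qed.

(** Multiplied by the Gaussian, the function becomes a Schwartz function. *)
Lemma moderate_meas m : moderate m -> Cmeas setT m.
Proof.
move=> mm; have g0 a : gauss a != 0 :> R[i] by rewrite rC_eq0 gt_eqF// gauss_gt0.
rewrite (_ : m = fun a => (m a * gauss a) * (gauss a)^-1).
  apply: CmeasM; first by apply: schwartz_meas; apply: schwartzM => //; exact: schwartz_gauss.
  by apply: CmeasV => //; apply: schwartz_meas; exact: schwartz_gauss.
by apply/funext => a; rewrite mulfK.
Qed.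

(** With the exponent equal to the dimension, the square of the weight [siz ^ n]
    dominates the product of the [1 + x_j^2], whose inverse is integrable. *)
Lemma rapid_L2 f : Cmeas setT f -> rapid f -> L2 mu f.
Proof.
move=> mf rf; split; [exact: mf.1|exact: mf.2|].
have [K hK] := rf n.
pose q (t : R) := (1 + t ^+ 2)^-1.
have q0 (t : R) : 0 < 1 + t ^+ 2 by apply: ltr_wpDr => //; exact: sqr_ge0.
have mq : measurable_fun setT q.
  by apply: continuous_measurable_fun => x; exact: (@continuous_oneDsqrV R x).
have c0 : (0 <= K ^+ 2)%R by rewrite sqr_ge0.
have P0 a : 0 <= \prod_j q (crd a j).
  by rewrite prodr_ge0// => j _; rewrite invr_ge0 ltW.
apply: (@le_lt_trans _ _ (\int[mu]_a ((K ^+ 2)%:E * (\prod_j q (crd a j))%:E))%E).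
  apply: ge0_le_integral => //.
  - by move=> a _; rewrite lee_fin sqr_ge0.
  - apply/measurable_EFinP; apply: measurable_funX; exact: Cmeas_cabs.
  - apply/measurable_EFinP; apply: measurable_funM => //.
    apply: measurable_prod => j _; apply: (measurableT_comp mq); exact: measurable_crd.
  - move=> a _; rewrite -EFinM lee_fin.
    have p0 : 0 < \prod_j (1 + crd a j ^+ 2) by rewrite prodr_gt0.
    rewrite /q prodfV ler_pdivlMr//.
    rewrite (@le_trans _ _ (cabs (f a) ^+ 2 * (siz a ^+ n) ^+ 2))//.
      rewrite ler_wpM2l ?sqr_ge0// -exprM mulnC exprM -[X in _ <= _ ^+ X](card_ord n) -prodr_const.
      apply: ler_prod => j _; rewrite ltW//=.
      rewrite (@le_trans _ _ ((1 + `|crd a j|) ^+ 2))//.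
        by rewrite sqrrD expr1n mul1r real_normK ?num_real//; have := normr_ge0 (crd a j); lra.
      have s0 : 0 <= \sum_j `|crd a j| by rewrite sumr_ge0.
      apply: lerXn2r; rewrite ?nnegrE ?addr_ge0 ?(ltW (siz_gt0 _))//.
      by rewrite /siz lerD2l (bigD1 j)//= lerDl sumr_ge0.
    rewrite -exprMn mulrC lerXn2r ?nnegrE ?hK//.
      by rewrite mulr_ge0 ?cabs_ge0// ltW// sizX_gt0.
    by rewrite (le_trans _ (hK a))// mulr_ge0 ?cabs_ge0// ltW// sizX_gt0.
rewrite ge0_integralZl//.
- rewrite (@ge0_integral_prod R n q pi)//; first exact: ltry.
  + by move=> t; rewrite invr_ge0 ltW.
  + rewrite -Rintegral_cauchy /Rintegral fineK//.
    exact: (integrable_fin_num measurableT (integrable_cauchy R)).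
- apply/measurable_EFinP; apply: measurable_prod => j _; apply: (measurableT_comp mq).
  exact: measurable_crd.
- by move=> a _; rewrite lee_fin.
Qed.

Lemma schwartz_L2 f : schwartz f -> L2 mu f.
Proof. by move=> sf; apply: rapid_L2; [exact: schwartz_meas|exact: schwartz_rapid]. Qed.

End SmoothMeasurable.

(** * The partial Fourier transform *)

Section PartialFourier.
Variables (R : realType) (n : nat) (k : 'I_n) (lam : R).
Hypothesis lam0 : lam != 0.
Local Notation T := (Rn R n).
Local Notation mu1 := (@lebesgue_measure R).
Implicit Types (f g : T -> R[i]) (a : T) (i j : 'I_n).

(** The Fourier kernel at frequency [lam]. *)
Definition fker (x t : R) : R[i] := cexp ('i%C * (- (lam * x * t))%:C).

(** The Fourier transform in the coordinate [k] alone, with values again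
    functions on the whole space. *)
Definition pft f a : R[i] := Cint setT (fun t => fker (crd a k) t * f (upd a k t)).

Lemma cabs_fker x t : cabs (fker x t) = 1. Proof. exact: cabs_cexpi. Qed.

Lemma fkerC x t : fker x t = fker t x.
Proof. by rewrite /fker mulrAC. Qed.

Lemma conj_fker x t : (fker x t)^*%C = fker (- x) t.
Proof.
by rewrite /fker cexp_conj conjM conj_i conj_rC mulNr -mulrN -rCN; congr (cexp ('i%C * _%:C)); ring.
Qed.

Lemma fkerD x y t : fker x t * fker y t = fker (x + y) t.
Proof. by rewrite /fker -cexpD -mulrDr -rCD -opprD -mulrDl -mulrDr. Qed.

Lemma Cder_fker x t : Cder (fker x) t ('i%C * (- (lam * x))%:C * fker x t).
Proof.
rewrite /fker; apply: (@Cder_ext _ (fun t => cexp ('i%C * (- (lam * x))%:C * t%:C))).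
  by move=> s; rewrite -mulrA -rCM mulNr.
apply: Cder_eq (Cder_cexp (CderZ ('i%C * (- (lam * x))%:C) (Cder_id t))) _.
by rewrite mulr1 mulrC -[in X in cexp X]mulrA -rCM mulNr.
Qed.

Lemma Cder_fkerl x t : Cder (fker ^~ t) x ('i%C * (- (lam * t))%:C * fker x t).
Proof. by rewrite fkerC; apply: Cder_ext (Cder_fker t x) => y; exact: fkerC. Qed.

Lemma Ccont_fker x : Ccont (fker x).
Proof. by apply: Cder_cont => t; exact: Cder_fker. Qed.

Lemma Cmeas_fker2 : Cmeas setT (fun p : measurableTypeR R * measurableTypeR R => fker p.1 p.2).
Proof.
apply: Cmeas_cexp; apply: CmeasM; first exact: Cmeas_cst.
apply: Cmeas_real; apply: measurable_funN; apply: measurable_funM; last exact: measurable_snd.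
by apply: measurable_funM => //; exact: measurable_fst.
Qed.

Lemma rapid_slice f : rapid f ->
  exists K : R, forall a t, cabs (f (upd a k t)) <= K * (1 + t ^+ 2)^-1.
Proof.
move=> /(_ 2%N)[K hK]; exists K => a t.
have p : 0 < 1 + t ^+ 2 by apply: ltr_wpDr => //; exact: sqr_ge0.
rewrite ler_pdivlMr// mulrC (le_trans _ (hK (upd a k t)))// ler_wpM2r ?cabs_ge0//.
have h : 1 + `|t| <= siz (upd a k t).
  by rewrite /siz lerD2l (bigD1 k)//= crd_upd_same lerDl sumr_ge0.
have h0 : 0 <= 1 + `|t| by rewrite addr_ge0.
apply: (@le_trans _ _ ((1 + `|t|) ^+ 2)); last first.
  by apply: lerXn2r; rewrite ?nnegrE// ltW// siz_gt0.
by rewrite sqrrD expr1n mul1r real_normK ?num_real//; have := normr_ge0 t; lra.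
Qed.

Lemma pder_slice f d a : (forall a, pder f k a (d a)) -> Ccont (fun t => f (upd a k t)).
Proof. by move=> hd; apply: Cder_cont => t; exact: pder_at hd. Qed.

Lemma schwartz_slice f a : schwartz f -> Ccont (fun t => f (upd a k t)).
Proof. by move=> sf; apply: pder_slice => b; exact: schwartz_pder. Qed.

Lemma Ccauchy_integrable (u : R -> R[i]) (K : R) : Ccont u ->
  (forall t, cabs (u t) <= K * (1 + t ^+ 2)^-1) -> Cintegrable mu1 setT u.
Proof.
move=> cu uK; apply: (Cint_dom measurableT (Ccont_meas measurableT cu)).
  exact: (integrable_cauchyZ K measurableT).
by move=> t _; exact: uK.
Qed.

Lemma pft_integrable f a x : schwartz f ->
  Cintegrable mu1 setT (fun t => fker x t * f (upd a k t)).
Proof.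
move=> sf; have [K hK] := rapid_slice (schwartz_rapid sf).
apply: (@Ccauchy_integrable _ K).
  by apply: CcontM; [exact: Ccont_fker|exact: schwartz_slice].
by move=> t; rewrite cabsM cabs_fker mul1r.
Qed.

Lemma pft_bounded f : schwartz f -> exists K : R, forall a, cabs (pft f a) <= K.
Proof.
move=> sf; have [K hK] := rapid_slice (schwartz_rapid sf).
exists (2 * \int[mu1]_t (K * (1 + t ^+ 2)^-1)) => a.
apply: Cint_le => //.
- apply: Ccont_meas => //.
  by apply: CcontM; [exact: Ccont_fker|exact: schwartz_slice].
- exact: (integrable_cauchyZ K measurableT).
- by move=> t _; rewrite cabsM cabs_fker mul1r.
Qed.

Lemma pftD f g a : schwartz f -> schwartz g -> pft (fun a => f a + g a) a = pft f a + pft g a.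
Proof.
move=> sf sg; rewrite /pft -CintD//; try exact: pft_integrable.
by apply: Cint_ext => t _; rewrite mulrDr.
Qed.

Lemma pftZ (c : R[i]) f a : schwartz f -> pft (fun a => c * f a) a = c * pft f a.
Proof.
move=> sf; rewrite /pft -CintZ//; last exact: pft_integrable.
by apply: Cint_ext => t _; rewrite mulrCA.
Qed.

Lemma pftZ_indep (m : T -> R[i]) f a : (forall a t, m (upd a k t) = m a) -> schwartz f ->
  pft (fun a => m a * f a) a = m a * pft f a.
Proof.
move=> hm sf; rewrite /pft -CintZ//; last exact: pft_integrable.
by apply: Cint_ext => t _; rewrite hm mulrCA.
Qed.

Lemma pder_pft_other i f a : i != k -> schwartz f -> pder (pft f) i a (pft (pderive i f) a).
Proof.
move=> ik sf; have sd := schwartz_pderive i sf.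
have [K hK] := rapid_slice (schwartz_rapid sd).
have ki : k != i by rewrite eq_sym.
have e (u : T -> R[i]) : (fun x => pft u (upd a i x)) =
    (fun x => Cint setT (fun t => fker (crd a k) t * u (upd (upd a k t) i x))).
  apply/funext => x; apply: Cint_ext => t _.
  by rewrite crd_upd (negbTE ki) upd_comm.
rewrite /pder e.
have -> : pft (pderive i f) a =
    Cint setT (fun t => fker (crd a k) t * pderive i f (upd (upd a k t) i (crd a i))).
  by have := congr1 (fun u => u (crd a i)) (e (pderive i f)); rewrite upd_crd.
apply: (@Cint_derive _ _ _
  (fun x t => fker (crd a k) t * pderive i f (upd (upd a k t) i x))
  (fun t => K * (1 + t ^+ 2)^-1) (crd a i - 1) (crd a i + 1)) => //.
- by apply/andP; split; lra.
- move=> x _; have := pft_integrable (upd a i x) (crd a k) sf.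
  by under eq_fun do rewrite upd_comm//.
- move=> x t _ _; apply: CderZ; apply: (pder_at (f := f)) => b; exact: schwartz_pder.
- move=> t; rewrite mulr_ge0 ?invr_ge0 ?addr_ge0 ?sqr_ge0//.
  by have := hK a 0; rewrite expr0n addr0 invr1 mulr1; apply: le_trans; exact: cabs_ge0.
- exact: integrable_cauchyZ.
- by move=> x t _ _; rewrite cabsM cabs_fker mul1r -upd_comm.
Qed.

Lemma pder_pft_self f a : schwartz f ->
  pder (pft f) k a (pft (fun b => 'i%C * (- lam)%:C * ((crd b k)%:C * f b)) a).
Proof.
move=> sf; have sc := schwartzM (moderate_crd R k) sf.
have [K hK] := rapid_slice (schwartz_rapid sc).
rewrite /pder (_ : (fun t => _) = fun x => Cint setT (fun t => fker x t * f (upd a k t))); last first.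
  by apply/funext => x; apply: Cint_ext => t _; rewrite crd_upd_same upd_upd.
rewrite /pft; under [X in Cder _ _ X]Cint_ext do rewrite crd_upd_same.
apply: (@Cint_derive _ _ _
  (fun x t => fker x t * ('i%C * (- lam)%:C * (t%:C * f (upd a k t))))
  (fun t => `|lam| * (K * (1 + t ^+ 2)^-1)) (crd a k - 1) (crd a k + 1)) => //.
- by apply/andP; split; lra.
- by move=> x _; exact: pft_integrable.
- move=> x t _ _; apply: Cder_eq (CderM (Cder_fkerl x t) (Cder_cst (f (upd a k t)) x)) _.
  rewrite mulr0 addr0 -mulNr rCM; ring.
- move=> t; rewrite !mulr_ge0 ?invr_ge0 ?addr_ge0 ?sqr_ge0//.
  by have := hK a 0; rewrite expr0n addr0 invr1 mulr1; apply: le_trans; exact: cabs_ge0.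
- by apply: RintegrableZ => //; exact: integrable_cauchyZ.
- move=> x t _ _; rewrite cabsM cabs_fker mul1r cabsM cabsM cabs_i mul1r cabs_rC normrN.
  by rewrite ler_wpM2l//; have := hK a t; rewrite crd_upd_same.
Qed.

Lemma Cint_exhaust (u : R -> R[i]) (g : R -> R) : Cmeas setT u ->
  mu1.-integrable setT (EFin \o g) -> (forall t, cabs (u t) <= g t) ->
  Ccvg (fun m : nat => Cint `[(- m%:R), m%:R] u) (Cint setT u).
Proof.
move=> mu_ ig ug; pose M (m : nat) : set R := `[(- m%:R), m%:R]%classic.
rewrite (_ : (fun m => _) = fun m => Cint setT (Crestr (M m) u)); last first.
  by apply/funext => m; exact: Cint_mkcond.
apply: (@Cint_dominated _ _ _ _ g) => //.
- move=> m; apply: (@Cintegrable_meas _ _ _ mu1).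
  have mM : measurable (M m) by exact: measurable_itv.
  apply: (Cintegrable_mkcond mM); apply: (Cint_dom (g := g) mM).
  - exact: Cmeas_S measurableT _ mu_.
  - by apply: integrableS ig.
  - by move=> t _; exact: ug.
- move=> m t _; rewrite /Crestr; case: ifP => // _.
  by rewrite cabs0 (le_trans _ (ug t))// cabs_ge0.
- move=> t _; have h : \forall m \near \oo, t \in M m.
    near=> m; rewrite inE /M /= in_itv /= -ler_norml; near: m; exact: nbhs_infty_ger.
  split; apply: cvg_near_cst; apply: filterS h => m tm; by rewrite /Crestr tm.
Unshelve. all: by end_near.
Qed.

(** Over [[- m, m]] the integral is a difference of values at the ends. *)
Lemma Cint_total_derivative (u u' : R -> R[i]) (K L : R) : (forall t, Cder u t (u' t)) -> Ccont u' ->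
  (forall t, cabs (u t) <= K * (1 + t ^+ 2)^-1) ->
  (forall t, cabs (u' t) <= L * (1 + t ^+ 2)^-1) -> Cint setT u' = 0.
Proof.
move=> du cu' uK uL.
apply: (@Ccvg_unique _ (fun m : nat => Cint `[(- m%:R), m%:R] u')).
  apply: (Cint_exhaust (Ccont_meas measurableT cu')) uL.
  exact: integrable_cauchyZ.
apply: (@Ccvg_bound _ _ _ (2 * `|K| * 2)) => m.
rewrite (Cint_FTC _ du cu'); last by rewrite (@le_trans _ _ 0)// oppr_le0.
rewrite subr0 (le_trans (cabsB _ _))//.
have h : `|K| * (1 + m%:R ^+ 2)^-1 <= `|K| * 2 * m.+1%:R^-1 :> R.
  rewrite -mulrA ler_wpM2l// -[X in X <= _]mul1r ler_pdivrMr; last first.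
    by apply: ltr_wpDr => //; exact: sqr_ge0.
  rewrite mulrAC ler_pdivlMr ?ltr0n// mul1r -natr1.
  by move: (m%:R : R) => x; have := sqr_ge0 (x - 1); have := sqr_ge0 x; rewrite sqrrB expr1n mulr1; lra.
have b s : s ^+ 2 = m%:R ^+ 2 -> cabs (u s) <= `|K| * 2 * m.+1%:R^-1.
  move=> e; rewrite (le_trans (uK s))// e (le_trans _ h)// ler_wpM2r ?ler_norm//.
rewrite (le_trans (lerD (b _ (erefl _)) (b _ (sqrrN _))))//.
by rewrite -mulr2n -[leLHS]mulr_natl !mulrA.
Unshelve. all: by end_near.
Qed.

Lemma pft_pderive f a : schwartz f ->
  pft (pderive k f) a = 'i%C * (lam * crd a k)%:C * pft f a.
Proof.
move=> sf; have sd := schwartz_pderive k sf.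
have [K hK] := rapid_slice (schwartz_rapid sf).
have [L hL] := rapid_slice (schwartz_rapid sd).
apply/eqP; rewrite -subr_eq0; apply/eqP.
rewrite {2}/pft -CintZ//; last exact: pft_integrable.
rewrite -CintB//; last 2 first.
- exact: pft_integrable.
- by apply: CintegrableZ => //; exact: pft_integrable.
apply: (@Cint_total_derivative (fun t => fker (crd a k) t * f (upd a k t)) _ K (L + `|lam * crd a k| * K)).
- move=> t; apply: Cder_eq (CderM (Cder_fker (crd a k) t) (pder_at a t (fun b => schwartz_pder k b sf))) _.
  rewrite rCN; ring.
- have c : Ccont (fun t => fker (crd a k) t * f (upd a k t)).
    by apply: CcontM; [exact: Ccont_fker|exact: schwartz_slice].
  under eq_fun do rewrite -mulNr; apply: CcontD.
    by apply: CcontM; [exact: Ccont_fker|exact: schwartz_slice].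
  by apply: CcontM => //; exact: Ccont_cst.
- by move=> t; rewrite cabsM cabs_fker mul1r.
- move=> t; rewrite (le_trans (cabsB _ _))// mulrDl lerD//.
    by rewrite cabsM cabs_fker mul1r.
  rewrite !cabsM cabs_i cabs_fker !mul1r cabs_rC -mulrA ler_wpM2l//.
Qed.

(** Multiplication by any coordinate stays within the transforms of Schwartz
    functions: for the coordinate [k] it comes from a derivative, and the others
    commute with the transform. *)
Lemma crd_pft f j : schwartz f ->
  exists2 g, schwartz g & forall a, (crd a j)%:C * pft f a = pft g a.
Proof.
move=> sf; have [->|jk] := eqVneq j k.
  have c0 : 'i%C * lam%:C != 0 :> R[i] by rewrite mulf_neq0 ?i_neq0 ?rC_eq0.
  exists (fun a => ('i%C * lam%:C)^-1 * pderive k f a).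
    by apply: schwartzZ; exact: schwartz_pderive.
  move=> a; rewrite pftZ; last exact: schwartz_pderive.
  by rewrite pft_pderive// rCM !mulrA -[_ * _ * lam%:C]mulrA mulVf// mul1r.
exists (fun a => (crd a j)%:C * f a); first by apply: schwartzM => //; exact: moderate_crd.
by move=> a; rewrite pftZ_indep// => b t; rewrite crd_upd (negbTE jk).
Qed.

Lemma pft_rapid f : schwartz f -> rapid (pft f).
Proof.
move=> sf N; elim: N => [|N ih] in f sf *.
  by have [K hK] := pft_bounded sf; exists K => a; rewrite expr0 mul1r.
have [K hK] := ih f sf.
have /choice[L hL] j : exists L : R, forall a, siz a ^+ N * (`|crd a j| * cabs (pft f a)) <= L.
  have [g sg hg] := crd_pft j sf; have [L hL] := ih g sg; exists L => a.
  by have := hL a; rewrite -hg cabsM cabs_rC.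
exists (K + \sum_j L j) => a.
rewrite exprSr -mulrA {2}/siz mulrDl mul1r mulrDr lerD// mulr_suml mulr_sumr.
exact: ler_sum.
Qed.

(** The transforms of Schwartz functions form a stable class. *)
Lemma schwartz_pft f : schwartz f -> schwartz (pft f).
Proof.
move=> sf; apply: (@stable_schwartz _ _ (fun g => exists2 f, schwartz f & g = pft f)); last by exists f.
- move=> _ i [g sg ->]; have [->|ik] := eqVneq i k.
    eexists; last by move=> a; exact: pder_pft_self.
    eexists; last reflexivity.
    by apply: schwartzZ; apply: schwartzM => //; exact: moderate_crd.
  exists (pft (pderive i g)); last by move=> a; exact: pder_pft_other.
  by exists (pderive i g) => //; exact: schwartz_pderive.
- by move=> _ [g sg ->]; exact: pft_rapid.
Qed.

End PartialFourier.

(** * Fubini's theorem for dominated complex integrands *)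

Section ComplexFubini.
Variable R : realType.
Local Notation mu1 := (@lebesgue_measure R).
Local Notation RR := (measurableTypeR R).

Section Real.
Variables (h : R -> R -> R) (g1 g2 : R -> R).
Hypothesis mh : measurable_fun setT (fun p : RR * RR => h p.1 p.2).
Hypotheses (i1 : mu1.-integrable setT (EFin \o g1)) (i2 : mu1.-integrable setT (EFin \o g2)).
Hypothesis hg : forall x y, `|h x y| <= g1 x * g2 y.

Let mhE : measurable_fun setT (fun p : RR * RR => (h p.1 p.2)%:E).
Proof. exact/measurable_EFinP. Qed.

Let mhx x : measurable_fun setT (fun y : RR => h x y).
Proof.
apply: (@measurableT_comp _ _ _ _ _ _ (fun p : RR * RR => h p.1 p.2) _ (fun y : RR => (x, y))) => //.
by apply/measurable_fun_pairP; split; [exact: measurable_cst|exact: measurable_id].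
Qed.

Let ix x : mu1.-integrable setT (fun y => (h x y)%:E).
Proof.
apply: (le_integrable measurableT _ _ (RintegrableZ (g1 x) measurableT i2)).
  by apply/measurable_EFinP; exact: mhx.
by move=> y _ /=; rewrite lee_fin (le_trans (hg x y))// ler_norm.
Qed.

Lemma dominated_integrable2 :
  (mu1 \x mu1)%E.-integrable setT (fun p : RR * RR => (h p.1 p.2)%:E).
Proof.
apply: (proj2 (@integrable12ltyP _ _ _ _ _ _ _ _ mhE)) => /=.
have e2 : (\int[mu1]_y `|(g2 y)%:E| < +oo)%E by have /integrableP[] := i2.
have m2 : measurable_fun setT (fun y : RR => `|(g2 y)%:E|%E).
  by apply: measurableT_comp => //; have /integrableP[] := i2.
have e1 : (\int[mu1]_y `|(g1 y)%:E| < +oo)%E by have /integrableP[] := i1.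
have m1 : measurable_fun setT (fun y : RR => `|(g1 y)%:E|%E).
  by apply: measurableT_comp => //; have /integrableP[] := i1.
have mF : measurable_fun setT (fun x : RR => \int[mu1]_y `|(h x y)%:E|)%E.
  apply: (measurable_fun_fubini_tonelli_F (fun p : RR * RR => `|(h p.1 p.2)%:E|%E)).
    by apply: measurableT_comp.
  by move=> p; exact: abse_ge0.
apply: (@le_lt_trans _ _ (\int[mu1]_x (`|(g1 x)%:E| * \int[mu1]_y `|(g2 y)%:E|))%E).
  apply: ge0_le_integral => //.
  - by move=> x _; exact: integral_ge0.
  - by apply: emeasurable_funM.
  - move=> x _; rewrite -(@ge0_integralZl _ _ _ _ _ measurableT _ m2)//.
    apply: ge0_le_integral => //.
    + by apply/measurable_EFinP; apply: measurableT_comp => //; exact: mhx.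
    + by apply: emeasurable_funM.
    + move=> y _; rewrite -abseM lee_fin (le_trans (hg x y))// ler_norm//.
rewrite (@ge0_integralZr _ _ _ _ _ measurableT _ m1)//; last exact: integral_ge0.
by apply: lte_mul_pinfty => //; [exact: integral_ge0|rewrite ge0_fin_numE//; exact: integral_ge0].
Qed.

Lemma Rint_finite x : ((\int[mu1]_y h x y)%:E = \int[mu1]_y (h x y)%:E)%E.
Proof. by rewrite /Rintegral fineK//; exact: (integrable_fin_num measurableT (ix x)). Qed.

End Real.

Lemma Rint_swap (h : R -> R -> R) (g1 g2 : R -> R) :
  measurable_fun setT (fun p : RR * RR => h p.1 p.2) ->
  mu1.-integrable setT (EFin \o g1) -> mu1.-integrable setT (EFin \o g2) ->
  (forall x y, `|h x y| <= g1 x * g2 y) ->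
  \int[mu1]_x \int[mu1]_y h x y = \int[mu1]_y \int[mu1]_x h x y.
Proof.
move=> mh i1 i2 hg; rewrite [LHS]/Rintegral [RHS]/Rintegral; congr fine.
transitivity (\int[mu1]_x \int[mu1]_y (h x y)%:E)%E.
  by apply: eq_integral => x _; exact: (Rint_finite mh i2 hg).
transitivity (\int[mu1]_y \int[mu1]_x (h x y)%:E)%E.
  exact: (Fubini (dominated_integrable2 mh i1 i2 hg)).
have mh' : measurable_fun setT (fun p : RR * RR => h p.2 p.1).
  apply: (@measurableT_comp _ _ _ _ _ _ (fun p : RR * RR => h p.1 p.2) _ (fun p : RR * RR => (p.2, p.1))) => //.
  by apply/measurable_fun_pairP; split; [exact: measurable_snd|exact: measurable_fst].
by apply: eq_integral => y _; apply/esym; apply: (@Rint_finite (fun x y => h y x) g2 g1 mh' i1) => a b; rewrite mulrC.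
Qed.

Variables (h : R -> R -> R[i]) (g1 g2 : R -> R).
Hypothesis mh : Cmeas setT (fun p : RR * RR => h p.1 p.2).
Hypotheses (i1 : mu1.-integrable setT (EFin \o g1)) (i2 : mu1.-integrable setT (EFin \o g2)).
Hypothesis hg : forall x y, cabs (h x y) <= g1 x * g2 y.

Let hr x y : `|Re (h x y)| <= g1 x * g2 y.
Proof. by rewrite (le_trans (Re_le_cabs _)). Qed.
Let hi x y : `|Im (h x y)| <= g1 x * g2 y.
Proof. by rewrite (le_trans (Im_le_cabs _)). Qed.

Lemma Cint_swap : Cint setT (fun x => Cint setT (h x)) = Cint setT (fun y => Cint setT (h ^~ y)).
Proof.
apply: complex_ext => /=.
- exact: (@Rint_swap (fun x y => Re (h x y)) g1 g2 mh.1 i1 i2 hr).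
- exact: (@Rint_swap (fun x y => Im (h x y)) g1 g2 mh.2 i1 i2 hi).
Qed.

End ComplexFubini.

(** * Fourier inversion on the line *)

Section FourierInversion.
Variable R : realType.
Local Notation mu1 := (@lebesgue_measure R).
Local Notation RR := (measurableTypeR R).

Lemma Cint_split (u : R -> R[i]) (a x b : R) : a <= x -> x <= b -> Ccont u ->
  Cint `[a, b] u = Cint `[a, x] u + Cint `[x, b] u.
Proof.
move=> ax xb cu.
have key (f : R -> R) : continuous f ->
    \int[mu1]_(t in `[a, b]) f t = \int[mu1]_(t in `[a, x]) f t + \int[mu1]_(t in `[x, b]) f t.
  move=> cf; rewrite -[in RHS](@Rintegral_itv_obnd_cbnd _ x); last first.
    apply: integrableS (Rcont_integrable x b cf) => //.
    by move=> t /=; rewrite !in_itv /= => /andP[/ltW -> ->].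
  rewrite -(@Rintegral_itvB _ f (BLeft a) (BRight b) x); first by rewrite addrC subrK.
  - exact: Rcont_integrable.
  - by rewrite bnd_simp.
  - by rewrite bnd_simp.
by apply: complex_ext; rewrite ?ReD ?ImD /=; [exact: key cu.1|exact: key cu.2].
Qed.

(** An integrable factor tending to one as [e] tends to zero. Being exponential on
    both half lines, it has an elementary Fourier transform. *)
Definition abel (e x : R) : R := expR (- (e * `|x|)).

Lemma abel_bound e x : 0 < e -> abel e x <= (1 + 4 / e ^+ 2) * (1 + x ^+ 2)^-1.
Proof.
move=> e0.
have p : 0 < 1 + x ^+ 2 by apply: ltr_wpDr => //; exact: sqr_ge0.
rewrite ler_pdivlMr// /abel expRN mulrC ler_pdivrMr ?expR_gt0//.
have y0 : 0 <= e * `|x| by rewrite mulr_ge0// ltW.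
have q : 1 + e ^+ 2 * x ^+ 2 / 4 <= expR (e * `|x|).
  have h := expR_ge1Dx (e * `|x| / 2).
  have h0 : 0 <= 1 + e * `|x| / 2 by rewrite addr_ge0 ?divr_ge0.
  apply: (@le_trans _ _ ((1 + e * `|x| / 2) ^+ 2)).
    rewrite sqrrD expr1n mul1r exprMn exprMn real_normK ?num_real//.
    by rewrite mulr2n; lra.
  rewrite (_ : e * `|x| = 2 * (e * `|x| / 2)); last by field.
  rewrite expRM_natl -(_ : e * `|x| / 2 = 2 * (e * `|x| / 2) / 2); last by field.
  by apply: lerXn2r => //; rewrite nnegrE ?expR_ge0.
have e2 : 0 < e ^+ 2 by rewrite exprn_gt0.
apply: (@le_trans _ _ ((1 + 4 / e ^+ 2) * (1 + e ^+ 2 * x ^+ 2 / 4))); last first.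
  by rewrite ler_wpM2l// addr_ge0// divr_ge0// ltW.
have -> : (1 + 4 / e ^+ 2) * (1 + e ^+ 2 * x ^+ 2 / 4) = 1 + x ^+ 2 + 4 / e ^+ 2 + e ^+ 2 * x ^+ 2 / 4.
  by field; rewrite gt_eqF.
have h1 : 0 <= 4 / e ^+ 2 by rewrite divr_ge0// ltW.
have h2 : 0 <= e ^+ 2 * x ^+ 2 / 4 by rewrite divr_ge0// mulr_ge0// ?sqr_ge0// ltW.
lra.
Qed.

Lemma abel_ge0 e x : 0 <= abel e x. Proof. exact: expR_ge0. Qed.
Lemma abel_le1 e x : 0 < e -> abel e x <= 1.
Proof. by move=> e0; rewrite -expR0 ler_expR oppr_le0 mulr_ge0// ltW. Qed.

Lemma continuous_abel e : continuous (abel e).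
Proof.
move=> x; apply: (@cvg_comp _ _ _ (fun x => - (e * `|x|)) (@expR R)); last exact: continuous_expR.
by apply: cvgN; apply: cvgM; [exact: cvg_cst|exact: norm_continuous].
Qed.

Lemma Ccont_abel e : Ccont (fun x => (abel e x)%:C).
Proof. by split => x /=; [exact: continuous_abel|exact: cvg_cst]. Qed.

Lemma integrable_abel e : 0 < e -> mu1.-integrable setT (EFin \o abel e).
Proof.
move=> e0; apply: (le_integrable measurableT _ _ (integrable_cauchyZ (1 + 4 / e ^+ 2) measurableT)).
  by apply/measurable_EFinP; apply: continuous_measurable_fun; exact: continuous_abel.
move=> x _ /=; rewrite lee_fin ger0_norm ?abel_ge0// (le_trans (abel_bound x e0))// ler_norm//.
Qed.

Lemma abel_integral e (s : R) : 0 < e ->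
  Cint setT (fun x => (abel e x)%:C * cexp ('i%C * (s * x)%:C)) =
  (2 * e / (e ^+ 2 + s ^+ 2))%:C.
Proof.
move=> e0; set u := fun x => _.
have cE : Ccont (fun x : R => cexp ('i%C * (s * x)%:C)).
  apply: Ccont_cexp; apply: CcontM; first exact: Ccont_cst.
  by under eq_fun do rewrite rCM; apply: CcontM; [exact: Ccont_cst|exact: Ccont_rC].
have cu : Ccont u by apply: CcontM => //; exact: Ccont_abel.
have ue x : cabs (u x) = abel e x.
  by rewrite cabsM cabs_cexpi mulr1 cabs_rC ger0_norm ?abel_ge0.
apply: (@Ccvg_unique _ (fun m : nat => Cint `[(- m%:R), m%:R] u)).
  apply: (Cint_exhaust (Ccont_meas measurableT cu) (integrable_abel e0)) => x.
  by rewrite ue.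
pose w (sg : R) : R[i] := 'i%C * s%:C + (sg * e)%:C.
have w0 sg : sg * e != 0 -> w sg != 0.
  move=> h; apply/negP => /eqP /(congr1 (@complex.Re R)); rewrite /w !CE mul0r mulr0 subrr add0r => h'.
  by rewrite h' eqxx in h.
have n1 : w 1 != 0 by apply: w0; rewrite mul1r gt_eqF.
have n2 : w (-1) != 0 by apply: w0; rewrite mulN1r oppr_eq0 gt_eqF.
have FTC sg (a b : R) : w sg != 0 -> a <= b -> (forall x, a <= x <= b -> `|x| = - sg * x) ->
    Cint `[a, b] u = (w sg)^-1 * (cexp (w sg * b%:C) - cexp (w sg * a%:C)).
  move=> h ab hx.
  rewrite (@Cint_ext _ _ _ (fun x => cexp (w sg * x%:C))); last first.
    move=> x /=; rewrite in_itv /= => /hx ex.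
    rewrite /u /abel ex (_ : (expR _)%:C = cexp (sg * e * x)%:C); last first.
      by apply: complex_ext; rewrite /= ?cos0 ?sin0 ?mulr1 ?mulr0//; congr expR; ring.
    by rewrite -cexpD; congr cexp; rewrite /w (rCM s) (rCM (sg * e)) addrC mulrA -mulrDl.
  rewrite (@Cint_FTC _ (fun x => (w sg)^-1 * cexp (w sg * x%:C))) ?mulrBr//.
  - move=> t; apply: Cder_eq (CderZ (w sg)^-1 (Cder_cexp (CderZ (w sg) (Cder_id t)))) _.
    by rewrite mulr1 mulrCA mulVf// mulr1.
  - by apply: Ccont_cexp; apply: CcontM; [exact: Ccont_cst|exact: Ccont_rC].
have val (m : nat) : Cint `[(- m%:R), m%:R] u =
    (w 1)^-1 * (1 - cexp (w 1 * (- m%:R)%:C)) + (w (-1))^-1 * (cexp (w (-1) * m%:R%:C) - 1).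
  have m0 : (0:R) <= m%:R by [].
  rewrite (@Cint_split u _ 0) ?oppr_le0//.
  rewrite (FTC 1 _ _ n1) ?oppr_le0//; last first.
    by move=> x /andP[_ x0]; rewrite mulN1r ler0_norm.
  rewrite (FTC (-1) _ _ n2)//; last first.
    by move=> x /andP[x0 _]; rewrite opprK mul1r ger0_norm.
  by rewrite rC0 !mulr0 cexp0.
have ex (m : nat) : cabs (cexp (w 1 * (- m%:R)%:C)) <= (1 + 4 / e ^+ 2) * 2 * m.+1%:R^-1 /\
    cabs (cexp (w (-1) * m%:R%:C)) <= (1 + 4 / e ^+ 2) * 2 * m.+1%:R^-1.
  have h : abel e m%:R <= (1 + 4 / e ^+ 2) * 2 * m.+1%:R^-1.
    rewrite (le_trans (abel_bound _ e0))// -mulrA ler_wpM2l//.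
      by rewrite addr_ge0// divr_ge0// exprn_ge0// ltW.
    rewrite -[X in X <= _]mul1r ler_pdivrMr; last first.
      by apply: ltr_wpDr => //; exact: sqr_ge0.
    rewrite mulrAC ler_pdivlMr ?ltr0n// mul1r -natr1.
    by move: (m%:R : R) => x; have := sqr_ge0 (x - 1); have := sqr_ge0 x; rewrite sqrrB expr1n mulr1; lra.
  have wE sg (x : R) : Re (w sg * x%:C) = sg * e * x.
    by rewrite /w !CE !mul0r !mulr0 !subr0 add0r.
  by split; rewrite cabs_cexp (le_trans _ h)// ler_expR normr_nat wE ?mulN1r ?mul1r ?mulrN ?mulNr.
have -> : (2 * e / (e ^+ 2 + s ^+ 2))%:C = (w 1)^-1 - (w (-1))^-1.
  have q0 : e ^+ 2 + s ^+ 2 != 0 by rewrite gt_eqF// ltr_wpDr ?sqr_ge0// exprn_gt0.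
  have wn : w 1 * w (-1) = - (e ^+ 2 + s ^+ 2)%:C.
    rewrite /w mul1r mulN1r rCN rCD !rCX.
    transitivity ('i%C * 'i%C * s%:C ^+ 2 - e%:C ^+ 2); first by ring.
    by rewrite sqr_i_; ring.
  rewrite -[RHS](mulfK (_ : w 1 * w (-1) != 0)) ?mulf_neq0//.
  rewrite mulrBl mulrA mulVf// mul1r [w 1 * _]mulrC mulrA mulVf// mul1r [w (-1) * _]mulrC wn.
  rewrite rCM rCV invrN mulrN -mulNr; congr (_ * _).
  by rewrite /w mul1r mulN1r rCN opprB rCM rC_nat; ring.
apply: (@Ccvg_bound _ _ _ ((cabs (w 1)^-1 + cabs (w (-1))^-1) * ((1 + 4 / e ^+ 2) * 2))) => m.
rewrite val; have [h1 h2] := ex m.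
set A := cexp _ in h1 *; set B := cexp _ in h2 *.
have -> : (w 1)^-1 * (1 - A) + (w (-1))^-1 * (B - 1) - ((w 1)^-1 - (w (-1))^-1) =
  (w (-1))^-1 * B - (w 1)^-1 * A by ring.
rewrite (le_trans (cabsB _ _))// !cabsM addrC -mulrA mulrDl.
by rewrite lerD// ler_wpM2l ?cabs_ge0.
Qed.

Lemma Cmeas_conj d (T : measurableType d) (D : set T) (v : T -> R[i]) :
  Cmeas D v -> Cmeas D (fun x => (v x)^*%C).
Proof.
move=> [mr mi]; split.
  by rewrite (_ : (fun x => _) = fun x => Re (v x))//; apply/funext => x; case: (v x).
rewrite (_ : (fun x => _) = fun x => - Im (v x)); last by apply/funext => x; case: (v x).
exact: measurable_funN.
Qed.

Lemma Cintegrable_conj d (T : measurableType d) (nu : {measure set T -> \bar R}) D (v : T -> R[i]) :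
  measurable D -> Cintegrable nu D v -> Cintegrable nu D (fun x => (v x)^*%C).
Proof.
move=> mD [i1 i2]; split.
  by rewrite (_ : (fun x => _) = fun x => (Re (v x))%:E)//; apply/funext => x; case: (v x).
rewrite (_ : (fun x => _) = fun x => (- (Im (v x))%:E)%E); last by apply/funext => x; case: (v x).
exact: integrableN.
Qed.

Variable lam : R.
Hypothesis lam0 : lam != 0.
Variables (u : R -> R[i]) (K L : R).
Hypothesis cu : Ccont u.
Hypothesis uK : forall t, cabs (u t) <= K * (1 + t ^+ 2)^-1.

Definition ft (c : R) : R[i] := Cint setT (fun t => fker lam c t * u t).

Hypothesis uL : forall t, cabs (ft t) <= L * (1 + t ^+ 2)^-1.
Hypothesis cft : Ccont ft.

Let mker : Cmeas setT (fun p : RR * RR => fker lam p.1 p.2 * u p.2).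
Proof.
apply: CmeasM; first exact: Cmeas_fker2.
by apply: Cmeas_comp; [exact: measurable_snd|exact: Ccont_meas].
Qed.

Let K0 : 0 <= K.
Proof. by have := uK 0; rewrite expr0n addr0 invr1 mulr1; apply: le_trans; exact: cabs_ge0. Qed.

Let ik c : Cintegrable mu1 setT (fun t => fker lam c t * u t).
Proof.
apply: (@Ccauchy_integrable _ _ K); first by apply: CcontM => //; exact: Ccont_fker.
by move=> t; rewrite cabsM cabs_fker mul1r.
Qed.

(** Inserting the Abel factor makes the double integral absolutely convergent.
    The inner integral is then the Cauchy kernel at [- b] of width [e / |lam|],
    and a change of variable moves the width into the argument of [u]. *)
Let smear (b e : R) : 0 < e ->
  Cint setT (fun c => (abel e c)%:C * (fker lam b c * ft c)) =
  Cint setT (fun x => (2 / `|lam| * (1 + x ^+ 2)^-1)%:C * u (e / lam * x - b)).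
Proof.
move=> e0.
transitivity (Cint setT (fun c => Cint setT (fun t => (abel e c)%:C * fker lam b c * (fker lam c t * u t)))).
  by apply: Cint_ext => c _; rewrite CintZ ?mulrA.
rewrite (@Cint_swap _ _ (abel e) (fun t => K * (1 + t ^+ 2)^-1)); last 4 first.
- apply: CmeasM; last exact: mker.
  apply: (@Cmeas_comp _ _ _ _ _ fst (fun c : RR => (abel e c)%:C * fker lam b c)).
    exact: measurable_fst.
  by apply: Ccont_meas => //; apply: CcontM; [exact: Ccont_abel|exact: Ccont_fker].
- exact: integrable_abel.
- exact: integrable_cauchyZ.
- move=> c t; rewrite !cabsM !cabs_fker mul1r mulr1 cabs_rC ger0_norm ?abel_ge0//.
  by rewrite ler_wpM2l ?abel_ge0.
have l0 : lam ^+ 2 != 0 by rewrite sqrf_eq0.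
pose q t := 2 * e / (e ^+ 2 + (- (lam * (b + t))) ^+ 2).
have qp t : 0 < e ^+ 2 + (- (lam * (b + t))) ^+ 2.
  by rewrite ltr_wpDr ?sqr_ge0// exprn_gt0.
transitivity (Cint setT (fun t => (q t)%:C * u t)).
  apply: Cint_ext => t _; rewrite -(abel_integral (- (lam * (b + t))) e0).
  rewrite mulrC -CintZ//; last first.
    apply: (Cint_dom (g := abel e)) => //.
    - apply: Ccont_meas => //; apply: CcontM; first exact: Ccont_abel.
      apply: Ccont_cexp; apply: CcontM; first exact: Ccont_cst.
      by under eq_fun do rewrite rCM; apply: CcontM; [exact: Ccont_cst|exact: Ccont_rC].
    - exact: integrable_abel.
    - by move=> c _; rewrite cabsM cabs_cexpi mulr1 cabs_rC ger0_norm ?abel_ge0.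
  apply: Cint_ext => c _; rewrite -!mulrA [RHS]mulrC -!mulrA; congr (_ * _).
  rewrite mulrA [fker lam c t]fkerC fkerD; congr (_ * _).
  by rewrite /fker; congr (cexp ('i%C * _%:C)); ring.
have el : e / lam != 0 by rewrite mulf_neq0 ?invr_eq0// gt_eqF.
have q0 t : 0 <= q t by rewrite divr_ge0 ?mulr_ge0 ?(ltW (qp t))// ltW.
have cq : Ccont (fun t => (q t)%:C * u t).
  apply: CcontM => //.
  rewrite (_ : (fun t => _) = fun t => (2 * e)%:C *
      ((e ^+ 2)%:C + (lam ^+ 2)%:C * ((b%:C + t%:C) * (b%:C + t%:C)))^-1); last first.
    by apply/funext => t; rewrite -!(rCD, rCM) -rCV -rCM; congr (_ / (_ + _))%:C; ring.
  apply: CcontM; first exact: Ccont_cst.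
  apply: CcontV => [t|].
    rewrite -!(rCD, rCM) rC_eq0 (_ : _ + _ = e ^+ 2 + (- (lam * (b + t))) ^+ 2); last by ring.
    by rewrite gt_eqF.
  apply: CcontD; first exact: Ccont_cst.
  apply: CcontM; first exact: Ccont_cst.
  by apply: CcontM; apply: CcontD; by [exact: Ccont_cst|exact: Ccont_rC].
have iq : Cintegrable mu1 setT (fun t => (q t)%:C * u t).
  apply: (@Ccauchy_integrable _ _ (2 / e * K)) => // t.
  rewrite cabsM cabs_rC ger0_norm// -[leRHS]mulrA ler_pM ?cabs_ge0//.
  rewrite /q ler_pdivrMr// mulrAC ler_pdivlMr//.
  by rewrite -!mulrA ler_wpM2l// -expr2 lerDl sqr_ge0.
rewrite (@Cint_affine _ (e / lam) (- b) el)//.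
rewrite -CintZ//.
  apply: Cint_ext => x _; rewrite mulrA -rCM; congr (_%:C * _).
  rewrite /q normrM normfV gtr0_norm//.
  have -> : (- (lam * (b + (e / lam * x + - b)))) ^+ 2 = e ^+ 2 * x ^+ 2 by field.
  have p : 1 + x ^+ 2 != 0 by rewrite gt_eqF// ltr_wpDr// sqr_ge0.
  have e1 : e != 0 by rewrite gt_eqF.
  have a0 : `|lam| != 0 by rewrite normr_eq0.
  have -> : e ^+ 2 + e ^+ 2 * x ^+ 2 = e ^+ 2 * (1 + x ^+ 2) by ring.
  by field; rewrite p a0 e1.
have [i1 i2] := iq; split.
- exact: (@integrable_affine _ (e / lam) (- b) el (fun t => Re ((q t)%:C * u t)) i1).
- exact: (@integrable_affine _ (e / lam) (- b) el (fun t => Im ((q t)%:C * u t)) i2).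
Qed.

(** Both sides of the smoothed formula converge as [e] tends to zero, by
    dominated convergence. *)
Lemma ft_inversion b : Cint setT (fun c => fker lam b c * ft c) = (2 * pi / `|lam|)%:C * u (- b).
Proof.
have a0 : `|lam| != 0 by rewrite normr_eq0.
have k0 : 0 <= 2 / `|lam| by rewrite divr_ge0.
pose e (m : nat) := m.+1%:R^-1 : R.
have ep m : 0 < e m by rewrite invr_gt0 ltr0n.
have ecv : e @ \oo --> (0 : R) by exact: cvg_harmonic.
apply: (@Ccvg_unique _ (fun m => Cint setT (fun c => (abel (e m) c)%:C * (fker lam b c * ft c)))).
  apply: (@Cint_dominated _ _ _ _ (fun t => L * (1 + t ^+ 2)^-1)) => //.
  - move=> m; apply: Ccont_meas => //; apply: CcontM; first exact: Ccont_abel.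
    by apply: CcontM => //; exact: Ccont_fker.
  - exact: integrable_cauchyZ.
  - move=> m t _; rewrite !cabsM cabs_fker mul1r cabs_rC ger0_norm ?abel_ge0//.
    by rewrite (le_trans _ (uL t))// ler_piMl ?cabs_ge0// abel_le1.
  - move=> t _; rewrite -[X in Ccvg _ X]mul1r; apply: CcvgM; last exact: Ccvg_cst.
    split => /=; last exact: cvg_cst.
    rewrite -[X in _ --> X]expR0; apply: (@cvg_comp _ _ _ (fun m => - (e m * `|t|)) (@expR R) \oo (nbhs 0)); last exact: continuous_expR.
    have : (fun m => - (e m * `|t|)) @ \oo --> - (0 * `|t|).
      by apply: cvgN; apply: cvgM => //; exact: cvg_cst.
    by rewrite mul0r oppr0.
under eq_fun do rewrite smear//.
have -> : (2 * pi / `|lam|)%:C * u (- b) = Cint setT (fun x => (2 / `|lam| * (1 + x ^+ 2)^-1)%:C * u (- b)).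
  rewrite (@Cint_ext _ _ _ (fun x => u (- b) * (2 / `|lam| * (1 + x ^+ 2)^-1)%:C)); last first.
    by move=> x _; rewrite mulrC.
  rewrite CintZ//; last by split; [exact: integrable_cauchyZ|exact: integrable0].
  rewrite mulrC; congr (_ * _); apply: complex_ext => /=; last by rewrite /Rintegral integral0_eq.
  by rewrite RintegralZl//= ?Rintegral_cauchy; [ring|exact: integrable_cauchy].
apply: (@Cint_dominated _ _ _ _ (fun x => 2 / `|lam| * K * (1 + x ^+ 2)^-1)) => //.
- move=> m; apply: CmeasM.
    apply: Cmeas_real; apply: measurable_funM => //.
    by apply: continuous_measurable_fun => x; exact: (@continuous_oneDsqrV R x).
  apply: (@Cmeas_comp _ _ _ _ _ (affine (e m / lam) (- b)) u); last exact: Ccont_meas.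
  exact: measurable_affine.
- exact: integrable_cauchyZ.
- move=> m t _; rewrite cabsM cabs_rC ger0_norm; last first.
    by rewrite mulr_ge0// invr_ge0 addr_ge0 ?sqr_ge0.
  rewrite [leRHS]mulrAC; apply: ler_wpM2l; first by rewrite mulr_ge0// invr_ge0 addr_ge0 ?sqr_ge0.
  rewrite (le_trans (uK _))// ler_piMr// invf_le1 ?lerDl ?sqr_ge0//.
  by rewrite ltr_wpDr ?sqr_ge0.
- move=> t _; apply: CcvgM; first exact: Ccvg_cst.
  have h : (fun m => e m / lam * t - b) @ \oo --> - b.
    rewrite -[X in _ --> X]add0r -(mul0r t) -[X in X * t](mul0r lam^-1).
    by apply: cvgB; [apply: cvgM; [apply: cvgM => //; exact: cvg_cst|exact: cvg_cst]|exact: cvg_cst].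
  split.
    exact: (@cvg_comp _ _ _ (fun m => e m / lam * t - b) (fun x => Re (u x)) \oo (nbhs (- b)) _ h (cu.1 (- b))).
  exact: (@cvg_comp _ _ _ (fun m => e m / lam * t - b) (fun x => Im (u x)) \oo (nbhs (- b)) _ h (cu.2 (- b))).
Qed.

Lemma mul_conj (z : R[i]) : z * z^*%C = (cabs z ^+ 2)%:C.
Proof. by rewrite cabs_sq; case: z => x y; apply: complex_ext => /=; ring. Qed.

Lemma Cint_rC (f : R -> R) : Cint setT (fun t => (f t)%:C) = (\int[mu1]_t f t)%:C.
Proof. by apply: complex_ext => //=; rewrite /Rintegral integral0_eq. Qed.

(** One of the two factors is written as a transform; exchanging the integrals
    applies inversion to the other. *)
Lemma ft_plancherel :
  \int[mu1]_c (cabs (ft c) ^+ 2) = 2 * pi / `|lam| * \int[mu1]_t (cabs (u t) ^+ 2).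
Proof.
suff : Cint setT (fun c => (cabs (ft c) ^+ 2)%:C) =
    (2 * pi / `|lam|)%:C * Cint setT (fun t => (cabs (u t) ^+ 2)%:C).
  by rewrite !Cint_rC -rCM => /(congr1 (@complex.Re R)).
have conj_u t : cabs ((u t)^*%C) <= K * (1 + t ^+ 2)^-1 by rewrite cabs_conj.
transitivity (Cint setT (fun c => Cint setT (fun t => ft c * (fker lam c t * u t)^*%C))).
  apply: Cint_ext => c _; rewrite -mul_conj {2}/ft Cint_conj// -CintZ//.
  exact: Cintegrable_conj.
rewrite (@Cint_swap _ _ (fun c => L * (1 + c ^+ 2)^-1) (fun t => K * (1 + t ^+ 2)^-1)); last 4 first.
- apply: CmeasM.
    by apply: (@Cmeas_comp _ _ _ _ _ fst ft); [exact: measurable_fst|exact: Ccont_meas].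
  exact: Cmeas_conj.
- exact: integrable_cauchyZ.
- exact: integrable_cauchyZ.
- by move=> c t; rewrite cabsM cabs_conj cabsM cabs_fker mul1r ler_pM ?cabs_ge0.
rewrite -CintZ//; last first.
  rewrite (_ : (fun x => _) = fun t => u t * (u t)^*%C); last by apply/funext => t; rewrite mul_conj.
  have iu : Cintegrable mu1 setT u by exact: Ccauchy_integrable uK.
  have [mc _] := Cintegrable_conj measurableT iu.
  apply: (@CintegrableM_bdd _ _ _ _ _ _ _ K) => //.
  - exact: Ccont_meas.
  - move=> t _; rewrite (le_trans (uK t))// ler_piMr// invf_le1 ?lerDl ?sqr_ge0//.
    by rewrite ltr_wpDr ?sqr_ge0.
  - exact: Cintegrable_conj.
apply: Cint_ext => t _; rewrite -mul_conj.
transitivity ((u t)^*%C * Cint setT (fun c => fker lam (- t) c * ft c)); last first.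
  by rewrite ft_inversion opprK mulrC mulrA.
rewrite -CintZ.
- apply: Cint_ext => c _; rewrite conjM conj_fker (_ : fker lam (- t) c = fker lam (- c) t); first by ring.
  by rewrite /fker; congr (cexp ('i%C * _%:C)); ring.
- exact: measurableT.
apply: (@Ccauchy_integrable _ _ L); first by apply: CcontM => //; exact: Ccont_fker.
by move=> c; rewrite cabsM cabs_fker mul1r.
Qed.

End FourierInversion.

(** * The unitary partial Fourier transform *)

Section UnitaryFourier.
Variables (R : realType) (n : nat) (k : 'I_n) (lam : R).
Hypothesis lam0 : lam != 0.
Local Notation T := (Rn R n).
Local Notation mu1 := (@lebesgue_measure R).
Local Notation mu := (lebesgue_Rn R n).
Implicit Types (f g : T -> R[i]) (a : T).

Definition reflect a : T := upd a k (- crd a k).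

Lemma reflectK a : reflect (reflect a) = a.
Proof. by rewrite /reflect crd_upd_same upd_upd opprK upd_crd. Qed.

Lemma pft_ft f a t : pft k lam f (upd a k t) = ft lam (fun t => f (upd a k t)) t.
Proof. by apply: Cint_ext => s _; rewrite crd_upd_same upd_upd. Qed.

Lemma pft_pft f a : schwartz f ->
  pft k lam (pft k lam f) a = (2 * pi / `|lam|)%:C * f (reflect a).
Proof.
move=> sf; have sF := schwartz_pft k lam0 sf.
have [K hK] := rapid_slice k (schwartz_rapid sf).
have [L hL] := rapid_slice k (schwartz_rapid sF).
have e t : ft lam (fun t => f (upd a k t)) t = pft k lam f (upd a k t) by rewrite pft_ft.
rewrite -(@ft_inversion _ _ lam0 (fun t => f (upd a k t)) K L _ (hK a)).
- by apply: Cint_ext => t _; rewrite e.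
- exact: schwartz_slice.
- by move=> t; rewrite e.
- by rewrite (_ : ft _ _ = fun t => pft k lam f (upd a k t)); [exact: schwartz_slice|exact/funext].
Qed.

Lemma sqnorm_slice f (K : R) a : Ccont (fun t => f (upd a k t)) ->
  (forall t, cabs (f (upd a k t)) <= K * (1 + t ^+ 2)^-1) ->
  (\int[mu1]_t (cabs (f (upd a k t)) ^+ 2)%:E = (\int[mu1]_t (cabs (f (upd a k t)) ^+ 2))%:E)%E.
Proof.
move=> cf hK; rewrite /Rintegral fineK//.
apply: integrable_fin_num => //.
apply: (le_integrable measurableT _ _ (integrable_cauchyZ (K ^+ 2) measurableT)).
  by apply/measurable_EFinP; apply: measurable_funX; apply: Cmeas_cabs; exact: Ccont_meas.
move=> t _ /=; rewrite lee_fin ger0_norm ?sqr_ge0//.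
rewrite (le_trans _ (ler_norm _))//.
have K0 : 0 <= K.
  by have := hK 0; rewrite expr0n addr0 invr1 mulr1; apply: le_trans; exact: cabs_ge0.
have p : 0 <= (1 + t ^+ 2)^-1 by rewrite invr_ge0 addr_ge0 ?sqr_ge0.
apply: (@le_trans _ _ ((K * (1 + t ^+ 2)^-1) ^+ 2)).
  by apply: lerXn2r; rewrite ?nnegrE ?cabs_ge0 ?mulr_ge0.
rewrite exprMn ler_wpM2l ?sqr_ge0// expr2 ler_piMl// invf_le1 ?lerDl ?sqr_ge0//.
by rewrite ltr_wpDr ?sqr_ge0.
Qed.

(** Plancherel's theorem on each line parallel to the axis [k]. *)
Lemma sqnorm_pft f : schwartz f ->
  sqnorm mu (pft k lam f) = ((2 * pi / `|lam|)%:E * sqnorm mu f)%E.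
Proof.
move=> sf; have sF := schwartz_pft k lam0 sf.
have [K hK] := rapid_slice k (schwartz_rapid sf).
have [L hL] := rapid_slice k (schwartz_rapid sF).
pose rho (t : R) : \bar R := (pi^-1 * (1 + t ^+ 2)^-1)%:E.
have pi0 := @pi_gt0 R.
have mrho : measurable_fun setT rho.
  apply/measurable_EFinP; apply: measurable_funM => //.
  by apply: continuous_measurable_fun => x; exact: (@continuous_oneDsqrV R x).
have rho0 t : (0 <= rho t)%E.
  rewrite lee_fin; apply: mulr_ge0; first by rewrite invr_ge0 ltW.
  by rewrite invr_ge0 addr_ge0 ?sqr_ge0.
have rho1 : (\int[mu1]_t rho t = 1)%E.
  have := integrable_fin_num measurableT (integrable_cauchyZ pi^-1 (measurableT : measurable [set: measurableTypeR R])).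
  move=> /fineK <-; congr (_%:E).
  rewrite -[LHS]/(\int[mu1]_t (pi^-1 * (1 + t ^+ 2)^-1)).
  rewrite RintegralZl//; last exact: integrable_cauchy.
  by rewrite Rintegral_cauchy mulVf// gt_eqF.
have c0 : 0 <= 2 * pi / `|lam| by rewrite divr_ge0// mulr_ge0// ltW.
have msq g : schwartz g -> measurable_fun setT (fun a => (cabs (g a) ^+ 2)%:E).
  by move=> sg; apply/measurable_EFinP; apply: measurable_funX; apply: Cmeas_cabs; exact: schwartz_meas.
rewrite /sqnorm -ge0_integralZl//; last 2 first.
- exact: msq.
- by move=> a _; rewrite lee_fin sqr_ge0.
rewrite (integral_slice k mrho rho0 rho1 (msq _ sF)); last by move=> a; rewrite lee_fin sqr_ge0.
rewrite [RHS](integral_slice k mrho rho0 rho1); last 2 first.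
- by apply: measurable_funeM; exact: msq.
- by move=> a; rewrite -EFinM lee_fin mulr_ge0 ?sqr_ge0.
apply: eq_integral => a _; congr (_ * _)%E.
rewrite (ge0_integralZl _ measurableT); last 3 first.
- apply/measurable_EFinP; apply: measurable_funX; apply: Cmeas_cabs.
  by apply: Ccont_meas => //; exact: schwartz_slice.
- by move=> t _; rewrite lee_fin sqr_ge0.
- by rewrite lee_fin.
rewrite (sqnorm_slice (schwartz_slice k a sf) (hK a)) (sqnorm_slice (schwartz_slice k a sF) (hL a)).
rewrite -EFinM; congr (_%:E).
have e t : ft lam (fun t => f (upd a k t)) t = pft k lam f (upd a k t) by rewrite pft_ft.
rewrite -(@ft_plancherel _ _ lam0 (fun t => f (upd a k t)) K L _ (hK a)).
- by apply: eq_Rintegral => t _; rewrite e.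
- exact: schwartz_slice.
- by move=> t; rewrite e.
- by rewrite (_ : ft _ _ = fun t => pft k lam f (upd a k t)); [exact: schwartz_slice|exact/funext].
Qed.

Definition kappa : R := Num.sqrt (`|lam| / (2 * pi)).

Lemma kappa_sq : kappa ^+ 2 * (2 * pi / `|lam|) = 1.
Proof.
have pi0 := @pi_gt0 R.
rewrite sqr_sqrtr ?divr_ge0 ?mulr_ge0 ?(ltW pi0)//.
have p0 : pi != 0 :> R by rewrite gt_eqF.
have l0 : `|lam| != 0 by rewrite normr_eq0.
have p2 : 2 * pi != 0 :> R by rewrite mulf_neq0.
by rewrite mulrA divfK// mulfV.
Qed.

Definition uft f a : R[i] := kappa%:C * pft k lam f a.

Lemma schwartz_uft f : schwartz f -> schwartz (uft f).
Proof. by move=> sf; apply: schwartzZ; exact: schwartz_pft. Qed.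

Lemma uftD f g a : schwartz f -> schwartz g -> uft (fun a => f a + g a) a = uft f a + uft g a.
Proof. by move=> sf sg; rewrite /uft pftD// mulrDr. Qed.

Lemma uftZ (c : R[i]) f a : schwartz f -> uft (fun a => c * f a) a = c * uft f a.
Proof. by move=> sf; rewrite /uft pftZ// mulrCA. Qed.

Lemma uft_uft f a : schwartz f -> uft (uft f) a = f (reflect a).
Proof.
move=> sf; rewrite /uft pftZ; last exact: schwartz_pft.
by rewrite pft_pft// !mulrA -!rCM -expr2 kappa_sq rC1 mul1r.
Qed.

(** The square of the unitary transform is a reflection. Thus its cube is an
    inverse that again preserves Schwartz functions. *)
Lemma uft4 f : schwartz f -> uft (uft (uft (uft f))) = f.
Proof.
move=> sf; apply/funext => a; rewrite uft_uft; last by do 2 apply: schwartz_uft.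
by rewrite uft_uft// reflectK.
Qed.

Lemma sqnorm_uft f : schwartz f -> sqnorm mu (uft f) = sqnorm mu f.
Proof.
move=> sf; have m : measurable_fun setT (fun a => (cabs (pft k lam f a) ^+ 2)%:E).
  by apply/measurable_EFinP; apply: measurable_funX; apply: Cmeas_cabs; apply: schwartz_meas; exact: schwartz_pft.
transitivity (\int[mu]_a ((kappa ^+ 2)%:E * (cabs (pft k lam f a) ^+ 2)%:E))%E.
  by apply: eq_integral => a _; rewrite cabsM exprMn cabs_rC real_normK ?num_real// EFinM.
rewrite ge0_integralZl//; last 2 first.
- by move=> a _; rewrite lee_fin sqr_ge0.
- by rewrite lee_fin sqr_ge0.
by rewrite -[X in (_ * X)%E]/(sqnorm mu (pft k lam f)) sqnorm_pft// muleA -EFinM kappa_sq mul1e.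
Qed.

End UnitaryFourier.

(** * Square integrable functions *)

Section SquareIntegrable.
Context (R : realType) d (T : measurableType d) (mu : {measure set T -> \bar R}).
Implicit Types (u v w : T -> R[i]).
Local Notation N := (sqnorm mu).
Local Notation meas := (@Cmeas R _ T setT).
Local Open Scope ereal_scope.

Lemma L2P u : L2 mu u <-> meas u /\ N u < +oo.
Proof. by split=> [[a b c]|[[a b] c]]; split. Qed.

Lemma L2_meas u : L2 mu u -> meas u. Proof. by case/L2P. Qed.

Lemma sqnorm_ge0 u : 0 <= N u.
Proof. by apply: integral_ge0 => x _; rewrite lee_fin sqr_ge0. Qed.

Lemma msq u : meas u -> measurable_fun setT (fun x => (cabs (u x) ^+ 2)%:E).
Proof. by move=> mu_; apply/measurable_EFinP; apply: measurable_funX; exact: Cmeas_cabs. Qed.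

Lemma sqnorm_le (C : R) u v : (0 <= C)%R -> meas u -> meas v ->
  (forall x, cabs (u x) ^+ 2 <= C * cabs (v x) ^+ 2)%R -> N u <= C%:E * N v.
Proof.
move=> C0 hu hv h.
have sq0 (w : T -> R[i]) (x : T) : setT x -> 0 <= (cabs (w x) ^+ 2)%:E by rewrite lee_fin sqr_ge0.
rewrite /sqnorm -(ge0_integralZl mu measurableT (msq hv) (sq0 v)); last by rewrite lee_fin.
apply: ge0_le_integral => //.
- exact: sq0.
- exact: msq.
- by apply: measurable_funeM; exact: msq.
- by move=> x _; rewrite -EFinM lee_fin.
Qed.

Lemma sqnorm_le1 u v : meas u -> meas v ->
  (forall x, cabs (u x) <= cabs (v x))%R -> N u <= N v.
Proof.
move=> hu hv h; rewrite -[leRHS]mul1e; apply: sqnorm_le => // x.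
by rewrite mul1r; apply: lerXn2r; rewrite ?nnegrE ?cabs_ge0.
Qed.

Lemma sqnormZ (c : R[i]) u : meas u -> N (fun x => c * u x)%R = (cabs c ^+ 2)%:E * N u.
Proof.
move=> hu; rewrite /sqnorm -(ge0_integralZl mu measurableT (msq hu)); last 2 first.
- by move=> x _; rewrite lee_fin sqr_ge0.
- by rewrite lee_fin sqr_ge0.
by apply: eq_integral => x _; rewrite cabsM exprMn EFinM.
Qed.

(** For any [e > 0], [(a + b)^2 <= (1 + e) a^2 + (1 + 1/e) b^2]. The parameter makes
    it possible to do without square roots of norms. *)
Lemma sqnormD_weighted (e : R) u v : (0 < e)%R -> meas u -> meas v ->
  N (fun x => u x + v x)%R <= (1 + e)%:E * N u + (1 + e^-1)%:E * N v.
Proof.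
move=> e0 hu hv.
have p1 : (0 <= 1 + e)%R by rewrite addr_ge0 ?ltW.
have p2 : (0 <= 1 + e^-1)%R by rewrite addr_ge0 ?invr_ge0 ?ltW.
have sq0 (w : T -> R[i]) (x : T) : setT x -> 0 <= (cabs (w x) ^+ 2)%:E by rewrite lee_fin sqr_ge0.
rewrite /sqnorm -(ge0_integralZl mu measurableT (msq hu) (sq0 u)); last by rewrite lee_fin.
rewrite -(ge0_integralZl mu measurableT (msq hv) (sq0 v)); last by rewrite lee_fin.
rewrite -(ge0_integralD mu measurableT); last 4 first.
- by move=> x _; rewrite mule_ge0 ?lee_fin ?sqr_ge0.
- by apply: measurable_funeM; exact: msq.
- by move=> x _; rewrite mule_ge0 ?lee_fin ?sqr_ge0.
- by apply: measurable_funeM; exact: msq.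
apply: ge0_le_integral => //.
- exact: (sq0 (fun x => u x + v x)%R).
- by apply: (@msq (fun x => u x + v x)%R); exact: CmeasD.
- by apply: emeasurable_funD; apply: measurable_funeM; exact: msq.
move=> x _; rewrite -!EFinM -EFinD lee_fin.
set a := cabs (u x); set b := cabs (v x).
apply: (@le_trans _ _ ((a + b) ^+ 2)%R).
  by apply: lerXn2r; rewrite ?nnegrE ?cabs_ge0 ?addr_ge0 ?cabs_ge0 ?cabsD.
have e1 : e != 0%R by rewrite gt_eqF.
rewrite -subr_ge0 (_ : _ - _ = (e * a - b) ^+ 2 / e)%R; last by field.
by rewrite divr_ge0 ?sqr_ge0 ?ltW.
Qed.

Lemma sqnormD u v : meas u -> meas v -> N (fun x => u x + v x)%R <= 2%:E * N u + 2%:E * N v.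
Proof. by move=> hu hv; have := sqnormD_weighted ltr01 hu hv; rewrite invr1. Qed.

Lemma sqnormN u : N (fun x => - u x)%R = N u.
Proof. by apply: eq_integral => x _; rewrite cabsN. Qed.

Lemma sqnormC u v : N (fun x => u x - v x)%R = N (fun x => v x - u x)%R.
Proof. by rewrite -sqnormN; apply: eq_integral => x _; rewrite opprB. Qed.

Lemma sqnormB u v w : meas u -> meas v -> meas w ->
  N (fun x => u x - w x)%R <= 2%:E * N (fun x => u x - v x)%R + 2%:E * N (fun x => v x - w x)%R.
Proof.
move=> hu hv hw; rewrite (_ : (fun x => u x - w x)%R = (fun x => (u x - v x) + (v x - w x))%R).
  by apply: sqnormD; exact: CmeasB.
by apply/funext => x; rewrite addrA subrK.
Qed.

Lemma L2_sqnormZ (c : R[i]) u : L2 mu u -> L2 mu (fun x => c * u x)%R.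
Proof.
move=> /L2P[hu Nu]; apply/L2P; split.
  by apply: CmeasM => //; exact: Cmeas_cst.
by rewrite sqnormZ// lte_mul_pinfty ?lee_fin ?sqr_ge0.
Qed.

Lemma L2D u v : L2 mu u -> L2 mu v -> L2 mu (fun x => u x + v x)%R.
Proof.
move=> /L2P[hu Nu] /L2P[hv Nv]; apply/L2P; split; first exact: CmeasD.
by rewrite (le_lt_trans (sqnormD hu hv))// lte_add_pinfty// lte_mul_pinfty.
Qed.

Lemma sqnorm_ae u v : meas u -> meas v -> {ae mu, forall x, u x = v x} -> N u = N v.
Proof.
move=> hu hv uv; apply: ae_eq_integral => //; [exact: msq|exact: msq|].
by apply: filterS uv => x -> _.
Qed.

Lemma sqnorm_eq0 u : meas u -> N u = 0 -> {ae mu, forall x, u x = 0%R}.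
Proof.
move=> hu h.
have := (ae_eq_integral_abs mu measurableT (msq hu)).1.
rewrite (eq_integral (fun x => (cabs (u x) ^+ 2)%:E)); last first.
  by move=> x _; rewrite gee0_abs// lee_fin sqr_ge0.
move=> /(_ h); apply: filterS => x /(_ Logic.I) [] /eqP.
by rewrite sqrf_eq0 => /eqP /cabs_eq0.
Qed.

Definition L2cvg (F : nat -> T -> R[i]) u :=
  (fun m => N (fun x => F m x - u x)%R) @ \oo --> 0.

Lemma L2cvg_le (F : nat -> T -> R[i]) u (c : nat -> \bar R) :
  (forall m, N (fun x => F m x - u x)%R <= c m) -> c @ \oo --> 0 -> L2cvg F u.
Proof.
move=> h hc; apply: (@squeeze_cvge _ _ _ _ (cst 0) _ c) => //.
- by apply: nearW => m; rewrite h sqnorm_ge0.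
- exact: cvg_cst.
Qed.

Lemma ecvg0M (C : R) (c : nat -> \bar R) : c @ \oo --> 0 -> (fun m => C%:E * c m) @ \oo --> 0.
Proof. by move=> h; rewrite -[X in _ --> X](mule0 C%:E); apply: cvgeZl. Qed.

Lemma ecvg0D (c e : nat -> \bar R) : c @ \oo --> 0 -> e @ \oo --> 0 ->
  (fun m => c m + e m) @ \oo --> 0.
Proof. by move=> hc he; rewrite -[X in _ --> X]adde0; apply: cvgeD. Qed.

Lemma L2cvgD (F G : nat -> T -> R[i]) u v : (forall m, meas (F m)) -> (forall m, meas (G m)) ->
  meas u -> meas v -> L2cvg F u -> L2cvg G v ->
  L2cvg (fun m x => F m x + G m x)%R (fun x => u x + v x)%R.
Proof.
move=> hF hG hu hv cF cG.
apply: (L2cvg_le (c := fun m => 2%:E * N (fun x => F m x - u x)%R + 2%:E * N (fun x => G m x - v x)%R)).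
  move=> m; rewrite (_ : (fun x => _) = (fun x => (F m x - u x) + (G m x - v x))%R).
    by apply: sqnormD; exact: CmeasB.
  by apply/funext => x; ring.
by apply: ecvg0D; exact: ecvg0M.
Qed.

Lemma L2cvgZ (C : R[i]) (F : nat -> T -> R[i]) u : (forall m, meas (F m)) -> meas u ->
  L2cvg F u -> L2cvg (fun m x => C * F m x)%R (fun x => C * u x)%R.
Proof.
move=> hF hu cF.
apply: (L2cvg_le (c := fun m => (cabs C ^+ 2)%:E * N (fun x => F m x - u x)%R)); last exact: ecvg0M.
move=> m; rewrite -sqnormZ; last exact: CmeasB.
by rewrite (_ : (fun x => _) = (fun x => C * (F m x - u x))%R)//; apply/funext => x; rewrite mulrBr.
Qed.

Lemma L2cvg_cst u : L2cvg (fun=> u) u.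
Proof.
apply: (L2cvg_le (c := cst 0)); last exact: cvg_cst.
move=> m; rewrite /sqnorm (eq_integral (cst 0)) ?integral0// => x _.
by rewrite subrr cabs0 expr0n.
Qed.

(** By the weighted inequality, applied to [u] and [w] with the weight [e] and then
    letting [e] tend to zero. *)
Lemma sqnorm_lim_le (C : R) (F G : nat -> T -> R[i]) u w : (0 <= C)%R ->
  (forall m, meas (F m)) -> (forall m, meas (G m)) -> L2 mu u -> meas w ->
  (forall m, N (G m) <= C%:E * N (F m)) -> L2cvg F u -> L2cvg G w -> N w <= C%:E * N u.
Proof.
move=> C0 hF hG Lu hw FG cF cG; have [hu Nu] := (L2P u).1 Lu.
have fu : N u \is a fin_num by rewrite ge0_fin_numE ?sqnorm_ge0.
have r0 : (0 <= fine (N u))%R by rewrite fine_ge0 ?sqnorm_ge0.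
rewrite -(fineK fu); set r := fine _ in r0 *.
have key (e : R) : (0 < e)%R -> N w <= ((1 + e) * (C * ((1 + e) * r)))%:E.
  move=> e0; have p1 : (0 <= 1 + e)%R by rewrite addr_ge0 ?ltW.
  have p2 : (0 <= 1 + e^-1)%R by rewrite addr_ge0 ?invr_ge0 ?ltW.
  pose c m := ((1 + e) * (C * (1 + e^-1)))%:E * N (fun x => F m x - u x)%R +
    (1 + e^-1)%:E * N (fun x => G m x - w x)%R.
  have cc : c @ \oo --> 0 by apply: ecvg0D; exact: ecvg0M.
  have cc' : (fun m => ((1 + e) * (C * ((1 + e) * r)))%:E + c m) @ \oo -->
      ((1 + e) * (C * ((1 + e) * r)))%:E + 0.
    by apply: cvgeD => //; exact: cvg_cst.
  rewrite -[leRHS]adde0 -(cvg_lim (@ereal_hausdorff R) cc').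
  apply: lime_ge; first by apply/cvg_ex; eexists; exact: cc'.
  apply: nearW => m.
  have h1 : N w <= (1 + e)%:E * N (G m) + (1 + e^-1)%:E * N (fun x => G m x - w x)%R.
    rewrite sqnormC -(_ : N (fun x => G m x + (w x - G m x))%R = N w); last first.
      by congr sqnorm; apply/funext => x; rewrite addrC subrK.
    by apply: sqnormD_weighted => //; exact: CmeasB.
  have h2 : N (F m) <= (1 + e)%:E * r%:E + (1 + e^-1)%:E * N (fun x => F m x - u x)%R.
    rewrite fineK// -(_ : N (fun x => u x + (F m x - u x))%R = N (F m)); last first.
      by congr sqnorm; apply/funext => x; rewrite addrC subrK.
    by apply: sqnormD_weighted => //; exact: CmeasB.
  rewrite (le_trans h1)// /c addeA leeD//.
  apply: (@le_trans _ _ ((1 + e)%:E * (C%:E * N (F m)))).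
    by apply: lee_wpmul2l; rewrite ?lee_fin.
  apply: (@le_trans _ _ ((1 + e)%:E * (C%:E * ((1 + e)%:E * r%:E + (1 + e^-1)%:E * N (fun x => F m x - u x)%R)))).
    by apply: lee_wpmul2l; rewrite ?lee_fin//; apply: lee_wpmul2l; rewrite ?lee_fin.
  rewrite ge0_muleDr ?mule_ge0 ?lee_fin ?sqnorm_ge0//.
  rewrite ge0_muleDr ?mule_ge0 ?lee_fin ?sqnorm_ge0//.
  by rewrite -!EFinM !muleA -!EFinM !mulrA.
apply/lee_addgt0Pr => e e0.
have q0 : (0 < 3 * (C * r) + 1)%R by rewrite ltr_wpDl// mulr_ge0// mulr_ge0.
pose b := Num.min 1%R (e / (3 * (C * r) + 1))%R.
have b0 : (0 < b)%R by rewrite lt_min ltr01 divr_gt0.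
rewrite (le_trans (key b b0))// -EFinM -EFinD lee_fin.
have b1 : (b <= 1)%R by rewrite ge_min lexx.
have b2 : (b * (3 * (C * r) + 1) <= e)%R by rewrite -ler_pdivlMr// ge_min lexx orbT.
have Cr : (0 <= C * r)%R by rewrite mulr_ge0.
have -> : ((1 + b) * (C * ((1 + b) * r)) = (1 + b) ^+ 2 * (C * r))%R by ring.
have h : ((1 + b) ^+ 2 <= 1 + 3 * b)%R by nra.
rewrite (le_trans (ler_wpM2r Cr h))//; nra.
Qed.

End SquareIntegrable.

(** * Completeness *)

Section Completeness.
Variable R : realType.

(** The sequences [x m - 2 s / 2 ^ m] and [x m + 2 s / 2 ^ m] are monotone and
    enclose the limit. *)
Lemma fast_cvg (x : nat -> R) (s : R) : (forall m, `|x m.+1 - x m| <= s / 2 ^+ m) ->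
  exists2 l : R, x @ \oo --> l & forall m, `|x m - l| <= 2 * s / 2 ^+ m.
Proof.
move=> h.
pose y m := x m - 2 * s / 2 ^+ m; pose z m := x m + 2 * s / 2 ^+ m.
have p m : (2:R) ^+ m != 0 by rewrite expf_neq0.
have e m : 2 * s / 2 ^+ m = s / 2 ^+ m + 2 * s / 2 ^+ m.+1.
  by rewrite exprS; have := p m; set q := 2 ^+ m => q0; field.
have s0 : 0 <= s by have := h 0%N; rewrite expr0 divr1; apply: le_trans.
have b0 m : 0 <= 2 * s / 2 ^+ m by rewrite divr_ge0 ?exprn_ge0 ?mulr_ge0.
have ny : nondecreasing_seq y.
  apply/nondecreasing_seqP => m; rewrite /y [in leLHS]e.
  by have := h m; rewrite ler_norml => /andP[]; lra.
have nz : nonincreasing_seq z.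
  apply/nonincreasing_seqP => m; rewrite /z [in leRHS]e.
  by have := h m; rewrite ler_norml => /andP[]; lra.
have yz m : y m <= z m by rewrite /y /z; have := b0 m; lra.
have cy : cvgn y.
  apply: nondecreasing_is_cvgn => //; exists (z 0%N) => _ [m _ <-].
  by rewrite (le_trans (yz m))// nz.
have c0 : (fun m => 2 * s / 2 ^+ m) @ \oo --> (0:R).
  rewrite -(mulr0 (2 * s)); apply: cvgM; first exact: cvg_cst.
  rewrite (_ : (fun m => _) = (fun m => 2^-1 ^+ m)); last by apply/funext => m; rewrite exprVn.
  by apply: cvg_expr; rewrite gtr0_norm ?invf_lt1 ?ltr1n.
have cx : x @ \oo --> limn y.
  rewrite -[X in _ --> X]addr0 (_ : x = fun m => y m + 2 * s / 2 ^+ m).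
    exact: cvgD.
  by apply/funext => m; rewrite /y subrK.
exists (limn y) => // m.
have cz : z @ \oo --> limn y by rewrite -[X in _ --> X]addr0; apply: cvgD.
have h1 := nondecreasing_cvgn_le ny cy m.
have h2 : limn y <= z m.
  by rewrite -(cvg_lim (@Rhausdorff R) cz); apply: nonincreasing_cvgn_ge => //; apply/cvg_ex; exists (limn y).
by rewrite ler_norml; move: h1 h2; rewrite /y /z; lra.
Qed.

Context d (T : measurableType d) (mu : {measure set T -> \bar R}).
Implicit Types (u v w : T -> R[i]).
Local Notation N := (sqnorm mu).
Local Notation meas := (@Cmeas R _ T setT).
Local Open Scope ereal_scope.

(** The sum [S] of the squared increments, weighted by [4 ^ m], is integrable.
    Where it is finite the increments are at most [sqrt S / 2 ^ m], so the sequence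
    converges pointwise at a rate controlled by [S]; integrating [S] gives
    convergence in mean square. *)
Lemma fast_L2cvg (F : nat -> T -> R[i]) : (forall m, L2 mu (F m)) ->
  (forall m, N (fun x => F m.+1 x - F m x)%R <= (8 ^- m)%:E) ->
  exists2 w, L2 mu w & L2cvg mu F w.
Proof.
move=> LF fast.
have mF m : meas (F m) by exact: L2_meas (LF m).
pose D m x := (F m.+1 x - F m x)%R.
have mD m : meas (D m) by exact: CmeasB.
pose t m x := ((4 ^+ m)%:E * (cabs (D m x) ^+ 2)%:E).
have t0 m x : 0 <= t m x by apply: mule_ge0; rewrite lee_fin; [exact: exprn_ge0|exact: sqr_ge0].
have mt m : measurable_fun setT (t m) by apply: measurable_funeM; exact: msq.
pose S x := \sum_(0 <= m <oo) t m x.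
have mS : measurable_fun setT S by exact: ge0_emeasurable_sum.
have S0 x : 0 <= S x by exact: nneseries_ge0.
have iS : \int[mu]_x S x <= 2%:E.
  rewrite integral_nneseries//.
  apply: le_trans (_ : \sum_(i <oo) (2 / (2 ^ i.+1)%:R)%:E <= _); last first.
    exact: (@epsilon_trick0 R 2 xpredT).
  apply: lee_nneseries => [m _ _|m _]; first exact: integral_ge0.
  rewrite (ge0_integralZl mu measurableT (msq (mD m))); last 2 first.
  - by move=> x _; rewrite lee_fin sqr_ge0.
  - by rewrite lee_fin exprn_ge0.
  rewrite (le_trans (lee_wpmul2l _ (fast m))) ?lee_fin ?exprn_ge0//.
  rewrite natrX exprS invfM mulrA mulfV// mul1r.
  rewrite (_ : 8 ^+ m = 4 ^+ m * 2 ^+ m :> R)%R; last by rewrite -exprMn -natrM.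
  by rewrite invfM mulrA mulfV ?mul1r// expf_neq0.
pose A := [set x | S x < +oo].
have mA : measurable A.
  by have := emeasurable_fun_infty_o measurableT mS +oo; rewrite setTI.
pose s x := Num.sqrt (fine (S x)).
have fS x : A x -> (fine (S x))%:E = S x by move=> Ax; rewrite fineK// ge0_fin_numE.
have hD m x : A x -> (cabs (D m x) <= s x / 2 ^+ m)%R.
  move=> Ax; rewrite ler_pdivlMr ?exprn_gt0// -[leLHS]ger0_norm ?mulr_ge0 ?cabs_ge0 ?exprn_ge0//.
  rewrite -sqrtr_sqr ler_sqrt ?fine_ge0// -lee_fin fS// exprMn mulrC exprAC -[(2 ^+ 2)%R]natrX EFinM.
  apply: (le_trans _ (nneseries_lim_ge (P := xpredT) (m := 0%N) m.+1 (fun m _ _ => t0 m x))).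
  by rewrite big_nat_recr//= leeDr// sume_ge0.
have /choice[w hw] : forall x, exists l : R[i], A x ->
    Ccvg (fun m => F m x) l /\ forall m, (cabs (F m x - l) <= 4 * s x / 2 ^+ m)%R.
  move=> x; have [Ax|nA] := pselect (A x); last by exists 0%R.
  have [a ca ha] := @fast_cvg (fun m => Re (F m x)) (s x)
    (fun m => ltac:(rewrite -ReB; exact: (le_trans (Re_le_cabs _) (hD m x Ax)))).
  have [b cb hb] := @fast_cvg (fun m => Im (F m x)) (s x)
    (fun m => ltac:(rewrite -ImB; exact: (le_trans (Im_le_cabs _) (hD m x Ax)))).
  exists (a +i* b) => _; split; first by split.
  move=> m; rewrite (le_trans (cabs_le_ReIm _))// ReB ImB.
  rewrite (le_trans (lerD (ha m) (hb m)))//=; lra.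
pose v x := ((\1_A x)%:C * w x)%R.
have mv : meas v.
  apply: (@Cmeas_cvg _ _ _ _ (fun m x => (\1_A x)%:C * F m x)%R).
  - move=> m; apply: CmeasM => //; apply: Cmeas_real; exact: measurable_indic.
  - move=> x _; have [Ax|nA] := pselect (A x).
      by apply: (CcvgM (Ccvg_cst _) (hw x Ax).1).1.
    rewrite /v indicE memNset//; under eq_fun do rewrite mul0r; rewrite mul0r; exact: cvg_cst.
  - move=> x _; have [Ax|nA] := pselect (A x).
      by apply: (CcvgM (Ccvg_cst _) (hw x Ax).1).2.
    rewrite /v indicE memNset//; under eq_fun do rewrite mul0r; rewrite mul0r; exact: cvg_cst.
have bound m : N (fun x => F m x - v x)%R <= (16 * 4 ^- m * 2)%:E.
  rewrite EFinM; apply: (@le_trans _ _ ((16 * 4 ^- m)%:E * \int[mu]_x S x)); last first.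
    by apply: lee_wpmul2l; rewrite ?lee_fin ?mulr_ge0 ?invr_ge0 ?exprn_ge0.
  rewrite -(ge0_integralZl mu measurableT mS); last 2 first.
  - by move=> x _; exact: S0.
  - by rewrite lee_fin mulr_ge0 ?invr_ge0 ?exprn_ge0.
  apply: ge0_le_integral => //.
  - by move=> x _; rewrite lee_fin sqr_ge0.
  - by apply: (@msq _ _ _ (fun x => F m x - v x)%R); exact: CmeasB.
  - exact: measurable_funeM.
  - move=> x _; have [Ax|nA] := pselect (A x); last first.
      have -> : S x = +oo by apply/eqP; rewrite -leye_eq leNgt; apply/negP.
      by rewrite gt0_muley ?leey// lte_fin mulr_gt0 ?invr_gt0 ?exprn_gt0.
    rewrite -(fS x Ax) -EFinM lee_fin /v indicE mem_set// mul1r.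
    have h := (hw x Ax).2 m.
    apply: (@le_trans _ _ ((4 * s x / 2 ^+ m) ^+ 2)%R).
      by apply: lerXn2r; rewrite ?nnegrE ?cabs_ge0 ?divr_ge0 ?mulr_ge0 ?sqrtr_ge0 ?exprn_ge0.
    rewrite exprMn exprMn sqr_sqrtr ?fine_ge0// exprVn exprAC.
    by rewrite -[(2 ^+ 2)%R]natrX -[(4 ^+ 2)%R]natrX mulrAC.
exists v.
  rewrite (_ : v = fun x => (F 0%N x + (v x - F 0%N x))%R); last first.
    by apply/funext => x; rewrite addrC subrK.
  apply: L2D => //; apply/L2P; split; first exact: CmeasB.
  by rewrite sqnormC (le_lt_trans (bound 0%N))// ltry.
apply: (L2cvg_le bound).
rewrite -[X in _ --> X]/(0%R%:E); apply: cvg_EFin; first exact: nearW.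
rewrite (_ : _ \o _ = fun m => (32 * 4^-1 ^+ m)%R); last first.
  by apply/funext => m /=; rewrite exprVn; ring.
rewrite -[X in _ --> X](mulr0 32%R); apply: cvgM; first exact: cvg_cst.
by apply: cvg_expr; rewrite gtr0_norm ?invf_lt1 ?ltr1n.
Qed.

Lemma L2cvg_dominated (F : nat -> T -> R[i]) u g : (forall m, meas (F m)) -> meas u ->
  L2 mu g -> (forall m x, cabs (F m x - u x) <= cabs (g x))%R ->
  (forall x, Ccvg (fun m => F m x) (u x)) -> L2cvg mu F u.
Proof.
move=> mF hu Lg dom cv; have [mg Ng] := (L2P mu g).1 Lg.
have ig : mu.-integrable setT (fun x => (cabs (g x) ^+ 2)%:E).
  apply/integrableP; split; first exact: msq.
  by under eq_integral do rewrite gee0_abs ?lee_fin ?sqr_ge0//.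
have m0 m : measurable_fun setT (fun x => (cabs (F m x - u x) ^+ 2)%:E).
  by apply: (@msq _ _ _ (fun x => F m x - u x)%R); exact: CmeasB.
have pc x : (fun m => (cabs (F m x - u x) ^+ 2)%:E) @ \oo --> 0.
  rewrite -[X in _ --> X]/(0%R%:E); apply: cvg_EFin; first exact: nearW.
  rewrite (_ : _ \o _ = fun m => (Re (F m x - u x) ^+ 2 + Im (F m x - u x) ^+ 2)%R); last first.
    by apply/funext => m /=; rewrite cabs_sq.
  have z : Ccvg (fun m => F m x - u x)%R (u x - u x)%R.
    by apply: CcvgD => //; exact: Ccvg_cst.
  rewrite -[X in _ --> X](_ : 0 ^+ 2 + 0 ^+ 2 = 0)%R; last by rewrite expr0n addr0.
  have [z1 z2] := z; rewrite subrr /= in z1 z2.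
  apply: cvgD.
    by apply: (@cvg_comp _ _ _ _ (fun x : R => x ^+ 2)%R _ _ _ z1); exact: exprn_continuous.
  by apply: (@cvg_comp _ _ _ _ (fun x : R => x ^+ 2)%R _ _ _ z2); exact: exprn_continuous.
have hg (x : T) (m : nat) : setT x -> `|(cabs (F m x - u x) ^+ 2)%:E| <= (cabs (g x) ^+ 2)%:E.
  move=> _; rewrite gee0_abs ?lee_fin ?sqr_ge0//.
  by apply: lerXn2r; rewrite ?nnegrE ?cabs_ge0.
have [_ _] := @dominated_convergence _ _ _ mu setT measurableT
  (fun m x => (cabs (F m x - u x) ^+ 2)%:E) (fun=> 0) (fun x => (cabs (g x) ^+ 2)%:E)
  m0 (measurable_cst _) (aeW mu (fun x _ => pc x)) ig (aeW mu hg).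
by rewrite integral0.
Qed.

End Completeness.

(** * Density of the Schwartz functions *)

Section Density.
Variables (R : realType) (n : nat).
Local Notation T := (Rn R n).
Local Notation mu := (lebesgue_Rn R n).
Local Notation meas := (@Cmeas R _ T setT).
Implicit Types (f g u v : T -> R[i]) (a : T) (B : set T).

(** This property defines a closed subspace of [L^2]; it is shown successively
    for the Gaussian restricted to boxes, to Borel sets, and multiplied by
    bounded functions. *)
Definition approximable u := forall e : R, 0 < e ->
  exists2 f, schwartz f & (sqnorm mu (fun a => u a - f a)%R <= e%:E)%E.

Lemma approximable_schwartz f : schwartz f -> approximable f.
Proof.
move=> sf e e0; exists f => //; apply: (@le_trans _ _ 0%E); last by rewrite lee_fin ltW.
rewrite /sqnorm (eq_integral (cst 0%E)) ?integral0// => x _.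
by rewrite subrr cabs0 expr0n.
Qed.

Lemma approximableD u v : meas u -> meas v -> approximable u -> approximable v ->
  approximable (fun a => u a + v a).
Proof.
move=> hu hv au av e e0.
have e4 : 0 < e / 4 by rewrite divr_gt0.
have [f sf hf] := au _ e4; have [g sg hg] := av _ e4.
exists (fun a => f a + g a); first exact: schwartzD.
rewrite (_ : (fun a => _) = (fun a => (u a - f a) + (v a - g a))); last first.
  by apply/funext => a; ring.
have mf := schwartz_meas sf; have mg := schwartz_meas sg.
apply: (le_trans (sqnormD _ (CmeasB hu mf) (CmeasB hv mg))).
apply: (@le_trans _ _ (2%:E * (e / 4)%:E + 2%:E * (e / 4)%:E)%E).
  by apply: leeD; apply: lee_wpmul2l; rewrite ?lee_fin.
by rewrite -!EFinM -EFinD lee_fin; lra.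
Qed.

Lemma approximableZ (c : R[i]) u : meas u -> approximable u -> approximable (fun a => c * u a).
Proof.
move=> hu au e e0.
have q0 : 0 < cabs c ^+ 2 + 1 by rewrite ltr_wpDl ?sqr_ge0.
have [f sf hf] := au _ (divr_gt0 e0 q0).
exists (fun a => c * f a); first exact: schwartzZ.
rewrite (_ : (fun a => _) = (fun a => c * (u a - f a))); last by apply/funext => a; ring.
rewrite sqnormZ; last by apply: CmeasB => //; exact: schwartz_meas.
apply: (le_trans (lee_wpmul2l _ hf)); first by rewrite lee_fin sqr_ge0.
rewrite -EFinM lee_fin mulrA ler_pdivrMr// mulrC ler_wpM2l ?(ltW e0)//.
by rewrite lerDl.
Qed.

Lemma approximable_lim (F : nat -> T -> R[i]) u : (forall m, meas (F m)) -> meas u ->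
  (forall m, approximable (F m)) -> L2cvg mu F u -> approximable u.
Proof.
move=> hF hu aF cF e e0.
have e4 : 0 < e / 4 by rewrite divr_gt0.
have [N hN] : exists N, (sqnorm mu (fun a => F N a - u a)%R <= (e / 4)%:E)%E.
  have : \forall m \near \oo, (sqnorm mu (fun a => F m a - u a)%R < (e / 4)%:E)%E.
    have := cF _ (_ : nbhs 0%E [set x | (x < (e / 4)%:E)%E]); apply.
    by apply: open_nbhs_nbhs; split; [exact: open_ereal_lt_ereal|rewrite /= lte_fin].
  by move=> [N _ h]; exists N; apply: ltW; apply: h => /=.
have [f sf hf] := aF N _ e4.
exists f => //; apply: (le_trans (sqnormB _ hu (hF N) (schwartz_meas sf))).
apply: (@le_trans _ _ (2%:E * (e / 4)%:E + 2%:E * (e / 4)%:E)%E).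
  apply: leeD; apply: lee_wpmul2l; rewrite ?lee_fin//.
  by rewrite sqnormC.
by rewrite -!EFinM -EFinD lee_fin; lra.
Qed.

Lemma approximable_sum (I : Type) (s : seq I) (F : I -> T -> R[i]) : (forall x, meas (F x)) ->
  (forall x, approximable (F x)) -> approximable (fun a => \sum_(x <- s) F x a).
Proof.
move=> hF aF; suff : meas (fun a => \sum_(x <- s) F x a) /\ approximable (fun a => \sum_(x <- s) F x a).
  by case.
elim: s => [|x s [ih1 ih2]].
  under eq_fun do rewrite big_nil; split; first exact: Cmeas_cst.
  rewrite (_ : (fun=> 0) = fun a => 0 * gauss a :> R[i]); last by apply/funext => a; rewrite mul0r.
  by apply: approximable_schwartz; apply: schwartzZ; exact: schwartz_gauss.
under eq_fun do rewrite big_cons; split; first exact: CmeasD.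
exact: approximableD.
Qed.

Lemma gauss_L2 : L2 mu (@gauss R n). Proof. by apply: schwartz_L2; exact: schwartz_gauss. Qed.
Lemma gauss_meas : meas (@gauss R n). Proof. exact: L2_meas gauss_L2. Qed.

(** * Boxes and the Borel sets *)

Definition box (t : 'I_n -> R) : set T := [set a | forall j, crd a j < t j].
Definition boxes : set (set T) := [set B | exists t, B = box t].

Lemma measurable_forall_ord d (X : measurableType d) (B : 'I_n -> set X) :
  (forall j, measurable (B j)) -> measurable [set a | forall j, B j a].
Proof.
move=> mB; rewrite -[mkset _]setCK; apply: measurableC.
rewrite (_ : ~` _ = \bigcup_(j in [set: 'I_n]) ~` B j); last first.
  rewrite -setC_bigcap; congr (~` _); apply/seteqP; split => a h j.
    by move=> _; exact: h.
  exact: (h j Logic.I).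
apply: countable_bigcupT_measurable; first exact: countableP.
by move=> j; apply: measurableC.
Qed.

Lemma measurable_boxes : @measurable _ T = <<s boxes >>.
Proof.
apply/seteqP; split.
  have mid : measurable_fun setT (fun a : g_sigma_algebraType boxes => (a : T)).
    apply/measurable_fun_tnthP => i.
    have := @measurability _ _ (g_sigma_algebraType boxes) (measurableTypeR R) setT
      (fun a => tnth a i) (@RGenInftyO.G R) (@RGenInftyO.measurableE R).
    apply.
    move=> _ [_ [x ->] <-].
    rewrite (_ : _ `&` _ = \bigcup_N box (fun j => if j == i then x else N%:R)); last first.
      apply/seteqP; split => a /=.
        rewrite in_itv /= => -[_ ax].
        exists (Num.bound (siz a)) => // j; case: eqP => [->//|_].
        by apply: le_lt_trans (archi_boundP (ltW (siz_gt0 a))); rewrite (le_trans (ler_norm _))// crd_le_siz.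
      by move=> [N _ /(_ i)]; rewrite eqxx in_itv.
    apply: bigcupT_measurable => N; apply: sub_sigma_algebra; by eexists.
  by move=> B mB; have := mid measurableT B mB; rewrite setTI.
apply: smallest_sub; first exact: sigma_algebra_measurable.
move=> _ [t ->]; apply: measurable_forall_ord => j.
rewrite (_ : (fun a => _) = (fun a : T => crd a j) @^-1` `]-oo, (t j)[%classic).
  by rewrite -[X in measurable X]setTI; apply: (@measurable_crd R n j).
by apply/seteqP; split => a /=; rewrite in_itv.
Qed.

Lemma moderate_prod (I : Type) (s : seq I) (F : I -> T -> R[i]) :
  (forall x, moderate (F x)) -> moderate (fun a => \prod_(x <- s) F x a).
Proof.
move=> mF; elim: s => [|x s ih].
  by under eq_fun do rewrite big_nil; exact: moderate_cst.
by under eq_fun do rewrite big_cons; exact: moderateM.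
Qed.

(** The argument is positive only for [x > 1 / N] and has slope [N ^ 2], so the
    limit at the origin is zero, in accordance with the strict inequalities
    defining a box. *)
Definition step (N : nat) (x : R) : R := logistic (N%:R ^+ 2 * x - N%:R).

Lemma step_cvg (x : R) : (fun N => step N x) @ \oo --> (if 0 < x then 1 else 0 : R).
Proof.
have h N : (if 0 < x then 2 / x <= N%:R else true) ->
    `|(if 0 < x then 1 else 0) - step N x| <= N.+1%:R^-1.
  rewrite /step /logistic; set y := N%:R ^+ 2 * x - N%:R; have ey := expR_gt0 (- y).
  have N0 : (0:R) <= N%:R by [].
  case: (ltrP 0 x) => [x0 hN|x0 _].
    have hy : N%:R <= y.
      rewrite /y lerBrDr; have : 2 <= N%:R * x by rewrite -ler_pdivrMr.
      by rewrite expr2 -mulrA => h; have := ler_wpM2l N0 h; lra.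
    rewrite (_ : 1 - _ = expR (- y) / (1 + expR (- y))); last by field; rewrite gt_eqF// ltr_wpDr// ltW.
    have p1 : 0 < 1 + expR (- y) by rewrite ltr_wpDr ?(ltW ey).
    rewrite ger0_norm ?divr_ge0 ?(ltW ey) ?(ltW p1)//.
    apply: (@le_trans _ _ (expR (- y))).
      by rewrite ler_pdivrMr// ler_peMr ?(ltW ey)// lerDl (ltW ey).
    rewrite expRN lef_pV2 ?posrE ?expR_gt0 ?ltr0n// -natr1.
    by apply: (le_trans _ (expR_ge1Dx _)); lra.
  have hy : y <= - N%:R.
    by rewrite /y lerBlDr addrC subrr mulr_ge0_le0 ?sqr_ge0.
  have p1 : 0 < 1 + expR (- y) by rewrite ltr_wpDr ?(ltW ey).
  rewrite sub0r normrN ger0_norm ?invr_ge0 ?(ltW p1)//.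
  rewrite lef_pV2 ?posrE ?ltr0n// -natr1 addrC lerD2l.
  by apply: (le_trans _ (le_trans (expR_ge1Dx (- y)) _)) => //; lra.
apply/cvgrPdist_le => e e0.
have /cvgrPdist_le/(_ e e0) c := @cvg_harmonic R.
near=> N.
apply: (@le_trans _ _ N.+1%:R^-1).
  apply: h; case: ifP => // _; near: N; exact: nbhs_infty_ger.
have : `|0 - harmonic N| <= e by near: N.
by rewrite sub0r normrN /harmonic /= ger0_norm ?invr_ge0.
Unshelve. all: by end_near.
Qed.

Lemma Ccvg_prod (I : Type) (s : seq I) (F : nat -> I -> R[i]) (l : I -> R[i]) :
  (forall x, Ccvg (F ^~ x) (l x)) ->
  Ccvg (fun m => \prod_(x <- s) F m x) (\prod_(x <- s) l x).
Proof.
move=> h; elim: s => [|x s ih].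
  by under eq_fun do rewrite big_nil; rewrite big_nil; exact: Ccvg_cst.
by under eq_fun do rewrite big_cons; rewrite big_cons; exact: CcvgM.
Qed.

Lemma cabs_prod_le1 (I : Type) (s : seq I) (F : I -> R[i]) :
  (forall x, cabs (F x) <= 1) -> cabs (\prod_(x <- s) F x) <= 1.
Proof.
move=> h; elim: s => [|x s ih]; first by rewrite big_nil cabs1.
by rewrite big_cons cabsM mulr_ile1 ?cabs_ge0.
Qed.

Definition gauss_on B a : R[i] := (\1_B a)%:C * gauss a.

Lemma gauss_on_meas B : measurable B -> meas (gauss_on B).
Proof. by move=> mB; apply: CmeasM gauss_meas; apply: Cmeas_real; exact: measurable_indic. Qed.

Lemma gauss_on_le B a : cabs (gauss_on B a) <= cabs (gauss a : R[i]).
Proof.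
rewrite cabsM cabs_rC ler_piMl ?cabs_ge0// indicE.
by case: (_ \in _); rewrite ?normr1 ?normr0.
Qed.

(** The indicator of a box is a product of steps, each the limit of logistic
    functions; the Gaussian dominates. *)
Lemma approximable_box t : approximable (gauss_on (box t)).
Proof.
pose F (N : nat) a : R[i] := (\prod_j (step N (t j - crd a j))%:C) * gauss a.
have sF N : schwartz (F N).
  apply: schwartzM; last exact: schwartz_gauss.
  apply: moderate_prod => j.
  rewrite (_ : (fun a => _) = fun a => (logistic (linform (N%:R ^+ 2 * t j - N%:R)
     (fun i => if i == j then - N%:R ^+ 2 else 0) a))%:C :> R[i]); first exact: moderate_logistic.
  apply/funext => a; rewrite /step /linform (bigD1 j)//= eqxx big1 ?addr0.
    by congr ((logistic _)%:C); ring.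
  by move=> i ij; rewrite (negbTE ij) mul0r.
have mb : measurable (box t) by rewrite measurable_boxes; apply: sub_gen_smallest; exists t.
apply: (@approximable_lim F) => //.
- by move=> N; exact: schwartz_meas.
- exact: gauss_on_meas.
- by move=> N; exact: approximable_schwartz.
apply: (L2cvg_dominated (g := fun a => 2%:R * gauss a)).
- by move=> N; exact: schwartz_meas.
- exact: gauss_on_meas.
- exact: L2_sqnormZ gauss_L2.
- move=> N a; rewrite (le_trans (cabsB _ _))// cabsM -rC_nat cabs_rC normr_nat mulr_natl mulr2n.
  rewrite lerD ?gauss_on_le// /F cabsM ler_piMl ?cabs_ge0// cabs_prod_le1// => j.
  by rewrite cabs_rC; have /andP[h0 h1] := logistic_bound (N%:R ^+ 2 * (t j - crd a j) - N%:R); rewrite ger0_norm.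
- move=> a; apply: CcvgM; last exact: Ccvg_cst.
  rewrite (_ : (\1_(box t) a)%:C = \prod_j ((if 0 < t j - crd a j then 1 else 0) : R)%:C).
    by apply: Ccvg_prod => j; split => /=; [exact: step_cvg|exact: cvg_cst].
  rewrite indicE; have [h|h] := pselect (box t a).
    rewrite mem_set// big1// => j _; have := h j; by rewrite -subr_gt0 => ->.
  rewrite memNset//; have [j hj] : exists j, ~ crd a j < t j by apply/existsNP.
  by rewrite (bigD1 j)//= subr_gt0; move/negP/negbTE : hj => ->; rewrite mul0r.
Qed.

(** Boxes are stable under intersection and generate the Borel sets; the sets
    for which the claim holds form a Dynkin system. *)
Lemma approximable_gauss_on B : measurable B -> approximable (gauss_on B).
Proof.
move=> mB; have {mB} : <<s boxes >> B by rewrite -measurable_boxes.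
move: B; apply: (@dynkin_induction _ T boxes (fun B => approximable (gauss_on B)) measurable_boxes).
- move=> _ _ [s ->] [t ->]; exists (fun j => Num.min (s j) (t j)).
  apply/seteqP; split => a /=.
    by move=> [h1 h2] j; rewrite lt_min h1 h2.
  by move=> h; split => j; have := h j; rewrite lt_min => /andP[].
- rewrite (_ : gauss_on _ = @gauss R n); last by apply/funext => a; rewrite /gauss_on indicT mul1r.
  by apply: approximable_schwartz; exact: schwartz_gauss.
- by move=> _ [t ->]; exact: approximable_box.
- move=> B mB aB.
  rewrite (_ : gauss_on _ = fun a => gauss a + (-1) * gauss_on B a); last first.
    apply/funext => a; rewrite /gauss_on !indicE in_setC; case: (a \in B) => /=; rewrite ?rC0 ?rC1; ring.
  apply: approximableD; first exact: gauss_meas.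
  + by apply: CmeasM; [exact: Cmeas_cst|exact: gauss_on_meas].
  + by apply: approximable_schwartz; exact: schwartz_gauss.
  + by apply: approximableZ => //; exact: gauss_on_meas.
- move=> F mF tF aF.
  have mU : measurable (\bigcup_k F k) by exact: bigcupT_measurable.
  pose G m a := \sum_(i < m) gauss_on (F i) a.
  have G1 m k a : F k a -> G m a = (k < m)%:R * gauss a.
    move=> Fk; have z i : i != k -> gauss_on (F i) a = 0.
      move=> ik; rewrite /gauss_on indicE memNset ?mul0r// => Fi.
      by have /trivIsetP/(_ i k Logic.I Logic.I ik) := tF; rewrite -subset0 => /(_ a); apply.
    rewrite /G; have [km|mk] := ltnP k m.
      rewrite (bigD1 (Ordinal km))//= big1 ?addr0.
        by rewrite /gauss_on indicE mem_set// mul1r.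
      by move=> i ik; exact: z.
    by rewrite mul0r big1// => i _; apply: z; rewrite ltn_eqF// (leq_trans (ltn_ord i)).
  have G0 m a : (forall k, ~ F k a) -> G m a = 0.
    by move=> h; rewrite /G big1// => i _; rewrite /gauss_on indicE memNset ?mul0r//; exact: h.
  have U1 k a : F k a -> gauss_on (\bigcup_k F k) a = gauss a.
    by move=> Fk; rewrite /gauss_on indicE mem_set ?mul1r//; exists k.
  have U0 a : (forall k, ~ F k a) -> gauss_on (\bigcup_k F k) a = 0.
    by move=> h; rewrite /gauss_on indicE memNset ?mul0r// => -[k _]; exact: h.
  have mG m : meas (G m).
    by split => /=; under eq_fun do rewrite ?Re_sum ?Im_sum; apply: measurable_sum => i;
      have [h1 h2] := gauss_on_meas (mF i).
  apply: (@approximable_lim G) => //.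
  + exact: gauss_on_meas.
  + by move=> m; apply: approximable_sum => // i; exact: gauss_on_meas.
  apply: (L2cvg_dominated (g := fun a => 2%:R * gauss a)) => //.
  + exact: gauss_on_meas.
  + exact: L2_sqnormZ gauss_L2.
  + move=> N a; rewrite (le_trans (cabsB _ _))// cabsM -rC_nat cabs_rC normr_nat mulr_natl mulr2n.
    rewrite lerD ?gauss_on_le//.
    have [[k Fk]|/forallNP h] := pselect (exists k, F k a); last by rewrite G0// cabs0 cabs_ge0.
    rewrite (G1 _ k)// cabsM -rC_nat cabs_rC ler_piMl ?cabs_ge0//.
    by case: (_ < _)%N; rewrite ?normr1 ?normr0.
  + move=> a; have [[k Fk]|/forallNP h] := pselect (exists k, F k a); last first.
      by rewrite U0//; under eq_fun do rewrite G0//; exact: Ccvg_cst.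
    have e m : (k < m)%N -> G m a = gauss_on (\bigcup_k F k) a.
      by move=> km; rewrite (G1 _ k)// km mul1r (U1 k).
    by split; apply: cvg_near_cst; exists k.+1 => // m /= km; rewrite e.
Qed.

Lemma floorP (z : int) (x : R) : (Num.floor x = z) <-> (z%:~R <= x < z%:~R + 1).
Proof.
split=> [<-|h]; first by rewrite Num.Theory.floor_le/= -(intrD _ _ 1) Num.Theory.floorD1_gt.
by apply: Num.Theory.floor_def; rewrite intrD.
Qed.

(** Rounding a bounded function makes it a finite combination of indicators. *)
Lemma approximable_gauss_bdd (v : T -> R) (M : R) : measurable_fun setT v ->
  (forall a, `|v a| <= M) -> approximable (fun a => (v a)%:C * gauss a).
Proof.
move=> mv vM.
pose E N (z : int) : set T := [set a | Num.floor (N.+1%:R * v a) = z].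
have mE N z : measurable (E N z).
  rewrite (_ : E N z = v @^-1` `[z%:~R / N.+1%:R, (z%:~R + 1) / N.+1%:R[%classic).
    by rewrite -[X in measurable X]setTI; apply: mv.
  apply/seteqP; split => a /=; rewrite in_itv /= ler_pdivrMr ?ltr0n// ltr_pdivlMr ?ltr0n// mulrC.
    by move=> /floorP.
  by move=> h; apply/floorP.
pose J N := Num.bound (N.+1%:R * M + 1).
pose zz N (j : nat) : int := j%:Z - (J N)%:Z.
pose F N a : R[i] := \sum_(j < (2 * J N)) ((zz N j)%:~R / N.+1%:R)%:C * gauss_on (E N (zz N j)) a.
have FE N a : F N a = (round N (v a))%:C * gauss a.
  have M0 : 0 <= M by rewrite (le_trans _ (vM a)).
  have bJ : N.+1%:R * M + 1 < (J N)%:R by apply: archi_boundP; rewrite addr_ge0 ?mulr_ge0.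
  have hv : `|N.+1%:R * v a| <= N.+1%:R * M by rewrite normrM ger0_norm// ler_wpM2l.
  have hf := Num.Theory.floor_le (N.+1%:R * v a); have hf' := Num.Theory.floorD1_gt (N.+1%:R * v a).
  rewrite intrD in hf'; move: hv; rewrite ler_norml => /andP[hv1 hv2].
  set f := Num.floor _ in hf hf'.
  have f1 : (- (J N)%:Z < f)%R by rewrite -(ltr_int R) rmorphN /= -[X in - X]/((J N)%:R); lra.
  have f2 : (f < (J N)%:Z)%R by rewrite -(ltr_int R) -[X in _ < X]/((J N)%:R); lra.
  have [j jE] : exists j : 'I_(2 * J N), zz N j = f.
    have lt : (absz (f + (J N)%:Z)%R < 2 * J N)%N by lia.
    by exists (Ordinal lt); rewrite /zz /=; lia.
  rewrite /F (bigD1 j)//= jE big1 ?addr0.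
    by rewrite /gauss_on indicE mem_set// mul1r /round.
  move=> i ij; rewrite /gauss_on indicE memNset ?mul0r ?mulr0// => h.
  move/eqP: ij; apply; apply: val_inj; move: jE; rewrite -/f in h; rewrite /E /= -/f in h.
  by move=> e; move: (etrans e h); rewrite /zz /=; lia.
have mF N : meas (F N).
  split => /=; under eq_fun do rewrite ?Re_sum ?Im_sum; apply: measurable_sum => j;
  have [h1 h2] := CmeasM (Cmeas_cst setT ((zz N j)%:~R / N.+1%:R)%:C) (gauss_on_meas (mE N (zz N j))) => //.
have mg : meas (fun a => (v a)%:C * gauss a) by apply: CmeasM gauss_meas; exact: Cmeas_real.
apply: (@approximable_lim F) => //.
  move=> N; apply: approximable_sum => j.
    by apply: CmeasM; [exact: Cmeas_cst|exact: gauss_on_meas].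
  by apply: approximableZ; [exact: gauss_on_meas|exact: approximable_gauss_on].
have bd N a : cabs (F N a - (v a)%:C * gauss a) <= cabs (gauss a : R[i]) * N.+1%:R^-1.
  by rewrite FE -mulrBl -rCB cabsM cabs_rC mulrC ler_wpM2l ?cabs_ge0// round_near.
apply: (L2cvg_dominated (g := @gauss R n)) => //.
- exact: gauss_L2.
- move=> N a; rewrite (le_trans (bd N a))// ler_piMr ?cabs_ge0// invf_le1 ?ler1n ?ltr0n//.
- by move=> a; apply: Ccvg_bound => N; exact: bd.
Qed.

(** Truncating [u] where it exceeds [m] times the Gaussian leaves a bounded
    function times the Gaussian, and the truncations converge to [u]. *)
Theorem schwartz_dense u : L2 mu u -> approximable u.
Proof.
move=> Lu; have hu := L2_meas Lu.
have g0 a : 0 < cabs (gauss a : R[i]) by rewrite cabs_rC normr_gt0 gt_eqF// gauss_gt0.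
have gn a : gauss a != 0 :> R[i] by rewrite rC_eq0 gt_eqF// gauss_gt0.
pose A (m : nat) : set T := [set a | cabs (u a) - m%:R * cabs (gauss a : R[i]) <= 0].
have mA m : measurable (A m).
  pose q a := cabs (u a) - m%:R * cabs (gauss a : R[i]).
  have mq : measurable_fun setT q.
    apply: measurable_funB; first exact: Cmeas_cabs.
    by apply: measurable_funM => //; apply: Cmeas_cabs; exact: gauss_meas.
  rewrite (_ : A m = q @^-1` `]-oo, 0]%classic).
    by rewrite -[X in measurable X]setTI; apply: mq.
  by apply/seteqP; split => a /=; rewrite in_itv.
pose w m a : R[i] := (\1_(A m) a)%:C * (u a / gauss a).
have mw m : meas (w m).
  apply: CmeasM; first by apply: Cmeas_real; exact: measurable_indic.
  by apply: CmeasM => //; apply: CmeasV; exact: gauss_meas.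
have wb m a : cabs (w m a) <= m%:R.
  rewrite cabsM cabs_rC indicE; have [h|h] := pselect (A m a).
    rewrite mem_set// normr1 mul1r cabsM cabsV ler_pdivrMr//.
    by move: h; rewrite /A /= subr_le0.
  by rewrite memNset// normr0 mul0r.
pose F m a := w m a * gauss a.
have FE m a : F m a = (\1_(A m) a)%:C * u a by rewrite /F /w mulrA divfK.
apply: (@approximable_lim F) => //.
- by move=> m; apply: CmeasM => //; exact: gauss_meas.
- move=> m; rewrite (_ : F m = fun a => (Re (w m a))%:C * gauss a + 'i%C * ((Im (w m a))%:C * gauss a)).
    apply: approximableD.
    + by apply: CmeasM gauss_meas; apply: Cmeas_real; exact: (mw m).1.
    + apply: CmeasM; first exact: Cmeas_cst.
      by apply: CmeasM gauss_meas; apply: Cmeas_real; exact: (mw m).2.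
    + apply: (@approximable_gauss_bdd _ m%:R); first exact: (mw m).1.
      by move=> a; rewrite (le_trans (Re_le_cabs _)).
    + apply: approximableZ.
        by apply: CmeasM gauss_meas; apply: Cmeas_real; exact: (mw m).2.
      apply: (@approximable_gauss_bdd _ m%:R); first exact: (mw m).2.
      by move=> a; rewrite (le_trans (Im_le_cabs _)).
  apply/funext => a; rewrite /F mulrA -mulrDl; congr (_ * _).
  by apply: complex_ext; rewrite !CE ?mul0r ?mulr0 ?mul1r ?subr0 ?addr0 ?add0r.
apply: (L2cvg_dominated (g := u)) => //.
- by move=> m; apply: CmeasM => //; exact: gauss_meas.
- move=> m a; rewrite FE indicE; case: (_ \in _).
    by rewrite mul1r subrr cabs0 cabs_ge0.
  by rewrite mul0r sub0r cabsN.
- move=> a; have e m : cabs (u a) / cabs (gauss a : R[i]) <= m%:R -> F m a = u a.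
    move=> h; have hA : A m a by move: h; rewrite ler_pdivrMr// -subr_le0.
    by rewrite FE indicE mem_set// mul1r.
  split; apply: cvg_near_cst; near=> m; rewrite e//; near: m; exact: nbhs_infty_ger.
Unshelve. all: by end_near.
Qed.

(** The geometric rate is the one required by [fast_L2cvg]. *)
Lemma schwartz_sequence u : L2 mu u -> exists F : nat -> T -> R[i],
  [/\ forall m, schwartz (F m), L2cvg mu F u &
      forall m, (sqnorm mu (fun a => F m.+1 a - F m a)%R <= (8 ^- m)%:E)%E].
Proof.
move=> Lu; have hu := L2_meas Lu.
have /choice[F hF] : forall m : nat, exists f, schwartz f /\ (sqnorm mu (fun a => u a - f a)%R <= (4^-1 * 8 ^- m)%:E)%E.
  move=> m; have [|f sf hf] := schwartz_dense Lu (e := 4^-1 * 8 ^- m).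
    by rewrite mulr_gt0// invr_gt0 exprn_gt0.
  by exists f.
exists F; split => [m||m]; first exact: (hF m).1.
  apply: (L2cvg_le (c := fun m => (4^-1 * 8 ^- m)%:E)).
    by move=> m; rewrite sqnormC; exact: (hF m).2.
  rewrite -[X in _ --> X]/(0%R%:E); apply: cvg_EFin; first exact: nearW.
  rewrite -[X in _ --> X](mulr0 (4^-1 : R)); apply: cvgM; first exact: cvg_cst.
  rewrite (_ : (fun m => _) = (fun m => 8^-1 ^+ m)); last by apply/funext => m; rewrite exprVn.
  by apply: cvg_expr; rewrite gtr0_norm ?invf_lt1 ?ltr1n.
have mF j : meas (F j) by apply: schwartz_meas; exact: (hF j).1.
apply: (le_trans (sqnormB _ (mF m.+1) hu (mF m))).
apply: (@le_trans _ _ (2%:E * (4^-1 * 8 ^- m.+1)%:E + 2%:E * (4^-1 * 8 ^- m)%:E)%E).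
  apply: leeD; apply: lee_wpmul2l; rewrite ?lee_fin//; last exact: (hF m).2.
  by rewrite sqnormC; exact: (hF m.+1).2.
rewrite -!EFinM -EFinD lee_fin exprS invfM.
have := invr_ge0 ((8:R) ^+ m); rewrite exprn_ge0//; move: (8 ^- m : R) => q; lra.
Qed.

End Density.

(** * Extension of operators from Schwartz functions *)

Section Extension.
Variables (R : realType) (n : nat).
Local Notation T := (Rn R n).
Local Notation mu := (lebesgue_Rn R n).
Local Notation meas := (@Cmeas R _ T setT).
Local Notation N := (sqnorm mu).
Implicit Types (f g u v w : T -> R[i]) (a : T).

Variables (A : (T -> R[i]) -> (T -> R[i])) (C : R).
Hypothesis C0 : 0 <= C.
Hypothesis AS : forall f, schwartz f -> schwartz (A f).
Hypothesis Alin : forall (c : R[i]) f g, schwartz f -> schwartz g ->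
  A (fun a => c * f a + g a) = (fun a => c * A f a + A g a).
Hypothesis Abd : forall f, schwartz f -> (N (A f) <= C%:E * N f)%E.

Local Notation graph := (op_closure mu (@schwartz R n) A).

Lemma schwartz_lin (c : R[i]) f g : schwartz f -> schwartz g ->
  schwartz (fun a => c * f a + g a).
Proof. by move=> sf sg; apply: schwartzD => //; exact: schwartzZ. Qed.

Lemma A_sub f g : schwartz f -> schwartz g ->
  A (fun a => f a - g a) = (fun a => A f a - A g a).
Proof.
move=> sf sg; rewrite (_ : (fun a => f a - g a) = (fun a => (-1) * g a + f a)); last first.
  by apply/funext => a; rewrite mulN1r addrC.
by rewrite Alin//; apply/funext => a; rewrite mulN1r addrC.
Qed.

Lemma graph_schwartz f : schwartz f -> graph f (A f).
Proof.
move=> sf; split; [exact: schwartz_L2|exact: (schwartz_L2 (AS sf))|].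
by exists (fun=> f); split => //; exact: L2cvg_cst.
Qed.

Lemma graph_lin (c : R[i]) u v w z : graph u w -> graph v z ->
  graph (fun a => c * u a + v a) (fun a => c * w a + z a).
Proof.
move=> [Lu Lw [F [sF cF cAF]]] [Lv Lz [G [sG cG cAG]]]; split.
- by apply: L2D => //; exact: L2_sqnormZ.
- by apply: L2D => //; exact: L2_sqnormZ.
have mF m := schwartz_meas (sF m); have mG m := schwartz_meas (sG m).
have mAF m := schwartz_meas (AS (sF m)); have mAG m := schwartz_meas (AS (sG m)).
have mZ x : meas x -> meas (fun a => c * x a) by move=> h; apply: CmeasM => //; exact: Cmeas_cst.
exists (fun m a => c * F m a + G m a); split.
- by move=> m; exact: schwartz_lin.
- apply: (L2cvgD (F := fun m a => c * F m a) (u := fun a => c * u a)) => //.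
  + by move=> m; exact: mZ.
  + by apply: mZ; exact: L2_meas Lu.
  + exact: L2_meas Lv.
  + by apply: L2cvgZ => //; exact: L2_meas Lu.
- under eq_fun do rewrite Alin//.
  apply: (L2cvgD (F := fun m a => c * A (F m) a) (u := fun a => c * w a)) => //.
  + by move=> m; exact: mZ.
  + by apply: mZ; exact: L2_meas Lw.
  + exact: L2_meas Lz.
  + by apply: L2cvgZ => //; exact: L2_meas Lw.
Qed.

Lemma graph_bound u w : graph u w -> (N w <= C%:E * N u)%E.
Proof.
move=> [Lu Lw [F [sF cF cAF]]].
apply: (sqnorm_lim_le C0 _ _ Lu (L2_meas Lw) _ cF cAF).
- by move=> m; exact: schwartz_meas.
- by move=> m; apply: schwartz_meas; exact: AS.
- by move=> m; exact: Abd.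
Qed.

Lemma graph_unique u w z : graph u w -> graph u z -> {ae mu, forall a, w a = z a}.
Proof.
move=> gw gz; have g := graph_lin (-1) gw gz.
have [Lw _] : L2 mu w /\ True by case: gw.
have [Lz _] : L2 mu z /\ True by case: gz.
have h : N (fun a => -1 * w a + z a) = 0%E.
  apply/eqP; rewrite eq_le sqnorm_ge0 andbT (le_trans (graph_bound g))//.
  rewrite [X in (_ * X)%E](_ : _ = 0%E) ?mule0//.
  rewrite /sqnorm (eq_integral (cst 0%E)) ?integral0// => x _.
  by rewrite mulN1r addNr cabs0 expr0n.
have mw : meas (fun a => -1 * w a + z a).
  exact: CmeasD (CmeasM (Cmeas_cst _ _) (L2_meas Lw)) (L2_meas Lz).
by apply: filterS (sqnorm_eq0 mw h) => a /eqP; rewrite mulN1r addrC subr_eq0 => /eqP.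
Qed.

Lemma schwartz_fast_sequence (K : R) u : L2 mu u -> exists F : nat -> T -> R[i],
  [/\ forall m, schwartz (F m), L2cvg mu F u &
      forall m, (K%:E * N (fun a => F m.+1 a - F m a)%R <= (8 ^- m)%:E)%E].
Proof.
move=> Lu; have [F [sF cF fF]] := schwartz_sequence Lu.
pose p := Num.bound `|K|.
have Kp : K <= 8 ^+ p.
  rewrite (le_trans (ler_norm _))// (le_trans (ltW (archi_boundP _)))// -natrX ler_nat.
  by rewrite (leq_trans (ltnW (ltn_expl _ (isT : 1 < 8)%N))).
exists (fun m => F (m + p)%N); split => [m||m]; first exact: sF.
  by have := cF; rewrite /L2cvg -(cvg_shiftn p (fun m => N (fun a => F m a - u a)%R)).
have [K0|K0] := leP 0 K; last first.
  apply: (@le_trans _ _ 0%E); last by rewrite lee_fin invr_ge0 exprn_ge0.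
  by rewrite mule_le0_ge0 ?sqnorm_ge0// lee_fin ltW.
apply: (le_trans (lee_wpmul2l _ (fF _))); first by rewrite lee_fin.
rewrite -EFinM lee_fin exprD invfM mulrC -mulrA ler_piMr ?invr_ge0 ?exprn_ge0//.
by rewrite mulrC ler_pdivrMr ?exprn_gt0// mul1r.
Qed.

(** A Schwartz sequence converging fast to [u] has images with fast decreasing
    increments. *)
Lemma graph_total u : L2 mu u -> exists w, graph u w.
Proof.
move=> Lu; have [F [sF cF fF]] := schwartz_fast_sequence C Lu.
have [m|m|w Lw cw] := @fast_L2cvg _ _ _ mu (fun m => A (F m)).
- by apply: schwartz_L2; exact: AS.
- rewrite -A_sub//; apply: (le_trans (Abd _) (fF m)); exact: schwartzB.
- by exists w; split => //; exists F.
Qed.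

(** The closure of [A] is everywhere defined and single valued up to null sets;
    a value is chosen. *)
Definition ext u : T -> R[i] :=
  if pselect (exists w, graph u w) is left h then projT1 (cid h) else (fun=> 0).

Lemma extP u : L2 mu u -> graph u (ext u).
Proof.
by move=> Lu; rewrite /ext; case: pselect => [h|/(_ (graph_total Lu))//]; exact: (projT2 (cid h)).
Qed.

Lemma ext_schwartz f : schwartz f -> {ae mu, forall a, ext f a = A f a}.
Proof.
by move=> sf; exact: graph_unique (extP (schwartz_L2 sf)) (graph_schwartz sf).
Qed.

Lemma ext_linear : L2_linear mu mu ext.
Proof.
split=> [u Lu|c u v Lu Lv]; first by case: (extP Lu).
apply: (@graph_unique (fun a => c * u a + v a)).
  by apply: extP; apply: L2D => //; exact: L2_sqnormZ.
by apply: graph_lin; exact: extP.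
Qed.

Lemma ext_bounded : L2_bounded mu mu ext.
Proof.
by split; [exact: ext_linear|exists C => u Lu; apply: graph_bound; exact: extP].
Qed.

Section Unitary.
Hypothesis Aiso : forall f, schwartz f -> N (A f) = N f.
Variable B : (T -> R[i]) -> (T -> R[i]).
Hypothesis BS : forall f, schwartz f -> schwartz (B f).
Hypothesis AB : forall f, schwartz f -> A (B f) = f.

Lemma graph_isometry u w : graph u w -> N w = N u.
Proof.
move=> [Lu Lw [F [sF cF cAF]]]; apply/eqP; rewrite eq_le; apply/andP; split.
- rewrite -[leRHS]mul1e; apply: (sqnorm_lim_le ler01 _ _ Lu (L2_meas Lw) _ cF cAF) => m.
  + exact: schwartz_meas.
  + by apply: schwartz_meas; exact: AS.
  + by rewrite mul1e Aiso.
- rewrite -[leRHS]mul1e; apply: (sqnorm_lim_le ler01 _ _ Lw (L2_meas Lu) _ cAF cF) => m.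
  + by apply: schwartz_meas; exact: AS.
  + exact: schwartz_meas.
  + by rewrite mul1e Aiso.
Qed.

Lemma sqnorm_inverse f g : schwartz f -> schwartz g ->
  N (fun a => B f a - B g a)%R = N (fun a => f a - g a)%R.
Proof.
move=> sf sg; rewrite -(Aiso (schwartzB (BS sf) (BS sg))) A_sub; [|exact: BS|exact: BS].
by rewrite !AB.
Qed.

Lemma graph_onto w : L2 mu w -> exists u, graph u w.
Proof.
move=> Lw; have [G [sG cG fG]] := schwartz_fast_sequence 1 Lw.
have [m|m|u Lu cu] := @fast_L2cvg _ _ _ mu (fun m => B (G m)).
- by apply: schwartz_L2; exact: BS.
- by rewrite sqnorm_inverse//; have := fG m; rewrite mul1e.
- exists u; split => //; exists (fun m => B (G m)); split; [by move=> m; exact: BS|exact: cu|].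
  rewrite (_ : (fun m => _) = (fun m => N (fun x => G m x - w x)%R))//.
  by apply/funext => j; rewrite AB.
Qed.

Lemma ext_unitary : L2_unitary mu mu ext.
Proof.
split; first exact: ext_linear.
- by move=> u Lu; apply: graph_isometry; exact: extP.
- move=> w Lw; have [u gu] := graph_onto Lw; have Lu : L2 mu u by case: gu.
  by exists u => //; exact: graph_unique (extP Lu) gu.
Qed.

Lemma graph_cvg (F : nat -> T -> R[i]) u w : (forall m, schwartz (F m)) -> graph u w ->
  L2cvg mu F u -> L2cvg mu (fun m => A (F m)) w.
Proof.
move=> sF g cF; rewrite /L2cvg (_ : (fun m => _) = (fun m => N (fun a => F m a - u a)%R))//.
apply/funext => m; have := graph_isometry (graph_lin (-1) g (graph_schwartz (sF m))).
rewrite (_ : (fun a => -1 * w a + _) = (fun a => A (F m) a - w a)); last first.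
  by apply/funext => a; rewrite mulN1r addrC.
by rewrite (_ : (fun a => -1 * u a + _) = (fun a => F m a - u a))//; apply/funext => a; rewrite mulN1r addrC.
Qed.

Lemma graph_cvg_inv (F : nat -> T -> R[i]) u w : (forall m, schwartz (F m)) -> graph u w ->
  L2cvg mu (fun m => A (F m)) w -> L2cvg mu F u.
Proof.
move=> sF g cF; rewrite /L2cvg (_ : (fun m => _) = (fun m => N (fun a => A (F m) a - w a)%R))//.
apply/funext => m; have := graph_isometry (graph_lin (-1) g (graph_schwartz (sF m))).
rewrite (_ : (fun a => -1 * w a + _) = (fun a => A (F m) a - w a)); last first.
  by apply/funext => a; rewrite mulN1r addrC.
by move=> ->; rewrite (_ : (fun a => -1 * u a + _) = (fun a => F m a - u a))//; apply/funext => a; rewrite mulN1r addrC.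
Qed.

Section Multiplier.
Variables (D : (T -> R[i]) -> (T -> R[i])) (m : T -> R).
Hypothesis DS : forall f, schwartz f -> schwartz (D f).
Hypothesis mm : moderate (fun a => (m a)%:C).
Local Notation W := (fun a => 1 + 'i%C * (m a)%:C).
Hypothesis mW : moderate (fun a => (W a)^-1).
Hypothesis AD : forall f, schwartz f -> A (D f) = (fun a => (m a)%:C * A f a).

(** The function [1 + i m] bounds both [1] and [m], so that dividing by it turns
    the unbounded multiplication into bounded ones. *)
Let W_ge a : 1 <= cabs (W a) /\ cabs (m a)%:C <= cabs (W a).
Proof.
have h : cabs (W a) ^+ 2 = 1 + m a ^+ 2.
  by rewrite cabs_sq !CE /= !mul0r !mulr0 subr0 mul1r !add0r addr0 expr1n.
split.
  rewrite -(@ler_pXn2r _ 2) ?nnegrE ?cabs_ge0// h expr1n lerDl sqr_ge0//.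
by rewrite -(@ler_pXn2r _ 2) ?nnegrE ?cabs_ge0// h cabs_rC real_normK ?num_real// lerDr.
Qed.

Let W0 a : W a != 0.
Proof.
apply/eqP => e; have [] := W_ge a; rewrite e cabs0 => h.
by have := lt_le_trans ltr01 h; rewrite ltxx.
Qed.

Let cabs_W a : 0 < cabs (W a). Proof. exact: lt_le_trans ltr01 (W_ge a).1. Qed.

Let mm' : meas (fun a => (m a)%:C). Proof. exact: moderate_meas. Qed.
Let mW' : meas (fun a => (W a)^-1). Proof. exact: moderate_meas. Qed.

(** After division by [1 + i m] both convergences can be used. *)
Lemma multiplier_closed (H : nat -> T -> R[i]) h w : (forall j, meas (H j)) ->
  L2 mu h -> L2 mu w -> L2cvg mu H h -> L2cvg mu (fun j a => (m a)%:C * H j a) w ->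
  {ae mu, forall a, w a = (m a)%:C * h a}.
Proof.
move=> mH Lh Lw cH cw; have mh := L2_meas Lh; have mw := L2_meas Lw.
pose q a := (W a)^-1 * (w a - (m a)%:C * h a).
have mq : meas q by apply: CmeasM => //; apply: CmeasB => //; exact: CmeasM.
have q0 : N q = 0%E.
  apply/eqP; rewrite eq_le sqnorm_ge0 andbT.
  have c : (fun j => 2%:E * N (fun a => (m a)%:C * H j a - w a)%R + 2%:E * N (fun a => H j a - h a)%R)%E @ \oo --> 0%E.
    by apply: ecvg0D; exact: ecvg0M.
  rewrite -(cvg_lim (@ereal_hausdorff R) c).
  apply: lime_ge; first by apply/cvg_ex; eexists; exact: c.
  apply: nearW => j.
  rewrite (_ : q = fun a => (W a)^-1 * (w a - (m a)%:C * H j a) + (W a)^-1 * (m a)%:C * (H j a - h a)); last first.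
    by apply/funext => a; rewrite /q; ring.
  have m1 : meas (fun a => (W a)^-1 * (w a - (m a)%:C * H j a)).
    by apply: CmeasM => //; apply: CmeasB => //; exact: CmeasM.
  have m2 : meas (fun a => (W a)^-1 * (m a)%:C * (H j a - h a)).
    by apply: CmeasM; [exact: CmeasM|exact: CmeasB].
  apply: (le_trans (sqnormD _ m1 m2)); apply: leeD; apply: lee_wpmul2l; rewrite ?lee_fin//.
    rewrite [leRHS]sqnormC; apply: sqnorm_le1 => //.
      by apply: CmeasB => //; exact: CmeasM.
    by move=> a; rewrite cabsM cabsV ler_piMl ?cabs_ge0// invf_le1//; have [] := W_ge a.
  apply: sqnorm_le1 => //; first exact: CmeasB.
  move=> a; rewrite !cabsM cabsV ler_piMl ?cabs_ge0// mulrC ler_pdivrMr// mul1r.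
  by have [] := W_ge a.
apply: filterS (sqnorm_eq0 mq q0) => a /eqP.
by rewrite /q mulf_eq0 invr_eq0 (negbTE (W0 a)) /= subr_eq0 => /eqP.
Qed.

(** Approximating [h + i w = (1 + i m) h] by Schwartz functions and dividing by
    [1 + i m] approximates [h] and [m h] at the same time. *)
Lemma multiplier_core h w : L2 mu h -> L2 mu w -> {ae mu, forall a, w a = (m a)%:C * h a} ->
  exists H : nat -> T -> R[i], [/\ forall j, schwartz (H j), L2cvg mu H h &
    L2cvg mu (fun j a => (m a)%:C * H j a) w].
Proof.
move=> Lh Lw hw; have mh := L2_meas Lh; have mw := L2_meas Lw.
pose p a := h a + 'i%C * w a.
have Lp : L2 mu p by apply: L2D => //; exact: L2_sqnormZ.
have mp := L2_meas Lp.
have [P [sP cP _]] := schwartz_sequence Lp.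
have sH j : schwartz (fun a => (W a)^-1 * P j a) by exact: schwartzM.
have mP j := schwartz_meas (sP j).
exists (fun j a => (W a)^-1 * P j a); split => //.
- apply: (L2cvg_le (c := fun j => N (fun a => P j a - p a)%R)) => // j.
  rewrite (@sqnorm_ae _ _ _ _ _ (fun a => (W a)^-1 * (P j a - p a))).
  + apply: sqnorm_le1; [by apply: CmeasM => //; exact: CmeasB|exact: CmeasB|].
    by move=> a; rewrite cabsM cabsV ler_piMl ?cabs_ge0// invf_le1//; have [] := W_ge a.
  + by apply: CmeasB => //; exact: CmeasM.
  + by apply: CmeasM => //; exact: CmeasB.
  + apply: filterS hw => a ha; rewrite mulrBr; congr (_ - _).
    by rewrite (_ : p a = W a * h a) ?mulKf// /p ha; ring.
- apply: (L2cvg_le (c := fun j => N (fun a => P j a - p a)%R)) => // j.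
  rewrite (@sqnorm_ae _ _ _ _ _ (fun a => (m a)%:C * (W a)^-1 * (P j a - p a))).
  + apply: sqnorm_le1; [by apply: CmeasM; [exact: CmeasM|exact: CmeasB]|exact: CmeasB|].
    move=> a; rewrite !cabsM cabsV ler_piMl ?cabs_ge0// ler_pdivrMr// mul1r.
    by have [] := W_ge a.
  + by apply: CmeasB => //; apply: CmeasM => //; exact: CmeasM.
  + by apply: CmeasM; [exact: CmeasM|exact: CmeasB].
  + apply: filterS hw => a ha; rewrite mulrBr mulrA; congr (_ - _).
    by rewrite (_ : p a = W a * h a); [rewrite -mulrA mulKf|rewrite /p ha; ring].
Qed.

(** The operator [D] with domain the Schwartz functions corresponds to
    multiplication by [m] on Schwartz functions, since [A] maps them onto
    themselves. Its closure therefore corresponds to the closure of this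
    multiplication, which is the maximal one. *)
Lemma ext_spectral : spectral_rep mu mu (op_closure mu (@schwartz R n) D) ext m.
Proof.
split; [exact: ext_unitary|exact: mm'.1|] => u v Lu Lv.
have gu := extP Lu; have gv := extP Lv.
have [LUu LUv] : L2 mu (ext u) /\ L2 mu (ext v) by case: gu; case: gv.
split.
- move=> [_ _ [F [sF cF cDF]]].
  have c1 := graph_cvg sF gu cF.
  have c2 := graph_cvg (fun j => DS (sF j)) gv cDF.
  have e : (fun j => A (D (F j))) = (fun j a => (m a)%:C * A (F j) a).
    by apply/funext => j; rewrite AD.
  rewrite e in c2.
  exact: (multiplier_closed (fun j => schwartz_meas (AS (sF j))) LUu LUv c1 c2).
- move=> h; have [H [sH cH cmH]] := multiplier_core LUu LUv h.
  split => //; exists (fun j => B (H j)); split.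
  + by move=> j; exact: BS.
  + apply: (graph_cvg_inv _ gu); first by move=> j; exact: BS.
    by rewrite (_ : (fun j => _) = H)//; apply/funext => j; rewrite AB.
  + apply: (graph_cvg_inv (F := fun j => D (B (H j))) _ gv); first by move=> j; apply: DS; exact: BS.
    rewrite (_ : (fun j => A (D (B (H j)))) = (fun j a => (m a)%:C * H j a))//.
    by apply/funext => j; rewrite AD ?AB//; exact: BS.
Qed.

End Multiplier.
End Unitary.
End Extension.

(** * Oscillatory integrals *)

Section Oscillatory.
Variable R : realType.
Local Notation mu1 := (@lebesgue_measure R).

Section Phase.
Variables (psi q q' : R -> R) (Q D : R).
Hypothesis dpsi : forall t, is_derive t (1:R) psi (q t).
Hypothesis dq : forall t, is_derive t (1:R) q (q' t).
Hypothesis cq' : continuous q'.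
Hypothesis q'Q : forall t, `|q' t| <= Q.
Hypothesis qD : forall t, 1 + t ^+ 2 <= D * (1 + q t ^+ 2).

Definition osc (t : R) : R[i] := cexp ('i%C * (psi t)%:C).

Let p t : 0 < 1 + q t ^+ 2. Proof. by rewrite ltr_wpDr ?sqr_ge0. Qed.
Let pn t : 1 + q t ^+ 2 != 0. Proof. by rewrite gt_eqF. Qed.
Let pt (t : R) : 0 < 1 + t ^+ 2. Proof. by apply: ltr_wpDr => //; exact: sqr_ge0. Qed.

Let r t := q t * (1 + q t ^+ 2)^-1.
Let r' t := q' t * (1 - q t ^+ 2) * ((1 + q t ^+ 2) ^+ 2)^-1.

Let dr t : is_derive t (1:R) r (r' t).
Proof.
have d : is_derive t (1:R) (fun t => 1 + q t ^+ 2) (2 * q t * q' t).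
  rewrite (_ : (fun t => 1 + q t ^+ 2) = (fun t => 1 + q t * q t)).
    apply: is_derive_eq (is_deriveD (is_derive_cst (1:R) t (1:R)) (is_deriveM (dq t) (dq t))) _.
    by rewrite /GRing.scale /=; ring.
  by apply/funext => s; rewrite expr2.
have dv := @is_deriveV R (fun t => 1 + q t ^+ 2) t _ 1 (pn t) d.
apply: is_derive_eq (is_deriveM (dq t) dv) _.
by rewrite /r' /GRing.scale /=; field; exact: pn.
Qed.

Let bdry t : R[i] := - 'i%C * (osc t * (r t)%:C).
Let rest t : R[i] := osc t * (((1 + q t ^+ 2)^-1)%:C + 'i%C * (r' t)%:C).

Let dosc t : Cder osc t (osc t * ('i%C * (q t)%:C)).
Proof. by apply: Cder_cexp; apply: CderZ; exact: Cder_real. Qed.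

(** Integration by parts: dividing by [1 + q ^ 2] instead of [q] avoids the
    stationary points. *)
Let dbdry t : Cder bdry t (osc t - rest t).
Proof.
apply: Cder_eq (CderZ (- 'i%C) (CderM (dosc t) (Cder_real (dr t)))) _.
rewrite /rest /r -/(r' t).
have e : q t * (q t * (1 + q t ^+ 2)^-1) = 1 - (1 + q t ^+ 2)^-1 by field; exact: pn.
rewrite -mulrA -mulrA -rCM e rCB rC1.
set X := (_^-1)%:C; set Y := (r' t)%:C; set U := osc t.
transitivity (- ('i%C * 'i%C) * U * (1 - X) - 'i%C * (U * Y)); first by ring.
by rewrite sqr_i_; ring.
Qed.

Lemma osc_cont : Ccont osc. Proof. by apply: Cder_cont => t; exact: dosc. Qed.

Let cq : continuous q. Proof. by move=> t; exact: is_derive_cvg (dq t). Qed.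

Let crest : Ccont rest.
Proof.
have cC (f : R -> R) : continuous f -> Ccont (fun t => (f t)%:C).
  by move=> cf; split => t /=; [exact: cf|exact: cvg_cst].
have c2 : continuous (fun t => 1 + q t ^+ 2).
  move=> t; apply: cvgD; first exact: cvg_cst.
  by apply: (@cvg_comp _ _ _ q (fun x : R => x ^+ 2) _ _ _ (cq (x:=t))); exact: exprn_continuous.
apply: CcontM; first exact: osc_cont.
apply: CcontD; first by apply: cC => t; apply: cvgV => //; exact: c2.
apply: CcontM; first exact: Ccont_cst.
apply: cC => t; apply: cvgM.
  apply: cvgM; first exact: cq'.
  apply: cvgB; first exact: cvg_cst.
  by apply: (@cvg_comp _ _ _ q (fun x : R => x ^+ 2) _ _ _ (cq (x:=t))); exact: exprn_continuous.
apply: cvgV; first by rewrite expf_neq0.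
by apply: (@cvg_comp _ _ _ (fun t => 1 + q t ^+ 2) (fun x : R => x ^+ 2) _ _ _ (c2 t)); exact: exprn_continuous.
Qed.

Let cabs_osc t : cabs (osc t) = 1. Proof. exact: cabs_cexpi. Qed.

Let D0 : 0 <= D.
Proof. by rewrite -(@pmulr_lge0 _ (1 + q 0 ^+ 2))// (le_trans _ (qD 0))// ltW. Qed.

Let invq t : (1 + q t ^+ 2)^-1 <= D * (1 + t ^+ 2)^-1.
Proof. by rewrite ler_pdivlMr// mulrC ler_pdivrMr. Qed.

Let rest_bound t : cabs (rest t) <= (1 + Q) * D * (1 + t ^+ 2)^-1.
Proof.
rewrite cabsM cabs_osc mul1r (le_trans (cabsD _ _))// cabsM cabs_i mul1r !cabs_rC.
have v0 : 0 <= (1 + q t ^+ 2)^-1 by rewrite invr_ge0 ltW.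
have h1 : `|r' t| <= Q * (1 + q t ^+ 2)^-1.
  rewrite /r' !normrM -mulrA ler_pM// expr2 invfM normrM !(ger0_norm v0).
  rewrite mulrA ler_piMl// ler_pdivrMr// mul1r ler_norml.
  by have := sqr_ge0 (q t); lra.
rewrite (ger0_norm v0) (le_trans (lerD (lexx _) h1))//.
rewrite -[X in X + _]mul1r -mulrDl -mulrA ler_wpM2l ?invq//.
by rewrite addr_ge0// (le_trans _ (q'Q 0)).
Qed.

(** As [q] grows at least linearly, [q / (1 + q ^ 2)] decays like [1 / t]. *)
Let bdry_bound t : cabs (bdry t) <= Num.sqrt (2 * D) / (1 + `|t|).
Proof.
rewrite cabsM cabsN cabs_i mul1r cabsM cabs_osc mul1r cabs_rC.
have s0 : 0 < 1 + `|t| by rewrite ltr_wpDr.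
rewrite ler_pdivlMr// -[leLHS]ger0_norm ?mulr_ge0 ?(ltW s0)//.
rewrite -sqrtr_sqr ler_sqrt; last by rewrite mulr_ge0.
rewrite exprMn real_normK ?num_real// /r exprMn.
have h1 : (1 + `|t|) ^+ 2 <= 2 * (1 + t ^+ 2).
  rewrite -[t ^+ 2]real_normK ?num_real//; have := sqr_ge0 (1 - `|t|).
  rewrite sqrrB sqrrD !expr1n !mul1r; lra.
have h2 : q t ^+ 2 * (1 + q t ^+ 2)^-1 ^+ 2 <= (1 + q t ^+ 2)^-1.
  have -> : q t ^+ 2 * (1 + q t ^+ 2)^-1 ^+ 2 = (1 - (1 + q t ^+ 2)^-1) * (1 + q t ^+ 2)^-1.
    by field; exact: pn.
  by rewrite ler_piMl ?invr_ge0 ?(ltW (p t))// gerBl invr_ge0 ltW.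
have h3 := invq t.
rewrite (le_trans (ler_pM _ _ (le_trans h2 h3) h1)) ?sqr_ge0//.
  by rewrite mulr_ge0 ?sqr_ge0.
by rewrite mulrCA -mulrA mulVf ?mulr1// gt_eqF.
Qed.

Let bdry_le1 t : cabs (bdry t) <= 1.
Proof.
rewrite cabsM cabsN cabs_i mul1r cabsM cabs_osc mul1r cabs_rC normrM normfV (gtr0_norm (p t)).
rewrite ler_pdivrMr// mul1r -[q t ^+ 2]real_normK ?num_real//.
by have := sqr_ge0 (`|q t| - 1); have := sqr_ge0 `|q t|; rewrite sqrrB expr1n mulr1; lra.
Qed.

Lemma osc_parts a b : a <= b -> Cint `[a, b] osc = bdry b - bdry a + Cint `[a, b] rest.
Proof.
move=> ab; rewrite -(Cint_FTC ab dbdry); last first.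
  under eq_fun do rewrite -mulN1r; apply: CcontD; first exact: osc_cont.
  by apply: CcontM => //; exact: Ccont_cst.
rewrite CintB//; [by rewrite subrK|exact: (Ccont_integrable _ _ osc_cont)|exact: (Ccont_integrable _ _ crest)].
Qed.

Lemma osc_bound a b : a <= b -> cabs (Cint `[a, b] osc) <= 2 + 2 * ((1 + Q) * D * pi).
Proof.
move=> ab; rewrite osc_parts// (le_trans (cabsD _ _))// lerD//.
  by rewrite (le_trans (cabsB _ _))//; have := bdry_le1 a; have := bdry_le1 b; lra.
rewrite Cint_mkcond.
rewrite -Rintegral_cauchy -RintegralZl//; last exact: integrable_cauchy.
apply: Cint_le => //.
- apply: (@Cintegrable_meas _ _ _ mu1); apply: Cintegrable_mkcond => //.
  exact: Ccont_integrable.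
- exact: integrable_cauchyZ.
- move=> t _; rewrite /Crestr; case: ifP => _ //.
  by rewrite cabs0 (le_trans _ (rest_bound t))// cabs_ge0.
Qed.

Lemma osc_half : exists l : R[i], forall s : nat -> R, s @ \oo --> +oo ->
  Ccvg (fun m => Cint `[0, s m] osc) l.
Proof.
exists ((0 - bdry 0) + Cint `[0, +oo[ rest) => s hs.
have pos : \forall m \near \oo, 0 <= s m by have /cvgryPge := hs; apply.
have E : \forall m \near \oo, (bdry (s m) - bdry 0) + Cint setT (Crestr `[0, s m] rest) = Cint `[0, s m] osc.
  by apply: filterS pos => m sm; rewrite osc_parts// -Cint_mkcond.
suff [h1 h2] : Ccvg (fun m => (bdry (s m) - bdry 0) + Cint setT (Crestr `[0, s m] rest))
    ((0 - bdry 0) + Cint `[0, +oo[ rest).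
  split; [apply: cvg_trans h1|apply: cvg_trans h2]; apply: near_eq_cvg;
    by apply: filterS E => m ->.
apply: CcvgD.
  apply: CcvgD; last exact: Ccvg_cst.
  have z : (fun m => cabs (bdry (s m))) @ \oo --> (0:R).
    apply: (@squeeze_cvgr _ _ _ _ (cst 0) (fun m => Num.sqrt (2 * D) / (1 + `|s m|))).
    - by apply: nearW => m; rewrite cabs_ge0 bdry_bound.
    - exact: cvg_cst.
    - rewrite -[X in _ --> X](mulr0 (Num.sqrt (2 * D))); apply: cvgM; first exact: cvg_cst.
      have hp : \forall m \near \oo, 0 < 1 + `|s m| by apply: nearW => m; rewrite ltr_wpDr.
      apply: (proj2 (@gtr0_cvgV0 R nat \oo _ (fun m => 1 + `|s m|) hp)).
      apply/cvgryPge => A; have /cvgryPge/(_ A) := hs; apply: filterS => m h.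
      by rewrite (le_trans h)// (le_trans (ler_norm _))// lerDr.
  split; apply/cvgrPdist_le => e e0; have /cvgrPdist_le/(_ e e0) := z; apply: filterS => m.
    rewrite !sub0r !normrN ger0_norm ?cabs_ge0// => h.
    by rewrite (le_trans (Re_le_cabs _)).
  rewrite !sub0r !normrN ger0_norm ?cabs_ge0// => h.
  by rewrite (le_trans (Im_le_cabs _)).
rewrite [X in Ccvg _ X]Cint_mkcond.
apply: (@Cint_dominated _ _ _ _ (fun t => (1 + Q) * D * (1 + t ^+ 2)^-1)) => //.
- move=> m; apply: (@Cintegrable_meas _ _ _ mu1); apply: Cintegrable_mkcond => //.
  exact: Ccont_integrable.
- exact: integrable_cauchyZ.
- move=> m t _; rewrite /Crestr; case: ifP => _ //.
  by rewrite cabs0 (le_trans _ (rest_bound t))// cabs_ge0.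
- move=> t _.
  have h : \forall m \near \oo, (t \in `[0, s m]%classic) = (t \in `[0, +oo[%classic).
    have /cvgryPge/(_ t) := hs; apply: filterS => m h.
    by apply/asboolP/asboolP; rewrite /= !in_itv /= andbT h ?andbT.
  split; apply: cvg_near_cst; apply: filterS h => m h; by rewrite /Crestr h.
Qed.

End Phase.

(** Limits at infinity are taken along sequences, as dominated convergence is a
    statement about sequences. *)
Lemma Ccvg_pinfty (h : R -> R[i]) (l : R[i]) :
  (forall s : nat -> R, s @ \oo --> +oo -> Ccvg (fun m => h (s m)) l) ->
  (fun M => Re (h M)) @ +oo --> Re l /\ (fun M => Im (h M)) @ +oo --> Im l.
Proof.
move=> hl; split; apply/cvg_pinftyP => s hs; by have [] := hl s hs.
Qed.

(** The two halves of the line are treated alike, by reflection. *)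
Lemma osc_improper (psi q q' : R -> R) (Q D : R) :
  (forall t, is_derive t (1:R) psi (q t)) -> (forall t, is_derive t (1:R) q (q' t)) ->
  continuous q' -> (forall t, `|q' t| <= Q) ->
  (forall t, 1 + t ^+ 2 <= D * (1 + q t ^+ 2)) ->
  Cimproper_cvg (osc psi) /\
  Ccvg (fun m : nat => Cint `[(- m%:R), m%:R] (osc psi)) (Cimproper_int (osc psi)).
Proof.
move=> dpsi dq cq' q'Q qD.
have co := osc_cont dpsi.
have [l1 hl1] := osc_half dpsi dq cq' q'Q qD.
have reflect_derive (f f' : R -> R) : (forall t, is_derive t (1:R) f (f' t)) ->
    forall t, is_derive t (1:R) (fun t => f (- t)) (- f' (- t)).
  move=> df t; have := is_derive_chain (is_deriveNid t (1:R)) (df (- t)); by rewrite mulN1r.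
have d1 := reflect_derive _ _ dpsi.
have d2 t : is_derive t (1:R) (fun t => - q (- t)) (q' (- t)).
  by have := is_deriveN (reflect_derive _ _ dq t); rewrite opprK.
have c2 : continuous (fun t => q' (- t)).
  move=> t; apply: (@cvg_comp _ _ _ (fun t => - t) q' _ (nbhs (- t))); last exact: cq'.
  exact: (is_derive_cvg (is_deriveNid (t : R) (1:R))).
have qD2 (t : R) : 1 + t ^+ 2 <= D * (1 + (- q (- t)) ^+ 2).
  by have := qD (- t); rewrite !sqrrN.
have [l2 hl2] := osc_half d1 d2 c2 (fun t => q'Q (- t)) qD2.
have co2 := osc_cont d1.
have refl M : Cint `[(- M), 0] (osc psi) = Cint `[0, M] (osc (fun t => psi (- t))).
  rewrite (@Cint_reflect _ _ `[0, M] _ 0)//.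
  - by apply: Cint_ext => t _; rewrite /osc sub0r.
  - exact: (Ccont_integrable _ _ co).
  - by move=> t; rewrite /= !in_itv /= sub0r; split => /andP[? ?]; apply/andP; split; lra.
have [r1 i1] := Ccvg_pinfty (h := fun M => Cint `[0, M] (osc psi)) hl1.
have [r2 i2] : (fun M => Re (Cint `[(- M), 0] (osc psi))) @ +oo --> Re l2 /\
    (fun M => Im (Cint `[(- M), 0] (osc psi))) @ +oo --> Im l2.
  by apply: (Ccvg_pinfty (h := fun M => Cint `[(- M), 0] (osc psi))) => s hs; under eq_fun do rewrite refl; exact: hl2.
have iM M := Ccont_integrable (- M) M co.
split.
  split; (split; [|apply/cvg_ex|apply/cvg_ex]).
  - by move=> M; exact: (iM M).1.
  - by exists (Re l1).
  - by exists (Re l2).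
  - by move=> M; exact: (iM M).2.
  - by exists (Im l1).
  - by exists (Im l2).
have -> : Cimproper_int (osc psi) = l2 + l1.
  by apply: complex_ext; rewrite addrC !CE /= /improper_int;
    [rewrite (cvg_lim (@Rhausdorff R) r1) (cvg_lim (@Rhausdorff R) r2)
    |rewrite (cvg_lim (@Rhausdorff R) i1) (cvg_lim (@Rhausdorff R) i2)].
rewrite (_ : (fun m : nat => _) = fun m : nat => Cint `[(- m%:R), 0] (osc psi) + Cint `[0, m%:R] (osc psi)); last first.
  by apply/funext => m; rewrite (@Cint_split _ _ _ 0)// oppr_le0.
apply: CcvgD; last by apply: hl1; exact: cvgr_idn.
under eq_fun do rewrite refl; apply: hl2; exact: cvgr_idn.
Qed.

End Oscillatory.

(** * Growth of the quantum logarithm *)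

(* Conversion must not unfold these functions. *)
#[local] Opaque phider phase cexp.

Section PhiGrowth.
Variables (R : realType) (h : R).
Hypothesis h0 : h != 0.
Local Notation P := (phider h).

(** Differentiating [phi' z + phi' (- z) = 1]. *)
Lemma phider_even m : exists c : R, forall z, P m.+1 z + (-1) ^+ m * P m.+1 (- z) = c.
Proof.
elim: m => [|m [c hc]].
  by exists 1 => z; rewrite expr0 mul1r phider1_sum.
exists 0 => z.
have d1 := is_deriveD (phider_derive h0 m.+1 z)
  (is_deriveZ ((-1) ^+ m) (is_derive_chain (is_deriveNid z (1:R)) (phider_derive h0 m.+1 (- z)))).
have d2 : is_derive z (1:R) (P m.+1 + (-1) ^+ m \*: (fun x => P m.+1 (- x))) 0.
  rewrite (_ : _ + _ = fun=> c); first exact: is_derive_cst.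
  by apply/funext => x; exact: hc.
have := @derive_val _ _ _ _ _ _ _ d1; rewrite (@derive_val _ _ _ _ _ _ _ d2) => ->.
by rewrite /GRing.scale /= exprS; ring.
Qed.

(** The contour integral gives the bound for negative arguments, the parity the
    rest. *)
Lemma phider_bounded m : exists K : R, forall z, `|P m.+1 z| <= K.
Proof.
have [c hc] := phider_even m; have [K hK] := phider_bound h0 m.+1.
exists (`|c| + K) => z; have [z0|z0] := leP z 0.
  by rewrite (le_trans (hK z z0))// lerDr.
have -> : P m.+1 z = c - (-1) ^+ m * P m.+1 (- z) by rewrite -(hc z) addrK.
rewrite (le_trans (ler_normB _ _))// lerD// normrM normrX normrN1 expr1n mul1r.
by apply: hK; rewrite oppr_le0 ltW.
Qed.

(** For negative [z] the values are bounded; for positive [z] the functional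
    equation adds [z]. *)
Lemma phider_near_positive_part : exists K : R, forall z, [/\ `|P 0 z| <= K + `|z|, z - K <= P 0 z & - K <= P 0 z].
Proof.
have [K hK] := phider_bound h0 0; exists K => z.
have [z0|z0] := leP z 0.
  have := hK z z0; rewrite ler_norml => /andP[h1 h2]; split; [|lra|lra].
  by rewrite (le_trans (hK z z0))// lerDl.
have zn : - z <= 0 by rewrite oppr_le0 ltW.
have hz := hK _ zn; have e := phider_sym h0 z.
have -> : P 0 z = P 0 (- z) + z by rewrite -[X in _ + X]e addrC subrK.
move: (hz); rewrite ler_norml => /andP[h1 h2]; split; [|lra|lra].
by rewrite (le_trans (ler_normD _ _))// lerD2r.
Qed.

(** If [A] and [B] are within a bounded distance of the positive parts of [d c -
    e] and [- d c - e], one of them grows like [d |c|]. *)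
Lemma positive_part_sum (A B d c e K : R) :
  d * c - e - K <= A -> - K <= A -> - (d * c) - e - K <= B -> - K <= B ->
  d * `|c| - `|e| - 2 * `|K| <= A + B.
Proof.
have := ler_norm e; have := ler_norm K.
by case: (leP 0 c) => c0; [rewrite (ger0_norm c0)|rewrite (ltr0_norm c0) mulrN]; lra.
Qed.

Lemma moderate_phi n (c : R) (l : 'I_n -> R) :
  moderate (fun a : Rn R n => (P 0 (linform c l a))%:C).
Proof.
apply: (@moderate_comp_lin _ _ (fun m z => (P m z)%:C)).
  by move=> m t; apply: Cder_real; exact: phider_derive.
case=> [|m].
  have [K hK] := phider_near_positive_part; exists 1%N, (`|K| + 1) => t.
  have [h1 _ _] := hK t; rewrite cabs_rC expr1 (le_trans h1)//.
  have := ler_norm K; have := normr_ge0 t; have := normr_ge0 K; nra.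
have [K hK] := phider_bounded m; exists 0%N, K => t.
by rewrite expr0 mulr1 cabs_rC.
Qed.

End PhiGrowth.

(** * The kernel of the intertwiner *)

Section Kernel.
Variables (R : realType) (n : nat) (s : seed n) (k : 'I_n) (hbar : R).
Hypothesis hbar0 : hbar != 0.
Local Notation T := (Rn R n).
Local Notation mu1 := (@lebesgue_measure R).
Implicit Types (f : T -> R[i]) (a : T) (i j : 'I_n).

Local Notation dh := (dhat R s k).
Local Notation hk := (dhat R s k * hbar).
Local Notation P := (phider (dhat R s k * hbar)).
Local Notation ek := (epsR R s k).

(** The frequency for which [exp (c y / (pi i hbar)) = e^(- i lam c y)]. *)
Definition lam : R := (pi * hbar)^-1.

Lemma dhat_gt0 i : 0 < dhat R s i.
Proof. by rewrite invr_gt0 ltr0n mult_gt0. Qed.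

Lemma hk_neq0 : hk != 0.
Proof. by rewrite mulf_neq0// gt_eqF// dhat_gt0. Qed.

Lemma pi_neq0 : pi != 0 :> R. Proof. by rewrite gt_eqF// pi_gt0. Qed.

Lemma lam_neq0 : lam != 0.
Proof. by rewrite invr_eq0 mulf_neq0// pi_neq0. Qed.

Lemma eps_skewR i j : epsR R s i j * dhat R s j = - (epsR R s j i * dhat R s i).
Proof.
have E (z : int) (m : nat) : @ratr R (z%:~R / m%:R) = z%:~R / m%:R.
  by rewrite rmorphM /= ratr_int fmorphV /= ratr_nat.
by have := congr1 (@ratr R) (hat_eps_skew s i j); rewrite rmorphN /= !E.
Qed.

Lemma eps_diag i : eps s i i = 0.
Proof.
have := eps_skewR i i => /eqP; rewrite -addr_eq0 -mulr2n mulrn_eq0 /= mulf_eq0.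
by rewrite [dhat _ _ _ == 0]gt_eqF ?dhat_gt0// orbF intr_eq0 => /eqP.
Qed.

Lemma epsR_diag i : epsR R s i i = 0. Proof. by rewrite /epsR eps_diag. Qed.

(** The two arguments of the quantum dilogarithms, and the form in the
    exponential, are written as linear forms so that composition with them and
    differentiation are covered by general lemmas. The integration variable
    takes the place of the coordinate [k], on which [eps_form] and
    [eps_pos_form] do not depend since [eps] has zero diagonal. *)
Definition arg_plus_coef j : R := (if j == k then dh else 0) - ek j.
Definition arg_minus_coef j : R := - (if j == k then dh else 0) - ek j.
Definition eps_pos_coef j : R := if 0 < eps s k j then ek j else 0.
Definition eps_form a : R := \sum_j ek j * crd a j.
Definition arg_plus a : R := linform 0 arg_plus_coef a.
Definition arg_minus a : R := linform 0 arg_minus_coef a.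
Definition eps_pos_form a : R := linform 0 eps_pos_coef a.

Lemma sum_delta (d : R) a : \sum_j (if j == k then d else 0) * crd a j = d * crd a k.
Proof.
rewrite (bigD1 k)//= eqxx big1 ?addr0// => j jk.
by rewrite (negbTE jk) mul0r.
Qed.

Lemma arg_plusE a : arg_plus a = dh * crd a k - eps_form a.
Proof.
by rewrite /arg_plus /linform add0r -sum_delta -sumrB; apply: eq_bigr => j _; rewrite mulrBl.
Qed.

Lemma arg_minusE a : arg_minus a = - (dh * crd a k) - eps_form a.
Proof.
rewrite /arg_minus /linform add0r -sum_delta -sumrN -sumrB; apply: eq_bigr => j _.
by rewrite mulrBl mulNr.
Qed.

Lemma eps_pos_formE a : eps_pos_form a = \sum_(j | 0 < eps s k j) ek j * crd a j.
Proof.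
rewrite /eps_pos_form /linform add0r [RHS]big_mkcond; apply: eq_bigr => j _.
by rewrite /eps_pos_coef; case: ifP => //; rewrite mul0r.
Qed.

Lemma eps_pos_coef_k : eps_pos_coef k = 0. Proof. by rewrite /eps_pos_coef eps_diag. Qed.
Lemma eps_form_upd a t : eps_form (upd a k t) = eps_form a.
Proof.
apply: eq_bigr => j _; rewrite crd_upd; case: eqP => [->|//].
by rewrite epsR_diag !mul0r.
Qed.
Lemma eps_pos_form_upd a t : eps_pos_form (upd a k t) = eps_pos_form a.
Proof. by rewrite /eps_pos_form linform_upd eps_pos_coef_k mul0r addr0. Qed.

(** The phase of the integrand, apart from its part bilinear in the
    integration variable and the coordinate [k]. *)
Definition theta a : R := phase hk (arg_minus a) - phase hk (arg_plus a) + lam * (crd a k * eps_pos_form a).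
Definition dtheta i a : R :=
  (arg_plus_coef i * P 0 (arg_plus a) - arg_minus_coef i * P 0 (arg_minus a)) / (2 * pi * hk)
  + lam * ((if k == i then eps_pos_form a else 0) + crd a k * eps_pos_coef i).
Definition phase_factor a : R[i] := cexp ('i%C * (theta a)%:C).

Lemma pder_theta i a : pder (fun a => (theta a)%:C) i a (dtheta i a)%:C.
Proof.
have dph l : pder (fun a => (phase hk (linform 0 l a))%:C) i a
    ((l i)%:C * (- P 0 (linform 0 l a) / (2 * pi * hk))%:C).
  apply: (@pder_comp_lin _ _ (fun z => (phase hk z)%:C)); apply: Cder_real.
  exact: (phase_derive hk_neq0).
have dep : pder (fun a => (eps_pos_form a)%:C) i a (eps_pos_coef i)%:C.
  have := @pder_comp_lin R n (fun z => z%:C) 0 eps_pos_coef i a 1 (Cder_id _).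
  by rewrite mulr1.
have dm : pder (fun a => - (phase hk (arg_plus a))%:C) i a (- ((arg_plus_coef i)%:C * (- P 0 (arg_plus a) / (2 * pi * hk))%:C)) := CderN (dph arg_plus_coef).
have D := pderD (pderD (dph arg_minus_coef) dm) (pderM (pder_cst lam%:C i a) (pderM (pder_crd k i a) dep)).
have E b : (phase hk (arg_minus b))%:C + - (phase hk (arg_plus b))%:C + lam%:C * ((crd b k)%:C * (eps_pos_form b)%:C) = (theta b)%:C.
  by rewrite /theta rCD rCB !rCM.
apply: Cder_ext (fun t => E (upd a i t)) (Cder_eq D _).
rewrite /dtheta -/(arg_minus a) mul0r add0r.
have -> : (if k == i then 1 else 0 : R[i]) = ((if k == i then 1 else 0 : R)%:C) by case: ifP.
rewrite -!(rCM, rCN, rCD); congr (_%:C); congr (_ + lam * (_ + _)); last by case: ifP; rewrite ?mul1r ?mul0r.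
move: (P 0 (arg_plus a)) (P 0 (arg_minus a)) ((2 * pi * hk)^-1) (arg_plus_coef i) (arg_minus_coef i) => A B h l l'.
by rewrite !mulNr !mulrN opprK mulrBl !mulrA addrC.
Qed.

Lemma pder_phase_factor i a : pder phase_factor i a ('i%C * (dtheta i a)%:C * phase_factor a).
Proof.
apply: Cder_eq (Cder_cexp (CderZ 'i%C (pder_theta i a))) _.
by rewrite upd_crd mulrC.
Qed.

Lemma cabs_phase_factor a : cabs (phase_factor a) = 1. Proof. exact: cabs_cexpi. Qed.

Lemma moderate_lin (c : R) l : moderate (fun a : T => (linform c l a)%:C).
Proof.
apply: (@moderate_comp_lin _ _ (fun m z => if m is m'.+1 then (if m' is 0%N then 1 else 0) else z%:C)).
  by case=> [|[|m]] t; [exact: Cder_id|exact: Cder_cst|exact: Cder_cst].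
case=> [|[|m]].
- by exists 1%N, 1 => t; rewrite cabs_rC expr1 mul1r lerDr.
- by exists 0%N, 1 => t; rewrite cabs1 expr0 mulr1.
- by exists 0%N, 0 => t; rewrite cabs0 expr0 mulr1.
Qed.

Lemma moderate_dtheta i : moderate (fun a => 'i%C * (dtheta i a)%:C).
Proof.
apply: moderateZ.
rewrite (_ : (fun a => _) = fun a => (arg_plus_coef i / (2 * pi * hk))%:C * (P 0 (arg_plus a))%:C
   + ((- arg_minus_coef i / (2 * pi * hk))%:C * (P 0 (arg_minus a))%:C
   + ((lam * (if k == i then 1 else 0))%:C * (eps_pos_form a)%:C + (lam * eps_pos_coef i)%:C * (crd a k)%:C))).
  by apply: moderateD; [|apply: moderateD; [|apply: moderateD]]; apply: moderateZ;
    [exact: (moderate_phi hk_neq0 0 arg_plus_coef)|exact: (moderate_phi hk_neq0 0 arg_minus_coef)|exact: (moderate_lin 0 eps_pos_coef)|exact: moderate_crd].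
apply/funext => a; rewrite -!(rCM, rCD); congr (_%:C); rewrite /dtheta.
by case: ifP => _; move: (P 0 (arg_plus a)) (P 0 (arg_minus a)) (eps_pos_form a) (crd a k) (arg_plus_coef i) (arg_minus_coef i) (eps_pos_coef i) lam (2 * pi * hk)
  => A B E x l1 l2 l3 l h; ring.
Qed.

Lemma moderate_phase_factor : moderate phase_factor.
Proof.
apply: (moderate_logder (w := fun i a => 'i%C * (dtheta i a)%:C)).
- by apply: (@slow_bdd _ _ _ 1) => a; rewrite cabs_phase_factor.
- exact: moderate_dtheta.
- exact: pder_phase_factor.
Qed.

(** The operator on Schwartz functions as [F e^(i theta) F]. *)
Definition kernel_op f a : R[i] := pft k lam (fun b => phase_factor b * pft k lam f b) a.

Lemma schwartz_gpft f : schwartz f -> schwartz (fun b => phase_factor b * pft k lam f b).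
Proof. by move=> sf; apply: schwartzM; [exact: moderate_phase_factor|exact: schwartz_pft lam_neq0 _ sf]. Qed.

Lemma schwartz_kernel_op f : schwartz f -> schwartz (kernel_op f).
Proof. by move=> sf; apply: (schwartz_pft k lam_neq0); exact: schwartz_gpft. Qed.

(** The total phase in the integral defining [G] and its first two derivatives in
    the integration variable [c]; the parameters [e] and [p] are the values of the
    two linear forms, and [y] is the value of the coordinate [k]. *)
Let psi e p y c := - (lam * y * c) + (phase hk (- (dh * c) - e) - phase hk (dh * c - e) + lam * (c * p)).
Let q e p y c := - (lam * y) + (P 0 (dh * c - e) + P 0 (- (dh * c) - e)) * (dh / (2 * pi * hk)) + lam * p.
Let q' e c := (P 1 (dh * c - e) - P 1 (- (dh * c) - e)) * (dh ^+ 2 / (2 * pi * hk)).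

Let daff (u e c : R) : is_derive c (1:R) (fun c => u * c - e) u.
Proof.
apply: is_derive_eq (is_deriveB (is_deriveZ u (is_derive_id c (1:R))) (is_derive_cst e c (1:R))) _.
by rewrite /GRing.scale /= subr0 mulr1.
Qed.

Let dchain (F F' : R -> R) u e c : (forall z, is_derive z (1:R) F (F' z)) ->
  is_derive c (1:R) (fun c => F (u * c - e)) (u * F' (u * c - e)).
Proof. by move=> dF; exact: is_derive_chain (daff u e c) (dF _). Qed.

Let psi_der e p y c : is_derive c (1:R) (psi e p y) (q e p y c).
Proof.
have d1 := dchain (- dh) e c (phase_derive hk_neq0).
have d2 := dchain dh e c (phase_derive hk_neq0).
have d3 := is_deriveZ (- (lam * y)) (is_derive_id c (1:R)).
have d4 := is_deriveZ (lam * p) (is_derive_id c (1:R)).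
rewrite (_ : psi e p y = (fun c => - (lam * y) * c +
    (phase hk (- dh * c - e) - phase hk (dh * c - e) + lam * p * c))); last first.
  apply/funext => x; have e2 : - dh * x - e = - (dh * x) - e by rewrite mulNr.
  by rewrite /psi e2; move: (phase _ (dh * x - e)) (phase _ (- (dh * x) - e)) lam => A B l; ring.
apply: is_derive_eq (is_deriveD d3 (is_deriveD (is_deriveB d1 d2) d4)) _.
have e2 : - dh * c - e = - (dh * c) - e by rewrite mulNr.
rewrite /q /GRing.scale /= e2.
move: (P 0 (dh * c - e)) (P 0 (- (dh * c) - e)) lam (2 * pi * hk)^-1 (dhat R s k) => A B l h d.
by ring.
Qed.

Let q_der e p y c : is_derive c (1:R) (q e p y) (q' e c).
Proof.
have d1 := dchain (- dh) e c (phider_derive hk_neq0 0).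
have d2 := dchain dh e c (phider_derive hk_neq0 0).
rewrite (_ : q e p y = (fun c => (- (lam * y) + lam * p) +
    dh / (2 * pi * hk) * (P 0 (dh * c - e) + P 0 (- dh * c - e)))); last first.
  apply/funext => x; have e2 : - dh * x - e = - (dh * x) - e by rewrite mulNr.
  by rewrite /q e2; move: (P 0 (dh * x - e)) (P 0 (- (dh * x) - e)) lam (dh / (2 * pi * hk)) => A B l h; ring.
apply: is_derive_eq (is_deriveD (is_derive_cst _ c (1:R)) (is_deriveZ _ (is_deriveD d2 d1))) _.
have e2 : - dh * c - e = - (dh * c) - e by rewrite mulNr.
rewrite /q' /GRing.scale /= e2 add0r.
move: (P 1 (dh * c - e)) (P 1 (- (dh * c) - e)) (2 * pi * hk)^-1 (dhat R s k) => A B h d.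
by ring.
Qed.

Let q'_cont e : continuous (q' e).
Proof.
have d u c := dchain u e c (phider_derive hk_neq0 1).
move=> c; apply: cvgM; last exact: cvg_cst.
rewrite /q'; apply: cvgB; first exact: is_derive_cvg (d dh c).
under eq_fun do rewrite -mulNr; rewrite -mulNr; exact: is_derive_cvg (d (- dh) c).
Qed.

(** The sum of the two values of [phi] in [q] grows like [|c|], whatever the
    sign of [c]; the constant is quadratic in [y], which is the source of the
    polynomial bound on [G]. *)
Let osc_bounds : exists Q : R, (forall e c, `|q' e c| <= Q) /\
  (forall e p, exists C : R, 0 <= C /\ forall y c, 1 + c ^+ 2 <= C * (1 + y ^+ 2) * (1 + q e p y c ^+ 2)).
Proof.
have [K1 hK1] := phider_bounded hk_neq0 0.
have [K hK] := phider_near_positive_part hk_neq0.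
exists (2 * K1 * `|dh ^+ 2 / (2 * pi * hk)|); split=> [e c|e p].
  rewrite normrM ler_wpM2r// (le_trans (ler_normB _ _))//.
  by rewrite mulr2n mulrDl mul1r lerD.
pose kap := `|dh / (2 * pi * hk)| * dh.
have d0 := dhat_gt0 k.
have k0 : 0 < `|dh / (2 * pi * hk)|.
  rewrite normr_gt0; apply: mulf_neq0; first by rewrite gt_eqF.
  rewrite invr_eq0; apply: mulf_neq0; last exact: hk_neq0.
  by rewrite mulf_neq0// pi_neq0.
have kap0 : 0 < kap by rewrite mulr_gt0.
pose rho := `|dh / (2 * pi * hk)| * (2 * `|K| + `|e|) + `|lam| * `|p|.
have rho0 : 0 <= rho by rewrite addr_ge0 ?mulr_ge0 ?addr_ge0.
exists (1 + 4 / kap ^+ 2 * (1 + rho ^+ 2 + lam ^+ 2)); split.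
  by rewrite addr_ge0// mulr_ge0 ?divr_ge0 ?sqr_ge0// addr_ge0 ?sqr_ge0// addr_ge0 ?sqr_ge0.
move=> y c.
have hS : dh * `|c| - `|e| - 2 * `|K| <= P 0 (dh * c - e) + P 0 (- (dh * c) - e).
  have [_ h1 h2] := hK (dh * c - e); have [_ h3 h4] := hK (- (dh * c) - e).
  exact: positive_part_sum.
have hq : kap * `|c| <= `|q e p y c| + (rho + `|lam| * `|y|).
  set S := P 0 (dh * c - e) + P 0 (- (dh * c) - e) in hS.
  have e1 : S * (dh / (2 * pi * hk)) = q e p y c + (lam * y - lam * p).
    by rewrite /q -/S; clear hS; move: S (dh / (2 * pi * hk)) lam => S' d l; ring.
  have h1 : `|dh / (2 * pi * hk)| * S <= `|q e p y c| + `|lam| * `|y| + `|lam| * `|p|.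
    rewrite (le_trans (ler_wpM2l (ltW k0) (ler_norm S)))// -normrM mulrC e1.
    rewrite (le_trans (ler_normD _ _))// -addrA lerD2l -!normrM; exact: ler_normB.
  have := ler_wpM2l (ltW k0) hS; rewrite /kap /rho; move: h1; clear e1 hS; move: `|dh / (2 * pi * hk)| S dh `|q e p y c| (`|lam| * `|y|) (`|lam| * `|p|) `|c| `|e| `|K|.
  move=> kk S' d q0 l1 l2 c1 e1' K2 h1 h2; lra.
set x := q e p y c in hq *; set z := `|lam| * `|y| in hq.
have z0 : 0 <= z by rewrite mulr_ge0.
have z2 : z ^+ 2 = lam ^+ 2 * y ^+ 2 by rewrite exprMn !real_normK ?num_real.
have h2 : kap ^+ 2 * c ^+ 2 <= 4 * (x ^+ 2 + rho ^+ 2 + z ^+ 2).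
  apply: (@le_trans _ _ ((`|x| + (rho + z)) ^+ 2)).
    rewrite -exprMn -[leLHS]real_normK ?num_real// normrM (gtr0_norm kap0).
    apply: lerXn2r; rewrite ?nnegrE.
    - by rewrite mulr_ge0// ltW.
    - by rewrite !addr_ge0.
    - exact: hq.
  rewrite -[x ^+ 2]real_normK ?num_real//.
  have := sqr_ge0 (`|x| - rho); have := sqr_ge0 (`|x| - z); have := sqr_ge0 (rho - z).
  have := sqr_ge0 `|x|; have := sqr_ge0 rho; have := sqr_ge0 z.
  move: `|x| => w; nra.
have x2 := sqr_ge0 x; have y2 := sqr_ge0 y; have r2 := sqr_ge0 rho; have l2 := sqr_ge0 lam.
have h3 : x ^+ 2 + rho ^+ 2 + z ^+ 2 <= (1 + rho ^+ 2 + lam ^+ 2) * (1 + y ^+ 2) * (1 + x ^+ 2).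
  rewrite z2; move: (x ^+ 2) (y ^+ 2) (rho ^+ 2) (lam ^+ 2) x2 y2 r2 l2 => A B C' E A0 B0 C0 E0.
  have := mulr_ge0 A0 B0; have := mulr_ge0 C0 B0; have := mulr_ge0 E0 B0; have := mulr_ge0 C0 A0; have := mulr_ge0 E0 A0.
  have := mulr_ge0 (mulr_ge0 C0 B0) A0; have := mulr_ge0 (mulr_ge0 E0 B0) A0; lra.
have kp2 : 0 < kap ^+ 2 by rewrite exprn_gt0.
have h4 : c ^+ 2 <= 4 / kap ^+ 2 * ((1 + rho ^+ 2 + lam ^+ 2) * (1 + y ^+ 2) * (1 + x ^+ 2)).
  rewrite mulrAC ler_pdivlMr// mulrC (le_trans h2)// ler_wpM2l//.
have h5 : 1 <= (1 + y ^+ 2) * (1 + x ^+ 2) by have := mulr_ge0 y2 x2; lra.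
rewrite [leRHS](_ : _ = (1 + y ^+ 2) * (1 + x ^+ 2) + 4 / kap ^+ 2 * ((1 + rho ^+ 2 + lam ^+ 2) * (1 + y ^+ 2) * (1 + x ^+ 2))); last by ring.
exact: lerD.
Qed.

Lemma oscE a y c : osc (psi (eps_form a) (eps_pos_form a) y) c = fker lam y c * phase_factor (upd a k c).
Proof.
rewrite /osc /fker /phase_factor -cexpD -mulrDr -rCD; congr (cexp ('i%C * _%:C)).
by rewrite /theta /psi arg_plusE arg_minusE crd_upd_same eps_form_upd eps_pos_form_upd.
Qed.

Lemma GintegrandE a y c : Gintegrand s hbar k (upd a k y) c = fker lam y c * phase_factor (upd a k c).
Proof.
rewrite /Gintegrand crd_upd_same -/(eps_form (upd a k y)) eps_form_upd.
rewrite -eps_pos_formE eps_pos_form_upd !qdilogE; [|exact: hk_neq0|exact: hk_neq0].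
rewrite -cexpN -!cexpD; congr cexp.
rewrite /theta arg_plusE arg_minusE crd_upd_same eps_form_upd eps_pos_form_upd.
have i1 : ((pi * hbar)%:C * 'i%C)^-1 = - 'i%C * lam%:C :> R[i].
  rewrite invfM /lam rCV mulrC; congr (_ * _).
  by apply: (mulIf (i_neq0 R)); rewrite mulVf ?i_neq0// mulNr sqr_i_ opprK.
rewrite i1; move: (phase _ (dh * c - eps_form a)) (phase _ (- (dh * c) - eps_form a)) (eps_pos_form a) lam => A B p l.
by rewrite !(rCM, rCD, rCN, rCB); ring.
Qed.

Lemma Gintegrand_cvg a : Cimproper_cvg (Gintegrand s hbar k a).
Proof.
have [Q [hQ hD]] := osc_bounds; have [C [_ hC]] := hD (eps_form a) (eps_pos_form a).
rewrite (_ : Gintegrand s hbar k a = osc (psi (eps_form a) (eps_pos_form a) (crd a k))).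
  exact: (osc_improper (psi_der (eps_form a) (eps_pos_form a) (crd a k)) (q_der (eps_form a) (eps_pos_form a) (crd a k)) (q'_cont (e:=eps_form a)) (hQ (eps_form a)) (hC (crd a k))).1.
by apply/funext => c; rewrite oscE -GintegrandE upd_crd.
Qed.

(** Over a bounded interval of [c] the double integral in [K f] converges
    absolutely; the truncations converge to [G] with a bound uniform in [m]. *)
Definition Gtrunc (m : nat) a y : R[i] :=
  Cint `[(- m%:R), m%:R] (fun c => fker lam y c * phase_factor (upd a k c)).

Lemma Gtrunc_cvg a y : Ccvg (fun m => Gtrunc m a y) (G s hbar k (upd a k y)).
Proof.
have [Q [hQ hD]] := osc_bounds; have [C [_ hC]] := hD (eps_form a) (eps_pos_form a).
rewrite /G (_ : Gintegrand s hbar k (upd a k y) = osc (psi (eps_form a) (eps_pos_form a) y)).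
  rewrite /Gtrunc (_ : (fun c => fker lam y c * phase_factor (upd a k c)) = osc (psi (eps_form a) (eps_pos_form a) y)).
    exact: (osc_improper (psi_der (eps_form a) (eps_pos_form a) y) (q_der (eps_form a) (eps_pos_form a) y) (q'_cont (e:=eps_form a)) (hQ (eps_form a)) (hC y)).2.
  by apply/funext => c; rewrite oscE.
by apply/funext => c; rewrite oscE GintegrandE.
Qed.

Lemma Gtrunc_bound a : exists C : R, forall m y, cabs (Gtrunc m a y) <= C * (1 + y ^+ 2).
Proof.
have [Q [hQ hD]] := osc_bounds; have [C [C0 hC]] := hD (eps_form a) (eps_pos_form a).
have Q0 : 0 <= Q by rewrite (le_trans _ (hQ 0 0)).
exists (2 + 2 * ((1 + Q) * C * pi)) => m y.
rewrite /Gtrunc (_ : (fun c => fker lam y c * phase_factor (upd a k c)) = osc (psi (eps_form a) (eps_pos_form a) y)); last first.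
  by apply/funext => c; rewrite oscE.
have mm : (- m%:R : R) <= m%:R by rewrite (@le_trans _ _ 0) ?oppr_le0.
rewrite (le_trans (osc_bound (psi_der (eps_form a) (eps_pos_form a) y) (q_der (eps_form a) (eps_pos_form a) y) (q'_cont (e:=eps_form a)) (hQ (eps_form a)) (hC y) mm))//.
rewrite [leRHS]mulrDl lerD//; first by rewrite ler_peMr// lerDl sqr_ge0.
rewrite le_eqVlt; apply/orP; left; apply/eqP; ring.
Qed.

Lemma phase_factor_slice_cont a : Ccont (fun c => phase_factor (upd a k c)).
Proof. by apply: (pder_slice (f := phase_factor)) => b; exact: pder_phase_factor. Qed.

Lemma Gtrunc_cont m a : Ccont (Gtrunc m a).
Proof.
apply: (@Cder_cont _ _ (fun y => Cint `[(- m%:R), m%:R]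
  (fun c => 'i%C * (- (lam * c))%:C * fker lam y c * phase_factor (upd a k c)))) => y.
have cg := phase_factor_slice_cont a.
apply: (@Cint_derive _ _ (fun y c => fker lam y c * phase_factor (upd a k c))
  (fun y c => 'i%C * (- (lam * c))%:C * fker lam y c * phase_factor (upd a k c))
  (fun=> `|lam| * m%:R) (y - 1) (y + 1)) => //.
- by apply/andP; split; lra.
- move=> x _; apply: Ccont_integrable; apply: CcontM => //; exact: Ccont_fker.
- move=> x t _ _; apply: Cder_eq (CderM (Cder_fkerl lam x t) (Cder_cst (phase_factor (upd a k t)) x)) _.
  by rewrite mulr0 addr0.
- exact: integrable_cst_itv.
- move=> x t _ tm; have /andP[t1 t2] : - m%:R <= t <= m%:R by move: tm; rewrite /= in_itv.
  rewrite !cabsM cabs_i cabs_fker cabs_phase_factor mul1r !mulr1 cabs_rC normrN normrM ler_wpM2l//.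
  by rewrite ler_norml t1 t2.
Qed.

Lemma schwartz_weighted_slice f : schwartz f -> exists K : R, forall a t,
  (1 + t ^+ 2) * cabs (f (upd a k t)) <= K * (1 + t ^+ 2)^-1.
Proof.
move=> sf.
have sg : schwartz (fun a => (1 + (crd a k)%:C * (crd a k)%:C) * f a).
  apply: schwartzM => //; apply: moderateD; first exact: moderate_cst.
  by apply: moderateM; exact: moderate_crd.
have [K hK] := rapid_slice k (schwartz_rapid sg); exists K => a t.
have := hK a t; rewrite crd_upd_same cabsM -rCM -rC1 -rCD cabs_rC -expr2 ger0_norm//.
by rewrite addr_ge0 ?sqr_ge0.
Qed.

Let gdom a f : schwartz f -> exists C : R, forall m t,
  cabs (Gtrunc m a (crd a k + t) * f (upd a k t)) <= C * (1 + t ^+ 2)^-1.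
Proof.
move=> sf; have [C hC] := Gtrunc_bound a; have [K hK] := schwartz_weighted_slice sf.
have C0 : 0 <= C by have := hC 0%N 0; rewrite expr0n addr0 mulr1; apply: le_trans; exact: cabs_ge0.
exists (C * (2 * (1 + crd a k ^+ 2)) * K) => m t; rewrite cabsM.
apply: (@le_trans _ _ (C * (2 * (1 + crd a k ^+ 2)) * ((1 + t ^+ 2) * cabs (f (upd a k t))))).
  rewrite mulrA ler_wpM2r ?cabs_ge0// (le_trans (hC _ _))// -mulrA ler_wpM2l//.
  have := sqr_ge0 (crd a k - t); have := mulr_ge0 (sqr_ge0 (crd a k)) (sqr_ge0 t).
  by rewrite sqrrB sqrrD; lra.
rewrite -[leRHS]mulrA ler_wpM2l// ?mulr_ge0// addr_ge0 ?sqr_ge0//.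
Qed.

Let Gtrunc_meas m a f : schwartz f ->
  Cmeas setT (fun t : measurableTypeR R => Gtrunc m a (crd a k + t) * f (upd a k t)).
Proof.
move=> sf; apply: CmeasM; last by apply: Ccont_meas => //; exact: schwartz_slice.
have := Cmeas_comp (@measurable_affine R 1 (crd a k)) (Ccont_meas measurableT (Gtrunc_cont m a)).
by rewrite /affine; under eq_fun do rewrite mul1r addrC.
Qed.

Let Kintegrand_cvg a f t : Ccvg (fun m => Gtrunc m a (crd a k + t) * f (upd a k t))
  (Kintegrand s hbar k f a t).
Proof. by apply: CcvgM; [exact: Gtrunc_cvg|exact: Ccvg_cst]. Qed.

Lemma Kintegrand_integrable f a : schwartz f ->
  Cintegrable mu1 setT (Kintegrand s hbar k f a).
Proof.
move=> sf; have [C hC] := gdom a sf.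
apply: (Cint_dom (g := fun t => 2 * C * (1 + t ^+ 2)^-1)) => //.
- apply: (@Cmeas_cvg _ _ _ _ (fun m t => Gtrunc m a (crd a k + t) * f (upd a k t))).
  + by move=> m; exact: Gtrunc_meas.
  + by move=> t _; exact: (Kintegrand_cvg a f t).1.
  + by move=> t _; exact: (Kintegrand_cvg a f t).2.
- exact: integrable_cauchyZ.
- move=> t _; have [c1 c2] := Kintegrand_cvg a f t.
  have b (u : nat -> R) l : u @ \oo --> l -> (forall m, `|u m| <= C * (1 + t ^+ 2)^-1) -> `|l| <= C * (1 + t ^+ 2)^-1.
    move=> cu hu; have cn : (fun m => `|u m|) @ \oo --> `|l| by exact: cvg_norm cu.
    by rewrite -(cvg_lim (@Rhausdorff R) cn); apply: limr_le; [apply/cvg_ex; exists (`|l|)|exact: nearW].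
  rewrite (le_trans (cabs_le_ReIm _))// -mulrA mulr_natl mulr2n lerD//.
    by apply: b c1 _ => m; rewrite (le_trans (Re_le_cabs _)).
  by apply: b c2 _ => m; rewrite (le_trans (Im_le_cabs _)).
Qed.

(** Both sides are limits of the truncated double integral: the left one by
    dominated convergence in [a_k], the right one by dominated convergence in
    [c] after exchanging the integrals and recognizing [F f]. *)
Lemma Kint_kernel_op f a : schwartz f -> Kint s hbar k f a = kernel_op f a.
Proof.
move=> sf; have [C hC] := gdom a sf.
have sW := schwartz_gpft sf; have [L hL] := rapid_slice k (schwartz_rapid sW).
have [K hK] := rapid_slice k (schwartz_rapid sf).
apply: (@Ccvg_unique _ (fun m => Cint setT (fun t => Gtrunc m a (crd a k + t) * f (upd a k t)))).
  apply: (@Cint_dominated _ _ _ _ (fun t => C * (1 + t ^+ 2)^-1)) => //.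
  - by move=> m; exact: Gtrunc_meas.
  - exact: integrable_cauchyZ.
pose M (m : nat) : set R := `[(- m%:R), m%:R]%classic.
rewrite (_ : (fun m => _) = fun m => Cint (M m)
    (fun c => fker lam (crd a k) c * (phase_factor (upd a k c) * pft k lam f (upd a k c)))); last first.
  apply/funext => m.
  have cg := phase_factor_slice_cont a.
  pose w c := fker lam (crd a k) c * phase_factor (upd a k c).
  have cw : Ccont w by apply: CcontM => //; exact: Ccont_fker.
  transitivity (Cint setT (fun t => Cint setT (fun c => Crestr (M m) w c * (fker lam c t * f (upd a k t))))).
    apply: Cint_ext => t _; rewrite /Gtrunc Cint_mkcond mulrC -CintZ//; last first.
      apply: Cintegrable_mkcond => //; apply: Ccont_integrable; apply: CcontM => //; exact: Ccont_fker.
    apply: Cint_ext => c _; rewrite /Crestr /M; case: ifP => _; rewrite ?mulr0 ?mul0r//.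
    (* The kernel at [a'_k + a_k] is the product of the two kernels. *)
    by rewrite /w -fkerD [fker lam c t]fkerC; ring.
  have cM c : cabs (Crestr (M m) w c) <= (1 + m%:R ^+ 2) * (1 + c ^+ 2)^-1.
    have p : 0 < 1 + c ^+ 2 by apply: ltr_wpDr => //; exact: sqr_ge0.
    rewrite ler_pdivlMr// /Crestr; case: ifP => [cm|_]; last by rewrite cabs0 mul0r addr_ge0 ?sqr_ge0.
    have /andP[c1 c2] : - m%:R <= c <= m%:R by move/set_mem: cm; rewrite /M /= in_itv.
    rewrite cabsM cabs_fker cabs_phase_factor !mul1r lerD2l.
    rewrite -[c ^+ 2]real_normK ?num_real//; apply: lerXn2r; rewrite ?nnegrE//.
    by rewrite ler_norml c1 c2.
  have mC : Cmeas setT (Crestr (M m) w).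
    apply: (@Cintegrable_meas _ _ _ mu1); apply: Cintegrable_mkcond; first exact: measurable_itv.
    exact: Ccont_integrable.
  rewrite (@Cint_swap _ (fun t c => Crestr (M m) w c * (fker lam c t * f (upd a k t)))
    (fun t => K * (1 + t ^+ 2)^-1) (fun c => (1 + m%:R ^+ 2) * (1 + c ^+ 2)^-1)).
  - rewrite [RHS]Cint_mkcond; apply: Cint_ext => c _.
    rewrite CintZ//; last exact: pft_integrable.
    rewrite /Crestr; case: ifP => _; last by rewrite mul0r.
    by rewrite /w -mulrA; congr (_ * (_ * _)); rewrite pft_ft.
  - apply: CmeasM; first by apply: (@Cmeas_comp _ _ _ _ _ snd (Crestr (M m) w)) => //; exact: measurable_snd.
    apply: CmeasM.
      rewrite (_ : (fun x => _) = fun x : measurableTypeR R * measurableTypeR R => fker lam x.1 x.2).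
        exact: Cmeas_fker2.
      by apply/funext => x; rewrite fkerC.
    apply: (@Cmeas_comp _ _ _ _ _ fst (fun t : measurableTypeR R => f (upd a k t))); first exact: measurable_fst.
    by apply: Ccont_meas => //; exact: schwartz_slice.
  - exact: integrable_cauchyZ.
  - exact: integrable_cauchyZ.
  - move=> t c; rewrite cabsM cabsM cabs_fker mul1r mulrC ler_pM ?cabs_ge0//.
apply: (Cint_exhaust (g := fun c => L * (1 + c ^+ 2)^-1)).
- apply: Ccont_meas => //; apply: CcontM; first exact: Ccont_fker.
  by apply: (schwartz_slice k a sW).
- exact: integrable_cauchyZ.
- by move=> c; rewrite cabsM cabs_fker mul1r; exact: hL.
Qed.

End Kernel.

(** * Intertwining relations *)

Section Intertwining.
Variables (R : realType) (n : nat) (s : seed n) (k : 'I_n) (hbar : R).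
Hypothesis hbar0 : hbar != 0.
Local Notation T := (Rn R n).
Local Notation mu := (lebesgue_Rn R n).
Implicit Types (f u v w : T -> R[i]) (a : T) (i j : 'I_n) (b : bool).

Local Notation dh := (dhat R s).
Local Notation hk := (dhat R s k * hbar).
Local Notation P0 := (phider (dhat R s k * hbar) 0).
Local Notation lam := (lam hbar).
Local Notation F := (pft k lam).
Local Notation phase_factor := (phase_factor s k hbar).
Local Notation dtheta := (dtheta s k hbar).
Local Notation kernel_op := (kernel_op s k hbar).
Local Notation E i := (epsR R s i k).
Local Notation ek := (epsR R s k).

Let pilam : pi * hbar * lam = 1.
Proof. by rewrite /lam mulfV// mulf_neq0// pi_neq0. Qed.

Lemma moderate_lincomb (l : 'I_n -> R) : moderate (fun a : T => (\sum_j l j * crd a j)%:C).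
Proof. by have := moderate_lin 0 l; rewrite /linform; under eq_fun do rewrite add0r. Qed.

Lemma schwartz_xdiff (s0 : seed n) b j f : schwartz f -> schwartz (xdiff s0 hbar b j f).
Proof.
move=> sf; apply: schwartzD; first by apply: schwartzZ; exact: schwartz_pderive.
by apply: schwartzM => //; exact: moderate_lincomb.
Qed.

(** The linear form [e - d a_k] for [x_k^+] and [e + d a_k] for [x_k^-]. *)
Definition multiplier_coef b j : R := ek j - (-1) ^+ b * (if j == k then dh k else 0).
Definition multiplier b a : R := linform 0 (multiplier_coef b) a.

Lemma multiplierE b a : multiplier b a = eps_form s k a - (-1) ^+ b * (dh k * crd a k).
Proof.
rewrite /multiplier /linform add0r -sum_delta mulr_sumr -sumrB; apply: eq_bigr => j _.
by rewrite mulrBl mulrA.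
Qed.

Let signC b : (-1) ^+ b = ((-1) ^+ b : R)%:C :> R[i].
Proof. by case: b; rewrite ?expr1 ?expr0// rCN. Qed.

Lemma momentum_scalar b (d x : R) :
  (-1) ^+ b * (pi * hbar * d)%:C * 'i%C * ('i%C * (lam * x)%:C) = (- ((-1) ^+ b * (d * x)))%:C :> R[i].
Proof.
rewrite signC; transitivity ('i%C * 'i%C * (pi * hbar * lam * ((-1) ^+ b * (d * x)))%:C : R[i]).
  by rewrite !rCM; move: 'i%C ((-1) ^+ b)%:C => I S; ring.
by rewrite sqr_i_ pilam mul1r mulN1r rCN.
Qed.

(** The transform replaces the derivative in [a_k] by [i lam a_k] and commutes
    with the form [e]. *)
Lemma pft_xdiff b f : schwartz f -> F (xdiff s hbar b k f) = (fun a => (multiplier b a)%:C * F f a).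
Proof.
move=> sf; apply/funext => a; have sd := schwartz_pderive k sf.
rewrite /xdiff pftD; [|exact: schwartzZ|apply: schwartzM sf; exact: moderate_lincomb].
rewrite pftZ// (pftZ_indep lam (m := fun a => (eps_form s k a)%:C))//; last by move=> c t; rewrite eps_form_upd.
rewrite pft_pderive// mulrA mulrA -[_ * 'i%C * 'i%C * _]mulrA momentum_scalar -mulrDl -rCD.
by congr (_%:C * _); rewrite multiplierE addrC.
Qed.

Lemma pderive_kernel_op_other i f : i != k -> schwartz f ->
  pderive i (kernel_op f) = F (pderive i (fun a => phase_factor a * F f a)).
Proof.
by move=> ik sf; apply: pderive_ext => a; apply: pder_pft_other => //; exact: schwartz_gpft.
Qed.

Lemma epsR_mutk j : epsR R (mutation s k) k j = - ek j.
Proof. by rewrite /epsR /= mxE eqxx /= rmorphN. Qed.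

Lemma epsR_mut_k i : epsR R (mutation s k) i k = - E i.
Proof. by rewrite /epsR /= mxE eqxx orbT /= rmorphN. Qed.

(** Under the outer transform the derivative in [a_k] becomes multiplication by
    [- i lam a_k]; with the opposite sign of [eps] the resulting form is the
    opposite of the one that comes from the inner transform. *)
Lemma kernel_op_xdiff_k b f : schwartz f ->
  xdiff (mutation s k) hbar b k (kernel_op f) = kernel_op (fun a => - xdiff s hbar b k f a).
Proof.
move=> sf; apply/funext => a.
have sW := schwartz_gpft s k hbar0 sf.
have sx := schwartz_xdiff s b k sf.
have sz : schwartz (fun a => (crd a k)%:C * (phase_factor a * F f a)) by apply: schwartzM => //; exact: moderate_crd.
rewrite /kernel_op /xdiff (pderP (pder_pft_self k lam a sW)).2.
have -> : \sum_l epsR R (mutation s k) k l * crd a l = - eps_form s k a.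
  by rewrite /eps_form -sumrN; apply: eq_bigr => l _; rewrite epsR_mutk mulNr.
rewrite -[(- eps_form s k a)%:C * _](pftZ_indep lam (m := fun a => (- eps_form s k a)%:C))//; last first.
  by move=> c t; rewrite eps_form_upd.
rewrite -pftZ; last exact: schwartzZ.
rewrite -pftD; last 2 first.
- by do 2 apply: schwartzZ.
- apply: schwartzM => //; rewrite /eps_form; under eq_fun do rewrite -sumrN; under eq_fun do under eq_bigr do rewrite -mulNr.
  exact: moderate_lincomb.
congr (F _ a); apply/funext => c.
have -> : F (fun a => - xdiff s hbar b k f a) c = - ((multiplier b c)%:C * F f c).
  under eq_fun do rewrite -mulN1r; rewrite pftZ// mulN1r; congr (- _).
  by rewrite pft_xdiff.
have e := momentum_scalar b (dh k) (crd c k).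
have -> : dhat R (mutation s k) k = dh k by [].
have e2 : (-1) ^+ b * (pi * hbar * dh k)%:C * 'i%C * ('i%C * (- lam)%:C * ((crd c k)%:C * (phase_factor c * F f c)))
   = ((-1) ^+ b * (dh k * crd c k))%:C * (phase_factor c * F f c) :> R[i].
  transitivity (- ((-1) ^+ b * (pi * hbar * dh k)%:C * 'i%C * ('i%C * (lam * crd c k)%:C)) * (phase_factor c * F f c) : R[i]).
    have -> : (lam * crd c k)%:C = lam%:C * (crd c k)%:C :> R[i] by exact: rCM.
    rewrite rCN; move: (phase_factor c) (F f c) (pi * hbar * dh k)%:C ((-1) ^+ b : R[i]) lam%:C (crd c k)%:C 'i%C.
    by move=> g h A S L X I; ring.
  by rewrite e rCN opprK.
rewrite e2 multiplierE rCB rCN.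
move: (phase_factor c) (F f c) ((-1) ^+ b * (dh k * crd c k))%:C (eps_form s k c)%:C => g h x y; ring.
Qed.

(** When [eps_ik > 0] the mutation rule adds the positive entries of the row
    [k], when [eps_ik < 0] the negative ones. *)
Lemma epsR_mut_other i j : i != k ->
  epsR R (mutation s k) i j = epsR R s i j - (if j == k then 2 * E i else 0)
  + (if 0 < eps s i k then E i * eps_pos_coef R s k j else if eps s i k < 0 then - E i * (ek j - eps_pos_coef R s k j) else 0).
Proof.
move=> ik; have [->|jk] := eqVneq j k.
  by rewrite epsR_mut_k eps_pos_coef_k epsR_diag subr0 !mulr0 !if_same addr0; ring.
rewrite subr0 /epsR /= mxE (negbTE ik) (negbTE jk) /= /eps_pos_coef /epsR.
case: (ltrgt0P (eps s i k)) => h.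
- rewrite pmulr_rle0// leNgt; case: ifPn => [/negbTE ->|/negPn ->]; first by rewrite mulr0 addr0.
  by rewrite intrD intrM.
- rewrite nmulr_rle0//; case: (ltrgt0P (eps s k j)) => h2 /=.
  + by rewrite subrr mulr0 addr0.
  + by rewrite intrD intrM intrN subr0.
  + by rewrite h2 subr0 mulr0 addr0.
- by rewrite h mul0r lexx addr0.
Qed.

Definition mut_corr i a : R :=
  if 0 < eps s i k then E i * eps_pos_form s k a else if eps s i k < 0 then - E i * (eps_form s k a - eps_pos_form s k a) else 0.

Definition eps_rest i a : R := \sum_(l | l != k) epsR R s i l * crd a l.

Lemma eps_rest_upd i a t : eps_rest i (upd a k t) = eps_rest i a.
Proof. by apply: eq_bigr => l lk; rewrite crd_upd (negbTE lk). Qed.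

Lemma mut_corr_upd i a t : mut_corr i (upd a k t) = mut_corr i a.
Proof. by rewrite /mut_corr eps_form_upd eps_pos_form_upd. Qed.

Lemma sum_eps i a : \sum_l epsR R s i l * crd a l = E i * crd a k + eps_rest i a.
Proof. by rewrite (bigD1 k). Qed.

Lemma sum_eps_mut i a : i != k ->
  \sum_l epsR R (mutation s k) i l * crd a l = - E i * crd a k + (eps_rest i a + mut_corr i a).
Proof.
move=> ik; transitivity ((\sum_l epsR R s i l * crd a l - 2 * E i * crd a k) + mut_corr i a); last first.
  by rewrite sum_eps; ring.
rewrite -sum_delta /mut_corr /eps_pos_form /eps_form /linform add0r -sumrB.
have -> : (if 0 < eps s i k then E i * (\sum_j eps_pos_coef R s k j * crd a j)
  else if eps s i k < 0 then - E i * (\sum_j ek j * crd a j - \sum_j eps_pos_coef R s k j * crd a j) else 0)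
  = \sum_j (if 0 < eps s i k then E i * eps_pos_coef R s k j else if eps s i k < 0 then - E i * (ek j - eps_pos_coef R s k j) else 0) * crd a j.
  case: ifP => _; first by rewrite mulr_sumr; apply: eq_bigr => j _; rewrite mulrA.
  case: ifP => _; last by rewrite big1// => j _; rewrite mul0r.
  by rewrite -sumrB mulr_sumr; apply: eq_bigr => j _; rewrite -mulrBl mulrA.
by rewrite -big_split; apply: eq_bigr => j _; rewrite epsR_mut_other// mulrDl mulrBl.
Qed.

(** The pointwise identity behind the intertwining relations: it follows from
    the functional equation [phi z - phi (- z) = z]. *)
Lemma phase_identity b i a : i != k ->
  (-1) ^+ b * (pi * hbar * dh i) * dtheta i a + E i * (pi * hbar) * dtheta k a =
  mut_corr i a + E i * P0 (- (sgz (eps s i k))%:~R * multiplier b a).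
Proof.
move=> ik.
have pi0 : pi != 0 :> R := pi_neq0 R.
have d0 : dh k != 0 by rewrite gt_eqF// dhat_gt0.
have skew : dh i * ek i = - (dh k * E i).
  by have := eps_skewR R s k i; rewrite mulrC => ->; rewrite mulrC.
have hk1 : dtheta k a * (pi * hbar) = (P0 (arg_plus s k a) + P0 (arg_minus s k a)) / 2 + eps_pos_form s k a.
  rewrite /dtheta eqxx eps_pos_coef_k mulr0 addr0 /arg_plus_coef /arg_minus_coef eqxx epsR_diag !subr0 mulNr opprK -mulrDr.
  rewrite mulrDl [lam * _ * _]mulrAC [lam * _]mulrC pilam mul1r; congr (_ + _).
  move: (P0 (arg_plus s k a) + P0 (arg_minus s k a)) (@pi R) pi0 => S p p0.
  by field; rewrite p0 hbar0 d0.
have hi1 : dtheta i a * (pi * hbar * dh i) = E i * (P0 (arg_plus s k a) - P0 (arg_minus s k a)) / 2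
    + crd a k * (dh i * eps_pos_coef R s k i).
  rewrite /dtheta [k == i]eq_sym (negbTE ik) add0r /arg_plus_coef /arg_minus_coef (negbTE ik) oppr0 !sub0r.
  rewrite mulrDl; congr (_ + _); last first.
    by transitivity (pi * hbar * lam * (crd a k * (dh i * eps_pos_coef R s k i))); [ring|rewrite pilam mul1r].
  move: (P0 (arg_plus s k a)) (P0 (arg_minus s k a)) (@pi R) pi0 => A B p p0.
  transitivity (- (dh i * ek i) * (A - B) / (2 * dh k)).
    by field; rewrite p0 hbar0 d0.
  by rewrite skew; field.
have -> : (-1) ^+ b * (pi * hbar * dh i) * dtheta i a + E i * (pi * hbar) * dtheta k a
   = (-1) ^+ b * (dtheta i a * (pi * hbar * dh i)) + E i * (dtheta k a * (pi * hbar)).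
  by move: (dtheta i a) (dtheta k a) (pi * hbar) ((-1) ^+ b : R) => A B p S; ring.
rewrite hi1 hk1 multiplierE.
have Sp : P0 (arg_plus s k a) - P0 (- arg_plus s k a) = arg_plus s k a by exact: phider_sym (hk_neq0 s k hbar0) _.
have Sm : P0 (arg_minus s k a) - P0 (- arg_minus s k a) = arg_minus s k a by exact: phider_sym (hk_neq0 s k hbar0) _.
have lqi : dh i * eps_pos_coef R s k i = if eps s i k < 0 then - (dh k * E i) else 0.
  rewrite /eps_pos_coef; have h : (0 < ek i) = (E i < 0).
    rewrite -(pmulr_rgt0 _ (dhat_gt0 R s i)) skew oppr_gt0 pmulr_rlt0//; exact: dhat_gt0.
  by rewrite /epsR ltr0z ltrz0 in h; rewrite h; case: ifP => _; rewrite ?mulr0.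
have cases : (sgz (eps s i k) = 1 /\ mut_corr i a = E i * eps_pos_form s k a /\ (eps s i k < 0) = false) \/
   (sgz (eps s i k) = -1 /\ mut_corr i a = - E i * (eps_form s k a - eps_pos_form s k a) /\ (eps s i k < 0) = true) \/
   (E i = 0 /\ mut_corr i a = 0 /\ (eps s i k < 0) = false).
  rewrite /mut_corr /epsR; case: (ltrgt0P (eps s i k)) => h.
  - by left; rewrite gtr0_sgz.
  - by right; left; rewrite ltr0_sgz.
  - by right; right; rewrite h.
have ze : arg_plus s k a = dh k * crd a k - eps_form s k a by exact: arg_plusE.
have zme : arg_minus s k a = - (dh k * crd a k) - eps_form s k a by exact: arg_minusE.
rewrite lqi; move: cases => [[-> [-> ->]]|[[-> [-> ->]]|[-> [-> ->]]]]; last by rewrite !(mul0r, mulr0, addr0).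
- have -> : - 1%:~R * (eps_form s k a - (-1) ^+ b * (dh k * crd a k)) = (if b then arg_minus s k a else arg_plus s k a).
    by case: b; rewrite ?ze ?zme ?expr1 ?expr0; ring.
  rewrite [P0 (if b then _ else _)](fun_if P0).
  by move: (P0 (arg_plus s k a)) (P0 (arg_minus s k a)) => A B; case: b; rewrite ?expr1 ?expr0; field.
- have -> : - (-1)%:~R * (eps_form s k a - (-1) ^+ b * (dh k * crd a k)) = (if b then - arg_minus s k a else - arg_plus s k a).
    by case: b; rewrite ?ze ?zme ?expr1 ?expr0; ring.
  have e1 : P0 (- arg_plus s k a) = P0 (arg_plus s k a) - (dh k * crd a k - eps_form s k a) by rewrite -ze -[X in _ - X]Sp subKr.
  have e2 : P0 (- arg_minus s k a) = P0 (arg_minus s k a) - (- (dh k * crd a k) - eps_form s k a) by rewrite -zme -[X in _ - X]Sm subKr.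
  rewrite [P0 (if b then _ else _)](fun_if P0) e1 e2.
  move: (P0 (arg_plus s k a)) (P0 (arg_minus s k a)) => A B; by case: b; rewrite ?expr1 ?expr0; field.
Qed.

Let gtd i f a : schwartz f ->
  pderive i (fun a => phase_factor a * F f a) a
  = 'i%C * (dtheta i a)%:C * phase_factor a * F f a + phase_factor a * pderive i (F f) a.
Proof.
move=> sf; have sF := schwartz_pft k (lam_neq0 hbar0) sf.
exact: (pderP (pderM (pder_phase_factor s k hbar0 i a) (schwartz_pder i a sF))).2.
Qed.

Lemma crd_mul_pft u a : schwartz u ->
  (crd a k)%:C * F u a = - ((pi * hbar)%:C * 'i%C) * F (pderive k u) a.
Proof.
move=> su; rewrite pft_pderive//.
transitivity (- ('i%C * 'i%C) * (pi * hbar * lam)%:C * ((crd a k)%:C * F u a)).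
  by rewrite pilam sqr_i_ opprK !mul1r.
have -> : (lam * crd a k)%:C = lam%:C * (crd a k)%:C :> R[i] by exact: rCM.
have -> : (pi * hbar * lam)%:C = (pi * hbar)%:C * lam%:C :> R[i] by exact: rCM.
by move: (F u a) (crd a k)%:C (pi * hbar)%:C lam%:C 'i%C => A B C D I; ring.
Qed.

Lemma pft_crd_mul u a : schwartz u ->
  F (fun c => (crd c k)%:C * u c) a = (pi * hbar)%:C * 'i%C * pderive k (F u) a.
Proof.
move=> su; rewrite (pderP (pder_pft_self k lam a su)).2.
rewrite pftZ; last by apply: schwartzM => //; exact: moderate_crd.
move: (F _ a) => X.
transitivity (- ('i%C * 'i%C) * (pi * hbar * lam)%:C * X).
  by rewrite pilam sqr_i_ opprK !mul1r.
have -> : (pi * hbar * lam)%:C = (pi * hbar)%:C * lam%:C :> R[i] by exact: rCM.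
by rewrite rCN; move: (pi * hbar)%:C lam%:C 'i%C => C D I; ring.
Qed.

Lemma pft_lincomb (c1 c2 : R[i]) (m u v w : T -> R[i]) a :
  moderate m -> (forall a t, m (upd a k t) = m a) -> schwartz u -> schwartz v -> schwartz w ->
  F (fun c => c1 * u c + (m c * v c + c2 * w c)) a = c1 * F u a + (m a * F v a + c2 * F w a).
Proof.
move=> mm hm su sv sw; rewrite pftD; [|exact: schwartzZ|]; last first.
  by apply: schwartzD; [exact: schwartzM|exact: schwartzZ].
rewrite pftZ// pftD; [|exact: schwartzM|exact: schwartzZ].
by rewrite (pftZ_indep lam a hm sv) pftZ.
Qed.

(** Both sides are brought under the outer transform, multiplication by [a_k]
    becoming a derivative in [a_k]. The terms in which [F f] is differentiated
    agree, and those in which [e^(i theta)] is differentiated are compared by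
    the identity above. *)
Lemma kernel_op_xdiff_other b i f v : i != k -> schwartz f -> schwartz v ->
  (forall a, F v a = (P0 (- (sgz (eps s i k))%:~R * multiplier b a))%:C * F f a) ->
  xdiff (mutation s k) hbar b i (kernel_op f) =
  kernel_op (fun a => xdiff s hbar b i f a - (E i)%:C * v a).
Proof.
move=> ik sf sv hv; apply/funext => a.
have sW := schwartz_gpft s k hbar0 sf.
have sF := schwartz_pft k (lam_neq0 hbar0) sf.
have sdf := schwartz_pderive i sf.
have mso : moderate (fun c => (eps_rest i c)%:C).
  rewrite /eps_rest; under eq_fun do rewrite big_mkcond /=.
  under eq_fun do under eq_bigr do rewrite -mulrb -mulrnAl.
  exact: moderate_lincomb.
have mcorr : moderate (fun c => (mut_corr i c)%:C).
  rewrite /mut_corr; case: (0 < eps s i k); last (case: (eps s i k < 0); last exact: moderate_cst).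
    by under eq_fun do rewrite rCM; apply: moderateZ; exact: (moderate_lin 0 (eps_pos_coef R s k)).
  under eq_fun do rewrite rCM rCB; apply: moderateZ; apply: moderateD; first exact: moderate_lincomb.
  by under eq_fun do rewrite -mulN1r; apply: moderateZ; exact: (moderate_lin 0 (eps_pos_coef R s k)).
pose c1 : R[i] := (-1) ^+ b * (pi * hbar * dh i)%:C * 'i%C.
pose c2 : R[i] := (E i)%:C * ((pi * hbar)%:C * 'i%C).
pose V c := phase_factor c * F f c.
have sV : schwartz V by [].
have sdV j : schwartz (pderive j V) by exact: schwartz_pderive.
have indep c t : (eps_rest i (upd c k t))%:C + (mut_corr i (upd c k t))%:C = (eps_rest i c)%:C + (mut_corr i c)%:C :> R[i].
  by rewrite eps_rest_upd mut_corr_upd.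
have msc : moderate (fun c => (eps_rest i c)%:C + (mut_corr i c)%:C) by exact: moderateD.
have lhs : xdiff (mutation s k) hbar b i (kernel_op f) a = F (fun c => c1 * pderive i V c +
    (((eps_rest i c)%:C + (mut_corr i c)%:C) * V c + c2 * pderive k V c)) a.
  apply: (etrans _ (esym (pft_lincomb c1 c2 a msc indep (sdV i) sV (sdV k)))).
  rewrite /xdiff pderive_kernel_op_other// sum_eps_mut//.
  rewrite -[dhat R (mutation s k) i]/(dh i) -/c1 -[kernel_op f a]/(F V a) -/V; congr (_ + _).
  rewrite rCD rCM rCN rCD mulrDl addrC; congr (_ + _).
  by rewrite -mulrA crd_mul_pft// /c2 !(mulNr, mulrN) opprK mulrA.
have rhs c : F (fun a => xdiff s hbar b i f a - (E i)%:C * v a) c =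
    c1 * pderive i (F f) c + ((eps_rest i c)%:C * F f c + c2 * pderive k (F f) c)
    - (E i)%:C * (P0 (- (sgz (eps s i k))%:~R * multiplier b c))%:C * F f c.
  have sk : schwartz (fun a => (crd a k)%:C * f a) by apply: schwartzM => //; exact: moderate_crd.
  have -> : (fun a => xdiff s hbar b i f a - (E i)%:C * v a) = (fun a =>
      c1 * pderive i f a + ((eps_rest i a)%:C * f a + (E i)%:C * ((crd a k)%:C * f a)) + (- (E i)%:C) * v a).
    apply/funext => d; rewrite /xdiff sum_eps -/c1 rCD rCM.
    by move: (c1 * _) (f d) (v d) (E i)%:C (eps_rest i d)%:C (crd d k)%:C => A B C D E' G; ring.
  have indep' d t : (eps_rest i (upd d k t))%:C = (eps_rest i d)%:C :> R[i] by rewrite eps_rest_upd.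
  have s4 : schwartz (fun a => c1 * pderive i f a + ((eps_rest i a)%:C * f a + (E i)%:C * ((crd a k)%:C * f a))).
    apply: schwartzD; first exact: schwartzZ.
    by apply: schwartzD; [exact: schwartzM|exact: schwartzZ].
  rewrite (pftD k lam c s4 (schwartzZ (- (E i)%:C) sv)) (pftZ k lam (- (E i)%:C) c sv).
  rewrite (pft_lincomb c1 (E i)%:C c mso indep' sdf sf sk).
  rewrite pft_crd_mul// hv /c2 (pderP (pder_pft_other lam c ik sf)).2.
  move: (c1 * _) (F f c) (pderive k (F f) c) (P0 _)%:C (E i)%:C (eps_rest i c)%:C ((pi * hbar)%:C * 'i%C) => A B C D E' G J; ring.
rewrite lhs /kernel_op; congr (F _ a); apply/funext => c.
rewrite rhs /V !gtd//.
have id : (-1) ^+ b * ((pi * hbar)%:C * (dh i)%:C) * (dtheta i c)%:C + (E i)%:C * (pi * hbar)%:C * (dtheta k c)%:C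
    = (mut_corr i c)%:C + (E i)%:C * (P0 (- (sgz (eps s i k))%:~R * multiplier b c))%:C :> R[i].
  by rewrite signC -!(rCM, rCD) phase_identity.
rewrite /c1 /c2 rCM.
move: id; move: (F f c) (phase_factor c) (pderive i (F f) c) (pderive k (F f) c) (dtheta i c)%:C (dtheta k c)%:C.
move: ((-1) ^+ b : R[i]) (P0 _)%:C (E i)%:C (eps_rest i c)%:C (mut_corr i c)%:C (dh i)%:C (pi * hbar)%:C => S P e sx cx d p.
move=> h g hi hkk t1 t2 id.
set I := 'i%C.
transitivity (g * (S * (p * d) * I * hi + (sx * h + e * (p * I) * hkk) - e * P * h)
  + (I * I) * (S * (p * d) * t1 + e * p * t2) * (g * h) + (cx + e * P) * (g * h)).
  by move: I => I; ring.
by rewrite id sqr_i_ mulN1r mulNr subrK.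
Qed.

(** The derivatives are polynomials in the resolvent itself, which is bounded. *)
Lemma moderate_resolvent (l : 'I_n -> R) :
  moderate (fun a : T => (1 + 'i%C * (linform 0 l a)%:C)^-1).
Proof.
have W2 x : cabs (1 + 'i%C * x%:C : R[i]) ^+ 2 = 1 + x ^+ 2.
  by rewrite cabs_sq !CE /= !mul0r !mulr0 subr0 mul1r !add0r addr0 expr1n.
have W0 x : 1 + 'i%C * x%:C != 0 :> R[i].
  apply/eqP => e; have := W2 x; rewrite e cabs0 expr0n => /eqP; rewrite eq_sym gt_eqF//.
  by rewrite ltr_wpDr ?sqr_ge0.
pose W a : R[i] := (1 + 'i%C * (linform 0 l a)%:C)^-1.
apply: (@alg_moderate _ _ (fun g => g = W)); last exact: alg_base.
- move=> _ ->; apply: (@slow_bdd _ _ _ 1) => a.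
  have b1 x : 1 <= cabs (1 + 'i%C * x%:C : R[i]).
    by rewrite -(@ler_pXn2r _ 2) ?nnegrE ?cabs_ge0// W2 expr1n lerDl sqr_ge0.
  by rewrite cabsV invf_le1 ?b1// (lt_le_trans ltr01 (b1 _)).
- move=> _ i ->; exists (fun a => (l i)%:C * (- 'i%C * (W a * W a))).
    apply: alg_mul; first exact: alg_cst.
    by apply: alg_mul; [exact: alg_cst|apply: alg_mul; exact: alg_base].
  move=> a; apply: (@pder_comp_lin _ _ (fun x => (1 + 'i%C * x%:C)^-1)).
  apply: Cder_eq (CderV (W0 _) (CderD (Cder_cst 1 _) (CderZ 'i%C (Cder_id _)))) _.
  by rewrite add0r mulr1 expr2 invfM mulNr.
Qed.

End Intertwining.

(** * The intertwining operator *)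

Section KernelOperator.
Variables (R : realType) (n : nat) (s : seed n) (k : 'I_n) (hbar : R).
Hypothesis hbar0 : hbar != 0.
Local Notation T := (Rn R n).
Local Notation mu := (lebesgue_Rn R n).
Implicit Types (f u v w : T -> R[i]) (a : T) (i j : 'I_n) (b : bool).
Local Notation l0 := (lam_neq0 hbar0).
Local Notation F := (pft k (lam hbar)).
Local Notation kernel_op := (kernel_op s k hbar).
Local Notation hk := (dhat R s k * hbar).

(** A constant sequence witnesses the closure. *)
Lemma op_closure_ae (D : (T -> R[i]) -> (T -> R[i])) f u w : schwartz f -> schwartz (D f) ->
  L2 mu u -> L2 mu w -> {ae mu, forall a, u a = f a} -> {ae mu, forall a, w a = D f a} ->
  op_closure mu (@schwartz R n) D u w.
Proof.
move=> sf sD Lu Lw uf wD; split => //; exists (fun=> f).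
have h g z : schwartz g -> L2 mu z -> {ae mu, forall a, z a = g a} -> L2cvg mu (fun=> g) z.
  move=> sg Lz zg; rewrite /L2cvg.
  rewrite (_ : (fun m => _) = (fun m : nat => sqnorm mu (fun a => (fun=> g) m a - g a))); first exact: L2cvg_cst.
  apply/funext => m; apply: sqnorm_ae.
  - by apply: CmeasB; [exact: (schwartz_meas sg)|exact: (L2_meas Lz)].
  - by apply: CmeasB; exact: (schwartz_meas sg).
  - by apply: filterS zg => a ->.
by split => //; exact: h.
Qed.

Let lin (L : (T -> R[i]) -> (T -> R[i])) := forall (c : R[i]) f v, schwartz f -> schwartz v ->
  L (fun a => c * f a + v a) = (fun a => c * L f a + L v a).

Lemma pft_lin (lam : R) : lam != 0 -> lin (pft k lam).
Proof.
by move=> h c f v sf sv; apply/funext => a; rewrite pftD// ?pftZ//; exact: schwartzZ.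
Qed.

Lemma kernel_op_lin : lin kernel_op.
Proof.
move=> c f v sf sv; rewrite /kernel_op.
rewrite -(pft_lin l0 c (schwartz_gpft s k hbar0 sf) (schwartz_gpft s k hbar0 sv)).
apply: congr1; apply/funext => a; rewrite (pft_lin l0)//.
by move: (phase_factor s k hbar a) (F f a) (F v a) => A B C; ring.
Qed.

Lemma uft_lin : lin (uft k (lam hbar)).
Proof.
by move=> c f v sf sv; apply/funext => a; rewrite uftD// ?uftZ//; exact: schwartzZ.
Qed.

Definition Kconst : R := (2 * pi / `|lam hbar|) ^+ 2.

Lemma sqnorm_kernel_op f : schwartz f -> (sqnorm mu (kernel_op f) <= Kconst%:E * sqnorm mu f)%E.
Proof.
move=> sf; rewrite /kernel_op sqnorm_pft; [|exact: l0|exact: schwartz_gpft].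
have -> : sqnorm mu (fun a => phase_factor s k hbar a * F f a) = sqnorm mu (F f).
  by apply: eq_integral => a _; rewrite cabsM cabs_phase_factor mul1r.
by rewrite sqnorm_pft ?l0// muleA -EFinM /Kconst expr2.
Qed.

Definition intertwiner := ext kernel_op.

Lemma intertwiner_bounded : L2_bounded mu mu intertwiner.
Proof.
exact: (ext_bounded (sqr_ge0 _) (fun f => @schwartz_kernel_op _ _ s k hbar hbar0 f) kernel_op_lin sqnorm_kernel_op).
Qed.

Lemma intertwiner_schwartz f : schwartz f -> {ae mu, forall a, intertwiner f a = kernel_op f a}.
Proof.
exact: (ext_schwartz (sqr_ge0 _) (fun f => @schwartz_kernel_op _ _ s k hbar hbar0 f) kernel_op_lin sqnorm_kernel_op).
Qed.

Lemma intertwiner_L2 f : schwartz f -> L2 mu (intertwiner f).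
Proof. by move=> sf; apply: intertwiner_bounded.1.1; exact: schwartz_L2. Qed.

(** The extension agrees almost everywhere with the operator on Schwartz
    functions, which maps Schwartz functions to Schwartz functions; so an
    identity there gives a point of the closed graph. *)
Lemma xhat_intertwiner (s0 : seed n) b j f w : schwartz f -> schwartz w ->
  xdiff s0 hbar b j (kernel_op f) = kernel_op w -> xhat s0 hbar b j (intertwiner f) (intertwiner w).
Proof.
move=> sf sw e; apply: (@op_closure_ae _ (kernel_op f)).
- exact: schwartz_kernel_op.
- by rewrite e; exact: schwartz_kernel_op.
- exact: intertwiner_L2.
- exact: intertwiner_L2.
- exact: intertwiner_schwartz.
- by rewrite e; exact: intertwiner_schwartz.
Qed.

Local Notation U := (uft k (lam hbar)).

Let sU f : schwartz f -> schwartz (U f). Proof. by move=> sf; apply: schwartz_uft; [exact: l0|]. Qed.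

Lemma U_spectral b : spectral_rep mu mu (xhat s hbar b k) (ext U) (multiplier s k b).
Proof.
apply: (@ext_spectral _ _ U 1 ler01 (fun f => @sU f) uft_lin _ _ (fun f => U (U (U f)))).
- by move=> f sf; rewrite mul1e sqnorm_uft// l0.
- by move=> f sf; rewrite sqnorm_uft// l0.
- by move=> f sf; exact: (sU (sU (sU sf))).
- by move=> f sf; exact: (uft4 k l0 sf).
- by move=> f sf; exact: schwartz_xdiff.
- exact: (moderate_lin 0 (multiplier_coef R s k b)).
- exact: (moderate_resolvent (multiplier_coef R s k b)).
- by move=> f sf; apply/funext => a; rewrite /uft pft_xdiff// mulrCA.
Qed.

(** The vector [phi (c x_k) f]. The cube of the transform inverts it, so this
    conjugates multiplication by [phi] of the linear form. *)
Definition phi_mult b (c : R) f : T -> R[i] :=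
  U (U (U (fun a => (phider hk 0 (c * multiplier s k b a))%:C * U f a))).

Let phi_moderate b (c : R) : moderate (fun a => (phider hk 0 (c * multiplier s k b a))%:C).
Proof.
rewrite (_ : (fun a => _) = fun a => (phider hk 0 (linform 0 (fun j => c * multiplier_coef R s k b j) a))%:C).
  exact: (moderate_phi (hk_neq0 s k hbar0) 0).
apply/funext => a; rewrite /multiplier /linform !add0r mulr_sumr; congr (phider _ _ _)%:C.
by apply: eq_bigr => j _; rewrite mulrA.
Qed.

Lemma schwartz_phi_mult b c f : schwartz f -> schwartz (phi_mult b c f).
Proof.
move=> sf; apply: sU; apply: sU; apply: sU; apply: schwartzM; [exact: phi_moderate|exact: sU].
Qed.

Lemma uft_phi_mult b c f : schwartz f ->
  U (phi_mult b c f) = (fun a => (phider hk 0 (c * multiplier s k b a))%:C * U f a).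
Proof.
move=> sf; rewrite /phi_mult uft4 ?l0//; apply: schwartzM; [exact: phi_moderate|exact: sU].
Qed.

Lemma pft_phi_mult b c f a : schwartz f ->
  F (phi_mult b c f) a = (phider hk 0 (c * multiplier s k b a))%:C * F f a.
Proof.
move=> sf; have := congr1 (fun g => g a) (uft_phi_mult b c sf); rewrite /uft mulrCA.
apply: mulfI; rewrite rC_eq0; apply/eqP => e.
by have := kappa_sq l0; rewrite e expr0n mul0r => /eqP; rewrite eq_sym oner_eq0.
Qed.

Lemma fcalc_phi_mult b c f : schwartz f ->
  fcalc mu (xhat s hbar b k) (fun z => qlog hk (c * z)) f (phi_mult b c f).
Proof.
move=> sf; have sv := schwartz_phi_mult b c sf.
split; [exact: schwartz_L2|exact: schwartz_L2|].
exists _, _, mu, (ext U), (multiplier s k b); split; first exact: U_spectral.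
have bd v : schwartz v -> (sqnorm mu (U v) <= 1%:E * sqnorm mu v)%E.
  by move=> sv'; rewrite mul1e sqnorm_uft// l0.
have h1 := ext_schwartz ler01 (fun f => @sU f) uft_lin bd sv.
have h2 := ext_schwartz ler01 (fun f => @sU f) uft_lin bd sf.
apply: filterS2 h1 h2 => a -> ->.
by rewrite uft_phi_mult// qlogE// hk_neq0.
Qed.

End KernelOperator.

Theorem theorem4p3 (R : realType) (n : nat) (s : seed n) (k : 'I_n)
    (hbar : R) (hbar_neq0 : hbar != 0) :
  let s' := mutation s k in
  let hk := dhat R s k * hbar in
  let mu := lebesgue_Rn R n in
  [/\ (* the integrals defining G and K f converge *)
      forall a, Cimproper_cvg (Gintegrand s hbar k a),
      forall f, schwartz f ->
        forall a, Cintegrable lebesgue_measure setT (Kintegrand s hbar k f a) &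
      (* K is the bounded operator given by the kernel on Schwartz functions *)
      exists K : (Rn R n -> R[i]) -> (Rn R n -> R[i]),
      [/\ L2_bounded mu mu K,
          forall f, schwartz f -> {ae mu, forall a, K f a = Kint s hbar k f a} &
          forall (b : bool) f, schwartz f ->
            xhat s' hbar b k (K f) (K (fun a => - xdiff s hbar b k f a)) /\
            (forall i, i != k ->
              exists2 v,
                fcalc mu (xhat s hbar b k)
                  (fun z => qlog hk (- (sgz (eps s i k))%:~R * z)) f v &
                xhat s' hbar b i (K f)
                  (K (fun a =>
                    xdiff s hbar b i f a - (epsR R s i k)%:C * v a)))]].
Proof.
move=> s' hk mu; split.
- exact: Gintegrand_cvg.
- by move=> f sf a; exact: Kintegrand_integrable.
exists (intertwiner s k hbar); split.
- exact: intertwiner_bounded.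
- move=> f sf; apply: filterS (intertwiner_schwartz s k hbar_neq0 sf) => a ->.
  by rewrite Kint_kernel_op.
move=> b f sf; split.
  apply: xhat_intertwiner => //; last exact: kernel_op_xdiff_k.
  have sx := schwartz_xdiff hbar s b k sf.
  by under eq_fun do rewrite -mulN1r; exact: schwartzZ.
move=> i ik; exists (phi_mult s k hbar b (- (sgz (eps s i k))%:~R) f).
  exact: fcalc_phi_mult.
have sv := schwartz_phi_mult s k hbar_neq0 b (- (sgz (eps s i k))%:~R) sf.
apply: xhat_intertwiner => //.
  by apply: schwartzB; [exact: schwartz_xdiff|exact: schwartzZ].
apply: kernel_op_xdiff_other => // a; exact: pft_phi_mult.
Qed.
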